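(* Let $q\in[1,\infty)$ and $T\in\mathcal K_q$. Then there exists a bounded subbilinear operator $R: H_1\times \mathrm{BMO}\to L^q$ such that, for any $(f,b)\in H_1\times\mathrm{BMO}$, $$|T(L(f,b))|-R(f,b)\le |[T,b](f)|\le R(f,b)+|T(L(f,b))|.$$ In particular, if $T$ is linear, then the bilinear operator $R$ defined by setting, for any $(f,b)\in H_1\times \mathrm{BMO}$, $$R(f,b):=[T,b](f)-T(L(f,b))$$ is bounded from $H_1\times\mathrm{BMO}$ into $L^q$.
   Context: $\mathbb Z_+=\{0,1,2,\dots\}$. $(\Omega,\mathcal F,\mathbb P)$ is a complete probability space and $(\mathcal F_n)_{n\in\mathbb Z_+}$ is an increasing sequence of sub-$\sigma$-algebras of $\mathcal F$ with $\mathcal F=\sigma(\bigcup_n\mathcal F_n)$ and $\mathcal F_0=\{\emptyset,\Omega\}$; $\mathbb E_n$ is the conditional expectation given $\mathcal F_n$, $\mathbb E_{-1}:=0$. For a martingale $f=(f_n)$: $f_{-1}:=0$, $d_nf:=f_n-f_{n-1}$, $S(f):=(\sum_{n\ge0}|d_nf|^2)^{1/2}$, $s(f):=(|d_0f|^2+\sum_{n\ge1}\mathbb E_{n-1}|d_nf|^2)^{1/2}$. An $L^1$ function $f$ is identified with the martingale $(\mathbb E_n f)_n$. $H_1$: martingales with $\|f\|_{H_1}:=\|S(f)\|_{L^1}<\infty$. $\mathrm{BMO}$: martingales with $\|f\|_{\mathrm{BMO}_p}:=\sup_{n\in\mathbb Z_+}\|\mathbb E_n(|f-f_{n-1}|^p)\|_{L^\infty}^{1/p}<\infty$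 (equivalent norms for all $p\in[1,\infty)$). $\|f\|_{L^{q,\infty}}:=\sup_{t>0}t\,[\mathbb P(|f|>t)]^{1/q}$. $L(f,b)$: for $f\in H_1$, $b\in\mathrm{BMO}$, $L(f,b)$ here denotes the $L^1$-function $\sum_{k\in\mathbb Z_+}d_kf\,d_kb$ (limit of the partial sums). Sublinear operator: $|T(\alpha f+\beta g)|\le|\alpha||Tf|+|\beta||Tg|$ for all functions $f,g$ and scalars $\alpha,\beta$. Subbilinear: sublinear in each variable. Bounded (sub)bilinear operator $R:H_1\times\mathrm{BMO}\to L^q$: $\|R(f,b)\|_{L^q}\le C\|f\|_{H_1}\|b\|_{\mathrm{BMO}}$. Commutator: for $f\in L^2$, $b\in\mathrm{BMO}$ and $x\in\Omega$, $[T,b](f)(x):=T(bf-b(x)f)(x)$ (if $T$ is linear, $[T,b](f)=T(bf)-bT(f)$); for $f\in H_1$ it is defined by continuity (with values in $L^{q,\infty}$) from the dense subspace $L^2$. Simple $(s,\infty)$-atom with respect to $n\in\mathbb Z_+$ and $A\in\mathcal F_n$: measurable $a$ with $\mathbb E_n(a)=0$, $\operatorname{supp}(a)\subset A$, $\|s(a)\|_{L^\infty}\le\mathbb P(A)^{-1}$. Martingale jump with respect to $n\in\mathbb Z_+$: an $\mathcal F_n$-measurable $g\in L^1$ with $\mathbb E_{n-1}(g)=0$. $\mathcal K_q$: the set of all continuous sublinear operators $T$ on $L^2$ such that (i) $T$ is bounded from $H_1$ to $L^q$; (ii) $T$ is bounded from $L^1$ to $L^{q,\infty}$; (iii) for every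 simple $(s,\infty)$-atom $a$ with respect to some $n\in\mathbb Z_+$ and every $b\in\mathrm{BMO}$, $\|(b-b_{n-1})T(a)\|_{L^q}\le C\|b\|_{\mathrm{BMO}}$ and $\|[T,b_{n-1}](a)\|_{L^q}\le C\|b\|_{\mathrm{BMO}}$; (iv) for every martingale jump $g$ with respect to some $n\in\mathbb Z_+$ and every $b\in\mathrm{BMO}$, $\|(b-b_{n-1})T(g)\|_{L^q}\le C\|g\|_{L^1}\|b\|_{\mathrm{BMO}}$ and $\|[T,b_{n-1}](g)\|_{L^q}\le C\|g\|_{L^1}\|b\|_{\mathrm{BMO}}$; here $C>0$ is independent of $a,g,b$. *)

(* Defs.v *)
From HB Require Import structures.
From mathcomp Require Import all_boot all_order all_algebra.
From mathcomp Require Import all_classical all_reals all_analysis.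
From mathcomp Require Import measurable_realfun.

Set Implicit Arguments.
Unset Strict Implicit.
Unset Printing Implicit Defensive.

Import Order.TTheory GRing.Theory Num.Theory.
Import numFieldNormedType.Exports.

Local Open Scope classical_set_scope.
Local Open Scope ring_scope.

(* All functions and scalars are real-valued.  Elements of function spaces are
   represented by functions [T -> R], so identities and inequalities between
   them are required almost everywhere, and operators on such spaces are
   required to respect almost everywhere equality.  [f \in Lfun P r%:E] is the
   library's "measurable, with finite L^r norm". *)

Section martingales.
Context d (T : measurableType d) (R : realType).
Variables (P : probability T R) (F : (set (set T))^nat).
Implicit Types (G : set (set T)) (f g h b phi : T -> R) (u v : (T -> R)^nat).

Record stochastic_basis : Prop := StochasticBasis {
  basis_complete : measure_is_complete P ;
  basis_sigma_algebra : forall n, sigma_algebra setT (F n) ;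
  basis_sub : forall n, F n `<=` d.-measurable ;
  basis_increasing : forall n, F n `<=` F n.+1 ;
  basis_generated : d.-measurable = <<s \bigcup_n F n >> ;
  basis_trivial : F 0 = [set set0; setT] }.

Definition measurable_for G d' (T' : sigmaRingType d') (f : T -> T') :=
  @measurable_fun _ d' (g_sigma_algebraType G) T' setT f.

(* The defining property makes sense, and determines [g] almost everywhere,
   both for integrable [f] and for arbitrary measurable [f >= 0] (in which case
   [g] may take the value +oo). *)
Definition is_cond_exp G (f g : T -> \bar R) :=
  measurable_for G g /\
  forall A, G A -> (\int[P]_(x in A) g x = \int[P]_(x in A) f x)%E.

Definition cond_exp G (f : T -> \bar R) : T -> \bar R :=
  xget (cst 0%E) [set g | is_cond_exp G f g].

Definition mart f : (T -> R)^nat :=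
  fun n x => fine (cond_exp (F n) (EFin \o f) x).

Definition is_martingale u :=
  forall n, [/\ measurable_for (F n) (u n), u n \in Lfun P 1%:E &
    {ae P, forall x, u n x = mart (u n.+1) n x}].

(* [prev u n] is u_(n-1), with the convention u_(-1) = 0. *)
Definition prev u n : T -> R := if n is m.+1 then u m else cst 0.

Definition mdiff u n : T -> R := u n \- prev u n.

Definition square_fun u (x : T) : \bar R :=
  ((\sum_(0 <= n <oo) (`|mdiff u n x| ^+ 2)%:E) `^ 2^-1)%E.

Definition cond_square_fun u (x : T) : \bar R :=
  (((`|mdiff u 0 x| ^+ 2)%:E +
    \sum_(0 <= n <oo)
      cond_exp (F n) (fun y => (`|mdiff u n.+1 y| ^+ 2)%:E) x) `^ 2^-1)%E.

Definition H1_norm u : \bar R := ('N[P]_1[square_fun u])%E.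

Definition H1 u := is_martingale u /\ (H1_norm u < +oo)%E.

Definition BMO_norm (p : R) b : \bar R :=
  ereal_sup [set ('N[P]_+oo[cond_exp (F n)
      (fun x => (`|b x - prev (mart b) n x| `^ p)%:E)] `^ p^-1)%E | n in setT].

Definition BMO (p : R) b := b \in Lfun P 1%:E /\ (BMO_norm p b < +oo)%E.

Definition weak_norm (q : R) f : \bar R :=
  ereal_sup [set (t%:E * P [set x | (t < `|f x|)%R] `^ q^-1)%E
            | t in [set t : R | 0 < t]].

(* L(f, b): the sum of the series of the d_k f d_k b in L^1. *)
Definition Lsum u b : T -> R :=
  xget (cst 0) [set g | g \in Lfun P 1%:E /\
    ('N[P]_1[EFin \o (fun x =>
        (\sum_(0 <= k < n) mdiff u k x * mdiff (mart b) k x) - g x)%R])%E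
      @[n --> \oo] --> 0%E].

Definition simple_atom n (A : set T) (a : T -> R) :=
  [/\ F n A, a \in Lfun P 1%:E, {ae P, forall x, mart a n x = 0},
      (forall x, a x != 0 -> A x) &
      ('N[P]_+oo[cond_square_fun (mart a)] <= (P A)^-1)%E].

Definition martingale_jump n g :=
  [/\ measurable_for (F n) g, g \in Lfun P 1%:E &
      {ae P, forall x, prev (mart g) n x = 0}].

Implicit Types (U : (T -> R) -> (T -> R)).

(* The values of U lie in a space of classes of functions, so that the value at
   x of U (b phi - b(x) phi) is understood through a version of the family
   c |-> U (b phi - c phi) depending continuously on c. *)
Definition commutator_on U b phi h :=
  measurable_fun setT h /\
  exists V : R -> T -> R,
    [/\ forall c, {ae P, forall x,
          V c x = U (fun y => b y * phi y - c * phi y) x},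
        {ae P, forall x, continuous (V ^~ x)} &
        {ae P, forall x, h x = V (b x) x}].

(* [h] is the limit in L^(q,oo) of [U, b](phi) when phi in L^2 tends to [u]
   in H_1. *)
Definition commutator_limit (q : R) U b u h :=
  measurable_fun setT h /\
  forall e : R, 0 < e -> exists2 r : R, 0 < r & forall phi,
    phi \in Lfun P 2%:E ->
    (H1_norm (fun n x => mart phi n x - u n x)%R < r%:E)%E ->
    exists2 k, commutator_on U b phi k & (weak_norm q (k \- h)%R < e%:E)%E.

(* By the formula if [u] comes from L^2, by continuity in general. *)
Definition is_commutator (q : R) U b u h :=
  (exists phi, [/\ phi \in Lfun P 2%:E,
      forall n, {ae P, forall x, u n x = mart phi n x} &
      commutator_on U b phi h]) \/
  commutator_limit q U b u h.

Definition commutator (q : R) U b u : T -> R :=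
  xget (cst 0) [set h | is_commutator q U b u h].

(* For sublinear [U] only the modulus of [U, b](u) is determined; it is
   [commutator q (abs_op U) b u], since
   |U(bf - b(x)f)(x)| = |U|(bf - b(x)f)(x). *)
Definition abs_op U : (T -> R) -> (T -> R) := fun f x => `|U f x|.

Record L1_operator U : Prop := L1Operator {
  op_measurable : forall f, f \in Lfun P 1%:E -> measurable_fun setT (U f) ;
  op_ae : forall f g, f \in Lfun P 1%:E -> g \in Lfun P 1%:E ->
    {ae P, forall x, f x = g x} -> {ae P, forall x, U f x = U g x} }.

Definition sublinear_op U := forall (s t : R) f g,
  f \in Lfun P 1%:E -> g \in Lfun P 1%:E ->
  {ae P, forall x, `|U (fun y => s * f y + t * g y) x|
                   <= `|s| * `|U f x| + `|t| * `|U g x|}.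

Definition linear_op U := forall (s t : R) f g,
  f \in Lfun P 1%:E -> g \in Lfun P 1%:E ->
  {ae P, forall x, U (fun y => s * f y + t * g y) x = s * U f x + t * U g x}.

Definition continuous_on_L2 U :=
  (forall f, f \in Lfun P 2%:E -> U f \in Lfun P 2%:E) /\
  forall f, f \in Lfun P 2%:E -> forall e : R, 0 < e ->
    exists2 r : R, 0 < r & forall g, g \in Lfun P 2%:E ->
      ('N[P]_(2%:E)[EFin \o (g \- f)%R] < r%:E)%E ->
      ('N[P]_(2%:E)[EFin \o (U g \- U f)%R] < e%:E)%E.

(* The class K_q; [p] is the exponent of the norm chosen on BMO.  An operator
   on L^2 of weak type (1, q) acts on the whole of L^1, which contains L^2 and
   H_1. *)
Record K_class (p q : R) U : Prop := KClass {
  K_operator : L1_operator U ;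
  K_sublinear : sublinear_op U ;
  K_continuous : continuous_on_L2 U ;
  K_H1 : exists2 C : R, 0 < C & forall f,
    f \in Lfun P 1%:E -> H1 (mart f) ->
    ('N[P]_(q%:E)[EFin \o U f] <= C%:E * H1_norm (mart f))%E ;
  K_L1 : exists2 C : R, 0 < C & forall f,
    f \in Lfun P 1%:E ->
    (weak_norm q (U f) <= C%:E * 'N[P]_1[EFin \o f])%E ;
  K_atom : exists2 C : R, 0 < C & forall n A a b,
    simple_atom n A a -> BMO p b ->
    ('N[P]_(q%:E)[EFin \o (fun x => (b x - prev (mart b) n x) * U a x)%R]
      <= C%:E * BMO_norm p b)%E /\
    ('N[P]_(q%:E)[EFin \o
        commutator q (abs_op U) (prev (mart b) n) (mart a)]
      <= C%:E * BMO_norm p b)%E ;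
  K_jump : exists2 C : R, 0 < C & forall n g b,
    martingale_jump n g -> BMO p b ->
    ('N[P]_(q%:E)[EFin \o (fun x => (b x - prev (mart b) n x) * U g x)%R]
      <= C%:E * 'N[P]_1[EFin \o g] * BMO_norm p b)%E /\
    ('N[P]_(q%:E)[EFin \o
        commutator q (abs_op U) (prev (mart b) n) (mart g)]
      <= C%:E * 'N[P]_1[EFin \o g] * BMO_norm p b)%E }.

Implicit Types (B : (T -> R)^nat -> (T -> R) -> (T -> R)).

Record bounded_H1_BMO (p q : R) B : Prop := BoundedH1BMO {
  bounded_measurable : forall u b, H1 u -> BMO p b ->
    measurable_fun setT (B u b) ;
  bounded_ae : forall u v b c, H1 u -> H1 v -> BMO p b -> BMO p c ->
    (forall n, {ae P, forall x, u n x = v n x}) ->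
    {ae P, forall x, b x = c x} ->
    {ae P, forall x, B u b x = B v c x} ;
  bounded_norm : exists2 C : R, 0 < C & forall u b, H1 u -> BMO p b ->
    ('N[P]_(q%:E)[EFin \o B u b] <= C%:E * H1_norm u * BMO_norm p b)%E }.

Definition subbilinear (p : R) B :=
  (forall (s t : R) u v b, H1 u -> H1 v -> BMO p b ->
    {ae P, forall x, `|B (fun n y => s * u n y + t * v n y) b x|
                     <= `|s| * `|B u b x| + `|t| * `|B v b x|}) /\
  (forall (s t : R) u b c, H1 u -> BMO p b -> BMO p c ->
    {ae P, forall x, `|B u (fun y => s * b y + t * c y) x|
                     <= `|s| * `|B u b x| + `|t| * `|B u c x|}).

Definition bilinear_H1_BMO (p : R) B :=
  (forall (s t : R) u v b, H1 u -> H1 v -> BMO p b ->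
    {ae P, forall x, B (fun n y => s * u n y + t * v n y) b x
                     = s * B u b x + t * B v b x}) /\
  (forall (s t : R) u b c, H1 u -> BMO p b -> BMO p c ->
    {ae P, forall x, B u (fun y => s * b y + t * c y) x
                     = s * B u b x + t * B u c x}).

Lemma commutator_on_linear U b phi : L1_operator U -> linear_op U ->
  measurable_fun setT b -> phi \in Lfun P 1%:E -> b \* phi \in Lfun P 1%:E ->
  commutator_on U b phi (fun x => U (b \* phi) x - b x * U phi x).
Proof.
move=> opU linU mb phi1 bphi1; split.
  apply: measurable_funB; first exact: (op_measurable opU).
  by apply: measurable_funM => //; exact: (op_measurable opU).
exists (fun c x => U (b \* phi) x - c * U phi x); split => [c||].
- have := linU 1 (- c) _ _ bphi1 phi1.
  apply: filterS => x; rewrite mul1r mulNr => <-.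
  by congr (U _ x); apply/funext => y /=; rewrite mul1r mulNr.
- apply: nearW => x c; apply: cvgB; first exact: cvg_cst.
  by apply: cvgM; [exact: cvg_id|exact: cvg_cst].
- exact: nearW.
Qed.

End martingales.

(* Main.v *)
(** On L^2 the operator R is the modulus of U (b phi - L(phi, b) - b(x) phi) (x).
    For W = |U|, and for W = U when U is linear, |W f - W g| <= |U (f - g)|, so
    that [W, b] phi and W (L(phi, b)) differ by at most R(phi, b); and a bound
    for R in L^q makes all three Lipschitz from the H1 distance to weak L^q, so
    that they extend to H1 together with the relations between them.

    To bound R, approximate phi by a finite sum of bounded jumps v_k, for which
    b phi - L(phi, b) may be replaced by the sum of the v_k (b_N - d_k b).  The
    Davis decomposition and stopping times of the conditional square function
    write phi as a sum of jumps and of multiples of atoms.  For a jump g at time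
    n, b g - L(g, b) is b_(n-1) g plus g (b_N - b_n), which is in H1; for an
    atom a it is b_(n-1) a plus the two paraproducts of a and b - b_(n-1), which
    are in H1 by the John-Nirenberg inequality, the Carleson embedding and
    Doob's inequality.  The conditions defining K_q control the first terms. *)

(* The product b phi formally splits into the sums of d_j b d_k phi over j < k, j > k and j = k; the
   diagonal is L(phi, b), merely integrable, and the sum over j < k lies outside H1 in general. On a
   piece starting at time n, subtracting b_(n-1) repairs this, and U (b_(n-1) a - b(x) a) (x) is
   what the conditions of K_q control. Two obstacles shape the rest. U acts on classes of functions,
   so freezing b(x) at each x has no direct meaning: every family c |-> U (psi - c phi) is Lipschitz
   in c with constant |U phi| (x), and comparisons are made at rational c, countably many almost
   sure statements at a time, before c approaches b(x). Strong bounds in L^q are first proved only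
   for finite sums of bounded jumps, and passing to phi costs an error that is small in L^1 only;
   the weak type (1, q) turns it into almost sure convergence along a fast sequence, and Fatou's
   lemma returns a strong bound, whose constant involves only the norms of phi in H1 and of b in
   BMO. *)
Require Import Defs.
From mathcomp Require Import all_boot all_order all_algebra.
From mathcomp Require Import all_classical all_reals all_analysis.
From mathcomp Require Import measurable_realfun ess_sup_inf lra ring.

Set Implicit Arguments.
Unset Strict Implicit.
Unset Printing Implicit Defensive.

Import Order.TTheory GRing.Theory Num.Theory.
Import numFieldNormedType.Exports.
Import HBNNSimple.

Local Open Scope classical_set_scope.
Local Open Scope ring_scope.

(** * Conditional expectations *)

Section expectation.
Context d (T : measurableType d) (R : realType) (P : probability T R).
Implicit Types (f g h w : T -> R) (A B : set T).

Notation L1 f := (P.-integrable setT (EFin \o f)).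
Notation Ex f := (Rintegral P setT f).

Lemma L1_measurable f : L1 f -> measurable_fun setT f.
Proof. by move=> /(measurable_int P) /measurable_EFinP. Qed.

Lemma LfunL1 f : f \in Lfun P 1%:E <-> L1 f.
Proof. exact: Lfun1_integrable. Qed.

Lemma ae2 (Q1 Q2 Q : T -> Prop) :
  (forall x, Q1 x -> Q2 x -> Q x) -> {ae P, forall x, Q1 x} ->
  {ae P, forall x, Q2 x} -> {ae P, forall x, Q x}.
Proof. by move=> H; apply: filterS2. Qed.

Lemma ae_le_integral f g : measurable_fun setT f -> measurable_fun setT g ->
  (forall x, 0 <= f x) -> (forall x, 0 <= g x) ->
  {ae P, forall x, f x <= g x} ->
  (\int[P]_x (f x)%:E <= \int[P]_x (g x)%:E)%E.
Proof.
move=> mf mg f0 g0 fg; apply: ae_ge0_le_integral => //.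
- by move=> x _; rewrite lee_fin.
- exact/measurable_EFinP.
- by move=> x _; rewrite lee_fin.
- exact/measurable_EFinP.
- by apply: filterS fg => x fgx _; rewrite lee_fin.
Qed.

Lemma L1_le f g : measurable_fun setT f -> L1 g ->
  {ae P, forall x, `|f x| <= g x} -> L1 f.
Proof.
move=> mf /integrableP[mg ig] fg; apply/integrableP; split.
  exact/measurable_EFinP.
apply: le_lt_trans ig => /=.
move/measurable_EFinP in mg.
apply: (@ae_le_integral (fun x => `|f x|) (fun x => `|g x|)) => //.
- exact: measurableT_comp.
- exact: measurableT_comp.
- by apply: filterS fg => x /le_trans; apply; exact: ler_norm.
Qed.

Lemma L1_cst (c : R) : L1 (fun=> c).
Proof. exact: finite_measure_integrable_cst. Qed.

Lemma L1D f g : L1 f -> L1 g -> L1 (fun x => f x + g x).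
Proof. move=> lf lg; have := integrableD measurableT lf lg; exact. Qed.

Lemma L1B f g : L1 f -> L1 g -> L1 (fun x => f x - g x).
Proof. move=> lf lg; have := integrableB measurableT lf lg.
by apply: eq_integrable => // x _. Qed.

Lemma L1Z (c : R) f : L1 f -> L1 (fun x => c * f x).
Proof. move=> lf; have := integrableZl measurableT c lf; exact. Qed.

Lemma L1_norm f : L1 f -> L1 (fun x => `|f x|).
Proof. by move=> lf; exact: integrable_norm. Qed.

Lemma L1_sum (I : Type) (s : seq I) (Q : pred I) (h : I -> T -> R) :
  (forall i, Q i -> L1 (h i)) -> L1 (fun x => \sum_(i <- s | Q i) h i x).
Proof.
move=> H; have := @integrable_sum _ _ _ P setT measurableT I s Q
  (fun i x => (h i x)%:E) H.
by apply: eq_integrable => // x _; rewrite /= sumEFin.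
Qed.

Lemma ExD f g : L1 f -> L1 g -> Ex (fun x => f x + g x) = Ex f + Ex g.
Proof. exact: RintegralD. Qed.

Lemma ExB f g : L1 f -> L1 g -> Ex (fun x => f x - g x) = Ex f - Ex g.
Proof. exact: RintegralB. Qed.

Lemma ExZ (c : R) f : L1 f -> Ex (fun x => c * f x) = c * Ex f.
Proof. exact: RintegralZl. Qed.

Lemma Ex_cst (c : R) : Ex (fun=> c) = c.
Proof.
rewrite (@Rintegral_cst _ _ _ P setT measurableT c).
rewrite (_ : fine _ = 1) ?mulr1 //.
by rewrite -[RHS]/(fine 1%E) -(probability_setT P).
Qed.

Lemma Ex_sum (I : Type) (s : seq I) (Q : pred I) (h : I -> T -> R) :
  (forall i, Q i -> L1 (h i)) ->
  Ex (fun x => \sum_(i <- s | Q i) h i x) = \sum_(i <- s | Q i) Ex (h i).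
Proof.
move=> H; elim: s => [|i s IH].
  by under eq_Rintegral do rewrite big_nil; rewrite Ex_cst big_nil.
under eq_Rintegral do rewrite big_cons; rewrite big_cons.
case: ifPn => // Qi; rewrite RintegralD ?IH //; [exact: H|exact: L1_sum].
Qed.

Lemma Ex_EFin f : L1 f -> (\int[P]_x (f x)%:E)%E = (Ex f)%:E.
Proof. by move=> lf; rewrite /Rintegral fineK// integrable_fin_num. Qed.

Lemma Ex_ae f g : L1 f -> measurable_fun setT g ->
  {ae P, forall x, f x = g x} -> L1 g /\ Ex g = Ex f.
Proof.
move=> lf mg fg.
have lg : L1 g.
  apply: (L1_le mg (L1_norm lf)).
  by apply: filterS fg => x ->.
split => //; congr fine; apply: ae_eq_integral => //.
- exact/measurable_EFinP.
- exact/measurable_EFinP/L1_measurable.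
- by apply: filterS fg => x /= ->.
Qed.

Lemma Ex_ge0 f : L1 f -> {ae P, forall x, 0 <= f x} -> 0 <= Ex f.
Proof.
move=> lf f0.
have [] := @Ex_ae f (fun x => `|f x|) lf.
- by apply: measurableT_comp => //; exact: L1_measurable.
- by apply: filterS f0 => x f0; rewrite ger0_norm.
- by move=> _ <-; apply: Rintegral_ge0.
Qed.

Lemma Ex_le f g : L1 f -> L1 g -> {ae P, forall x, f x <= g x} -> Ex f <= Ex g.
Proof.
move=> lf lg fg; rewrite -subr_ge0 -ExB//; apply: Ex_ge0; first exact: L1B.
by apply: filterS fg => x; rewrite subr_ge0.
Qed.

Lemma Ex_eq0 f : L1 f -> {ae P, forall x, 0 <= f x} -> Ex f <= 0 ->
  {ae P, forall x, f x = 0}.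
Proof.
move=> lf f0 Ef.
have lf' := L1_norm lf.
have E0 : Ex (fun x => `|f x|) = 0.
  have [|_ ->] := @Ex_ae f (fun x => `|f x|) lf (L1_measurable lf').
    by apply: filterS f0 => x f0; rewrite ger0_norm.
  by apply/eqP; rewrite eq_le Ef Ex_ge0.
have : (\int[P]_x `|(EFin \o f) x|)%E = 0%E.
  by rewrite -[RHS]/(0%:E) -E0 -Ex_EFin.
move=> /ae_eq_integral_abs H; have {H} := H measurableT (measurable_int P lf).
by apply: filterS => x /(_ Logic.I) [].
Qed.

Lemma integral_le_L1 f (c : R) : measurable_fun setT f -> (forall x, 0 <= f x) ->
  (\int[P]_x (f x)%:E <= c%:E)%E -> L1 f /\ Ex f <= c.
Proof.
move=> mf f0 H.
have lf : L1 f.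
  apply/integrableP; split; first exact/measurable_EFinP.
  under eq_integral => x _ do rewrite /= ger0_norm//.
  exact: le_lt_trans H (ltry _).
by split => //; rewrite -lee_fin -Ex_EFin.
Qed.

Lemma L1_indicM A f : measurable A -> L1 f -> L1 (fun x => \1_A x * f x).
Proof.
move=> mA lf; apply: (L1_le _ (L1_norm lf)).
  by apply: measurable_funM => //; exact: L1_measurable.
apply: aeW => x; rewrite normrM ger0_norm// indicE.
by case: (x \in A); rewrite ?mul1r ?mul0r.
Qed.

Lemma Ex_indic A f : measurable A ->
  Ex (fun x => \1_A x * f x) = Rintegral P A f.
Proof.
move=> mA; rewrite [RHS]Rintegral_mkcond; apply: eq_Rintegral => x _.
by rewrite indicE patchE; case: ifPn => _; rewrite ?mul1r ?mul0r.
Qed.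

Lemma Ex_indic1 A : measurable A -> (Ex \1_A)%:E = P A.
Proof.
move=> mA; rewrite -Ex_EFin; last exact: integrable_indic.
by rewrite integral_indic// setIT.
Qed.

End expectation.

(** * Conditional expectation given one sigma-algebra: existence and integrability *)

Section sub_sigma_algebra.
Context d (T : measurableType d) (R : realType) (P : probability T R).
Context (G : set (set T)) (sG : sigma_algebra setT G) (GT : G `<=` d.-measurable).
Implicit Types (f g h w : T -> R) (A B : set T).

Notation L1 f := (P.-integrable setT (EFin \o f)).
Notation Ex f := (Rintegral P setT f).
Notation gT := (g_sigma_algebraType G).

Lemma g_measurableE : (@measurable _ gT) = G.
Proof. exact: sigma_algebra_id. Qed.

Lemma g_measurable A : (@measurable _ gT) A -> G A.
Proof. by rewrite g_measurableE. Qed.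

Lemma measurable_forW d' (T' : sigmaRingType d') (f : T -> T') :
  measurable_for G f -> measurable_fun setT f.
Proof.
move=> mf _ Y mY; apply: GT.
have := mf _ Y mY; rewrite g_measurableE; apply.
by rewrite -(g_measurableE); exact: (@measurableT _ gT).
Qed.

Lemma measurable_for_preimage d' (T' : sigmaRingType d') (f : T -> T') Y :
  measurable_for G f -> measurable Y -> G (f @^-1` Y).
Proof.
move=> mf mY; have := mf (@measurableT _ gT) Y mY.
by rewrite g_measurableE setTI.
Qed.

Lemma measurable_for_indic A : G A -> measurable_for G (\1_A : T -> R).
Proof. by move=> GA; apply: (@measurable_indic _ gT); rewrite g_measurableE. Qed.

Lemma measurable_for_EFin f : measurable_for G (EFin \o f) <-> measurable_for G f.
Proof. exact: (@measurable_EFinP _ gT). Qed.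

(** The identity is read as a random variable with values in the space that carries only [G]: its
    distribution is the restriction of [P] to [G], the reference measure of the Radon-Nikodym
    theorem below. *)
Let toG : T -> gT := id.
Let mtoG : measurable_fun setT toG.
Proof. by move=> _ Y; rewrite g_measurableE setTI; exact: GT. Qed.

Let X : {mfun T >-> gT} :=
  MeasurableFun.Pack (MeasurableFun.Class (isMeasurableFun.Build _ _ _ _ _ mtoG)).

(** The conditional expectation is the Radon-Nikodym derivative, on the coarser sigma-algebra, of
    the charge A |-> E(f 1_A) with respect to the restriction of [P]. That derivative is finite
    everywhere, so that a real-valued version exists. *)
Lemma cond_exp_exists_L1 f : L1 f ->
  exists g, [/\ measurable_for G g, L1 g &
    forall A, G A -> (\int[P]_(x in A) (g x)%:E = \int[P]_(x in A) (f x)%:E)%E].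
Proof.
move=> lf.
pose nu : {charge set gT -> \bar R} :=
  measure_function_pushforward__canonical__charge_Charge (induced_charge lf) mtoG.
pose mu := distribution P X.
have numu : nu `<< mu.
  apply/null_content_dominatesP => A mA muA.
  rewrite /nu/= /pushforward /induced_charge/=.
  apply: null_set_integral => //.
  - by apply: GT; rewrite -g_measurableE.
  - apply: measurable_funTS; exact: measurable_int lf.
pose h := Radon_Nikodym nu mu.
have hfin x : h x \is a fin_num by exact: Radon_Nikodym_fin_num.
have ih : mu.-integrable setT h by exact: Radon_Nikodym_integrable.
have mh : @measurable_fun _ _ gT _ setT h := measurable_int _ ih.
have ihP : P.-integrable setT h.
  apply/integrableP; split; first exact: measurable_forW.
  move/integrableP : ih => [_].
  rewrite /mu /distribution ge0_integral_pushforward//.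
  exact: measurableT_comp.
exists (fine \o h); split.
- by apply/measurable_for_EFin; move: mh; congr measurable_fun;
    apply/funext => x /=; rewrite fineK.
- by move: ihP; apply: eq_integrable => // x _ /=; rewrite fineK.
- move=> A GA.
  have mA : @measurable _ gT A by rewrite g_measurableE.
  have <- : nu A = (\int[P]_(x in A) (f x)%:E)%E by [].
  rewrite (Radon_Nikodym_integral numu mA).
  under eq_integral => x _ do rewrite /= fineK//.
  rewrite /mu /distribution integral_pushforward//.
  by apply: integrableS ihP => //; exact: GT.
Qed.

Lemma simple_integral (h : {nnsfun gT >-> R}) (f : T -> \bar R) :
  measurable_fun setT f -> (forall x, 0 <= f x)%E ->
  (\int[P]_x ((h x)%:E * f x) =
   \sum_(y \in range h) y%:E * \int[P]_(x in h @^-1` [set y]) f x)%E.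
Proof.
move=> mf f0.
have mh1 y : d.-measurable (h @^-1` [set y]).
  by apply: GT; apply: g_measurable; exact: measurable_funPTI.
transitivity (\int[P]_x
   (\sum_(y \in range h) (y * \1_(h @^-1` [set y]) x)%:E * f x))%E.
  apply: eq_integral => x _.
  rewrite -ge0_mule_fsuml => [|y]; last exact: nnfun_muleindic_ge0.
  by congr (_ * _)%E; rewrite {1}(fimfunE h x) -fsumEFin.
rewrite ge0_integral_fsum//; last 2 first.
- move=> y; apply: emeasurable_funM => //; apply/measurable_EFinP.
  by apply: measurable_funM => //; exact: measurable_indic.
- by move=> y x _; rewrite mule_ge0 // nnfun_muleindic_ge0.
apply: eq_fsbigr => y; rewrite inE => -[t _ <-].
under eq_integral do rewrite EFinM -muleA.
rewrite ge0_integralZl//.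
- congr (_ * _)%E; under eq_integral do rewrite muleC.
  rewrite [RHS]integral_mkcond; apply: eq_integral => x _.
  by rewrite epatch_indic.
- apply: emeasurable_funM => //; apply/measurable_EFinP.
  exact: measurable_indic.
- by move=> x _; rewrite mule_ge0 // lee_fin.
- by rewrite lee_fin.
Qed.

(** The identity holds for indicators of sets of [G] by hypothesis, hence for simple functions, and
    monotone convergence along simple functions measurable for [G] gives it for [w]. The function
    [g] may take the value +oo. *)
Lemma ge0_pull_out (f g : T -> \bar R) w :
  measurable_fun setT f -> measurable_fun setT g ->
  (forall x, 0 <= f x)%E -> (forall x, 0 <= g x)%E ->
  (forall A, G A -> \int[P]_(x in A) g x = \int[P]_(x in A) f x)%E ->
  measurable_for G w -> (forall x, 0 <= w x) ->
  (\int[P]_x ((w x)%:E * g x) = \int[P]_x ((w x)%:E * f x))%E.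
Proof.
move=> mf mg f0 g0 fg mw w0.
have mw' : @measurable_fun _ _ gT _ setT (EFin \o w).
  exact/measurable_for_EFin.
pose h := nnsfun_approx (@measurableT _ gT) mw'.
have lim_h (k : T -> \bar R) : measurable_fun setT k -> (forall x, 0 <= k x)%E ->
    (\int[P]_x ((w x)%:E * k x) =
     limn (fun n => \int[P]_x ((h n x)%:E * k x)))%E.
  move=> mk k0.
  rewrite -monotone_convergence//.
  - apply: eq_integral => x _; apply/esym/cvg_lim => //.
    have := @cvg_nnsfun_approx _ _ _ _ (@measurableT _ gT) _ mw'
      (fun x _ => ltac:(by rewrite lee_fin)) x I.
    move: (k0 x); case: (k x) => [r r0|_|//] H.
    + by apply: cvgeZr H.
    (* At a point where [k] is infinite, the product with [w x = 0] is 0 and so are all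
       approximations, since they stay below [w]; where [w x > 0] they are eventually positive and
       the products are eventually +oo. *)
    + have [wx0|wx0] := eqVneq (w x) 0.
        rewrite wx0 mul0e.
        rewrite (_ : (fun _ => _) = cst 0%E); first exact: cvg_cst.
        apply/funext => n; rewrite (_ : h n x = 0) ?mul0e//.
        have := @le_approx _ gT R setT (EFin \o w) n x
          (fun x _ => ltac:(by rewrite lee_fin)) I.
        rewrite -nnsfun_approxE /= wx0 lee_fin => hle.
        by apply/eqP; rewrite eq_le hle/=.
      have wx : 0 < w x by rewrite lt_neqAle eq_sym wx0 w0.
      rewrite gt0_muley ?lte_fin//.
      have : \forall n \near \oo, (0 < (h n x)%:E)%E.
        move/fine_cvgP : H => [_ /cvgr_gt /(_ _ wx)]; apply: filterS => n.
        by rewrite lte_fin.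
      move=> hn; apply: cvg_near_cst; near=> n.
      rewrite gt0_muley//; near: n; exact: hn.
  - move=> n; apply: emeasurable_funM => //; apply/measurable_EFinP.
    exact: measurable_forW (measurable_funPT _).
  - by move=> n x _; rewrite mule_ge0// lee_fin.
  - move=> x _ m n mn; apply: lee_wpmul2r => //; rewrite lee_fin.
    have /lefP := @nd_nnsfun_approx _ gT R _ (@measurableT _ gT) _ mw' _ _ mn.
  exact.
rewrite !lim_h//; congr (limn _); apply/funext => n.
rewrite !simple_integral//; apply: eq_fsbigr => y _; congr (_ * _)%E.
by apply: fg; apply: g_measurable; exact: measurable_funPTI.
Unshelve. all: by end_near. Qed.

Lemma L1_set A f : L1 f -> measurable A ->
  (\int[P]_(x in A) (f x)%:E)%E = (Ex (fun x => \1_A x * f x))%:E.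
Proof.
move=> lf mA; rewrite Ex_indic// /Rintegral fineK//.
by apply: integrable_fin_num => //; exact: integrableS lf.
Qed.

(** The set where f > g belongs to [G]; testing the hypothesis on it forces the nonnegative function
    1_A (f - g) to have integral at most 0, hence to vanish almost everywhere. *)
Lemma cond_le f g : measurable_for G f -> measurable_for G g -> L1 f -> L1 g ->
  (forall A, G A -> Ex (fun x => \1_A x * f x) <= Ex (fun x => \1_A x * g x)) ->
  {ae P, forall x, f x <= g x}.
Proof.
move=> mf mg lf lg H.
pose A := [set x | 0 < f x - g x].
have GA : G A.
  have mfg : measurable_for G (fun x => f x - g x).
    exact: (@measurable_funB _ gT).
  rewrite (_ : A = (fun x => f x - g x) @^-1` `]0, +oo[%classic).
    exact: measurable_for_preimage.
  by apply/seteqP; split => x /=; rewrite in_itv/= andbT.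
have mA := GT GA.
have lA : L1 (fun x => \1_A x * (f x - g x)) by apply: L1_indicM => //; exact: L1B.
have A0 x : 0 <= \1_A x * (f x - g x).
  rewrite indicE; case: (boolP (x \in A)) => [|_]; last by rewrite mul0r.
  by rewrite inE mul1r /A/= => /ltW.
have : {ae P, forall x, \1_A x * (f x - g x) = 0}.
  apply: Ex_eq0 => //; first exact: aeW.
  under eq_Rintegral do rewrite mulrBr.
  by rewrite ExB ?subr_le0 ?H//; exact: L1_indicM.
apply: filterS => x; rewrite indicE.
case: (boolP (x \in A)) => [|].
  by rewrite inE /A/= mul1r => + h; rewrite h ltxx.
by rewrite notin_setE /A/= => /negP; rewrite -leNgt subr_le0.
Qed.

Lemma cond_ge0 f : measurable_for G f -> L1 f ->
  (forall A, G A -> 0 <= Ex (fun x => \1_A x * f x)) ->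
  {ae P, forall x, 0 <= f x}.
Proof.
move=> mf lf H.
apply: (@cond_le (fun=> 0) f) => //; first exact: (@measurable_cst _ _ gT).
  exact: L1_cst.
move=> A GA; under eq_Rintegral do rewrite mulr0.
by rewrite Ex_cst H.
Qed.

(** The function is cut into the slices min(f, k + 1) - min(f, k), with values in [0, 1], whose
    conditional expectations exist in L^1; their sum is the one sought, with values up to +oo. *)
Lemma cond_exp_exists_ge0 f : measurable_fun setT f -> (forall x, 0 <= f x) ->
  exists g : T -> \bar R, is_cond_exp P G (EFin \o f) g.
Proof.
move=> mf f0.
pose fk k x := Num.min (f x) k.+1%:R - Num.min (f x) k%:R.
have fk0 k x : 0 <= fk k x.
  by rewrite subr_ge0 le_min2// ler_nat.
have mfk k : measurable_fun setT (fk k).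
  by apply: measurable_funB; apply: measurable_minr.
have lfk k : L1 (fk k).
  apply: (@L1_le _ _ _ _ _ (fun=> 1)) => //; first exact: L1_cst.
  apply: aeW => x; rewrite ger0_norm// /fk -natr1.
  rewrite /Num.min; case: ifP; case: ifP; lra.
have sumfk x : (\sum_(0 <= k <oo) (fk k x)%:E = (f x)%:E)%E.
  apply/cvg_lim => //.
  rewrite (_ : (fun _ => _) = fun n : nat => (Num.min (f x) n%:R)%:E); last first.
    apply/funext => n; rewrite sumEFin /fk telescope_sumr//.
    by rewrite (_ : Num.min (f x) 0%:R = 0) ?subr0//; apply/min_idPr.
  apply: cvg_near_cst; near=> n; congr EFin; apply/min_idPl.
  near: n; exact: nbhs_infty_ger.
have /choice[h hP] k := cond_exp_exists_L1 (lfk k).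
have h0 k : {ae P, forall x, 0 <= h k x}.
  have [mh lh Eh] := hP k; apply: cond_ge0 => // A GA.
  rewrite -lee_fin -L1_set//; last exact: GT.
  by rewrite Eh// integral_ge0// => x _; rewrite lee_fin.
(* The conditional expectations are nonnegative only almost everywhere; absolute values make the
   series meaningful at every point without changing the integrals. *)
have mh k : measurable_for G (fun x => `|h k x|).
  apply: (@measurableT_comp _ _ _ gT) => //.
  by have [] := hP k.
exists (fun x => \sum_(0 <= k <oo) (`|h k x|)%:E)%E; split.
  apply: (@ge0_emeasurable_sum _ gT) => //.
  by move=> k _; apply/measurable_for_EFin; exact: mh.
move=> A GA; have mA := GT GA.
rewrite integral_nneseries//; last first.
  by move=> k; apply/measurable_EFinP/measurable_funTS; apply: measurable_forW.
under eq_integral => x _ do rewrite /= -sumfk.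
rewrite integral_nneseries//; last 2 first.
- by move=> k; apply/measurable_EFinP/measurable_funTS.
- by move=> k x _; rewrite lee_fin.
apply: eq_eseriesr => k _; have [mhk lh <-//] := hP k.
apply: ae_eq_integral => //.
- by apply/measurable_EFinP/measurable_funTS; apply: measurable_forW.
- by apply/measurable_EFinP/measurable_funTS; apply: measurable_forW.
- by apply: filterS (h0 k) => x hx _; rewrite ger0_norm.
Unshelve. all: by end_near. Qed.

(** [cond_exp] is an arbitrarily chosen function with the defining property, so its integrability
    has to come from that property alone: the sets where it is nonnegative and negative belong to
    [G], and on each the integral of |g| is, up to sign, that of f. *)
Lemma is_cond_exp_integrable f (g : T -> \bar R) : L1 f -> is_cond_exp P G (EFin \o f) g ->
  P.-integrable setT g.
Proof.
move=> lf [mg Eg].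
have mg' := measurable_forW mg.
pose A := g @^-1` `[0%E, +oo[%classic.
have GA : G A.
  rewrite /A; apply: measurable_for_preimage => //.
  exact: emeasurable_itv.
have GAc : G (~` A).
  by apply: g_measurable; apply: measurableC; rewrite g_measurableE.
have mA := GT GA; have mAc := GT GAc.
apply/integrableP; split => //.
have mag : measurable_fun setT (fun x => `|g x|%E) by exact: measurableT_comp.
rewrite -(setUv A) ge0_integral_setU//; last 2 first.
- by rewrite setUv.
- by apply/disj_setPS; rewrite setICr.
apply: lte_add_pinfty.
  rewrite (eq_integral g); last first.
    by move=> x; rewrite inE /A/= in_itv/= andbT => g0; rewrite gee0_abs.
  rewrite Eg// L1_set//; exact: ltry.
rewrite (_ : integral _ _ _ = (- \int[P]_(x in ~` A) g x)%E).
  by rewrite Eg// L1_set// -EFinN ltry.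
rewrite -[LHS]oppeK; congr (- _)%E.
rewrite -integral_ge0N//; apply: eq_integral => x.
rewrite inE /A/= in_itv/= andbT => /negP; rewrite -ltNge => g0.
by rewrite lte0_abs// oppeK.
Qed.

(** An integrable version is finite almost everywhere, so nothing is lost in the passage to real
    values by [fine] that defines [mart]. *)
Lemma cond_expP f : L1 f ->
  [/\ measurable_for G (fine \o cond_exp P G (EFin \o f)),
      L1 (fine \o cond_exp P G (EFin \o f)),
      {ae P, forall x, cond_exp P G (EFin \o f) x =
                       (fine (cond_exp P G (EFin \o f) x))%:E} &
      forall A, G A -> Ex (fun x => \1_A x * fine (cond_exp P G (EFin \o f) x)) =
                       Ex (fun x => \1_A x * f x)].
Proof.
move=> lf; set c := cond_exp P G _.
have [mc Ec] : is_cond_exp P G (EFin \o f) c.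
  have [g [mg lg Eg]] := cond_exp_exists_L1 lf.
  apply: (@xgetPex _ _ [set g | is_cond_exp P G (EFin \o f) g]).
  by exists (EFin \o g); split => //; apply/measurable_for_EFin.
have ic : P.-integrable setT c by apply: is_cond_exp_integrable lf _; split.
have mfc : measurable_for G (fine \o c).
  exact: (@measurableT_comp _ _ _ gT).
have cfin : {ae P, forall x, c x = (fine (c x))%:E}.
  have := integrable_ae measurableT ic; apply: filterS => x /(_ I) cx.
  by rewrite fineK.
have lfc : L1 (fine \o c).
  apply/integrableP; split; first by apply/measurable_EFinP/measurable_forW.
  move/integrableP : ic => [mc' ]; apply: le_lt_trans.
  apply: ge0_le_integral => //.
  - by apply: measurableT_comp => //; apply/measurable_EFinP/measurable_forW.
  - exact: measurableT_comp.
  - by move=> x _ /=; case: (c x) => [r| |] /=; rewrite ?normr0 ?leey.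
split => // A GA; apply: EFin_inj; rewrite -!L1_set//; [|exact: GT..].
rewrite -Ec//; apply: ae_eq_integral => //.
- exact: GT.
- by apply/measurable_EFinP/measurable_funTS/measurable_forW.
- exact/measurable_funTS/measurable_forW.
- by apply: filterS cfin => x ->.
Qed.

End sub_sigma_algebra.

(** Each call adds an almost sure fact as a premise of the pointwise goal; [ae_intro] then fixes the
    point. The premises are introduced in the reverse order of the calls. *)
Ltac ae_using H := generalize H; apply: filter_app.
Ltac ae_intro := apply: aeW; cbv beta.

Lemma ae_countable (I : countType) d (T : measurableType d) (R : realType)
    (P : {measure set T -> \bar R}) (Q : I -> T -> Prop) :
  (forall i, {ae P, forall x, Q i x}) -> {ae P, forall x, forall i, Q i x}.
Proof.
move=> H.
have : {ae P, forall x, forall k : nat, forall i, unpickle k = Some i -> Q i x}.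
  apply/ae_foralln => k; case E : (unpickle k) => [i|].
    by apply: filterS (H i) => x Qx j [<-].
  exact: aeW.
by apply: filterS => x Hx i; apply: (Hx (pickle i)); rewrite pickleK.
Qed.

(** * Conditional expectations along the filtration *)

Section filtration.
Context d (T : measurableType d) (R : realType) (P : probability T R).
Context (F : (set (set T))^nat) (SB : stochastic_basis P F).
Implicit Types (f g h w : T -> R) (A B : set T) (n m : nat).

Notation L1 f := (P.-integrable setT (EFin \o f)).
Notation Ex f := (Rintegral P setT f).
Notation mart := (mart P F).

Let sF n : sigma_algebra setT (F n) := @basis_sigma_algebra _ _ _ _ _ SB n.
Let FT n : F n `<=` d.-measurable := @basis_sub _ _ _ _ _ SB n.

Lemma filtration_mono n m : (n <= m)%N -> F n `<=` F m.
Proof.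
move=> /subnK <-; elim: (m - n)%N => // k IH.
by apply: subset_trans IH _; exact: basis_increasing SB _.
Qed.

Lemma filtration_setT n : F n setT.
Proof. by have [F0 FD _] := sF n; rewrite -(setD0 setT); exact: FD. Qed.

Lemma filtration_measurable n A : F n A -> d.-measurable A.
Proof. exact: FT. Qed.

Lemma adapted_measurable n f : measurable_for (F n) f -> measurable_fun setT f.
Proof. exact: measurable_forW (sF n) (@FT n) _ _ _. Qed.

Lemma adapted_mono n m f : (n <= m)%N -> measurable_for (F n) f ->
  measurable_for (F m) f.
Proof.
move=> nm mf _ Y mY; rewrite setTI (g_measurableE (sF m)).
apply: (filtration_mono nm).
exact: measurable_for_preimage (sF n) _ _ _ _ mf mY.
Qed.

Lemma adapted_set n (f : T -> R) Y : measurable_for (F n) f -> measurable Y ->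
  F n (f @^-1` Y).
Proof. exact: measurable_for_preimage (sF n) _ _ _ _. Qed.

Lemma adapted_indic n A : F n A -> measurable_for (F n) (\1_A : T -> R).
Proof. exact: measurable_for_indic (sF n) _. Qed.

Section martingale_of_function.
Context (f : T -> R) (lf : L1 f) (n : nat).

Lemma mart_adapted : measurable_for (F n) (mart f n).
Proof. by have [] := cond_expP (sF n) (@FT n) lf. Qed.

Lemma mart_measurable : measurable_fun setT (mart f n).
Proof. exact: adapted_measurable mart_adapted. Qed.

Lemma mart_L1 : L1 (mart f n).
Proof. by have [] := cond_expP (sF n) (@FT n) lf. Qed.

Lemma mart_set A : F n A ->
  Ex (fun x => \1_A x * mart f n x) = Ex (fun x => \1_A x * f x).
Proof. by have [_ _ _] := cond_expP (sF n) (@FT n) lf; apply. Qed.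

Lemma cond_exp_mart :
  {ae P, forall x, cond_exp P (F n) (EFin \o f) x = (mart f n x)%:E}.
Proof. by have [_ _ +] := cond_expP (sF n) (@FT n) lf. Qed.

End martingale_of_function.
Arguments mart_adapted {f} lf n _ _ _.
Arguments mart_measurable {f} lf n _ _ _.

Lemma adapted_le n f g : measurable_for (F n) f -> measurable_for (F n) g ->
  L1 f -> L1 g ->
  (forall A, F n A -> Ex (fun x => \1_A x * f x) <= Ex (fun x => \1_A x * g x)) ->
  {ae P, forall x, f x <= g x}.
Proof. exact: cond_le (sF n) (@FT n) _ _. Qed.

Lemma adapted_eq n f g : measurable_for (F n) f -> measurable_for (F n) g ->
  L1 f -> L1 g ->
  (forall A, F n A -> Ex (fun x => \1_A x * f x) = Ex (fun x => \1_A x * g x)) ->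
  {ae P, forall x, f x = g x}.
Proof.
move=> mf mg lf lg H; have := @adapted_le n f g mf mg lf lg.
have := @adapted_le n g f mg mf lg lf.
move=> H1 H2; apply: ae2 (H1 _) (H2 _) => [x||].
- by move=> h1 h2; apply/eqP; rewrite eq_le h1 h2.
- by move=> A GA; rewrite H.
- by move=> A GA; rewrite H.
Qed.

Lemma mart_unique n f g : L1 f -> measurable_for (F n) g -> L1 g ->
  (forall A, F n A -> Ex (fun x => \1_A x * g x) = Ex (fun x => \1_A x * f x)) ->
  {ae P, forall x, mart f n x = g x}.
Proof.
move=> lf mg lg H; apply: (@adapted_eq n).
- exact: mart_adapted.
- exact: mg.
- exact: mart_L1.
- exact: lg.
- by move=> A FA; rewrite mart_set// H.
Qed.

Lemma Ex_mart f n : L1 f -> Ex (mart f n) = Ex f.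
Proof.
move=> lf; have := mart_set lf (@filtration_setT n).
under eq_Rintegral do rewrite indicT mul1r.
by under [in X in _ = X -> _]eq_Rintegral do rewrite indicT mul1r.
Qed.

Lemma Ex_indic_le A f g : measurable A -> L1 f -> L1 g ->
  {ae P, forall x, f x <= g x} ->
  Ex (fun x => \1_A x * f x) <= Ex (fun x => \1_A x * g x).
Proof.
move=> mA lf lg fg; apply: Ex_le; [exact: L1_indicM|exact: L1_indicM|].
by apply: filterS fg => x fgx; apply: ler_wpM2l.
Qed.

Lemma mart_le f g n : L1 f -> L1 g -> {ae P, forall x, f x <= g x} ->
  {ae P, forall x, mart f n x <= mart g n x}.
Proof.
move=> lf lg fg; apply: (@adapted_le n);
  [exact: mart_adapted|exact: mart_adapted|exact: mart_L1|exact: mart_L1|].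
move=> A FA; rewrite !mart_set//; apply: Ex_indic_le => //.
exact: filtration_measurable FA.
Qed.

Lemma mart_ae f g n : L1 f -> L1 g -> {ae P, forall x, f x = g x} ->
  {ae P, forall x, mart f n x = mart g n x}.
Proof.
move=> lf lg fg; have fg' : {ae P, forall x, g x = f x} by apply: filterS fg.
apply: ae2 (mart_le n lf lg _) (mart_le n lg lf _) => [x h1 h2||].
- by apply/eqP; rewrite eq_le h1 h2.
- by apply: filterS fg => x ->.
- by apply: filterS fg => x ->.
Qed.

Lemma adaptedD n f g : measurable_for (F n) f -> measurable_for (F n) g ->
  measurable_for (F n) (fun x => f x + g x).
Proof. exact: (@measurable_funD _ (g_sigma_algebraType (F n))). Qed.

Lemma adaptedB n f g : measurable_for (F n) f -> measurable_for (F n) g ->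
  measurable_for (F n) (fun x => f x - g x).
Proof. exact: (@measurable_funB _ (g_sigma_algebraType (F n))). Qed.

Lemma adaptedM n f g : measurable_for (F n) f -> measurable_for (F n) g ->
  measurable_for (F n) (fun x => f x * g x).
Proof. exact: (@measurable_funM _ (g_sigma_algebraType (F n))). Qed.

Lemma adapted_cst n (c : R) : measurable_for (F n) (fun=> c).
Proof. exact: (@measurable_cst _ _ (g_sigma_algebraType (F n))). Qed.

Lemma adapted_comp n (k : R -> R) f : measurable_fun setT k ->
  measurable_for (F n) f -> measurable_for (F n) (fun x => k (f x)).
Proof.
by move=> mk; exact: (@measurableT_comp _ _ _ (g_sigma_algebraType (F n))).
Qed.

Lemma adapted_sum n (I : Type) (s : seq I) (Q : pred I) (h : I -> T -> R) :
  (forall i, Q i -> measurable_for (F n) (h i)) ->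
  measurable_for (F n) (fun x => \sum_(i <- s | Q i) h i x).
Proof.
move=> H; elim: s => [|i s IH].
  by under eq_fun do rewrite big_nil; exact: adapted_cst.
under eq_fun do rewrite big_cons; case Qi : (Q i) => //.
by apply: adaptedD => //; exact: H.
Qed.

Lemma mart_lin (a b : R) f g n : L1 f -> L1 g ->
  {ae P, forall x, mart (fun y => a * f y + b * g y) n x =
                   a * mart f n x + b * mart g n x}.
Proof.
move=> lf lg; have lfg : L1 (fun y => a * f y + b * g y).
  by apply: L1D; exact: L1Z.
have mf := mart_adapted lf n; have mg := mart_adapted lg n.
have lf' := mart_L1 lf n; have lg' := mart_L1 lg n.
apply: mart_unique => //.
- by apply: adaptedD; apply: adaptedM => //; exact: adapted_cst.
- by apply: L1D; exact: L1Z.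
- move=> A FA; have mA := filtration_measurable FA.
  have E h k : L1 h -> L1 k -> Ex (fun x => \1_A x * (a * h x + b * k x)) =
      a * Ex (fun x => \1_A x * h x) + b * Ex (fun x => \1_A x * k x).
    move=> lh lk; under eq_Rintegral do rewrite mulrDr (mulrCA _ a) (mulrCA _ b).
    rewrite ExD ?ExZ//; do ?[exact: L1_indicM]; by apply: L1Z; exact: L1_indicM.
  by rewrite !E// !mart_set.
Qed.

Lemma martB f g n : L1 f -> L1 g ->
  {ae P, forall x, mart (fun y => f y - g y) n x = mart f n x - mart g n x}.
Proof.
move=> lf lg; have := mart_lin 1 (-1) n lf lg; apply: filterS => x.
rewrite mul1r mulN1r => <-; congr (mart _ n x).
by apply/funext => y; rewrite mul1r mulN1r.
Qed.

Lemma martD f g n : L1 f -> L1 g ->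
  {ae P, forall x, mart (fun y => f y + g y) n x = mart f n x + mart g n x}.
Proof.
move=> lf lg; have := mart_lin 1 1 n lf lg; apply: filterS => x.
rewrite !mul1r => <-; congr (mart _ n x).
by apply/funext => y; rewrite !mul1r.
Qed.

Lemma mart_id f n m : (n <= m)%N -> measurable_for (F n) f -> L1 f ->
  {ae P, forall x, mart f m x = f x}.
Proof. by move=> nm mf lf; apply: mart_unique => //; exact: adapted_mono mf. Qed.

Lemma mart_cst (c : R) n : {ae P, forall x, mart (fun=> c) n x = c}.
Proof.
by apply: (@mart_id _ n n) => //; [exact: adapted_cst|exact: L1_cst].
Qed.

Lemma mart_tower f n m : (n <= m)%N -> L1 f ->
  {ae P, forall x, mart (mart f m) n x = mart f n x}.
Proof.
move=> nm lf; apply: mart_unique.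
- exact: mart_L1.
- exact: mart_adapted.
- exact: mart_L1.
- move=> A FA; rewrite mart_set// mart_set//; exact: filtration_mono nm _ FA.
Qed.

Lemma mart_ge0 f n : L1 f -> {ae P, forall x, 0 <= f x} ->
  {ae P, forall x, 0 <= mart f n x}.
Proof.
move=> lf f0; apply: ae2 (mart_le n (L1_cst P 0) lf f0) (mart_cst 0 n) => x.
by move=> + <-.
Qed.

Lemma mart_norm f n : L1 f ->
  {ae P, forall x, `|mart f n x| <= mart (fun y => `|f y|) n x}.
Proof.
move=> lf; have lf' := L1_norm lf.
have h1 := mart_le n lf lf' (aeW P (fun x => ler_norm (f x))).
have h2 : {ae P, forall x, 0 <= mart (fun y => `|f y| + f y) n x}.
  apply: mart_ge0; first exact: L1D.
  apply: aeW => x; rewrite -lerBlDr sub0r; have := ler_norm (- f x).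
  by rewrite normrN.
ae_using h1; ae_using h2; ae_using (martD n lf' lf); ae_intro => x ->.
by rewrite ler_norml => h3 ->; rewrite andbT; lra.
Qed.

Lemma mart_bound f n (C : R) : L1 f -> {ae P, forall x, `|f x| <= C} ->
  {ae P, forall x, `|mart f n x| <= C}.
Proof.
move=> lf fC; have h := mart_le n (L1_norm lf) (L1_cst P C) fC.
ae_using (mart_norm n lf); ae_using h; ae_using (mart_cst C n).
by ae_intro => x -> h1 h2; exact: le_trans h2 h1.
Qed.

(** First of three stages of the pull-out property: here w and f are nonnegative and monotone
    convergence applies; next f = |f| - (|f| - f) removes the sign of f, then w = |w| - (|w| - w)
    that of w. *)
Lemma pull_out_ge0 w f n : measurable_for (F n) w -> L1 f ->
  L1 (fun x => w x * f x) -> (forall x, 0 <= w x) -> (forall x, 0 <= f x) ->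
  L1 (fun x => w x * mart f n x) /\
  Ex (fun x => w x * mart f n x) = Ex (fun x => w x * f x).
Proof.
move=> mw lf lwf w0 f0.
have g0 := mart_ge0 n lf (aeW P f0).
have mg := mart_measurable lf n.
have mag : measurable_fun setT (fun x => `|mart f n x|).
  exact: measurableT_comp.
have mw' := adapted_measurable mw.
have gag : {ae P, forall x, `|mart f n x| = mart f n x}.
  by apply: filterS g0 => x ?; rewrite ger0_norm.
have EA A : F n A ->
    (\int[P]_(x in A) (`|mart f n x|)%:E = \int[P]_(x in A) (EFin \o f) x)%E.
  move=> FA; have mA := filtration_measurable FA.
  rewrite [RHS]L1_set// -(mart_set lf FA) -L1_set//; last exact: mart_L1.
  apply: ae_eq_integral => //.
  - exact/measurable_EFinP/measurable_funTS.
  - exact/measurable_EFinP/measurable_funTS.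
  - by apply: filterS gag => x ->.
have Ew : (\int[P]_x (w x * `|mart f n x|)%:E = \int[P]_x (w x * f x)%:E)%E.
  under eq_integral do rewrite EFinM.
  under [in RHS]eq_integral do rewrite EFinM.
  apply: (@ge0_pull_out _ _ _ P _ (sF n) (@FT n) (EFin \o f)
      (fun x => (`|mart f n x|)%:E) w) => //.
  - apply/measurable_EFinP; exact: L1_measurable lf.
  - exact/measurable_EFinP.
have [|||law eaw] := @integral_le_L1 _ _ _ P (fun x => w x * `|mart f n x|)
    (Ex (fun x => w x * f x)).
- exact: measurable_funM.
- by move=> x; rewrite mulr_ge0.
- by rewrite -Ex_EFin// Ew.
have [||lw ->] := @Ex_ae _ _ _ P (fun x => w x * `|mart f n x|)
    (fun x => w x * mart f n x) law.
- exact: measurable_funM.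
- by apply: filterS gag => x ->.
- by split => //; rewrite /Rintegral Ew.
Qed.

Lemma L1_dom f g : measurable_fun setT f -> L1 g ->
  (forall x, `|f x| <= `|g x|) -> L1 f.
Proof. by move=> mf lg fg; apply: L1_le mf (L1_norm lg) _; exact: aeW. Qed.

Lemma pull_out_w0 w f n : measurable_for (F n) w -> L1 f ->
  L1 (fun x => w x * f x) -> (forall x, 0 <= w x) ->
  L1 (fun x => w x * mart f n x) /\
  Ex (fun x => w x * mart f n x) = Ex (fun x => w x * f x).
Proof.
move=> mw lf lwf w0; have mw' := adapted_measurable mw.
have mf := L1_measurable lf.
have laf := L1_norm lf.
have lB := L1B laf lf.
have lw1 : L1 (fun x => w x * `|f x|).
  apply: (L1_dom _ lwf) => [|x]; last by rewrite !normrM normr_id.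
  by apply: measurable_funM => //; exact: L1_measurable laf.
have lw2 : L1 (fun x => w x * (`|f x| - f x)).
  by have := L1B lw1 lwf; apply: eq_integrable => // x _ /=; rewrite mulrBr.
have [l1 E1] := pull_out_ge0 mw laf lw1 w0 (fun x => normr_ge0 _).
have [|l2 E2] := pull_out_ge0 mw lB lw2 w0.
  by move=> x; rewrite subr_ge0 ler_norm.
have [] := @Ex_ae _ _ _ P (fun x => w x * mart (fun y => `|f y|) n x -
   w x * mart (fun y => `|f y| - f y) n x) (fun x => w x * mart f n x).
- exact: L1B.
- by apply: measurable_funM => //; exact: mart_measurable.
- apply: filterS (martB n laf lf) => x ->; rewrite -mulrBr; congr (_ * _); ring.
- move=> lw ->; split => //; rewrite ExB// E1 E2 -ExB//.
  by apply: eq_Rintegral => x _; ring.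
Qed.

Lemma pull_out w f n : measurable_for (F n) w -> L1 f ->
  L1 (fun x => w x * f x) ->
  L1 (fun x => w x * mart f n x) /\
  Ex (fun x => w x * mart f n x) = Ex (fun x => w x * f x).
Proof.
move=> mw lf lwf; have mw' := adapted_measurable mw.
have mf := L1_measurable lf.
have maw : measurable_for (F n) (fun x => `|w x|).
  by apply: adapted_comp.
have mB : measurable_for (F n) (fun x => `|w x| - w x) by exact: adaptedB.
have lw1 : L1 (fun x => `|w x| * f x).
  apply: (L1_dom _ lwf) => [|x]; last by rewrite !normrM normr_id.
  by apply: measurable_funM => //; exact: adapted_measurable maw.
have lw2 : L1 (fun x => (`|w x| - w x) * f x).
  by have := L1B lw1 lwf; apply: eq_integrable => // x _ /=; rewrite mulrBl.
have [l1 E1] := pull_out_w0 maw lf lw1 (fun x => normr_ge0 _).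
have [|l2 E2] := pull_out_w0 mB lf lw2.
  by move=> x; rewrite subr_ge0 ler_norm.
have lw : L1 (fun x => w x * mart f n x).
  by have := L1B l1 l2; apply: eq_integrable => // x _ /=; congr EFin; ring.
split => //.
transitivity (Ex (fun x => `|w x| * mart f n x - (`|w x| - w x) * mart f n x)).
  by apply: eq_Rintegral => x _; ring.
rewrite ExB// E1 E2 -ExB//; by apply: eq_Rintegral => x _; ring.
Qed.

Lemma mart_pull w f n : measurable_for (F n) w -> L1 f ->
  L1 (fun x => w x * f x) ->
  {ae P, forall x, mart (fun y => w y * f y) n x = w x * mart f n x}.
Proof.
move=> mw lf lwf; have [lw _] := pull_out mw lf lwf.
apply: mart_unique => //.
  by apply: adaptedM => //; exact: mart_adapted.
move=> A FA; have mA := filtration_measurable FA.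
have mAw : measurable_for (F n) (fun x => \1_A x * w x).
  by apply: adaptedM => //; exact: adapted_indic.
have lAw : L1 (fun x => (\1_A x * w x) * f x).
  by have := L1_indicM mA lwf; apply: eq_integrable => // x _ /=; rewrite mulrA.
have [_] := pull_out mAw lf lAw.
under eq_Rintegral do rewrite -mulrA.
by under [in X in _ = X -> _]eq_Rintegral do rewrite -mulrA.
Qed.

(** Conditional Jensen's inequality for the square, which is the supremum of its tangents 2 c y -
    c^2. Rational c leave countably many almost sure inequalities. *)
Lemma mart_sqr f n : L1 f -> L1 (fun x => f x ^+ 2) ->
  {ae P, forall x, mart f n x ^+ 2 <= mart (fun y => f y ^+ 2) n x}.
Proof.
move=> lf lf2.
have H (c : rat) : {ae P, forall x,
    2 * ratr c * mart f n x - (ratr c) ^+ 2 <= mart (fun y => f y ^+ 2) n x}.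
  set r : R := ratr c.
  have l1 : L1 (fun y => 2 * r * f y + r ^+ 2 * (- 1)).
    by apply: L1D; apply: L1Z => //; exact: L1_cst.
  have l2 : {ae P, forall x, 2 * r * f x + r ^+ 2 * (- 1) <= f x ^+ 2}.
    by apply: aeW => x; have := sqr_ge0 (f x - r); rewrite !expr2; nra.
  ae_using (mart_le n l1 lf2 l2); ae_using (mart_lin (2 * r) (r ^+ 2) n lf (L1_cst P (-1))).
  ae_using (mart_cst (-1) n); ae_intro => x.
  by move=> -> -> ; rewrite mulrN1.
have := ae_countable H; apply: filterS => x Hx.
set m := mart f n x in Hx *.
apply/ler_addgt0Pr => e e0.
(* With |c - m| below min(1, e), (c - m)^2 <= e, and the tangent at c misses m^2 by exactly (c -
   m)^2. *)
have /rat_in_itvoo[c] : m - Num.min 1 e < m + Num.min 1 e.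
  by rewrite ltrBlDr -addrA ltrDl addr_gt0// lt_min ltr01.
rewrite in_itv/= => /andP[c1 c2]; have := Hx c.
have : (ratr c - m) ^+ 2 <= e.
  have d0 : 0 < Num.min 1 e by rewrite lt_min ltr01.
  have d1 : Num.min 1 e <= 1 by rewrite ge_min lexx.
  have d2 : Num.min 1 e <= e by rewrite ge_min lexx orbT.
  move: (Num.min 1 e) c1 c2 d0 d1 d2 => D; set r := ratr c.
  rewrite expr2; nra.
rewrite !expr2; set r : R := ratr c; nra.
Qed.

End filtration.
Arguments mart_adapted [d T R P F] SB [f] lf n _ _ _ _ _.

(** * Square sums and running maxima of a numerical sequence *)

Section sequences.
Context (R : realType).
Implicit Types (a : R^nat) (k n N : nat).

(** The sum stops before k: for adapted differences, [sqsum a k] is known at the time k - 1, the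
    predictability on which the Davis decomposition rests. *)
Definition sqsum a k : R := Num.sqrt (\sum_(i < k) a i ^+ 2).

Lemma sqsum_ge0 a k : 0 <= sqsum a k.
Proof. exact: sqrtr_ge0. Qed.

Lemma sqr_sqsum a k : sqsum a k ^+ 2 = \sum_(i < k) a i ^+ 2.
Proof. by rewrite sqr_sqrtr// sumr_ge0// => i _; rewrite sqr_ge0. Qed.

Lemma sqsum0 a : sqsum a 0 = 0.
Proof. by rewrite /sqsum big_ord0 sqrtr0. Qed.

Lemma sqsumS a k : sqsum a k.+1 ^+ 2 = sqsum a k ^+ 2 + a k ^+ 2.
Proof. by rewrite !sqr_sqsum big_ord_recr. Qed.

Lemma sqsum_leS a k : sqsum a k <= sqsum a k.+1.
Proof.
rewrite -(@ler_pXn2r _ 2)// ?nnegrE ?sqsum_ge0// sqsumS.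
by rewrite lerDl sqr_ge0.
Qed.

Lemma sqsum_le a k n : (k <= n)%N -> sqsum a k <= sqsum a n.
Proof.
move=> /subnK <-; elim: (n - k)%N => // m IH.
by apply: le_trans IH _; exact: sqsum_leS.
Qed.

Lemma normr_sqsum a k : `|a k| <= sqsum a k.+1.
Proof.
rewrite -(@ler_pXn2r _ 2)// ?nnegrE ?sqsum_ge0// sqsumS real_normK ?num_real//.
by rewrite lerDr sqr_ge0.
Qed.

Lemma sqsum_sum a k : sqsum a k <= \sum_(i < k) `|a i|.
Proof.
elim: k => [|k IH]; first by rewrite sqsum0 big_ord0.
rewrite big_ord_recr/=.
have := sqsumS a k; have := sqsum_ge0 a k; have := sqsum_ge0 a k.+1.
have := normr_ge0 (a k); have : `|a k| ^+ 2 = a k ^+ 2 by rewrite real_normK ?num_real.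
by rewrite !expr2; nra.
Qed.

(** With s and t the values at k and k + 1, (t - s)(t + s) = a_k^2. Here t + s < (1 + sqrt 2) |a_k|
    because s < |a_k|, and 3 bounds 1 + sqrt 2: a difference larger than its past is paid by the
    growth of the square sum. *)
Lemma sqsum_large a k : sqsum a k < `|a k| ->
  `|a k| <= 3 * (sqsum a k.+1 - sqsum a k).
Proof.
have := sqsumS a k; have := sqsum_ge0 a k; have := sqsum_ge0 a k.+1.
have := normr_ge0 (a k); have <- : `|a k| ^+ 2 = a k ^+ 2 by rewrite real_normK ?num_real.
have := sqsum_leS a k.
by rewrite !expr2; move: (sqsum a k) (sqsum a k.+1) `|a k| => s t z; nra.
Qed.

(** When |a_k| <= s one has t <= 2 s, so the factor t + s of a_k^2 = (t - s)(t + s) is at most 3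
    s. *)
Lemma sqsum_small a k : `|a k| <= sqsum a k ->
  a k ^+ 2 <= 3 * (sqsum a k.+1 - sqsum a k) * sqsum a k.
Proof.
have := sqsumS a k; have := sqsum_ge0 a k; have := sqsum_ge0 a k.+1.
have := normr_ge0 (a k); have <- : `|a k| ^+ 2 = a k ^+ 2 by rewrite real_normK ?num_real.
have := sqsum_leS a k.
rewrite !expr2; move: (sqsum a k) (sqsum a k.+1) `|a k| => s t z st z0 t0 s0 e zs.
have ht : t <= 2 * s by nra.
have -> : z * z = (t - s) * (t + s) by lra.
nra.
Qed.

Lemma sqsum_incr a k : a k ^+ 2 <= 2 * (sqsum a k.+1 - sqsum a k) * sqsum a k.+1.
Proof.
have := sqsumS a k; have := sqsum_ge0 a k; have := sqsum_ge0 a k.+1.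
have := sqsum_leS a k.
by rewrite !expr2; move: (sqsum a k) (sqsum a k.+1) => s t; nra.
Qed.

Fixpoint runmax a k : R := if k is m.+1 then Num.max (runmax a m) `|a k| else `|a 0%N|.

Lemma runmax_ge a k : `|a k| <= runmax a k.
Proof. by case: k => //= k; rewrite le_max lexx orbT. Qed.

Lemma runmax_leS a k : runmax a k <= runmax a k.+1.
Proof. by rewrite /= le_max lexx. Qed.

Lemma runmax_ge0 a k : 0 <= runmax a k.
Proof. exact: le_trans (normr_ge0 _) (runmax_ge _ _). Qed.

(* The pathwise form of Doob's L^2 inequality. *)
Lemma runmax_doob a k :
  runmax a k ^+ 2 + 4 * \sum_(i < k) runmax a i * (`|a i.+1| - `|a i|)
    <= 4 * `|a k| ^+ 2.
Proof.
(* A summation by parts bounds the sum by m z - m^2 / 2, where m is the running maximum and z =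
   |a_k|; inserting this leaves 4 m z - m^2 <= 4 z^2, that is (m - 2 z)^2 >= 0. *)
suff H : \sum_(i < k) runmax a i * (`|a i.+1| - `|a i|) <=
    runmax a k * `|a k| - 2^-1 * runmax a k ^+ 2.
  have := sqr_ge0 (runmax a k - 2 * `|a k|).
  rewrite !expr2 in H *; move: (\sum_(i < k) _) (runmax a k) `|a k| H => s m z; nra.
elim: k => [|k IH].
  by rewrite big_ord0/= expr2; have := normr_ge0 (a 0%N); nra.
rewrite big_ord_recr/=; have := runmax_ge0 a k; have := runmax_ge a k.
rewrite !expr2 in IH *; move: (\sum_(i < k) _) IH => s IH.
have := normr_ge0 (a k.+1); rewrite /Num.max.
move: (runmax a k) `|a k| `|a k.+1| IH => m z y IH; case: ifP => [|/negbT]; last rewrite -leNgt; nra.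
Qed.

End sequences.

(** * The algebra of essentially bounded measurable functions *)

Section bounded_functions.
Context d (T : measurableType d) (R : realType) (P : probability T R).
Implicit Types (f g h w : T -> R).

Notation L1 f := (P.-integrable setT (EFin \o f)).

(** Bounds are essential because conditional expectations are only determined almost everywhere;
    such functions form an algebra inside L^1, so that their products need no separate integrability
    argument. *)
Definition essbdd f := measurable_fun setT f /\
  exists C : R, {ae P, forall x, `|f x| <= C}.

Lemma essbdd_measurable f : essbdd f -> measurable_fun setT f.
Proof. by case. Qed.

Lemma essbdd_L1M f g : essbdd f -> L1 g -> L1 (fun x => f x * g x).
Proof.
move=> [mf [C fC]] lg; apply: (@L1_le _ _ _ P _ (fun x => C * `|g x|)).
- by apply: measurable_funM => //; exact: L1_measurable lg.
- exact/L1Z/L1_norm.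
- by apply: filterS fC => x fC; rewrite normrM ler_wpM2r.
Qed.

Lemma essbdd_cst (c : R) : essbdd (fun=> c).
Proof. by split => //; exists `|c|; exact: aeW. Qed.

Lemma essbdd_L1 f : essbdd f -> L1 f.
Proof.
move=> bf; have := essbdd_L1M bf (L1_cst P 1).
by apply: eq_integrable => // x _ /=; rewrite mulr1.
Qed.

Lemma essbddM f g : essbdd f -> essbdd g -> essbdd (fun x => f x * g x).
Proof.
move=> [mf [C fC]] [mg [D gD]]; split; first exact: measurable_funM.
exists (C * D); ae_using fC; ae_using gD; ae_intro => x h1 h2.
by rewrite normrM; apply: ler_pM.
Qed.

Lemma essbddD f g : essbdd f -> essbdd g -> essbdd (fun x => f x + g x).
Proof.
move=> [mf [C fC]] [mg [D gD]]; split; first exact: measurable_funD.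
exists (C + D); ae_using fC; ae_using gD; ae_intro => x h1 h2.
by apply: le_trans (ler_normD _ _) _; exact: lerD.
Qed.

Lemma essbddZ (c : R) f : essbdd f -> essbdd (fun x => c * f x).
Proof. by move=> bf; apply: essbddM => //; exact: essbdd_cst. Qed.

Lemma essbddB f g : essbdd f -> essbdd g -> essbdd (fun x => f x - g x).
Proof.
move=> bf bg; have := essbddD bf (essbddZ (-1) bg).
by under eq_fun do rewrite mulN1r.
Qed.

Lemma essbdd_norm f : essbdd f -> essbdd (fun x => `|f x|).
Proof.
move=> [mf [C fC]]; split; first exact: measurableT_comp.
by exists C; apply: filterS fC => x; rewrite normr_id.
Qed.

Lemma essbddX f : essbdd f -> essbdd (fun x => f x ^+ 2).
Proof. by move=> bf; under eq_fun do rewrite expr2; exact: essbddM. Qed.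

Lemma essbdd_le f g : measurable_fun setT f -> essbdd g ->
  {ae P, forall x, `|f x| <= g x} -> essbdd f.
Proof.
move=> mf [mg [C gC]] fg; split => //; exists C.
ae_using fg; ae_using gC; ae_intro => x h1 h2.
by apply: le_trans h2 (le_trans (ler_norm _) h1).
Qed.

Lemma essbdd_sum (I : Type) (s : seq I) (Q : pred I) (h : I -> T -> R) :
  (forall i, Q i -> essbdd (h i)) -> essbdd (fun x => \sum_(i <- s | Q i) h i x).
Proof.
move=> H; elim: s => [|i s IH].
  by under eq_fun do rewrite big_nil; exact: essbdd_cst.
under eq_fun do rewrite big_cons; case Qi : (Q i) => //.
by apply: essbddD => //; exact: H.
Qed.

Lemma essbdd_indic A : measurable A -> essbdd (\1_A : T -> R).
Proof.
move=> mA; apply: (@essbdd_le _ (fun=> 1)) => //; first exact: essbdd_cst.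
by apply: aeW => x; rewrite indicE; case: (x \in A); rewrite ?normr1 ?normr0.
Qed.

Lemma measurable_sqsum (v : nat -> T -> R) k :
  (forall i, (i < k)%N -> measurable_fun setT (v i)) ->
  measurable_fun setT (fun x => sqsum (v ^~ x) k).
Proof.
move=> mv; apply: measurableT_comp => //.
  by apply: continuous_measurable_fun; exact: sqrt_continuous.
apply: measurable_sum => i; apply: measurable_funX; exact: mv.
Qed.

Lemma essbdd_sqsum (v : nat -> T -> R) k : (forall i, (i < k)%N -> essbdd (v i)) ->
  essbdd (fun x => sqsum (v ^~ x) k).
Proof.
move=> bv; apply: (@essbdd_le _ (fun x => \sum_(i < k) `|v i x|)).
- by apply: measurable_sqsum => i ik; apply: essbdd_measurable; exact: bv.
- by apply: essbdd_sum => i _; apply: essbdd_norm; exact: bv.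
- by apply: aeW => x; rewrite ger0_norm ?sqsum_ge0// sqsum_sum.
Qed.

End bounded_functions.

Ltac essbdd_tac := repeat first [assumption | exact: essbdd_cst |
  apply: essbddX | apply: essbdd_norm | apply: essbddB | apply: essbddD |
  apply: essbddM].

(** * Orthogonality of bounded jumps and the Carleson embedding *)

Section martingale_differences.
Context d (T : measurableType d) (R : realType) (P : probability T R).
Context (F : (set (set T))^nat) (SB : stochastic_basis P F).
Implicit Types (f g h w : T -> R) (A B : set T) (n m k N M : nat) (v : nat -> T -> R).

Notation L1 f := (P.-integrable setT (EFin \o f)).
Notation Ex f := (Rintegral P setT f).
Notation mart := (mart P F).
Notation essbdd := (essbdd P).
Notation prev := (@Defs.prev d T R).
Notation mdiff := (@Defs.mdiff d T R).

Lemma essbdd_mart f n : essbdd f -> essbdd (mart f n).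
Proof.
move=> bf; have lf := essbdd_L1 bf; case: (bf) => mf [C fC].
split; last by exists C; exact: mart_bound.
exact (mart_measurable SB lf n).
Qed.

Lemma essbdd_prev u n : (forall k, essbdd (u k)) -> essbdd (prev u n).
Proof. by case: n => [|n] bu //=; exact: essbdd_cst. Qed.

Lemma L1_prev u n : (forall k, L1 (u k)) -> L1 (prev u n).
Proof. by case: n => [|n] bu //=; exact: L1_cst. Qed.

Lemma L1_mdiff u n : (forall k, L1 (u k)) -> L1 (mdiff u n).
Proof. by move=> lu; apply: L1B => //; exact: L1_prev. Qed.

Lemma adapted_prev u n : (forall k, measurable_for (F k) (u k)) ->
  measurable_for (F n) (prev u n).
Proof.
case: n => [|n] mu /=; first exact: adapted_cst.
exact: (adapted_mono SB (leqnSn n)) (mu n).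
Qed.

Lemma adapted_mdiff u n : (forall k, measurable_for (F k) (u k)) ->
  measurable_for (F n) (mdiff u n).
Proof. by move=> mu; apply: adaptedB => //; exact: adapted_prev. Qed.

Lemma sum_mdiff u N x : \sum_(k < N) mdiff u k x = prev u N x.
Proof.
elim: N => [|N IH]; first by rewrite big_ord0.
by rewrite big_ord_recr/= IH /Defs.mdiff/= addrC subrK.
Qed.

Lemma prev_mdiff u n x : prev u n.+1 x = prev u n x + mdiff u n x.
Proof. by rewrite /Defs.mdiff/= addrC subrK. Qed.

(* A bounded martingale jump; at the time 0 there is no cancellation. *)
Definition jump k g := [/\ measurable_for (F k) g, essbdd g &
  {ae P, forall x, prev (mart g) k x = 0}].

Lemma jump_orth k g w : jump k.+1 g -> measurable_for (F k) w ->
  L1 (fun x => w x * g x) -> Ex (fun x => w x * g x) = 0.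
Proof.
move=> [mg bg g0] mw lwg; have lg := essbdd_L1 bg.
have [lwm <-] := pull_out SB mw lg lwg.
have [||_ ->] := @Ex_ae _ _ _ P (fun=> 0) (fun x => w x * mart g k x) (L1_cst P 0); last exact: Ex_cst.
- exact: L1_measurable lwm.
- by apply: filterS g0 => x /= ->; rewrite mulr0.
Qed.

Lemma jump_mul k g w : jump k.+1 g -> measurable_for (F k) w -> essbdd w ->
  jump k.+1 (fun x => w x * g x).
Proof.
move=> [mg bg g0] mw bw; split.
- by apply: adaptedM => //; exact: (adapted_mono SB (leqnSn k)) mw.
- exact: essbddM.
- have := mart_pull SB mw (essbdd_L1 bg) (essbdd_L1 (essbddM bw bg)).
  move=> H; ae_using g0; ae_using H; ae_intro => x /= -> ->.
  by rewrite mulr0.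
Qed.

Lemma mart_sum (I : eqType) (s : seq I) (h : I -> T -> R) n :
  (forall i, i \in s -> L1 (h i)) ->
  {ae P, forall x, mart (fun y => \sum_(i <- s) h i y) n x =
                   \sum_(i <- s) mart (h i) n x}.
Proof.
elim: s => [|i s IH] H.
  have := mart_cst SB 0 n; apply: filterS => x E; rewrite big_nil -[RHS]E.
  by congr (Defs.mart P F _ n x); apply/funext => y; rewrite big_nil.
have li : L1 (h i) by apply: H; rewrite mem_head.
have ls j : j \in s -> L1 (h j) by move=> js; apply: H; rewrite in_cons js orbT.
have ls' : L1 (fun y => \sum_(i <- s) h i y).
  under eq_fun do rewrite big_seq; exact: L1_sum.
ae_using (IH ls); ae_using (martD SB n li ls'); ae_intro => x h1 h2.
rewrite big_cons -h2 -h1; congr (Defs.mart P F _ n x).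
by apply/funext => y; rewrite big_cons.
Qed.

Section finite_martingale.
Context (v : nat -> T -> R) (N : nat).
Hypothesis jv : forall k, (k < N)%N -> jump k (v k).

Let f x := \sum_(k < N) v k x.

Lemma finite_mart_essbdd : essbdd f.
Proof. by apply: essbdd_sum => k _; have [] := jv (ltn_ord k). Qed.

(** A jump at a time k > m has conditional expectation 0 at the time k - 1, hence at m by the tower
    property; the earlier jumps are already known at m. *)
Lemma finite_mart m :
  {ae P, forall x, mart f m x = \sum_(k < N | (k <= m)%N) v k x}.
Proof.
have lv (k : 'I_N) : L1 (v k) by have [_ /essbdd_L1] := jv (ltn_ord k).
have Hk : {ae P, forall x, forall k : 'I_N,
    mart (v k) m x = if (k <= m)%N then v k x else 0}.
  apply: ae_countable => k; have [mv bv v0] := jv (ltn_ord k).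
  case: leqP => km; first exact: (mart_id SB km).
  case: (nat_of_ord k) km mv bv v0 => // j; rewrite ltnS => mj mv bv v0.
  have v0' : {ae P, forall x, mart (v j.+1) j x = 0} by [].
  have lj := mart_L1 SB (essbdd_L1 bv) j.
  ae_using (mart_ae SB m lj (L1_cst P 0) v0').
  ae_using (mart_tower SB mj (essbdd_L1 bv)); ae_using (mart_cst SB 0 m).
  by ae_intro => x -> <-.
ae_using Hk; ae_using (@mart_sum _ (enum 'I_N) (fun k : 'I_N => v k) m (fun i _ => lv i)).
ae_intro => x; rewrite !big_enum/= => h1 h2.
transitivity (mart (fun y => \sum_(i <- enum 'I_N) v i y) m x).
  by congr (Defs.mart P F _ m x); apply/funext => y; rewrite big_enum.
rewrite h1 [RHS]big_mkcond/=; by apply: eq_bigr => k _; rewrite h2.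
Qed.

Lemma finite_mdiff m : {ae P, forall x, mdiff (mart f) m x =
  if (m < N)%N then v m x else 0}.
Proof.
have H : {ae P, forall x, prev (mart f) m x = \sum_(k < N | (k < m)%N) v k x}.
  case: m => [|m] /=; last exact: finite_mart.
  by apply: aeW => x; rewrite big_pred0.
ae_using H; ae_using (finite_mart m); ae_intro => x; rewrite /Defs.mdiff/= => -> ->.
case: ifPn => mN; last first.
  rewrite (eq_bigl (fun k : 'I_N => (k < m)%N)) ?subrr// => k.
  rewrite -leqNgt in mN; rewrite leq_eqVlt; case: eqP => // km.
  by have := ltn_ord k; rewrite km ltnNge mN.
rewrite (bigD1 (Ordinal mN))//= (eq_bigl (fun k : 'I_N => (k < m)%N)) ?addrK//.
by move=> k; rewrite ltn_neqAle andbC.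
Qed.

End finite_martingale.

Lemma jump_mdiff f k : L1 f -> essbdd (mdiff (mart f) k) ->
  jump k (mdiff (mart f) k).
Proof.
move=> lf bd; have lm j := mart_L1 SB lf j; split => //.
- by apply: adapted_mdiff => j; exact (mart_adapted SB lf j).
- case: k bd => [|k] bd; first exact: aeW.
  rewrite /Defs.mdiff/=.
  ae_using (martB SB k (lm k.+1) (lm k)).
  ae_using (mart_tower SB (leqnSn k) lf); ae_using (mart_tower SB (leqnn k) lf).
  by ae_intro => x /= -> -> ->; rewrite subrr.
Qed.

Lemma essbdd_tail v n M : (forall k, (n <= k < M)%N -> essbdd (v k)) ->
  essbdd (fun x => \sum_(n <= k < M) v k x).
Proof.
move=> bv; under eq_fun do rewrite big_nat.
by apply: essbdd_sum => k; exact: bv.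
Qed.

Lemma adapted_tail v n M m : (forall k, (n <= k < M)%N -> measurable_for (F m) (v k)) ->
  measurable_for (F m) (fun x => \sum_(n <= k < M) v k x).
Proof.
move=> bv; under eq_fun do rewrite big_nat.
by apply: adapted_sum => k; exact: bv.
Qed.

(** Orthogonality of martingale differences, localized: when the last index M is split off, the
    cross term is [v M] times a function known at the time M - 1, because [A] is known at a time n <
    M. *)
Lemma jump_sum_sqr v n M A : F n A ->
  (forall k, (n <= k < M)%N -> jump k (v k)) ->
  Ex (fun x => \1_A x * (\sum_(n <= k < M) v k x) ^+ 2) =
  Ex (fun x => \1_A x * \sum_(n <= k < M) v k x ^+ 2).
Proof.
move=> FA; have mA := filtration_measurable SB FA.
have bA : essbdd (\1_A) by exact: essbdd_indic.
elim: M => [|M IH] jv.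
  by congr Rintegral; apply/funext => x; rewrite !big_geq ?expr0n.
have [nM|Mn] := leqP n M; last first.
  by congr Rintegral; apply/funext => x; rewrite !big_geq ?expr0n.
have jv' k : (n <= k < M)%N -> jump k (v k).
  by move=> /andP[h1 h2]; apply: jv; rewrite h1 ltnS ltnW.
have bv k : (n <= k < M)%N -> essbdd (v k) by move=> /jv'[].
have [mM bM _] : jump M (v M) by apply: jv; rewrite nM leqnn.
have bS := essbdd_tail bv.
have bS2 : essbdd (fun x => \sum_(n <= k < M) v k x ^+ 2).
  by apply: essbdd_tail => k /bv; exact: essbddX.
transitivity (Ex (fun x => \1_A x * (\sum_(n <= k < M) v k x) ^+ 2 +
   2 * ((\1_A x * \sum_(n <= k < M) v k x) * v M x) + \1_A x * v M x ^+ 2)).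
  by congr Rintegral; apply/funext => x; rewrite big_nat_recr//=; ring.
(* For n = M the sum is empty. This covers M = 0, where a jump has no cancellation. *)
have orth : Ex (fun x => (\1_A x * \sum_(n <= k < M) v k x) * v M x) = 0.
  move: nM; rewrite leq_eqVlt => /predU1P[<-|nM].
    under eq_Rintegral do rewrite big_geq// mulr0 mul0r; exact: Ex_cst.
  case: M nM {IH} jv jv' bv mM bM bS bS2 => // M nM jv jv' bv mM bM bS bS2.
  rewrite ltnS in nM.
  apply: (@jump_orth M).
  - by apply: jv; rewrite (leq_trans nM)/=.
  - apply: adaptedM; first by apply: (adapted_indic SB); apply: (filtration_mono SB nM).
    apply: adapted_tail => k /[dup] /andP[nk kM] /jv'[+ _ _].
    exact: (adapted_mono SB).
  - by apply: essbdd_L1; do !apply: essbddM.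
rewrite ExD ?ExD ?ExZ; do ?[by apply: essbdd_L1; essbdd_tac].
rewrite orth mulr0 addr0 IH// -ExD; do ?[by apply: essbdd_L1; essbdd_tac].
by congr Rintegral; apply/funext => x; rewrite big_nat_recr//=; ring.
Qed.

(** The hypothesis on all sets of F_n is an inequality between conditional expectations, which may
    be integrated against any nonnegative weight known at time n. *)
Lemma adapted_weight_le n f g w : measurable_for (F n) w -> (forall x, 0 <= w x) ->
  L1 f -> L1 g -> L1 (fun x => w x * f x) -> L1 (fun x => w x * g x) ->
  (forall A, F n A -> Ex (fun x => \1_A x * f x) <= Ex (fun x => \1_A x * g x)) ->
  Ex (fun x => w x * f x) <= Ex (fun x => w x * g x).
Proof.
move=> mw w0 lf lg lwf lwg H.
have [l1 <-] := pull_out SB mw lf lwf.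
have [l2 <-] := pull_out SB mw lg lwg.
apply: Ex_le => //.
have := @adapted_le _ _ _ _ _ SB n (mart f n) (mart g n)
  (mart_adapted SB lf n) (mart_adapted SB lg n) (mart_L1 SB lf n) (mart_L1 SB lg n).
move=> h; apply: filterS (h _) => [x|A FA]; first exact: ler_wpM2l.
by rewrite !mart_set//; exact: H.
Qed.

(* [dv] plays the role of the differences of a function of BMO. *)
Lemma carleson dv (W : nat -> T -> R) (L : R) M :
  (forall k, (k < M)%N -> jump k (dv k)) ->
  (forall n A, (n <= M)%N -> F n A -> Ex (fun x => \1_A x * \sum_(n <= k < M) dv k x ^+ 2)
     <= L * Ex (\1_A)) ->
  (forall k, measurable_for (F k) (W k)) -> (forall k, L1 (W k)) ->
  (forall k x, 0 <= W k x <= W k.+1 x) -> 0 <= L ->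
  Ex (fun x => \sum_(k < M) W k x * dv k x ^+ 2) <= L * Ex (W M).
Proof.
move=> jd HL mW lW W0 L0.
have bd k : (k < M)%N -> essbdd (fun x => dv k x ^+ 2).
  by move=> /jd[_ /essbddX].
have lWd k j : (k < M)%N -> L1 (fun x => W j x * dv k x ^+ 2).
  move=> kM; have := essbdd_L1M (bd k kM) (lW j).
  by apply: eq_integrable => // x _ /=; rewrite mulrC.
have bT n : essbdd (fun x => \sum_(n <= k < M) dv k x ^+ 2).
  by apply: essbdd_tail => k /andP[_ /bd].
have tail n w : (n <= M)%N -> measurable_for (F n) w -> (forall x, 0 <= w x) -> L1 w ->
    L1 (fun x => w x * \sum_(n <= k < M) dv k x ^+ 2) /\
    Ex (fun x => w x * \sum_(n <= k < M) dv k x ^+ 2) <= L * Ex w.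
  move=> nM mw w0 lw.
  have lwT : L1 (fun x => w x * \sum_(n <= k < M) dv k x ^+ 2).
    have := essbdd_L1M (bT n) lw.
    by apply: eq_integrable => // x _ /=; rewrite mulrC.
  split => //.
  rewrite -ExZ//; under [leRHS]eq_Rintegral do rewrite mulrC.
  apply: (@adapted_weight_le n) => //.
  - exact: essbdd_L1.
  - exact: L1_cst.
  - by have := L1Z L lw; apply: eq_integrable => // x _ /=; rewrite mulrC.
  - move=> A FA; apply: le_trans (HL n A nM FA) _.
    under [leRHS]eq_Rintegral do rewrite mulrC.
    rewrite ExZ//; apply: integrable_indic => //.
    exact: (filtration_measurable SB FA).
(* Summation by parts in the form of a downward induction on n: W_k - W_n is the sum of the
   increments W_(m+1) - W_m with n <= m < k. Each increment is nonnegative, known at time m + 1, and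
   multiplies the squares from m + 1 on, where [HL] applies. *)
have H n : (n <= M)%N -> Ex (fun x => \sum_(n <= k < M) (W k x - W n x) * dv k x ^+ 2)
    <= L * Ex (fun x => W M x - W n x).
  move=> nM; rewrite -(subKn nM); elim: (M - n)%N (leq_subr n M) => [|j IH] jM.
    rewrite subn0; under eq_Rintegral do rewrite big_geq//.
    under [in leRHS]eq_Rintegral do rewrite subrr.
    by rewrite !Ex_cst mulr0.
  have {}IH := IH (ltnW jM).
  set m := (M - j.+1)%N; have mM : (m < M)%N by rewrite /m ltn_subrL/= (leq_ltn_trans _ jM).
  have mS : (M - j = m.+1)%N by rewrite /m subnSK.
  rewrite mS in IH.
  have [l1 t1] := tail m.+1 (fun x => W m.+1 x - W m x) mM
     (adaptedB (mW m.+1) (adapted_mono SB (leqnSn m) (mW m)))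
     (fun x => ltac:(by rewrite subr_ge0; have /andP[] := W0 m x)) (L1B (lW _) (lW _)).
  rewrite (_ : Ex (fun x => W M x - W m x) =
     Ex (fun x => W M x - W m.+1 x) + Ex (fun x => W m.+1 x - W m x)); last first.
    rewrite -ExD; [|exact: L1B..].
    by congr Rintegral; apply/funext => x; ring.
  rewrite mulrDr (_ : (fun x => \sum_(m <= k < M) _) = fun x =>
     (\sum_(m.+1 <= k < M) (W k x - W m.+1 x) * dv k x ^+ 2) +
     (W m.+1 x - W m x) * \sum_(m.+1 <= k < M) dv k x ^+ 2); last first.
    apply/funext => x; rewrite big_ltn// subrr mul0r add0r mulr_sumr -big_split/=.
    by apply: eq_bigr => k _; ring.
  rewrite [leLHS]ExD//; first exact: (lerD IH t1).
  under eq_fun do rewrite big_nat; apply: L1_sum => k /andP[_ kM].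
  have := L1B (lWd k k kM) (lWd k m.+1 kM).
  by apply: eq_integrable => // x _ /=; rewrite mulrBl.
(* The initial value W_0 weighs the full sum and completes the bound: L E(W_M - W_0) + L E W_0. *)
have [l0 t0] := tail 0%N (W 0%N) (leq0n _) (mW 0%N)
  (fun x => ltac:(by have /andP[] := W0 0%N x)) (lW 0%N).
have := lerD (H 0%N (leq0n _)) t0.
rewrite -mulrDr -!ExD//; last 2 first.
- exact: L1B.
- under eq_fun do rewrite big_nat; apply: L1_sum => k /andP[_ kM].
  have := L1B (lWd k k kM) (lWd k 0%N kM).
  by apply: eq_integrable => // x _ /=; rewrite mulrBl.
under [in X in _ <= X -> _]eq_Rintegral do rewrite subrK.
congr (_ <= _); congr Rintegral; apply/funext => x.
rewrite -(big_mkord xpredT (fun k => W k x * dv k x ^+ 2)) mulr_sumr -big_split/=.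
by apply: eq_bigr => k _; ring.
Qed.

End martingale_differences.

(** * The John-Nirenberg inequality *)

Section john_nirenberg.
Context d (T : measurableType d) (R : realType) (P : probability T R).
Context (F : (set (set T))^nat) (SB : stochastic_basis P F).
Implicit Types (f g h w b : T -> R) (A B : set T) (n m k N M : nat).

Notation L1 f := (P.-integrable setT (EFin \o f)).
Notation Ex f := (Rintegral P setT f).
Notation mart := (mart P F).
Notation essbdd := (essbdd P).
Notation prev := (@Defs.prev d T R).
Notation mdiff := (@Defs.mdiff d T R).
Notation jump := (jump P F).

(** The norm of BMO with exponent 1, its conditional expectation being tested on sets of F_n. The
    comparison with b_(n-1) rather than b_n also bounds the jumps of b. *)
Definition bmo1 (K : R) b := L1 b /\ forall n A, F n A ->
  Ex (fun x => \1_A x * `|b x - prev (mart b) n x|) <= K * Ex (\1_A).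

Context (b : T -> R) (K : R) (K0 : 0 < K) (bK : bmo1 K b).

(** [c k] is b_(k-1), with c_0 = 0, and is known at time k - 1; [dd k] is d_k b = c_(k+1) - c_k. *)
Let c k := prev (mart b) k.
Let dd k := mdiff (mart b) k.

Lemma bmo1_L1 : L1 b. Proof. by have [] := bK. Qed.
Let lb := bmo1_L1.

Lemma L1_prev_mart k : L1 (c k).
Proof. by apply: L1_prev => j; exact: mart_L1. Qed.

Lemma adapted_prev_mart k : measurable_for (F k) (c k.+1).
Proof. exact (mart_adapted SB lb k). Qed.

Lemma adapted_prev_martW k m : (k <= m)%N -> measurable_for (F m) (c k).
Proof.
move=> km; apply: (adapted_mono SB km).
by apply: (adapted_prev SB) => j; exact (mart_adapted SB lb j).
Qed.

Lemma mart_sub_prev n m : (n <= m)%N ->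
  {ae P, forall x, mart (fun y => b y - c n y) m x = c m.+1 x - c n x}.
Proof.
move=> nm; ae_using (martB SB m lb (L1_prev_mart n)).
have := mart_id SB (leqnn m) (adapted_prev_martW nm) (L1_prev_mart n).
by move=> h; ae_using h; ae_intro => x -> ->.
Qed.

(** For m > n, c_m - c_n is the conditional expectation of b - c_n at time m - 1 >= n, so its
    modulus is dominated by that of |b - c_n|, integrated over a set known at that time. *)
Lemma bmo1_prev n m A : (n <= m)%N -> F n A ->
  Ex (fun x => \1_A x * `|c m x - c n x|) <= K * Ex (\1_A).
Proof.
move=> nm FA; have mA := filtration_measurable SB FA.
have E0 : 0 <= Ex (\1_A : T -> R) by apply: Rintegral_ge0.
case: m nm => [|m] nm.
  have -> : n = 0%N by case: n nm {FA}.
  under eq_Rintegral do rewrite subrr normr0 mulr0.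
  by rewrite Ex_cst mulr_ge0// ltW.
move: nm; rewrite leq_eqVlt => /predU1P[->|nm].
  under eq_Rintegral do rewrite subrr normr0 mulr0.
  by rewrite Ex_cst mulr_ge0// ltW.
rewrite ltnS in nm.
have lB := L1B lb (L1_prev_mart n); have laB := L1_norm lB.
have FmA := filtration_mono SB nm FA.
apply: le_trans (bK.2 _ _ FA).
rewrite -(mart_set SB laB FmA).
apply: Ex_indic_le => //.
- by apply/L1_norm/L1B; exact: L1_prev_mart.
- exact: mart_L1.
- ae_using (mart_sub_prev nm); ae_using (mart_norm SB m lB).
  by ae_intro => x + <-.
Qed.

(** d_k b is the conditional expectation at k of b - b_(k-1), whose conditional absolute moment is
    at most K. *)
Lemma bmo1_mdiff k : {ae P, forall x, `|dd k x| <= K}.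
Proof.
have lB := L1B lb (L1_prev_mart k); have laB := L1_norm lB.
have h : {ae P, forall x, mart (fun y => `|b y - c k y|) k x <= K}.
  apply: (@adapted_le _ _ _ _ _ SB k _ (fun=> K)).
  - exact (mart_adapted SB laB k).
  - exact: adapted_cst.
  - exact: mart_L1.
  - exact: L1_cst.
  - move=> A FA; rewrite mart_set//; apply: le_trans (bK.2 _ _ FA) _.
    rewrite -ExZ; last by apply/integrable_indic/(filtration_measurable SB FA).
    by under [leRHS]eq_Rintegral do rewrite mulrC.
ae_using h; ae_using (mart_norm SB k lB); ae_using (mart_sub_prev (leqnn k)).
by ae_intro => x ->; exact: le_trans.
Qed.

Lemma essbdd_bmo_mdiff k : essbdd (dd k).
Proof.
split; last by exists K; exact: bmo1_mdiff.
by apply: measurable_funB; apply: L1_measurable; [exact: mart_L1|exact: L1_prev_mart].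
Qed.

Lemma jump_bmo_mdiff k : jump k (dd k).
Proof. by apply: jump_mdiff => //; exact: essbdd_bmo_mdiff. Qed.

Lemma sum_tail_mdiff n M x : (n <= M)%N ->
  \sum_(n <= k < M) dd k x = c M x - c n x.
Proof.
move=> nM; rewrite (eq_bigr (fun k => c k.+1 x - c k x)).
  by rewrite telescope_sumr.
by move=> k _; rewrite /dd /Defs.mdiff.
Qed.

(** While b may be unbounded, b_(k-1) is a finite sum of differences bounded by K, the one at time 0
    included. This is what makes manipulations at finite times legitimate. *)
Lemma essbdd_prev_mart k : essbdd (c k).
Proof.
rewrite (_ : c k = fun x => \sum_(i < k) dd i x).
  by apply: essbdd_sum => i _; exact: essbdd_bmo_mdiff.
by apply/funext => x; rewrite sum_mdiff.
Qed.

Section stopping.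
Context (M n : nat) (A : set T) (nM : (n <= M)%N) (FA : F n A).

Let mA : measurable A := filtration_measurable SB FA.
Let e j x : R := (`|c j x - c n x| <= 2 * K)%R%:R.

(* [I k] is the indicator of the event that no jump above the level 2K has
   occurred up to the time k. *)
Let I k x : R := \prod_(n <= j < k.+1) e j x.

Let IS k x : (n <= k)%N -> I k.+1 x = I k x * e k.+1 x.
Proof. by move=> nk; rewrite /I big_nat_recr//= (leq_trans nk). Qed.

Let In x : I n x = 1.
Proof. by rewrite /I big_nat1 /e subrr normr0 pmulr_rge0// ltW. Qed.

Let I01 k x : (n <= k)%N -> I k x = 0 \/ I k x = 1.
Proof.
move=> /subnK <-; elim: (k - n)%N => [|m IH]; first by right; rewrite add0n In.
rewrite addSn IS ?leq_addl// /e; case: (_ <= _); rewrite ?mulr1 ?mulr0; by tauto.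
Qed.

(** The stopping rule is predictable: the event up to the index k + 1 involves only c_(k+1) = b_k
    and earlier values. *)
Let I_adapted k : measurable_for (F k) (I k.+1).
Proof.
rewrite /I.
have H j : (n <= j < k.+2)%N -> measurable_for (F k) (e j).
  move=> /andP[nj jk].
  have mc : measurable_for (F k) (fun x => `|c j x - c n x|).
    have mj : measurable_for (F k) (c j).
      case: j nj jk => [|j] nj jk; first exact: adapted_prev_martW.
      by apply: (adapted_mono SB _ (@adapted_prev_mart j)).
    have mn : measurable_for (F k) (c n).
      case: n nj => [|m] nj; first exact: adapted_prev_martW.
      apply: (adapted_mono SB _ (@adapted_prev_mart m)).
      by rewrite -ltnS (leq_trans nj).
    apply: (@adapted_comp _ _ _ F k (@Num.norm _ _) (fun x => c j x - c n x)).
      exact: normr_measurable.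
    exact: adaptedB.
  have FY := adapted_set SB mc (@measurable_itv R `]-oo, (2 * K)]).
  have := adapted_indic SB FY.
  congr (measurable_for (F k) _); apply/funext => x.
  rewrite indicE /e; congr (nat_of_bool _)%:R.
  by apply/idP/idP; rewrite inE/= in_itv/=.
elim: {-2}k.+2 (leqnn k.+2) H => [|m IH] mk H.
  by under eq_fun do rewrite big_geq//; exact: adapted_cst.
have [nm|mn] := leqP n m; last first.
  by under eq_fun do rewrite big_geq//; exact: adapted_cst.
under eq_fun do rewrite big_nat_recr//=.
apply: adaptedM; last by apply: H; rewrite nm leqnn.
apply: IH; first exact: ltnW.
by move=> j /andP[nj jm]; apply: H; rewrite nj ltnW.
Qed.

Let essbdd_I k : essbdd (I k).
Proof.
have [nk|kn] := leqP n k; last first.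
  rewrite (_ : I k = fun=> 1); first exact: essbdd_cst.
  by apply/funext => x; rewrite /I big_geq.
split; last first.
  exists 1; apply: aeW => x; have [->|->] := I01 x nk; by rewrite ?normr0 ?normr1.
case: k nk => [|k] nk.
  rewrite (_ : I 0 = fun=> 1)//; apply/funext => x.
  by have <- : n = 0%N by case: n nk.
exact: (adapted_measurable SB (@I_adapted k)).
Qed.

Let jump_I k : (n <= k)%N -> jump k (fun x => I k x * dd k x).
Proof.
case: k => [|k] nk; last first.
  apply: (jump_mul SB); [exact: jump_bmo_mdiff|exact (@I_adapted k)|exact: essbdd_I].
rewrite (_ : (fun x => _) = dd 0); first exact: jump_bmo_mdiff.
apply/funext => x; have n0 : n = 0%N by case: n nk.
by rewrite -{1}n0 In mul1r.
Qed.

(** Before the stop the sum is c_k - c_n, at most 2K in modulus; the difference that crosses the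
    level adds at most K, and nothing follows. *)
Let stopped_bound : {ae P, forall x, `|\sum_(n <= k < M) I k x * dd k x| <= 3 * K}.
Proof.
have := ae_countable (P := P) bmo1_mdiff; apply: filterS => x Hd.
suff: (I M x = 1 /\ \sum_(n <= k < M) I k x * dd k x = c M x - c n x /\
       `|c M x - c n x| <= 2 * K) \/
      (I M x = 0 /\ `|\sum_(n <= k < M) I k x * dd k x| <= 3 * K).
  move=> [[_ [-> h]]|[_ h]//]; apply: le_trans h _; rewrite ler_pM2r// ler_nat//.
rewrite -(subnK nM); elim: (M - n)%N => [|m IH].
  left; rewrite add0n In big_geq// subrr normr0; split => //; split => //.
  by rewrite mulr_ge0// ltW.
rewrite addSn; set k := (m + n)%N in IH *; have nk : (n <= k)%N by exact: leq_addl.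
rewrite big_nat_recr//= IS//.
have cS : c k.+1 x = c k x + dd k x by exact: prev_mdiff.
have := Hd k => dk.
case: IH => [[Ik [-> ck]]|[Ik ck]]; rewrite Ik ?mul1r ?mul0r ?addr0; last by right.
have bnd : `|c k.+1 x - c n x| <= 3 * K.
  have -> : c k.+1 x - c n x = (c k x - c n x) + dd k x by rewrite cS; ring.
  by apply: le_trans (ler_normD _ _) _; move: ck dk; rewrite -/(dd k x); lra.
have sE : c k x - c n x + dd k x = c k.+1 x - c n x by rewrite cS; ring.
rewrite sE /e; case: (boolP (`|c k.+1 x - c n x| <= 2 * K)) => h.
- by left.
- by right; rewrite bnd.
Qed.

(** The indicator of the part of [A] where the stop has occurred, extended by 0 before time n: a
    nondecreasing adapted weight, as [carleson] requires. *)
Let W k x : R := if (k < n)%N then 0 else \1_A x * (1 - I k x).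

Let W_adapted k : measurable_for (F k) (W k).
Proof.
rewrite /W; case: ltnP => nk; first exact: adapted_cst.
apply: adaptedM.
  by apply: (adapted_indic SB); apply: (filtration_mono SB nk).
apply: adaptedB; first exact: adapted_cst.
case: k nk => [|k] nk; last exact: (adapted_mono SB (leqnSn k) (@I_adapted k)).
rewrite (_ : I 0 = fun=> 1); first exact: adapted_cst.
by apply/funext => x; have <- : n = 0%N by case: n nk.
Qed.

Let essbdd_W k : essbdd (W k).
Proof.
rewrite /W; case: ltnP => _; first exact: essbdd_cst.
apply: essbddM; first exact: essbdd_indic.
by apply: essbddB; [exact: essbdd_cst|exact: essbdd_I].
Qed.

Let indic01 x : \1_A x = 0 :> R \/ \1_A x = 1 :> R.
Proof. by rewrite indicE; case: (x \in A); [right|left]. Qed.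

Let W_mono k x : 0 <= W k x <= W k.+1 x.
Proof.
rewrite /W; case: ltnP => nk.
  rewrite lexx/=; case: ltnP => // nk'.
  have [->|->] := I01 x nk'; have [->|->] := indic01 x; lra.
rewrite ltnNge (leq_trans nk)//= IS//.
rewrite /e; case: (`|c _ x - c n x| <= _); rewrite ?mulr1 ?mulr0;
  have [->|->] := I01 x nk; have [->|->] := indic01 x; lra.
Qed.

(** A maximal inequality: at the index j + 1 of the first crossing, |c_(j+1) - c_n| > 2K, and
    conditional Jensen replaces c_(j+1) by c_M. Summing over j, 2K E W_M <= E(1_A |c_M - c_n|) <= K
    P(A). *)
Let maximal : Ex (W M) <= 2^-1 * Ex (\1_A).
Proof.
have bD k : essbdd (fun x => `|c k x - c n x|).
  by apply/essbdd_norm/essbddB; exact: essbdd_prev_mart.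
have bA : essbdd (\1_A : T -> R) by exact: essbdd_indic.
have bI := essbdd_I.
have step j : (n <= j < M)%N ->
    2 * K * Ex (fun x => \1_A x * (I j x - I j.+1 x)) <=
    Ex (fun x => (\1_A x * (I j x - I j.+1 x)) * `|c M x - c n x|).
  move=> /andP[nj jM].
  have w0 x : 0 <= \1_A x * (I j x - I j.+1 x) :> R.
    rewrite IS// /e; case: (`|c _ x - c n x| <= _); rewrite ?mulr1 ?mulr0;
    have [->|->] := I01 x nj;
    have [->|->] := indic01 x; lra.
  have bw : essbdd (fun x => \1_A x * (I j x - I j.+1 x)).
    by apply: essbddM => //; exact: essbddB.
  apply: (@le_trans _ _ (Ex (fun x => (\1_A x * (I j x - I j.+1 x)) * `|c j.+1 x - c n x|))).
    rewrite -ExZ; last exact: essbdd_L1.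
    apply: Ex_le.
    - by apply: essbdd_L1; essbdd_tac.
    - by apply: essbdd_L1; apply: essbddM.
    - apply: aeW => x; rewrite IS// /e; case: (leP `|c j.+1 x - c n x| (2 * K)) => h.
        by rewrite mulr1 subrr mulr0 mulr0 mul0r.
      rewrite mulr0 subr0 mulrC; apply: ler_wpM2l; last exact: ltW.
      by have [->|->] := I01 x nj; have [->|->] := indic01 x; lra.
  apply: (@adapted_weight_le _ _ _ _ _ SB j) => //.
  - apply: adaptedM; first exact: (adapted_indic SB (filtration_mono SB nj FA)).
    apply: adaptedB; last exact: I_adapted.
    case: j nj {jM w0 bw} => [|j] nj.
      rewrite (_ : I 0 = fun=> 1); first exact: adapted_cst.
      by apply/funext => x; have <- : n = 0%N by case: n nj.
    exact: (adapted_mono SB (leqnSn j) (@I_adapted j)).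
  - exact: essbdd_L1.
  - exact: essbdd_L1.
  - by apply: essbdd_L1; apply: essbddM.
  - by apply: essbdd_L1; apply: essbddM.
  - move=> B FB; have mB := filtration_measurable SB FB.
    case: M jM => // m jm; rewrite ltnS in jm.
    have lc k := L1_prev_mart k.
    have lM := L1B (lc m.+1) (lc n); have laM := L1_norm lM.
    rewrite -[leRHS](mart_set SB laM FB); apply: Ex_indic_le => //.
    + exact: essbdd_L1.
    + exact: mart_L1.
    + ae_using (mart_norm SB j lM); ae_using (martB SB j (lc m.+1) (lc n)).
      ae_using (mart_tower SB jm lb).
      ae_using (mart_id SB (leqnn j) (adapted_prev_martW nj) (lc n)).
      by ae_intro => x h1 h2 h3; rewrite h3 h1 {1}/c /= h2.
have WE : W M = fun x => \sum_(n <= j < M) \1_A x * (I j x - I j.+1 x).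
  apply/funext => x; rewrite /W ltnNge nM/= -mulr_sumr; congr (_ * _).
  by rewrite -[RHS]opprK -sumrN; under eq_bigr do rewrite opprB;
    rewrite telescope_sumr// In opprB.
have H : 2 * K * Ex (W M) <= K * Ex (\1_A).
  apply: le_trans (bmo1_prev nM FA).
  rewrite WE; under eq_Rintegral do rewrite big_nat.
  rewrite Ex_sum; last first.
    by move=> j _; apply: essbdd_L1; apply: essbddM => //; exact: essbddB.
  rewrite mulr_sumr; apply: (@le_trans _ _ (\sum_(n <= j < M | (n <= j < M)%N)
     Ex (fun x => (\1_A x * (I j x - I j.+1 x)) * `|c M x - c n x|))).
    by apply: ler_sum.
  rewrite -Ex_sum; last first.
    by move=> j _; apply: essbdd_L1; apply: essbddM => //; apply: essbddM => //;
      exact: essbddB.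
  apply: Ex_le.
  - under eq_fun do rewrite -big_nat.
    by apply: essbdd_L1; apply: essbdd_tail => j _; apply: essbddM => //;
     apply: essbddM => //; exact: essbddB.
  - by apply: essbdd_L1; exact: essbddM.
  - apply: aeW => x; rewrite -big_nat -mulr_suml.
    have -> : \sum_(n <= j < M) \1_A x * (I j x - I j.+1 x) = W M x by rewrite WE.
    apply: ler_wpM2r => //; rewrite /W ltnNge nM/=.
    by have [->|->] := I01 x nM; have [->|->] := indic01 x; lra.
have := K0; move: H; set u := Ex (W M); set v := Ex (\1_A).
by nra.
Qed.

(** The squares before the stop contribute at most (3K)^2 P(A) by orthogonality. Those after it are
    weighed by W, so that the assumed bound L applies through [carleson], with E W_M at most half of
    P(A). *)
Lemma jn_step (L : R) : 0 <= L ->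
  (forall m B, (m <= M)%N -> F m B ->
     Ex (fun x => \1_B x * \sum_(m <= k < M) dd k x ^+ 2) <= L * Ex (\1_B)) ->
  Ex (fun x => \1_A x * \sum_(n <= k < M) dd k x ^+ 2) <=
    (9 * K ^+ 2 + 2^-1 * L) * Ex (\1_A).
Proof.
move=> L0 HL.
have bA : essbdd (\1_A : T -> R) by exact: essbdd_indic.
have bI := essbdd_I; have bd := essbdd_bmo_mdiff; have bW := essbdd_W.
have car := @carleson _ _ _ _ _ SB dd W L M (fun k _ => jump_bmo_mdiff k)
  HL W_adapted (fun k => essbdd_L1 (bW k)) W_mono L0.
have b1 : essbdd (fun x => \sum_(k < M) W k x * dd k x ^+ 2).
  by apply: essbdd_sum => k _; apply: essbddM => //; exact: essbddX.
have b2 : essbdd (fun x => \sum_(n <= k < M) (I k x * dd k x) ^+ 2).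
  by apply: essbdd_tail => k _; apply: essbddX; exact: essbddM.
have E2 : Ex (fun x => \1_A x * \sum_(n <= k < M) (I k x * dd k x) ^+ 2) <=
    9 * K ^+ 2 * Ex (\1_A).
  rewrite -(@jump_sum_sqr _ _ _ _ _ SB (fun k x => I k x * dd k x))//; last first.
    by move=> k /andP[nk _]; exact: jump_I.
  rewrite -ExZ; last exact: essbdd_L1.
  apply: Ex_le.
  - apply: essbdd_L1; apply: essbddM => //; apply: essbddX; apply: essbdd_tail => k _.
    exact: essbddM.
  - by apply: essbdd_L1; apply: essbddZ.
  - apply: filterS stopped_bound => x h; rewrite mulrC; apply: ler_wpM2r => //.
    rewrite -real_normK ?num_real//.
    have := normr_ge0 (\sum_(n <= k < M) I k x * dd k x).
    by move: h; have := K0; rewrite !expr2; nra.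
apply: le_trans (_ : _ <= Ex (fun x => \1_A x * \sum_(n <= k < M) (I k x * dd k x) ^+ 2) +
   Ex (fun x => \sum_(k < M) W k x * dd k x ^+ 2)) _; last first.
  rewrite mulrDl; apply: lerD => //; apply: le_trans car _.
  have -> : 2^-1 * L * Ex (\1_A) = L * (2^-1 * Ex (\1_A)) by ring.
  exact: ler_wpM2l.
rewrite -ExD; [|by apply: essbdd_L1; apply: essbddM|exact: essbdd_L1].
apply: Ex_le.
- apply: essbdd_L1; apply: essbddM => //.
  by apply: essbdd_tail => k _; exact: essbddX.
- by apply: essbdd_L1; apply: essbddD => //; apply: essbddM.
- apply: aeW => x.
  rewrite -(big_mkord xpredT (fun k => W k x * dd k x ^+ 2)).
  rewrite [X in _ <= _ + X](@big_cat_nat _ _ _ n)//=.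
  have -> : \sum_(0 <= i < n) W i x * dd i x ^+ 2 = 0.
    by rewrite big_nat_cond big1// => k /andP[/andP[_ kn] _]; rewrite /W kn mul0r.
  rewrite add0r.
  rewrite !mulr_sumr -big_split/= big_nat_cond [leRHS]big_nat_cond.
  apply: ler_sum => k /andP[/andP[nk _] _]; rewrite /W ltnNge nk/= exprMn.
  by have [->|->] := I01 x nk; rewrite ?expr0n ?expr1n/=; lra.
Qed.

End stopping.

(** 18 K^2 is the fixed point of L |-> 9 K^2 + L / 2. Starting from a crude bound with the excess M
    K^2, whose dependence on M is harmless, each application of [jn_step] halves the excess. *)
Lemma john_nirenberg M n A : (n <= M)%N -> F n A ->
  Ex (fun x => \1_A x * \sum_(n <= k < M) dd k x ^+ 2) <= 18 * K ^+ 2 * Ex (\1_A).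
Proof.
pose L0 := M%:R * K ^+ 2.
have L00 : 0 <= L0 by rewrite mulr_ge0// sqr_ge0.
have H i m B : (m <= M)%N -> F m B ->
    Ex (fun x => \1_B x * \sum_(m <= k < M) dd k x ^+ 2) <=
    (18 * K ^+ 2 + 2 ^- i * L0) * Ex (\1_B).
  elim: i m B => [|i IH] m B mM FB.
    have mB := filtration_measurable SB FB.
    have bB : essbdd (\1_B : T -> R) by exact: essbdd_indic.
    rewrite -ExZ; last exact: essbdd_L1.
    apply: Ex_le.
    - apply: essbdd_L1; apply: essbddM => //; apply: essbdd_tail => k _.
      exact/essbddX/essbdd_bmo_mdiff.
    - exact/essbdd_L1/essbddZ.
    - have := ae_countable (P := P) bmo1_mdiff; apply: filterS => x Hd.
      rewrite mulrC; apply: ler_wpM2r => //.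
      apply: (@le_trans _ _ (\sum_(m <= k < M) K ^+ 2)).
        apply: ler_sum => k _; rewrite -real_normK ?num_real//.
        by rewrite ler_pXn2r// ?nnegrE ?ltW.
      rewrite sumr_const_nat -[leLHS]mulr_natl expr0 invr1 mul1r /L0.
      have : (M - m)%:R * K ^+ 2 <= M%:R * K ^+ 2.
        by apply: ler_wpM2r; rewrite ?sqr_ge0// ler_nat leq_subr.
      have := sqr_ge0 K; lra.
  have L'0 : 0 <= 18 * K ^+ 2 + 2 ^- i * L0.
    have h2 : 0 <= 2 ^- i * L0 by rewrite mulr_ge0// invr_ge0 exprn_ge0.
    by have := sqr_ge0 K; lra.
  apply: le_trans (@jn_step M m B mM FB _ L'0 IH) _.
  apply: ler_wpM2r; first exact: Rintegral_ge0.
  by rewrite (exprS 2 i) invfM; lra.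
move=> nM FA; apply/ler_addgt0Pr => eps eps0.
have [i Hi] : exists i : nat, L0 * Ex (\1_A) <= eps * 2 ^+ i.
  exists (Num.truncn (L0 * Ex (\1_A) / eps)).+1.
  rewrite -ler_pdivrMl// mulrC.
  apply: le_trans (ltW (truncnS_gt _)) _.
  by rewrite -natrX ler_nat ltnW// ltn_expl.
apply: le_trans (H i n A nM FA) _.
rewrite mulrDl lerD2l -mulrA mulrC ler_pdivrMr// exprn_gt0//.
Qed.

Lemma john_nirenberg_prev M n A : (n <= M)%N -> F n A ->
  Ex (fun x => \1_A x * (c M x - c n x) ^+ 2) <= 18 * K ^+ 2 * Ex (\1_A).
Proof.
move=> nM FA; apply: le_trans (john_nirenberg nM FA).
rewrite -(@jump_sum_sqr _ _ _ _ _ SB dd)//; last by move=> k _; exact: jump_bmo_mdiff.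
apply: Ex_le.
- apply: essbdd_L1; apply: essbddM; first exact/essbdd_indic/(filtration_measurable SB FA).
  by apply/essbddX/essbddB; exact: essbdd_prev_mart.
- apply: essbdd_L1; apply: essbddM; first exact/essbdd_indic/(filtration_measurable SB FA).
  by apply/essbddX/essbdd_tail => k _; exact: essbdd_bmo_mdiff.
- by apply: aeW => x; rewrite sum_tail_mdiff.
Qed.

End john_nirenberg.

Lemma measurable_inv_norm (R : realType) (e : R) : 0 < e ->
  measurable_fun setT (fun y : R => (`|y| + e)^-1).
Proof.
move=> e0; apply: continuous_measurable_fun => y; apply: cvgV.
  by rewrite gt_eqF// ltr_wpDl.
by apply: cvgD; [exact: (cvg_norm cvg_id)|exact: cvg_cst].
Qed.

(** * Numerical inequalities behind the stopping levels *)

Section real_lemmas.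
Context (R : realType).
Implicit Types (s : nat -> R) (t e : R).

(** Partial sums are nondecreasing, so the retained terms form an initial segment, whose sum is at
    most t. *)
Lemma truncated_sum s t N : (forall i, 0 <= s i) -> 0 <= t ->
  \sum_(k < N) (\sum_(i < k.+1) s i <= t)%R%:R * s k <= t.
Proof.
move=> s0 t0.
have H M : \sum_(k < M) (\sum_(i < k.+1) s i <= t)%R%:R * s k <= \sum_(i < M) s i.
  by apply: ler_sum => i _; case: (\sum_(_ < _) _ <= t); rewrite ?mul1r ?mul0r.
elim: N => [|N IH]; first by rewrite big_ord0.
case: (leP (\sum_(i < N.+1) s i) t) => h; first exact: le_trans (H _) h.
by rewrite big_ord_recr/= [in X in _ + X]leNgt h mul0r addr0.
Qed.

(** The active levels are those with 2^j e < t; the geometric sum up to the last active j is at most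
    2^(j+2) e, that is four times 2^j e. *)
Lemma dyadic_sum e t J : 0 < e -> 0 <= t ->
  \sum_(j < J) 2 ^+ j.+1 * e * (2 ^+ j * e < t)%R%:R <= 4 * t.
Proof.
move=> e0 t0; elim: J => [|J IH]; first by rewrite big_ord0 mulr_ge0.
rewrite big_ord_recr/=; case: ltP => h; last by rewrite mulr0 addr0.
have H M : \sum_(j < M) 2 ^+ j.+1 * e * (2 ^+ j * e < t)%R%:R <= 2 ^+ M.+1 * e.
  elim: M => [|M HM]; first by rewrite big_ord0 mulr_ge0// ltW.
  rewrite big_ord_recr/= (exprS 2 M.+1).
  have : 2 ^+ M.+1 * e * (2 ^+ M * e < t)%R%:R <= 2 ^+ M.+1 * e.
    by case: (_ < _); rewrite ?mulr1 ?mulr0// mulr_ge0// ltW.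
  lra.
have := H J; rewrite mulr1 (exprS 2 J); lra.
Qed.

Lemma sqrt_amgm (a b : R) : 0 <= a -> 0 <= b -> Num.sqrt (a * b) <= 2^-1 * (a + b).
Proof.
move=> a0 b0; rewrite -(@ler_pXn2r _ 2)// ?nnegrE ?sqrtr_ge0//; last first.
  by rewrite mulr_ge0// addr_ge0.
rewrite sqr_sqrtr ?mulr_ge0// exprMn; have := sqr_ge0 (a - b).
by rewrite !expr2; nra.
Qed.

End real_lemmas.

(** * The Davis decomposition *)

Section atomic_decomposition.
Context d (T : measurableType d) (R : realType) (P : probability T R).
Context (F : (set (set T))^nat) (SB : stochastic_basis P F).
Implicit Types (f g h w b : T -> R) (A B : set T) (n m k N M : nat).

Notation L1 f := (P.-integrable setT (EFin \o f)).
Notation Ex f := (Rintegral P setT f).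
Notation mart := (mart P F).
Notation essbdd := (essbdd P).
Notation prev := (@Defs.prev d T R).
Notation jump := (jump P F).

Lemma jumpB k g h : jump k g -> jump k h -> jump k (fun x => g x - h x).
Proof.
move=> [mg bg g0] [mh bh h0]; split; [exact: adaptedB|exact: essbddB|].
case: k mg mh g0 h0 => [|k] mg mh g0 h0; first exact: aeW.
ae_using g0; ae_using h0; ae_using (martB SB k (essbdd_L1 bg) (essbdd_L1 bh)).
by ae_intro => x /= -> -> ->; rewrite subrr.
Qed.

Lemma jump0 k : jump k (fun=> 0).
Proof.
split; [exact: adapted_cst|exact: essbdd_cst|].
case: k => [|k]; [exact: aeW|exact: mart_cst].
Qed.

(* [k.-1] is the time k - 1 for [0 < k]; at the time 0 the conditional
   expectation given the past is 0. *)
Lemma prev_mart_adapted k w : essbdd w -> measurable_for (F k.-1) (prev (mart w) k).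
Proof.
case: k => [|k] bw /=; first exact: adapted_cst.
exact (mart_adapted SB (essbdd_L1 bw) k).
Qed.

Lemma prev_mart_essbdd k w : essbdd w -> essbdd (prev (mart w) k).
Proof. by move=> bw; apply: essbdd_prev => j; exact: essbdd_mart. Qed.

Lemma prev_mart_adaptedW k w : essbdd w -> measurable_for (F k) (prev (mart w) k).
Proof. by move=> bw; apply: (adapted_mono SB (leq_pred k)); exact: prev_mart_adapted. Qed.

Lemma jump_center k w : measurable_for (F k) w -> essbdd w ->
  jump k (fun x => w x - prev (mart w) k x).
Proof.
move=> mw bw; have bp := prev_mart_essbdd k bw; split.
- by apply: adaptedB => //; exact: prev_mart_adaptedW.
- exact: essbddB.
- case: k mw bp => [|k] mw bp; first exact: aeW.
  ae_using (martB SB k (essbdd_L1 bw) (essbdd_L1 bp)).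
  ae_using (mart_tower SB (leqnn k) (essbdd_L1 bw)).
  by ae_intro => x /= -> ->; rewrite subrr.
Qed.

Lemma Ex_norm_prev_mart k w : essbdd w ->
  Ex (fun x => `|prev (mart w) k x|) <= Ex (fun x => `|w x|).
Proof.
move=> bw; have lw := essbdd_L1 bw; have law := L1_norm lw.
case: k => [|k] /=.
  by under eq_Rintegral do rewrite normr0; rewrite Ex_cst; apply: Rintegral_ge0.
rewrite -(Ex_mart SB k law); apply: Ex_le.
- exact/L1_norm/mart_L1.
- exact: mart_L1.
- exact: mart_norm.
Qed.

Lemma mart_center_sqr k w : essbdd w ->
  {ae P, forall x, mart (fun y => (w y - mart w k y) ^+ 2) k x <=
                   mart (fun y => w y ^+ 2) k x}.
Proof.
move=> bw; have bm := essbdd_mart SB k bw.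
have lw := essbdd_L1 bw; have mm := mart_adapted SB lw k.
have b1 := essbddX bw; have b2 := essbddM bm bw; have b3 := essbddX bm.
have -> : (fun y => (w y - mart w k y) ^+ 2) =
   fun y => 1 * (1 * w y ^+ 2 + (-2) * (mart w k y * w y)) + 1 * mart w k y ^+ 2.
  by apply/funext => y; ring.
have b4 : essbdd (fun y => 1 * w y ^+ 2 + (-2) * (mart w k y * w y)).
  by essbdd_tac.
ae_using (mart_lin SB 1 1 k (essbdd_L1 b4) (essbdd_L1 b3)).
ae_using (mart_lin SB 1 (-2) k (essbdd_L1 b1) (essbdd_L1 b2)).
ae_using (mart_pull SB mm lw (essbdd_L1 b2)).
have mm2 : measurable_for (F k) (fun x => mart w k x ^+ 2).
  by under eq_fun do rewrite expr2; exact: adaptedM.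
have h3 := mart_id SB (leqnn k) mm2 (essbdd_L1 b3).
ae_using h3; ae_intro => x -> -> -> ->.
have := sqr_ge0 (mart w k x); rewrite !expr2; lra.
Qed.

(** An unnormalized atom kept as its sequence of differences: up to the factor c P(A), the sum of
    the [a k] is an atom at n. The last clause bounds the square of the conditional square function,
    and leaving out the normalization admits sets of probability 0. *)
Definition atomic N n A (c : R) (a : nat -> T -> R) :=
  [/\ F n A, 0 < c, forall k, jump k (a k),
      (forall k x, (k <= n)%N \/ ~ A x -> a k x = 0) &
      {ae P, forall x, \sum_(k < N) prev (mart (fun y => a k y ^+ 2)) k x <= c ^+ 2}].

Section davis.
Context (v : nat -> T -> R) (N' : nat) (eta : R).
Hypothesis jv : forall k, jump k (v k).
Hypothesis eta0 : 0 < eta.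

Let N := N'.+1.
(** The Davis splitting: a difference is small if the square sum [S k] of its strict past dominates
    it. Recentering the small part gives the jumps [g k]; the rest [h k] is charged to the growth of
    [S]. The modulus in [sg] turns almost sure nonnegativity into nonnegativity everywhere. *)
Let S k x : R := sqsum (v ^~ x) k.
Let small k x : R := (`|v k x| <= S k x)%R%:R.
Let dsm k x : R := small k x * v k x.
Let dlg k x : R := v k x - dsm k x.
Let g k x : R := dsm k x - prev (mart (dsm k)) k x.
Let h k x : R := v k x - g k x.
Let sg k x : R := `|prev (mart (fun y => dsm k y ^+ 2)) k x|.
Let Q k x : R := \sum_(i < k) sg i x.
Let t j : R := (2 ^+ j * eta) ^+ 2.
Let lev j k x : R := (Q k x <= t j)%R%:R.

Let bv k : essbdd (v k). Proof. by have [] := jv k. Qed.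
Let mv k : measurable_for (F k) (v k). Proof. by have [] := jv k. Qed.

Let S_adapted k m : (k <= m.+1)%N -> measurable_for (F m) (S k).
Proof.
move=> km.
have ms : measurable_for (F m) (fun x => \sum_(i < k) v i x ^+ 2).
  apply: adapted_sum => i _; under eq_fun do rewrite expr2.
  have im : (i <= m)%N by rewrite -ltnS (leq_trans (ltn_ord i)).
  by apply: adaptedM; exact: (adapted_mono SB im (@mv i)).
apply: (@adapted_comp _ _ _ F m (@Num.sqrt R) _ _ ms).
by apply: continuous_measurable_fun; exact: sqrt_continuous.
Qed.

Let bS k : essbdd (S k).
Proof. by apply: essbdd_sqsum => i _; exact: bv. Qed.

Lemma le_indic_adapted m (f1 f2 : T -> R) : measurable_for (F m) f1 ->
  measurable_for (F m) f2 ->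
  measurable_for (F m) (fun x => (f1 x <= f2 x)%R%:R : R).
Proof.
move=> m1 m2; have FY := adapted_set SB (adaptedB m2 m1) (@measurable_itv R `[0, +oo[).
have := adapted_indic SB FY.
congr (measurable_for (F m) _); apply/funext => x.
rewrite indicE; congr (nat_of_bool _)%:R.
by apply/idP/idP; rewrite inE/= in_itv/= andbT subr_ge0.
Qed.

Lemma le_indic_essbdd m (f1 f2 : T -> R) : measurable_for (F m) f1 ->
  measurable_for (F m) f2 -> essbdd (fun x => (f1 x <= f2 x)%R%:R : R).
Proof.
move=> m1 m2; split.
  exact: (adapted_measurable SB (@le_indic_adapted _ _ _ m1 m2)).
by exists 1; apply: aeW => x; case: (f1 x <= f2 x); rewrite ?normr1 ?normr0.
Qed.

Let av_adapted k : measurable_for (F k) (fun x => `|v k x|).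
Proof. exact: (@adapted_comp _ _ _ F k (@Num.norm _ R) (v k)). Qed.

Let dsm_adapted k : measurable_for (F k) (dsm k).
Proof.
by apply: adaptedM (@mv k); apply: le_indic_adapted (@av_adapted k) _; exact: S_adapted.
Qed.

Let bdsm k : essbdd (dsm k).
Proof.
by apply: essbddM (bv k); apply: le_indic_essbdd (@av_adapted k) _; exact: S_adapted.
Qed.

Let bdlg k : essbdd (dlg k). Proof. exact: essbddB. Qed.

Let jg k : jump k (g k).
Proof. by apply: jump_center; [exact (@dsm_adapted k)|exact: bdsm]. Qed.

Let jh k : jump k (h k).
Proof. exact: jumpB. Qed.

Let bsg k : essbdd (sg k).
Proof. by apply/essbdd_norm/prev_mart_essbdd/essbddX. Qed.

Let sg_adapted k m : (k <= m.+1)%N -> measurable_for (F m) (sg k).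
Proof.
move=> km; apply: (@adapted_comp _ _ _ F m (@Num.norm _ R)) => //.
apply: (adapted_mono SB _ (prev_mart_adapted (essbddX (bdsm k)))).
by case: k km.
Qed.

Let Q_adapted k m : (k <= m.+2)%N -> measurable_for (F m) (Q k).
Proof.
move=> km; apply: adapted_sum => i _; apply: sg_adapted.
by rewrite -ltnS (leq_trans (ltn_ord i)).
Qed.

Let bQ k : essbdd (Q k).
Proof. by apply: essbdd_sum => i _; exact: bsg. Qed.

Let Q_le k m x : (k <= m)%N -> Q k x <= Q m x.
Proof.
move=> /subnK <-; elim: (m - k)%N => // j IH.
apply: le_trans IH _; rewrite addSn /Q [leRHS]big_ord_recr/= lerDl.
exact: normr_ge0.
Qed.

(** The past at time 0 is empty, so the whole of v_0 goes into the large part: [g] vanishes at the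
    time 0, where jumps have no cancellation. *)
Let dsm0 x : dsm 0 x = 0.
Proof.
rewrite /dsm /small /S sqsum0 normr_le0; case: eqP => [->|_]; by rewrite ?mulr0 ?mul0r.
Qed.

Let g0 x : g 0 x = 0.
Proof. by rewrite /g dsm0 subr0. Qed.

Let Q1 x : Q 1 x = 0.
Proof. by rewrite /Q big_ord1 /sg/= normr0. Qed.

Let Q_ge0 k x : 0 <= Q k x.
Proof. by rewrite /Q; apply: sumr_ge0 => i _; exact: normr_ge0. Qed.

Let dlg_bound k x : `|dlg k x| <= 3 * (S k.+1 x - S k x).
Proof.
rewrite /dlg /dsm /small; case: (leP `|v k x| (S k x)) => vS.
  by rewrite mul1r subrr normr0 mulr_ge0// subr_ge0; exact: sqsum_leS.
by rewrite mul0r subr0; exact: (@sqsum_large R (v ^~ x)).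
Qed.

(** As v_k has conditional expectation 0 given the past, h_k is the large part minus its own
    conditional expectation; each of the two costs 3 (E S_(k+1) - E S_k). *)
Let h_bound k : Ex (fun x => `|h k x|) <= 6 * (Ex (S k.+1) - Ex (S k)).
Proof.
have bl := bdlg k; have lS i := essbdd_L1 (bS i).
have H : {ae P, forall x, `|h k x| <= `|dlg k x| + `|prev (mart (dlg k)) k x|}.
  have E : {ae P, forall x, prev (mart (dsm k)) k x = - prev (mart (dlg k)) k x}.
    case: k bl => [|k] bl; first by apply: aeW => x /=; rewrite oppr0.
    have [_ _ vk0] := jv k.+1.
    ae_using (martB SB k (essbdd_L1 (bv k.+1)) (essbdd_L1 (bdsm k.+1))).
    by ae_using vk0; ae_intro => x /= -> ->; rewrite sub0r opprK.
  apply: filterS E => x E; rewrite /h /g E.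
  have -> : v k x - (dsm k x - - prev (mart (dlg k)) k x) =
    dlg k x - prev (mart (dlg k)) k x by rewrite /dlg; ring.
  exact: ler_normB.
have [_ bh _] := jh k.
have bp := prev_mart_essbdd k bl.
apply: le_trans (Ex_le (essbdd_L1 (essbdd_norm bh)) _ H) _.
  by apply: essbdd_L1; essbdd_tac.
rewrite ExD; [|exact/essbdd_L1/essbdd_norm..].
have h1 := Ex_norm_prev_mart k bl.
have : Ex (fun x => `|dlg k x|) <= 3 * (Ex (S k.+1) - Ex (S k)).
  rewrite -ExB// -ExZ; last exact: L1B.
  apply: Ex_le; [exact/essbdd_L1/essbdd_norm|exact/L1Z/L1B|].
  by apply: aeW => x; exact: dlg_bound.
lra.
Qed.

Lemma davis_jumps : \sum_(k < N) Ex (fun x => `|h k x|) <= 6 * Ex (S N).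
Proof.
apply: (@le_trans _ _ (\sum_(k < N) 6 * (Ex (S k.+1) - Ex (S k)))).
  by apply: ler_sum => k _; exact: h_bound.
rewrite -mulr_sumr -(big_mkord xpredT (fun k => Ex (S k.+1) - Ex (S k))).
rewrite telescope_sumr// ler_pM2l// lerBlDr lerDl.
by apply: Rintegral_ge0 => x _; exact: sqsum_ge0.
Qed.

(** The weight 1 / (S_i + eta) is predictable; eta keeps it bounded where the past vanishes and is
    one source of the additive error in eta. *)
Let Wi i x : R := (`|S i x| + eta)^-1.

Let Wi_adapted i m : (i <= m.+1)%N -> measurable_for (F m) (Wi i).
Proof.
move=> im; apply: (@adapted_comp _ _ _ F m (fun y => (`|y| + eta)^-1) (S i)).
  exact: measurable_inv_norm.
exact: S_adapted.
Qed.

Let bW i : essbdd (Wi i).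
Proof.
split.
  by apply: (adapted_measurable SB (@Wi_adapted i i _)).
exists eta^-1; apply: aeW => x; rewrite ger0_norm; last by rewrite invr_ge0 addr_ge0// ltW.
by rewrite lef_pV2 ?posrE ?ltr_wpDl// lerDr.
Qed.

(** The predictable weight lets the conditional variance be replaced by the square of the small part
    itself, and [sqsum_small] bounds that square by 3 (S_(i+1) - S_i) S_i, which the weight divides
    by S_i + eta. *)
Let weighted i : Ex (fun x => Wi i x * sg i x) <= 3 * (Ex (S i.+1) - Ex (S i)).
Proof.
have lS j := essbdd_L1 (bS j).
rewrite -ExB// -ExZ; last exact: L1B.
have b2 := essbddX (bdsm i).
have bWd := essbddM (bW i) b2.
apply: (@le_trans _ _ (Ex (fun x => Wi i x * dsm i x ^+ 2))); last first.
  apply: Ex_le; [exact: essbdd_L1|exact/L1Z/L1B|].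
  apply: aeW => x; rewrite /Wi /dsm /small ger0_norm ?sqsum_ge0//.
  have Sp : 0 < S i x + eta by rewrite ltr_wpDl ?sqsum_ge0.
  have Sm := @sqsum_leS R (v ^~ x) i; rewrite -/(S i x) -/(S i.+1 x) in Sm.
  case: (leP `|v i x| (S i x)) => vS; last by rewrite mul0r expr0n mulr0 mulr_ge0// subr_ge0.
  rewrite mul1r ler_pdivrMl//.
  apply: le_trans (@sqsum_small R (v ^~ x) i vS) _.
  rewrite -/(S i x) -/(S i.+1 x) mulrC; apply: ler_wpM2r.
    by rewrite mulr_ge0// subr_ge0.
  by rewrite lerDl ltW.
case: i lS b2 bWd => [|i] lS b2 bWd.
  under [leRHS]eq_Rintegral do rewrite dsm0 expr0n mulr0.
  by under eq_Rintegral do rewrite /sg/= normr0 mulr0.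
have [_ <-] := pull_out SB (@Wi_adapted i.+1 i (leqnn _)) (essbdd_L1 b2) (essbdd_L1 bWd).
apply: Ex_le.
- by apply: essbdd_L1; apply: essbddM.
- by apply: essbdd_L1; apply: essbddM => //; exact: essbdd_mart.
- have := mart_ge0 SB i (essbdd_L1 b2) (aeW P (fun x => sqr_ge0 (dsm i.+1 x))).
  by apply: filterS => x m0; rewrite /sg/= ger0_norm.
Qed.

(** Each summand of Q_N is at most W_i sg_i (S_N + eta), as S_i <= S_N. So sqrt(Q_N) is at most half
    of the sum of the W_i sg_i plus half of S_N + eta, and 2 = (3 + 1) / 2. *)
Lemma davis_predictable : Ex (fun x => Num.sqrt (Q N x)) <= 2 * Ex (S N) + 2^-1 * eta.
Proof.
have lS j := essbdd_L1 (bS j).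
have bsq : essbdd (fun x => \sum_(i < N) Wi i x * sg i x).
  by apply: essbdd_sum => i _; exact: essbddM.
apply: (@le_trans _ _ (Ex (fun x => 2^-1 * (\sum_(i < N) Wi i x * sg i x + (S N x + eta))))).
  apply: Ex_le.
  - apply: (L1_le _ (essbdd_L1 (essbddD (bQ N) (essbdd_cst P 1)))).
      apply: measurableT_comp; last exact: essbdd_measurable (bQ N).
      by apply: continuous_measurable_fun; exact: sqrt_continuous.
    apply: aeW => x; rewrite ger0_norm ?sqrtr_ge0//.
    have := @sqrt_amgm R (Q N x) 1 (Q_ge0 N x) ler01; have := Q_ge0 N x.
    by rewrite mulr1; lra.
  - apply: essbdd_L1; apply: essbddZ; apply: essbddD => //.
    by apply: essbddD => //; exact: essbdd_cst.
  - apply: aeW => x; apply: le_trans _ (sqrt_amgm _ _).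
    + apply: ler_wsqrtr; rewrite mulr_suml; apply: ler_sum => i _.
      rewrite mulrAC -[X in X <= _]mul1r; apply: ler_wpM2r; first exact: normr_ge0.
      rewrite /Wi mulrC ler_pdivlMr ?mul1r ?ltr_wpDl//.
      rewrite lerD2r ger0_norm ?sqsum_ge0//.
      by apply: sqsum_le; exact: ltnW.
    + apply: sumr_ge0 => i _; apply: mulr_ge0; last exact: normr_ge0.
      by rewrite invr_ge0 addr_ge0// ltW.
    + by rewrite addr_ge0 ?sqsum_ge0// ltW.
have lc := L1_cst P eta.
rewrite ExZ; last by apply: L1D; [exact: essbdd_L1|exact: L1D].
rewrite ExD; [|exact: essbdd_L1|exact: L1D].
rewrite ExD// Ex_cst Ex_sum; last by move=> i _; apply: essbdd_L1; exact: essbddM.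
have : \sum_(i < N) Ex (fun x => Wi i x * sg i x) <= 3 * Ex (S N).
  apply: (@le_trans _ _ (\sum_(k < N) 3 * (Ex (S k.+1) - Ex (S k)))).
    by apply: ler_sum => k _; exact: weighted.
  rewrite -mulr_sumr -(big_mkord xpredT (fun k => Ex (S k.+1) - Ex (S k))).
  rewrite telescope_sumr// ler_pM2l// lerBlDr lerDl.
  by apply: Rintegral_ge0 => x _; exact: sqsum_ge0.
lra.
Qed.

Let lev_adapted j k m : (k <= m.+2)%N -> measurable_for (F m) (lev j k).
Proof.
by move=> km; apply: le_indic_adapted; [exact: Q_adapted|exact: adapted_cst].
Qed.

Let blev j k : essbdd (lev j k).
Proof.
apply: (@le_indic_essbdd k); last exact: adapted_cst.
by apply: Q_adapted; rewrite ltnW.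
Qed.

Let lev01 j k x : lev j k x = 0 \/ lev j k x = 1.
Proof. by rewrite /lev; case: (_ <= _); [right|left]. Qed.

Let lev_dec j k m x : (k <= m)%N -> lev j m x <= lev j k x.
Proof.
move=> /(Q_le x) km; rewrite /lev; case: (leP (Q k x) (t j)) => h1; first by rewrite lern1 leq_b1.
by rewrite (leNgt (Q m x)) (lt_le_trans h1 km).
Qed.

Let t_mono j i : (j <= i)%N -> t j <= t i.
Proof.
move=> ji; have p i' : 0 <= 2 ^+ i' * eta by rewrite mulr_ge0// ltW.
by rewrite /t ler_pXn2r ?nnegrE// ler_pM2r// ler_weXn2l// ler1n.
Qed.

Let t_ge0 j : 0 <= t j. Proof. exact: sqr_ge0. Qed.

Let lev_inc j k x : lev j k x <= lev j.+1 k x.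
Proof.
rewrite /lev; case: (leP (Q k x) (t j.+1)) => h1; first by rewrite lern1 leq_b1.
by rewrite (leNgt (Q k x)) (le_lt_trans (t_mono (leqnSn j)) h1).
Qed.

Let lev1 j x : lev j 1 x = 1.
Proof. by rewrite /lev Q1 t_ge0. Qed.

(* The restriction of the differences [g k] by a predictable weight bounded by
   the indicator of [Q k.+1 <= t j] has conditional square function at most
   the square root of [t j]. *)
Let restricted_sum j (w : nat -> T -> R) :
  (forall k, measurable_for (F k.-1) (w k)) ->
  (forall k x, 0 <= w k x <= lev j k.+1 x) ->
  {ae P, forall x, \sum_(k < N) prev (mart (fun y => (w k y * g k y) ^+ 2)) k x <= t j}.
Proof.
move=> mw w0.
have bw k : essbdd (w k).
  apply: (@essbdd_le _ _ _ _ _ (lev j k.+1)) => //.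
    exact: (adapted_measurable SB (mw k)).
  by apply: aeW => x; have /andP[h1 h2] := w0 k x; rewrite ger0_norm.
have H k : {ae P, forall x, prev (mart (fun y => (w k y * g k y) ^+ 2)) k x <=
    lev j k.+1 x * sg k x}.
  case: k => [|k].
    by apply: aeW => x; rewrite /sg/= normr0 mulr0.
  have [_ bg _] := jg k.+1.
  have bwg : essbdd (fun x => w k.+1 x ^+ 2 * g k.+1 x ^+ 2).
    by apply: essbddM; exact: essbddX.
  have mw2 : measurable_for (F k) (fun x => w k.+1 x ^+ 2).
    by under eq_fun do rewrite expr2; apply: adaptedM; exact (mw k.+1).
  have E : (fun y => (w k.+1 y * g k.+1 y) ^+ 2) = fun x => w k.+1 x ^+ 2 * g k.+1 x ^+ 2.
    by apply/funext => y; rewrite exprMn.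
  rewrite /= E.
  ae_using (mart_pull SB mw2 (essbdd_L1 (essbddX bg)) (essbdd_L1 bwg)).
  ae_using (mart_center_sqr k (bdsm k.+1)).
  ae_using (mart_ge0 SB k (essbdd_L1 (essbddX bg)) (aeW P (fun x => sqr_ge0 (g k.+1 x)))).
  ae_intro => x m0 m1 ->; have /andP[w1 w2] := w0 k.+1 x.
  have l1 : lev j k.+2 x <= 1 by case: (lev01 j k.+2 x) => ->.
  have m2 : mart (fun y => g k.+1 y ^+ 2) k x <= sg k.+1 x.
    by apply: le_trans m1 _; exact: ler_norm.
  apply: ler_pM => //; first exact: sqr_ge0.
  rewrite expr2; nra.
have := ae_countable (P := P) H; apply: filterS => x Hx.
apply: (@le_trans _ _ (\sum_(k < N) lev j k.+1 x * sg k x)); first exact: ler_sum.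
by apply: (@truncated_sum R (sg ^~ x)) => // i; exact: normr_ge0.
Qed.

(** The stopping time of the level j equals n on this event: Q_(n+1) <= t_j < Q_(n+2), where Q_(n+2)
    contains the conditional variances up to the index n + 1 and is known at n. The weight below
    switches on after n, and off when the next level is passed. *)
Let atom_set j n : set T := [set x | lev j n.+1 x - lev j n.+2 x = 1].
Let atom_weight j n k x : R := if (k <= n)%N then 0 else
  (lev j n.+1 x - lev j n.+2 x) * lev j.+1 k.+1 x.

Let atom_setF j n : F n (atom_set j n).
Proof.
have mf : measurable_for (F n) (fun x => lev j n.+1 x - lev j n.+2 x).
  by apply: adaptedB; apply: lev_adapted => //; exact: leqW.
exact: (adapted_set SB mf (measurable_set1 1)).
Qed.

Let atom_setE j n x : lev j n.+1 x - lev j n.+2 x = \1_(atom_set j n) x.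
Proof.
rewrite indicE /atom_set; case: (boolP (x \in _)) => [|]; first by rewrite inE.
rewrite notin_setE/=; have := @lev_dec j n.+1 n.+2 x (leqnSn _).
have [->|->] := lev01 j n.+1 x; have [->|->] := lev01 j n.+2 x => //=; lra.
Qed.

Let weight_jump (w : T -> R) k : measurable_for (F k.-1) w -> essbdd w ->
  jump k (fun x => w x * g k x).
Proof.
case: k => [|k] mw bw; last exact: (jump_mul SB).
under eq_fun do rewrite g0 mulr0; exact: jump0.
Qed.

Let atom_weight_adapted j n k : measurable_for (F k.-1) (atom_weight j n k).
Proof.
rewrite /atom_weight; case: leqP => nk; first exact: adapted_cst.
case: k nk => // k nk; rewrite ltnS in nk.
apply: adaptedM; last exact: lev_adapted.
by apply: adaptedB; apply: lev_adapted; rewrite ?ltnS// ltnW.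
Qed.

Let batom_weight j n k : essbdd (atom_weight j n k).
Proof.
rewrite /atom_weight; case: leqP => nk; first exact: essbdd_cst.
by apply: essbddM => //; exact: essbddB.
Qed.

(** The weight lives where Q_(k+1) <= t_(j+1), whence the size 2^(j+1) eta of the next level rather
    than that of the level j. *)
Let atom_atomic j n :
  atomic N n (atom_set j n) (2 ^+ j.+1 * eta) (fun k x => atom_weight j n k x * g k x).
Proof.
split.
- exact: atom_setF.
- by rewrite mulr_gt0// exprn_gt0.
- by move=> k; apply: weight_jump; [exact (@atom_weight_adapted j n k)|exact: batom_weight].
- move=> k x [kn|Ax]; rewrite /atom_weight; first by rewrite kn mul0r.
  by rewrite atom_setE indicE memNset//; case: ifP => _; rewrite !mul0r.
- apply: restricted_sum => [k|k x]; first exact (@atom_weight_adapted j n k).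
  rewrite /atom_weight atom_setE indicE; case: ifP => _.
    by rewrite lexx/=; case: (lev01 j.+1 k.+1 x) => ->; rewrite ?lexx ?ler01.
  by case: (x \in _); case: (lev01 j.+1 k.+1 x) => ->; rewrite ?mul1r ?mul0r ?lexx ?ler01 ?lexx.
Qed.

(** What lies below the lowest level forms one further atom, on the whole space and at time 0; its
    size eta does not shrink with S, but eta is arbitrary. *)
Let bottom_weight k x : R := if (k <= 0)%N then 0 else lev 0 k.+1 x.

Let bottom_atomic : atomic N 0 setT eta (fun k x => bottom_weight k x * g k x).
Proof.
have mw k : measurable_for (F k.-1) (bottom_weight k).
  rewrite /bottom_weight; case: k => [|k] /=; first exact: adapted_cst.
  exact: lev_adapted.
split => //.
- exact: (filtration_setT SB).
- move=> k; apply: weight_jump; first exact: (mw k).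
  by rewrite /bottom_weight; case: k => [|k] /=; [exact: essbdd_cst|exact: blev].
- move=> k x [k0|[]//]; by rewrite /bottom_weight k0 mul0r.
- have -> : eta ^+ 2 = t 0 by rewrite /t expr0 mul1r.
  apply: restricted_sum => // k x; rewrite /bottom_weight; case: ifP => _.
    by rewrite lexx/=; case: (lev01 0 k.+1 x) => ->; rewrite ?lexx ?ler01.
  by case: (lev01 0 k.+1 x) => ->; rewrite ?lexx ?ler01.
Qed.

(** Summing over n turns the level j into lev_(j+1) - lev_j, because lev_j <= lev_(j+1) are
    indicators and lev_j is 1 at the index 1; the sum over j then telescopes, starting from the
    bottom weight. *)
Let weights_sum J k x : (0 < k < N)%N ->
  bottom_weight k x + \sum_(j < J) \sum_(n < N') atom_weight j n k x = lev J k.+1 x.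
Proof.
move=> /andP[k0 kN]; rewrite /bottom_weight leqNgt k0/=.
have H j : \sum_(n < N') atom_weight j n k x = lev j.+1 k.+1 x - lev j k.+1 x.
  rewrite -(big_mkord xpredT (fun n => atom_weight j n k x)).
  rewrite (@big_cat_nat _ _ _ k)//=.
  rewrite [X in _ + X]big_nat_cond [X in _ + X]big1 ?addr0; last first.
    by move=> n /andP[/andP[kn _] _]; rewrite /atom_weight kn.
  rewrite big_nat_cond (eq_bigr (fun n => (lev j n.+1 x - lev j n.+2 x) * lev j.+1 k.+1 x)).
    rewrite -mulr_suml -big_nat_cond.
    have -> : \sum_(0 <= i < k) (lev j i.+1 x - lev j i.+2 x) = 1 - lev j k.+1 x.
      rewrite -[LHS]opprK -sumrN; under eq_bigr do rewrite opprB.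
      by rewrite (telescope_sumr (fun i => lev j i.+1 x))// lev1 opprB.
    have := lev_inc j k.+1 x.
    by have [->|->] := lev01 j k.+1 x; have [->|->] := lev01 j.+1 k.+1 x; lra.
  by move=> n /andP[/andP[_ nk] _]; rewrite /atom_weight leqNgt nk.
under eq_bigr do rewrite H.
rewrite -(big_mkord xpredT (fun j => lev j.+1 k.+1 x - lev j k.+1 x)).
by rewrite telescope_sumr// addrC subrK.
Qed.

(** For fixed j the sets are disjoint and fill the event sqrt(Q_N) > 2^j eta: the last index n = N'
    - 1 ends exactly at Q_N since N = N' + 1. The weighted sum over j is then [dyadic_sum]. *)
Let atom_mass J : \sum_(j < J) \sum_(n < N') 2 ^+ j.+1 * eta * Ex (\1_(atom_set j n)) <=
  4 * Ex (fun x => Num.sqrt (Q N x)).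
Proof.
have lsq : L1 (fun x => Num.sqrt (Q N x)).
  apply: (L1_le _ (essbdd_L1 (essbddD (bQ N) (essbdd_cst P 1)))).
    apply: measurableT_comp; last exact: essbdd_measurable (bQ N).
    by apply: continuous_measurable_fun; exact: sqrt_continuous.
  apply: aeW => x; rewrite ger0_norm ?sqrtr_ge0//.
  have := @sqrt_amgm R (Q N x) 1 (Q_ge0 N x) ler01; have := Q_ge0 N x.
  by rewrite mulr1; lra.
have b1 j : essbdd (fun x => 2 ^+ j.+1 * eta * (1 - lev j N x)).
  by apply: essbddZ; apply: essbddB => //; exact: essbdd_cst.
have H j : \sum_(n < N') 2 ^+ j.+1 * eta * Ex (\1_(atom_set j n)) =
    Ex (fun x => 2 ^+ j.+1 * eta * (1 - lev j N x)).
  have bA n : essbdd (\1_(atom_set j n) : T -> R).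
    by apply/essbdd_indic/(filtration_measurable SB (@atom_setF j n)).
  rewrite ExZ; last by apply: essbdd_L1; apply: essbddB => //; exact: essbdd_cst.
  rewrite -mulr_sumr -Ex_sum; last by move=> n _; exact: essbdd_L1.
  congr (_ * _); apply: eq_Rintegral => x _.
  rewrite -(big_mkord xpredT (fun n => \1_(atom_set j n) x)).
  under eq_bigr do rewrite -atom_setE.
  rewrite -[LHS]opprK -sumrN; under eq_bigr do rewrite opprB.
  by rewrite (telescope_sumr (fun i => lev j i.+1 x))// lev1 opprB.
under eq_bigr do rewrite H.
rewrite -Ex_sum; last by move=> j _; exact: essbdd_L1.
rewrite -ExZ//; apply: Ex_le.
- by apply: essbdd_L1; apply: essbdd_sum => j _.
- exact: L1Z.
- apply: aeW => x; apply: le_trans _ (@dyadic_sum R eta _ J eta0 (sqrtr_ge0 _)).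
  apply: ler_sum => j _; apply: ler_wpM2l; first by rewrite mulr_ge0// ltW.
  rewrite /lev; case: (leP (Q N x) (t j)) => Qt; first by rewrite subrr.
  rewrite subr0 (_ : (_ < _) = true)//.
  have te : 0 <= 2 ^+ j * eta by rewrite mulr_ge0// ltW.
  rewrite -(@ltr_pXn2r _ 2)// ?nnegrE ?sqrtr_ge0// sqr_sqrtr//.
Qed.

Lemma davis_decomposition : exists (I : finType) (n : I -> nat) (A : I -> set T)
    (c : I -> R) (a : I -> nat -> T -> R) (h : nat -> T -> R),
  [/\ (forall i, atomic N (n i) (A i) (c i) (a i)),
      (forall k, jump k (h k)),
      {ae P, forall x, forall k, (k < N)%N -> v k x = h k x + \sum_i a i k x},
      \sum_(k < N) Ex (fun x => `|h k x|) <= 6 * Ex (S N) &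
      \sum_i c i * Ex (\1_(A i)) <= 8 * Ex (S N) + 3 * eta].
Proof.
have [_ [C QC]] := bQ N.
(* Q_N is essentially bounded, so finitely many levels exhaust it and the index set is finite: one
   bottom atom, and a pair of level and time for each other atom. *)
have [J HJ] : exists J, C <= t J.
  exists (Num.truncn (C / eta ^+ 2)).+1.
  have e2 : 0 < eta ^+ 2 by rewrite exprn_gt0.
  rewrite /t exprMn -ler_pdivrMr//.
  apply: le_trans (ltW (truncnS_gt _)) _.
  rewrite -exprM -natrX ler_nat; apply: leq_trans (ltnW (ltn_expl _ (ltnSn 1))) _.
  by rewrite leq_exp2l// leq_pmulr.
pose I : finType := ('I_1 + 'I_J * 'I_N')%type.
exists I, (fun i : I => if i is inr p then nat_of_ord p.2 else 0%N).
exists (fun i : I => if i is inr p then atom_set p.1 p.2 else setT).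
exists (fun i : I => if i is inr p then 2 ^+ p.1.+1 * eta else eta).
exists (fun (i : I) k x => (if i is inr p then atom_weight p.1 p.2 k x else bottom_weight k x) * g k x).
exists h; split.
- by case=> [_|[j m]]; [exact: bottom_atomic|exact: atom_atomic].
- exact: jh.
- apply: filterS QC => x Qx k kN.
  rewrite -mulr_suml big_sumType big_ord1/= -(pair_big xpredT xpredT (fun (j : 'I_J) (m : 'I_N') => atom_weight j m k x))/=.
  case: k kN => [|k] kN; first by rewrite /h g0 subr0 mulr0 addr0.
  rewrite weights_sum; last by rewrite kN.
  rewrite /lev (_ : (_ <= _) = true) ?mul1r ?/h ?subrK//.
  by apply: le_trans HJ; apply: le_trans Qx; apply: le_trans (ler_norm _); exact: Q_le.
- exact: davis_jumps.
- rewrite big_sumType big_ord1/=.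
  rewrite -(pair_big xpredT xpredT (fun (j : 'I_J) (m : 'I_N') =>
    2 ^+ j.+1 * eta * Ex (\1_(atom_set j m))))/=.
  (* The bottom atom weighs eta, the others at most 4 (2 E S_N + eta / 2), whence 8 E S_N + 3
     eta. *)
  have := atom_mass J; have := davis_predictable.
  have -> : Ex (\1_[set: T] : T -> R) = 1.
    by rewrite indicT; exact: Ex_cst.
  lra.
Qed.

End davis.

End atomic_decomposition.

(** * Paraproducts *)

Section hardy.
Context d (T : measurableType d) (R : realType) (P : probability T R).
Context (F : (set (set T))^nat) (SB : stochastic_basis P F).
Implicit Types (f g h b : T -> R) (A B : set T) (n m k l N M : nat) (u v w : nat -> T -> R).

Notation L1 f := (P.-integrable setT (EFin \o f)).
Notation Ex f := (Rintegral P setT f).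
Notation mart := (mart P F).
Notation essbdd := (essbdd P).
Notation prev := (@Defs.prev d T R).
Notation mdiff := (@Defs.mdiff d T R).
Notation jump := (jump P F).
Notation square_fun := (@square_fun d T R).
Notation H1_norm := (H1_norm P).

Lemma eseries_finite (s : nat -> R) N : (forall k, (N <= k)%N -> s k = 0) ->
  (\sum_(0 <= k <oo) (s k)%:E = (\sum_(k < N) s k)%:E)%E.
Proof.
move=> sN; apply/cvg_lim => //; apply: cvg_near_cst.
exists N => // n /= Nn; rewrite -sumEFin -(big_mkord xpredT (fun k => (s k)%:E)).
have z : (\sum_(N <= k < n) (s k)%:E = 0)%E.
  by rewrite big_nat_cond big1// => k /andP[/andP[Nk _] _]; rewrite sN.
by rewrite (@big_cat_nat _ _ _ N)//= z adde0.
Qed.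

Lemma square_fun_ge0 u x : (0 <= square_fun u x)%E.
Proof. exact: poweR_ge0. Qed.

Lemma H1_normE u : H1_norm u = (\int[P]_x square_fun u x)%E.
Proof.
rewrite /Defs.H1_norm Lnorm1; apply: eq_integral => x _.
by rewrite gee0_abs// square_fun_ge0.
Qed.

Lemma eq_square_fun u v x : (forall k, mdiff u k x ^+ 2 = mdiff v k x ^+ 2) ->
  square_fun u x = square_fun v x.
Proof.
move=> uv; congr (_ `^ _)%E; apply: eq_eseriesr => k _.
by rewrite !real_normK ?num_real// uv.
Qed.

Lemma square_fun_finite u N x : (forall k, (N <= k)%N -> mdiff u k x = 0) ->
  square_fun u x = (sqsum (mdiff u ^~ x) N)%:E.
Proof.
move=> uN; rewrite /Defs.square_fun (@eseries_finite _ N).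
  rewrite poweR_EFin powR12_sqrt; last by apply: sumr_ge0 => i _; rewrite exprn_ge0.
  by congr (Num.sqrt _)%:E; apply: eq_bigr => k _; rewrite real_normK ?num_real.
by move=> k /uN ->; rewrite normr0 expr0n.
Qed.

Lemma measurable_square_fun u : (forall k, measurable_fun setT (u k)) ->
  measurable_fun setT (square_fun u).
Proof.
move=> mu; apply: (measurableT_comp (measurable_poweR _)).
apply: ge0_emeasurable_sum => // k _.
apply/measurable_EFinP; apply: measurable_funX; apply: measurableT_comp => //.
by apply: measurable_funB => //; case: k => [|k] //=; exact: measurable_cst.
Qed.

Lemma ae_eq_H1_norm u v : (forall k, measurable_fun setT (u k)) ->
  (forall k, measurable_fun setT (v k)) ->
  (forall k, {ae P, forall x, mdiff u k x = mdiff v k x}) ->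
  H1_norm u = H1_norm v.
Proof.
move=> mu mv uv; rewrite !H1_normE; apply: ae_eq_integral => //.
- exact: measurable_square_fun.
- exact: measurable_square_fun.
- have := ae_countable (P := P) uv; apply: filterS => x H _.
  by apply: eq_square_fun => k; rewrite H.
Qed.

Lemma mart_is_martingale f : L1 f -> is_martingale P F (mart f).
Proof.
move=> lf n; split.
- exact: mart_adapted.
- by apply/LfunL1; exact: mart_L1.
- by apply: filterS (mart_tower SB (leqnSn n) lf) => x.
Qed.

Lemma H1_finite w N : (forall k, (k < N)%N -> jump k (w k)) ->
  let f := fun x => \sum_(k < N) w k x in
  H1_norm (mart f) = (Ex (fun x => sqsum (w ^~ x) N))%:E.
Proof.
move=> jw f; have bf := finite_mart_essbdd jw.
have lf := essbdd_L1 bf.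
have bw k : (k < N)%N -> essbdd (w k) by move=> /jw[].
rewrite H1_normE -Ex_EFin; last exact/essbdd_L1/essbdd_sqsum.
apply: ae_eq_integral => //.
- by apply: measurable_square_fun => k; exact: mart_measurable.
- by apply/measurable_EFinP/measurable_sqsum => k /bw[].
- have := ae_countable (P := P) (finite_mdiff SB jw); apply: filterS => x H _.
  rewrite (@square_fun_finite _ N); last by move=> k Nk; rewrite H ltnNge Nk.
  congr (Num.sqrt _)%:E; apply: eq_bigr => k _; by rewrite H ltn_ord.
Qed.

Lemma H1_finite_mart w N : (forall k, (k < N)%N -> jump k (w k)) ->
  H1 P F (mart (fun x => \sum_(k < N) w k x)).
Proof.
move=> jw; split; last by rewrite (H1_finite jw) ltry.
by apply: mart_is_martingale; apply: essbdd_L1; exact: finite_mart_essbdd jw.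
Qed.

(** Cauchy-Schwarz on [A] in its linear form: sqrt(Y) <= (Y / theta + theta 1_A) / 2 pointwise for a
    square sum Y vanishing off [A]. The parameter theta is left free to balance the two terms. *)
Lemma Ex_sqsum_le w N A (X theta : R) : F N A -> 0 < theta ->
  (forall k, (k < N)%N -> essbdd (w k)) ->
  (forall k x, (k < N)%N -> ~ A x -> w k x = 0) ->
  Ex (fun x => \sum_(k < N) w k x ^+ 2) <= X ->
  Ex (fun x => sqsum (w ^~ x) N) <= 2^-1 * (X / theta + theta * Ex (\1_A)).
Proof.
move=> FA t0 bw wA HX.
have bA : essbdd (\1_A : T -> R) by exact/essbdd_indic/(filtration_measurable SB FA).
have b2 : essbdd (fun x => \sum_(k < N) w k x ^+ 2).
  by apply: essbdd_sum => k _; exact/essbddX/bw.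
apply: (@le_trans _ _ (Ex (fun x => 2^-1 * (theta^-1 * (\sum_(k < N) w k x ^+ 2) + theta * \1_A x)))).
  apply: Ex_le.
  - exact/essbdd_L1/essbdd_sqsum.
  - apply: essbdd_L1; apply: essbddZ; apply: essbddD; exact: essbddZ.
  - apply: aeW => x; rewrite /sqsum indicE; case: (boolP (x \in A)) => [_|].
      have := @sqrt_amgm R (theta^-1 * (\sum_(k < N) w k x ^+ 2)) theta.
      rewrite mulrAC mulVf ?gt_eqF// mul1r mulr1; apply; last exact: ltW.
      apply: mulr_ge0; first by rewrite invr_ge0 ltW.
      by apply: sumr_ge0 => k _; exact: sqr_ge0.
    rewrite notin_setE => Ax; rewrite big1; last by move=> k _; rewrite wA// expr0n.
    by rewrite sqrtr0 !mulr0 addr0 mulr0.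
rewrite ExZ; last by apply: essbdd_L1; apply: essbddD; exact: essbddZ.
rewrite ExD; [|exact/essbdd_L1/essbddZ|exact/essbdd_L1/essbddZ].
rewrite !ExZ; [|exact: essbdd_L1..].
rewrite ler_pM2l ?invr_gt0// lerD2r mulrC ler_pM2r ?invr_gt0//.
Qed.

(** The pathwise inequality is integrated; each summand runmax_i (|al_(i+1)| - |al_i|) has
    nonnegative mean since |al| is a submartingale. Indices are shifted by one: al_(k+1) is the
    value at time k. *)
Lemma doob_runmax (al : nat -> T -> R) N : (forall k, measurable_for (F k) (al k.+1)) ->
  (forall x, al 0%N x = 0) -> (forall k, essbdd (al k)) ->
  (forall k, (k.+1 < N)%N -> {ae P, forall x, mart (al k.+2) k x = al k.+1 x}) ->
  Ex (fun x => runmax (al ^~ x) N ^+ 2) <= 4 * Ex (fun x => al N x ^+ 2).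
Proof.
move=> mal al0 bal Hal.
have baln k : essbdd (fun x => `|al k x|) by exact: essbdd_norm.
have mr k : measurable_for (F k) (fun x => runmax (al ^~ x) k.+1).
  elim: k => [|k IH] /=.
    apply: (@measurable_maxr _ (g_sigma_algebraType (F 0))).
      by under eq_fun do rewrite al0; exact: adapted_cst.
    by apply: (@adapted_comp _ _ _ F 0 (@Num.norm _ R)).
  apply: (@measurable_maxr _ (g_sigma_algebraType (F k.+1))).
    exact: (adapted_mono SB (leqnSn k) IH).
  by apply: (@adapted_comp _ _ _ F k.+1 (@Num.norm _ R)).
have br k : essbdd (fun x => runmax (al ^~ x) k).
  elim: k => [|k IH] /=; first exact: baln.
  apply: (@essbdd_le _ _ _ _ _ (fun x => runmax (al ^~ x) k + `|al k.+1 x|)).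
  - apply: measurable_maxr; first exact: essbdd_measurable IH.
    exact: essbdd_measurable (baln k.+1).
  - exact: essbddD.
  - apply: aeW => x; rewrite ger0_norm; last first.
      by rewrite le_max; apply/orP; left; exact: runmax_ge0.
    by rewrite ge_max lerDl lerDr normr_ge0 runmax_ge0.
pose inc i x := runmax (al ^~ x) i * (`|al i.+1 x| - `|al i x|).
have binc i : essbdd (inc i) by apply: essbddM => //; exact: essbddB.
have inc0 i : (i < N)%N -> 0 <= Ex (inc i).
  case: i => [|i] iN.
    by apply: Rintegral_ge0 => x _; rewrite /inc/= al0 normr0 mul0r.
  have l1 : L1 (fun x => runmax (al ^~ x) i.+1 * `|al i.+1 x|).
    by apply: essbdd_L1; exact: essbddM.
  have l2 : L1 (fun x => runmax (al ^~ x) i.+1 * `|al i.+2 x|).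
    by apply: essbdd_L1; exact: essbddM.
  rewrite /inc; under eq_Rintegral do rewrite mulrBr.
  rewrite ExB// subr_ge0.
  have [_ <-] := pull_out SB (mr i) (essbdd_L1 (baln i.+2)) l2.
  apply: Ex_le => //.
    have [] := pull_out SB (mr i) (essbdd_L1 (baln i.+2)) l2; done.
  ae_using (mart_norm SB i (essbdd_L1 (bal i.+2))); ae_using (Hal i iN).
  by ae_intro => x -> h; apply: ler_wpM2l => //; exact: runmax_ge0.
have : Ex (fun x => runmax (al ^~ x) N ^+ 2 + 4 * \sum_(i < N) inc i x) <=
   4 * Ex (fun x => al N x ^+ 2).
  rewrite -ExZ; last exact/essbdd_L1/essbddX.
  apply: Ex_le.
  - apply: essbdd_L1; apply: essbddD; first exact: essbddX.
    by apply: essbddZ; apply: essbdd_sum => i _.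
  - exact/essbdd_L1/essbddZ/essbddX.
  - apply: aeW => x; have := @runmax_doob R (al ^~ x) N.
    by rewrite real_normK ?num_real.
apply: le_trans; rewrite ExD; first last.
- by apply: essbdd_L1; apply: essbddZ; apply: essbdd_sum => i _.
- exact/essbdd_L1/essbddX.
rewrite lerDl ExZ; last by apply: essbdd_L1; apply: essbdd_sum => i _.
rewrite mulr_ge0// Ex_sum; last by move=> i _; exact: essbdd_L1.
by apply: sumr_ge0 => i _; exact: inc0.
Qed.

Section paraproducts.
Context (b : T -> R) (K : R) (K0 : 0 < K) (bK : bmo1 P F K b) (N : nat).

Let c k := prev (mart b) k.
Let dd k := mdiff (mart b) k.
Let bc k : essbdd (c k). Proof. exact: (essbdd_prev_mart SB bK). Qed.
Let bdd k : essbdd (dd k). Proof. exact: (essbdd_bmo_mdiff SB bK). Qed.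
Let jdd k : jump k (dd k). Proof. exact: (jump_bmo_mdiff SB bK). Qed.
Let mc k m : (k <= m.+1)%N -> measurable_for (F m) (c k).
Proof.
case: k => [|k] km; first exact: adapted_cst.
rewrite ltnS in km; apply: (adapted_mono SB km).
exact (@adapted_prev_mart _ _ _ _ _ SB b K bK k).
Qed.
Let lb : L1 b. Proof. exact: bmo1_L1 bK. Qed.
Let mart_c m k : (k < m)%N -> {ae P, forall x, mart (c m) k x = c k.+1 x}.
Proof. by case: m => // m; rewrite ltnS => km; exact: (mart_tower SB km lb). Qed.

(** The differences of h (b_(N-1) - b_k): a jump at time k acts as a multiplier, known from k on, of
    the later differences of b. *)
Definition jump_para k h l x : R := if (k < l)%N then h x * dd l x else 0.

Lemma jump_para_jump k h l : jump k h -> jump l (jump_para k h l).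
Proof.
move=> [mh bh _]; rewrite /jump_para; case: ltnP => kl; last exact: jump0.
case: l kl => // l kl; rewrite ltnS in kl; apply: (jump_mul SB) => //.
exact: (adapted_mono SB kl mh).
Qed.

Lemma sum_jump_para k h x : (k < N)%N ->
  \sum_(l < N) jump_para k h l x = h x * (c N x - c k.+1 x).
Proof.
move=> kN; rewrite -(big_mkord xpredT (fun l => jump_para k h l x)).
rewrite (@big_cat_nat _ _ _ k.+1)//= big_nat_cond big1 ?add0r; last first.
  by move=> l /andP[/andP[_ lk] _]; rewrite /jump_para ltnNge -ltnS lk.
rewrite big_nat_cond (eq_bigr (fun l => h x * dd l x)); last first.
  by move=> l /andP[/andP[kl _] _]; rewrite /jump_para kl.
rewrite -big_nat_cond -mulr_sumr (sum_tail_mdiff P F b x kN)//.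
Qed.

(** The square sum is |h| times the square root of the tail of |d_l b|^2 after k, whose conditional
    mean is at most 18 K^2. The splitting parameter 5K gives (18/5 + 5) K / 2, below 5K. *)
Lemma jump_para_bound k h : (k < N)%N -> jump k h ->
  Ex (fun x => sqsum (jump_para k h ^~ x) N) <= 5 * K * Ex (fun x => `|h x|).
Proof.
move=> kN jh; have [mh bh _] := jh.
have bah := essbdd_norm bh.
pose tl x := \sum_(k.+1 <= l < N) dd l x ^+ 2.
have btl : essbdd tl by apply: essbdd_tail => l _; exact: essbddX.
have jb l : essbdd (jump_para k h l) by have [] := @jump_para_jump k h l jh.
apply: (@le_trans _ _ (Ex (fun x => `|h x| * (2^-1 * ((5 * K)^-1 * tl x + 5 * K))))).
  apply: Ex_le.
  - exact/essbdd_L1/essbdd_sqsum.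
  - apply: essbdd_L1; apply: essbddM => //; apply: essbddZ; apply: essbddD.
      exact: essbddZ.
    exact: essbdd_cst.
  - apply: aeW => x.
    have -> : sqsum (jump_para k h ^~ x) N = `|h x| * Num.sqrt (tl x).
      rewrite /sqsum -sqrtr_sqr -sqrtrM ?sqr_ge0//; congr Num.sqrt.
      rewrite -(big_mkord xpredT (fun l => jump_para k h l x ^+ 2)).
      rewrite (@big_cat_nat _ _ _ k.+1)//= big_nat_cond big1 ?add0r; last first.
        by move=> l /andP[/andP[_ lk] _]; rewrite /jump_para ltnNge -ltnS lk expr0n.
      rewrite big_nat_cond (eq_bigr (fun l => h x ^+ 2 * dd l x ^+ 2)); last first.
        by move=> l /andP[/andP[kl _] _]; rewrite /jump_para kl exprMn.
      by rewrite -big_nat_cond -mulr_sumr.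
    apply: ler_wpM2l => //.
    have K5 : 0 < 5 * K by rewrite mulr_gt0.
    have tl0 : 0 <= tl x by apply: sumr_ge0 => l _; exact: sqr_ge0.
    have := @sqrt_amgm R ((5 * K)^-1 * tl x) (5 * K).
    rewrite mulrAC mulVf ?gt_eqF// mul1r; apply; last exact: ltW.
    by rewrite mulr_ge0// invr_ge0 ltW.
have H : Ex (fun x => `|h x| * tl x) <= Ex (fun x => `|h x| * (18 * K ^+ 2)).
  apply: (@adapted_weight_le _ _ _ _ _ SB k.+1) => //.
  - apply: (@adapted_comp _ _ _ F k.+1 (@Num.norm _ R)) => //.
    exact: (adapted_mono SB (leqnSn k) mh).
  - exact: essbdd_L1.
  - exact: L1_cst.
  - by apply: essbdd_L1; exact: essbddM.
  - by apply: essbdd_L1; apply: essbddM => //; exact: essbdd_cst.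
  - move=> A FA; apply: le_trans (john_nirenberg SB K0 bK kN FA) _.
    rewrite -ExZ; last by apply/integrable_indic/(filtration_measurable SB FA).
    by under [leRHS]eq_Rintegral do rewrite mulrC.
have -> : Ex (fun x => `|h x| * (2^-1 * ((5 * K)^-1 * tl x + 5 * K))) =
   2^-1 * ((5 * K)^-1 * Ex (fun x => `|h x| * tl x) + 5 * K * Ex (fun x => `|h x|)).
  rewrite -!ExZ ?(=^~ ExD); do ?[by apply: essbdd_L1; essbdd_tac].
  rewrite -ExZ; last by apply: essbdd_L1; essbdd_tac.
  by apply: eq_Rintegral => x _; ring.
move: H; under [in leRHS]eq_Rintegral do rewrite mulrC.
rewrite ExZ; last exact: essbdd_L1.
have : 0 <= Ex (fun x => `|h x|) by exact: Rintegral_ge0.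
move: (Ex (fun x => `|h x| * tl x)) (Ex (fun x => `|h x|)) => X Y Y0 XY.
have : (5 * K)^-1 * X <= 18 / 5 * (K * Y).
  rewrite ler_pdivrMl ?mulr_gt0//; apply: le_trans XY _; rewrite expr2; lra.
have : 0 <= K * Y by rewrite mulr_ge0// ltW.
lra.
Qed.

Context (n : nat) (A : set T) (s : R) (a : nat -> T -> R).
Hypothesis Aa : atomic P F N n A s a.

Let ja k : jump k (a k). Proof. by have [] := Aa. Qed.
Let ba k : essbdd (a k). Proof. by have [] := ja k. Qed.
Let a_early k x : (k <= n)%N -> a k x = 0.
Proof. by have [_ _ _ H _] := Aa => kn; apply: H; left. Qed.
Let a_off k x : ~ A x -> a k x = 0.
Proof. by have [_ _ _ H _] := Aa => Ax; apply: H; right. Qed.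
Let s0 : 0 < s. Proof. by have [] := Aa. Qed.
Let FA : F n A. Proof. by have [] := Aa. Qed.
Let bA : essbdd (\1_A : T -> R).
Proof. exact/essbdd_indic/(filtration_measurable SB FA). Qed.

Let sg k := prev (mart (fun y => a k y ^+ 2)) k.
Let bsg k : essbdd (sg k). Proof. by apply/prev_mart_essbdd => //; exact: essbddX. Qed.

(** The atom lives on a set known at time n and starts after n, so its conditional variances vanish
    off [A] as well. *)
Let sg_off k : {ae P, forall x, 0 <= sg k x /\ (\1_A x = 0 :> R -> sg k x = 0)}.
Proof.
rewrite /sg; have b2 := essbddX (ba k).
case: k b2 => [|k] b2 /=; first exact: aeW.
have [kn|nk] := leqP k.+1 n.
  rewrite (_ : (fun y => _) = fun=> 0); last first.
    by apply/funext => y; rewrite a_early// expr0n.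
  by apply: filterS (mart_cst SB 0 k) => x ->.
rewrite ltnS in nk; have FkA := filtration_mono SB nk FA.
have E : (fun y => a k.+1 y ^+ 2) = fun y => \1_A y * a k.+1 y ^+ 2.
  apply/funext => y; rewrite indicE; case: (boolP (y \in A)); rewrite ?mul1r//.
  by rewrite notin_setE => /a_off ->; rewrite expr0n mul0r.
have h := mart_pull SB (adapted_indic SB FkA) (essbdd_L1 b2) (essbdd_L1 (essbddM bA b2)).
ae_using h; ae_using (mart_ge0 SB k (essbdd_L1 b2) (aeW P (fun x => sqr_ge0 (a k.+1 x)))).
by ae_intro => x h0 h1; split => // Ax; rewrite E h1 Ax mul0r.
Qed.

Let sg_sum : {ae P, forall x, \sum_(k < N) sg k x <= s ^+ 2 * \1_A x}.
Proof.
have [_ _ _ _ H] := Aa.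
ae_using H; ae_using (ae_countable (P := P) sg_off); ae_intro => x h1 h2.
rewrite indicE; case: (boolP (x \in A)) => Ax; first by rewrite mulr1.
rewrite mulr0 big1// => k _; have [_] := h1 k; apply.
by rewrite indicE (negbTE Ax).
Qed.

Let weight_sg k (w : T -> R) : (k < N)%N -> measurable_for (F k.-1) w -> essbdd w ->
  Ex (fun x => w x * a k x ^+ 2) = Ex (fun x => w x * sg k x).
Proof.
move=> kN; rewrite /sg; case: k kN => [|k] kN mw bw /=.
  by apply: eq_Rintegral => x _; rewrite a_early// expr0n mulr0.
have b2 := essbddX (ba k.+1).
by have [_ ->] := pull_out SB mw (essbdd_L1 b2) (essbdd_L1 (essbddM bw b2)).
Qed.

Let EA0 : 0 <= Ex (\1_A : T -> R). Proof. exact: Rintegral_ge0. Qed.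

(** The past of b against the differences of the atom, after removal of b_(n-1): a martingale
    transform of [a]. *)
Definition para2 k x : R := (c k x - c n x) * a k x.

Lemma para2_jump k : jump k (para2 k).
Proof.
case: k => [|k].
  rewrite (_ : para2 0 = fun=> 0); first exact: jump0.
  by apply/funext => x; rewrite /para2 a_early// mulr0.
have [kn|nk] := leqP k.+1 n.
  rewrite (_ : para2 k.+1 = fun=> 0); first exact: jump0.
  by apply/funext => x; rewrite /para2 a_early// mulr0.
apply: (jump_mul SB) => //; last exact: essbddB.
by apply: adaptedB; apply: mc => //; exact: ltnW.
Qed.

(** Conditioning at k - 1 replaces |a_k|^2 by its conditional mean [sg k], and (c_k - c_n)^2 by (c_N
    - c_n)^2. The sum of the [sg k] is at most s^2 on [A], which leaves the quadratic John-Nirenberg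
    bound; the choice theta = 5 s K balances 18 s^2 K^2. *)
Lemma para2_bound : Ex (fun x => sqsum (para2 ^~ x) N) <= 5 * s * K * Ex (\1_A).
Proof.
have bcn k : essbdd (fun x => c k x - c n x) by exact: essbddB.
have [Nn|nN] := leqP N n.
  rewrite (_ : (fun x => _) = fun=> 0); last first.
    apply/funext => x; rewrite /sqsum big1 ?sqrtr0// => k _.
    by rewrite /para2 a_early ?mulr0 ?expr0n// ltnW// (leq_trans (ltn_ord k)).
  by rewrite Ex_cst !mulr_ge0// ltW.
have H k : (k < N)%N -> Ex (fun x => para2 k x ^+ 2) <= Ex (fun x => (c N x - c n x) ^+ 2 * sg k x).
  move=> kN.
  have [kn|nk] := leqP k n.
    rewrite (_ : (fun x => para2 k x ^+ 2) = fun=> 0); last first.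
      by apply/funext => x; rewrite /para2 a_early// mulr0 expr0n.
    rewrite Ex_cst; apply: Ex_ge0.
      by apply: essbdd_L1; apply: essbddM => //; exact: essbddX.
    by apply: filterS (sg_off k) => x [h _]; rewrite mulr_ge0// sqr_ge0.
  case: k nk kN => // k nk kN.
  rewrite ltnS in nk.
  have mck : measurable_for (F k) (fun x => (c k.+1 x - c n x) ^+ 2).
    have h : measurable_for (F k) (fun x => c k.+1 x - c n x).
      by apply: adaptedB; apply: mc => //; exact: leqW.
    by under eq_fun do rewrite expr2; exact: adaptedM.
  under eq_Rintegral do rewrite /para2 exprMn.
  rewrite (weight_sg kN mck); last exact: essbddX.
  (* A weight must be nonnegative everywhere, and [sg] is so only almost everywhere. *)
  pose w x := `|sg k.+1 x|.
  have aw : {ae P, forall x, w x = sg k.+1 x}.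
    by apply: filterS (sg_off k.+1) => x [h _]; rewrite /w ger0_norm.
  have bw : essbdd w by exact: essbdd_norm.
  have Ew f : essbdd f -> Ex (fun x => f x * sg k.+1 x) = Ex (fun x => w x * f x).
    move=> bf; have [|||_ ->//] := @Ex_ae _ _ _ P (fun x => w x * f x) (fun x => f x * sg k.+1 x).
    - by apply: essbdd_L1; exact: essbddM.
    - by apply: (@essbdd_measurable _ _ _ P); exact: essbddM.
    - by apply: filterS aw => x ->; rewrite mulrC.
  rewrite !Ew; [|exact: essbddX|exact: essbddX].
  apply: (@adapted_weight_le _ _ _ _ _ SB k).
  - apply: (@adapted_comp _ _ _ F k (@Num.norm _ R)) => //.
    exact: (@prev_mart_adapted _ _ _ _ _ SB k.+1 _ (essbddX (ba k.+1))).
  - by move=> x; exact: normr_ge0.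
  - exact/essbdd_L1/essbddX.
  - exact/essbdd_L1/essbddX.
  - by apply: essbdd_L1; apply: essbddM => //; exact: essbddX.
  - by apply: essbdd_L1; apply: essbddM => //; exact: essbddX.
  - move=> B FB; have b2 := essbddX (bcn N).
    rewrite -[leRHS](mart_set SB (essbdd_L1 b2) FB); apply: Ex_indic_le.
    + exact: (filtration_measurable SB FB).
    + exact/essbdd_L1/essbddX.
    + exact/mart_L1/essbdd_L1.
    + ae_using (mart_sqr SB k (essbdd_L1 (bcn N)) (essbdd_L1 b2)).
      ae_using (martB SB k (essbdd_L1 (bc N)) (essbdd_L1 (bc n))).
      have h1 := mart_id SB (leqnn k) (@mc n k (leqW nk)) (essbdd_L1 (bc n)).
      ae_using h1.
      by ae_using (mart_c (ltnW kN)); ae_intro => x -> -> ->.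
have bp k : essbdd (para2 k) by have [] := para2_jump k.
have F5 : 0 < 5 * s * K by rewrite !mulr_gt0.
have G1 : F N A by exact: (filtration_mono SB (ltnW nN) FA).
have G2 : forall k x, (k < N)%N -> ~ A x -> para2 k x = 0.
  by move=> k x _ Ax; rewrite /para2 a_off ?mulr0.
have G3 : Ex (fun x => \sum_(k < N) para2 k x ^+ 2) <= 18 * s ^+ 2 * K ^+ 2 * Ex (\1_A); last first.
  apply: le_trans (Ex_sqsum_le G1 F5 (fun k _ => bp k) G2 G3) _.
  set Y := Ex (\1_A).
  have -> : 18 * s ^+ 2 * K ^+ 2 * Y / (5 * s * K) = 18 / 5 * (s * K * Y).
    by field; rewrite !gt_eqF.
  have : 0 <= s * K * Y by rewrite !mulr_ge0// ltW.
  lra.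
rewrite Ex_sum; last by move=> k _; exact/essbdd_L1/essbddX.
apply: (@le_trans _ _ (\sum_(k < N) Ex (fun x => (c N x - c n x) ^+ 2 * sg k x))).
  by apply: ler_sum => k _; exact: H.
have bcs k : essbdd (fun x => (c N x - c n x) ^+ 2 * sg k x).
  by apply: essbddM => //; exact: essbddX.
rewrite -Ex_sum; last by move=> k _; exact: essbdd_L1.
apply: (@le_trans _ _ (Ex (fun x => s ^+ 2 * (\1_A x * (c N x - c n x) ^+ 2)))).
  apply: Ex_le.
  + by apply: essbdd_L1; apply: essbdd_sum.
  + by apply: essbdd_L1; apply: essbddZ; apply: essbddM => //; exact: essbddX.
  + apply: filterS sg_sum => x hx; rewrite -mulr_sumr.
      have := ler_wpM2l (sqr_ge0 (c N x - c n x)) hx.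
      by congr (_ <= _); ring.
  rewrite ExZ; last by apply: essbdd_L1; apply: essbddM => //; exact: essbddX.
have := john_nirenberg_prev SB K0 bK (ltnW nN) FA; rewrite -/(c N) -/(c n).
have := sqr_ge0 s; rewrite !expr2; move: (Ex _) (Ex (\1_A)) => X Y; nra.
Qed.

(** [al l] is the atom seen at the time l - 1, so [para1] pairs the strict past of the atom with the
    differences of b: a martingale transform of b. *)
Let al l x := \sum_(k < l) a k x.
Definition para1 l x : R := al l x * dd l x.

Let al_adapted l : measurable_for (F l) (al l.+1).
Proof.
apply: adapted_sum => i _; have il : (i <= l)%N by rewrite -ltnS.
by have [mi _ _] := ja i; exact: (adapted_mono SB il mi).
Qed.

Let bal l : essbdd (al l). Proof. by apply: essbdd_sum. Qed.

Let al0 x : al 0 x = 0. Proof. by rewrite /al big_ord0. Qed.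

Lemma para1_jump l : jump l (para1 l).
Proof.
case: l => [|l].
  rewrite (_ : para1 0 = fun=> 0); first exact: jump0.
  by apply/funext => x; rewrite /para1 al0 mul0r.
by apply: (jump_mul SB) => //; exact (@al_adapted l).
Qed.

(** |al_l|^2 is replaced by the square of the running maximum, a nondecreasing adapted weight, and
    [carleson] gives 18 K^2 times the second moment of the maximum. Doob's factor 4 and the bound
    s^2 P(A) yield 72; theta = 9 s K balances it. *)
Lemma para1_bound : Ex (fun x => sqsum (para1 ^~ x) N) <= 9 * s * K * Ex (\1_A).
Proof.
have [Nn|nN] := leqP N n.
  rewrite (_ : (fun x => _) = fun=> 0); last first.
    apply/funext => x; rewrite /sqsum big1 ?sqrtr0// => l _.
    rewrite /para1 /al big1 ?mul0r ?expr0n// => k _; apply: a_early.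
    by apply: ltnW; rewrite (leq_trans (ltn_ord k))// ltnW// (leq_trans (ltn_ord l)).
  by rewrite Ex_cst !mulr_ge0// ltW.
have bp l : essbdd (para1 l) by apply: essbddM.
have F9 : 0 < 9 * s * K by rewrite !mulr_gt0.
have G1 : F N A by exact: (filtration_mono SB (ltnW nN) FA).
have G2 : forall k x, (k < N)%N -> ~ A x -> para1 k x = 0.
  move=> k x _ Ax; rewrite /para1 /al big1 ?mul0r// => i _; exact: a_off.
have G3 : Ex (fun x => \sum_(k < N) para1 k x ^+ 2) <= 72 * s ^+ 2 * K ^+ 2 * Ex (\1_A); last first.
  apply: le_trans (Ex_sqsum_le G1 F9 (fun k _ => bp k) G2 G3) _.
  set Y := Ex (\1_A).
  have -> : 72 * s ^+ 2 * K ^+ 2 * Y / (9 * s * K) = 8 * (s * K * Y).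
    by field; rewrite !gt_eqF.
  have : 0 <= s * K * Y by rewrite !mulr_ge0// ltW.
  lra.
pose rm l x := runmax (al ^~ x) l.
have mrm l : measurable_for (F l) (rm l).
  elim: l => [|l IH].
    by rewrite /rm /=; under eq_fun do rewrite al0; exact: adapted_cst.
  apply: (@measurable_maxr _ (g_sigma_algebraType (F l.+1))).
    exact: (adapted_mono SB (leqnSn l) IH).
  apply: (adapted_mono SB (leqnSn l)).
  exact: (@adapted_comp _ _ _ F l (@Num.norm _ R)).
have brm l : essbdd (rm l).
  elim: l => [|l IH].
    by rewrite /rm /=; under eq_fun do rewrite al0; exact: essbdd_cst.
  apply: (@essbdd_le _ _ _ _ _ (fun x => rm l x + `|al l.+1 x|)).
  - exact: (adapted_measurable SB (mrm l.+1)).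
  - by apply: essbddD => //; exact: essbdd_norm.
  - apply: aeW => x; rewrite ger0_norm; last exact: runmax_ge0.
    by rewrite /rm /= ge_max lerDl lerDr normr_ge0 runmax_ge0.
have bdd2 l : essbdd (fun x => rm l x ^+ 2 * dd l x ^+ 2) by apply: essbddM; exact: essbddX.
apply: (@le_trans _ _ (Ex (fun x => \sum_(l < N) rm l x ^+ 2 * dd l x ^+ 2))).
  apply: Ex_le.
  - by apply: essbdd_L1; apply: essbdd_sum => l _; exact: essbddX.
  - by apply: essbdd_L1; apply: essbdd_sum.
  - apply: aeW => x; apply: ler_sum => l _; rewrite /para1 exprMn.
    apply: ler_wpM2r; first exact: sqr_ge0.
    rewrite -real_normK ?num_real// ler_pXn2r ?nnegrE//; last exact: runmax_ge0.
    exact: (@runmax_ge R (al ^~ x)).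
have K2 : 0 <= 18 * K ^+ 2 by rewrite mulr_ge0// sqr_ge0.
have car := @carleson _ _ _ _ _ SB dd (fun l x => rm l x ^+ 2) (18 * K ^+ 2) N
  (fun k _ => jdd k) (fun m B mN FB => john_nirenberg SB K0 bK mN FB).
apply: le_trans (car _ _ _ K2) _.
- move=> l; under eq_fun do rewrite expr2; apply: adaptedM; exact (mrm l).
- by move=> l; apply: essbdd_L1; exact: essbddX.
- move=> l x; rewrite sqr_ge0/= ler_pXn2r ?nnegrE//; [exact: runmax_leS|exact: runmax_ge0|exact: runmax_ge0].
have doob : Ex (fun x => rm N x ^+ 2) <= 4 * Ex (fun x => al N x ^+ 2).
  apply: doob_runmax => //.
  move=> k kN; have [_ _ ak0] := ja k.+1.
  have h1 := martD SB k (essbdd_L1 (bal k.+1)) (essbdd_L1 (ba k.+1)).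
  have h2 := mart_id SB (leqnn k) (@al_adapted k) (essbdd_L1 (bal k.+1)).
  ae_using h1; ae_using h2; ae_using ak0; ae_intro => x /= z e1 e2.
  have -> : al k.+2 = fun y => al k.+1 y + a k.+1 y.
    by apply/funext => y; rewrite /al big_ord_recr.
  by rewrite e2 e1 z addr0.
have al2 : Ex (fun x => al N x ^+ 2) <= s ^+ 2 * Ex (\1_A).
  have := @jump_sum_sqr _ _ _ _ _ SB a 0 N setT (filtration_setT SB 0) (fun k _ => ja k).
  rewrite indicT => E.
  have -> : Ex (fun x => al N x ^+ 2) = Ex (fun x => \sum_(k < N) a k x ^+ 2).
    transitivity (Ex (fun x => cst 1 x * (\sum_(0 <= k < N) a k x) ^+ 2)).
      by apply: eq_Rintegral => x _; rewrite /= mul1r big_mkord.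
    by rewrite E; apply: eq_Rintegral => x _; rewrite /= mul1r big_mkord.
  rewrite Ex_sum; last by move=> k _; exact/essbdd_L1/essbddX.
  rewrite (eq_bigr (fun k : 'I_N => Ex (sg k))); last first.
    move=> k _; have := weight_sg (ltn_ord k) (@adapted_cst _ _ _ F k.-1 1) (essbdd_cst P 1).
    under eq_Rintegral do rewrite mul1r.
    by under [in X in _ = X -> _]eq_Rintegral do rewrite mul1r.
  rewrite -Ex_sum; last by move=> k _; exact: essbdd_L1.
  rewrite -ExZ; last exact: essbdd_L1.
  apply: Ex_le => //.
  - by apply: essbdd_L1; exact: essbdd_sum.
  - by apply: essbdd_L1; exact: essbddZ.
have := sqr_ge0 K; move: doob al2; rewrite !expr2.
move: (Ex (fun x => rm N x * rm N x)) (Ex (fun x => al N x * al N x)) (Ex (\1_A)) => X Z Y.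
nra.
Qed.

(** b_(N-1) - d_k b is cut into c_N - c_(k+1), c_k - c_n and c_n. Interchanging the summations in
    the first part turns it into [para1]; the second is [para2]. *)
Lemma paraproduct_identity x :
  \sum_(k < N) a k x * (c N x - dd k x) =
  \sum_(l < N) para1 l x + \sum_(k < N) para2 k x + c n x * \sum_(k < N) a k x.
Proof.
have H M : \sum_(k < M) a k x * (c M x - c k.+1 x) = \sum_(l < M) para1 l x.
  elim: M => [|M IH]; first by rewrite !big_ord0.
  rewrite !big_ord_recr/= -IH /para1 /al subrr mulr0 addr0 mulr_suml -big_split/=.
  apply: eq_bigr => k _; have -> : mart b M x = c M x + dd M x by exact: prev_mdiff.
  ring.
rewrite -H mulr_sumr -!big_split/=; apply: eq_bigr => k _.
have -> : mart b k x = c k x + dd k x by exact: prev_mdiff.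
rewrite /para2; ring.
Qed.

End paraproducts.
End hardy.

(** * Truncation of real numbers *)

Section clip.
Context (R : realType).
Implicit Types (K y z : R).

Definition clip K y := Num.min (Num.max y (- K)) K.

Lemma clip_norm K y : 0 <= K -> `|clip K y| <= K.
Proof.
move=> K0; rewrite ler_norml /clip /Order.min /Order.max.
by case: (ltP y (- K)) => ?; case: ltP => ?; lra.
Qed.

Lemma clip_lip K y z : `|clip K y - clip K z| <= `|y - z|.
Proof.
wlog yz : y z / z <= y => [h|].
  by have [/h//|/ltW/h] := leP z y; rewrite distrC [leRHS]distrC.
rewrite -subr_ge0 in yz; rewrite /clip /Order.min /Order.max.
by rewrite (ger0_norm yz) ler_norml; case: (ltP y (- K)) => ?; case: (ltP z (- K)) => ?; case: ltP => ?; case: ltP => ?; lra.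
Qed.

Lemma clip_diff K y : 0 <= K -> `|y - clip K y| <= `|y|.
Proof.
move=> K0; rewrite /clip /Order.min /Order.max.
have [yz|yz] := leP 0 y.
  by rewrite (ger0_norm yz) ler_norml; case: (ltP y (- K)) => ?; case: ltP => ?; lra.
by rewrite (ltr0_norm yz) ler_norml; case: (ltP y (- K)) => ?; case: ltP => ?; lra.
Qed.

Lemma clip_id K y : `|y| <= K -> clip K y = y.
Proof.
rewrite ler_norml /clip /Order.min /Order.max => /andP[f1 f2].
by case: (ltP y (- K)) => ?; case: ltP => ?; lra.
Qed.

Lemma measurable_clip K : measurable_fun setT (clip K).
Proof.
apply: measurable_minr; last exact: measurable_cst.
by apply: measurable_maxr; [exact: measurable_id|exact: measurable_cst].
Qed.

End clip.

(** * Density and norms *)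

Section density.
Context d (T : measurableType d) (R : realType) (P : probability T R).
Implicit Types (f g h b : T -> R) (A B : set T) (n m k l N M : nat).
Notation L1 f := (P.-integrable setT (EFin \o f)).
Notation Ex f := (Rintegral P setT f).

Lemma Ex_dominated_convergence (f : nat -> T -> R) f0 g : (forall k, measurable_fun setT (f k)) ->
  measurable_fun setT f0 -> L1 g -> (forall k, {ae P, forall x, `|f k x| <= g x}) ->
  {ae P, forall x, f k x @[k --> \oo] --> f0 x} ->
  forall e : R, 0 < e -> exists N, forall k, (N <= k)%N -> Ex (fun x => `|f k x - f0 x|) <= e.
Proof.
move=> mf mf0 lg fg f_f0 e e0.
have := @dominated_convergence _ _ _ P setT measurableT (fun k => EFin \o f k) (EFin \o f0) (EFin \o g).
case.
- by move=> k; apply/measurable_EFinP.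
- exact/measurable_EFinP.
- ae_using f_f0; ae_intro => x h _ /=.
  by apply: cvg_EFin => //; apply: nearW.
- exact: lg.
- ae_using (ae_countable (P := P) fg); ae_intro => x h k _ /=.
  by rewrite lee_fin.
move=> _ + _ => /fine_cvgP [_ /cvgrPdist_le /(_ _ e0) [N _ HN]].
exists N => k Nk; have := HN k Nk; rewrite /= sub0r normrN => h.
by apply: le_trans h; exact: ler_norm.
Qed.

Context (F : (set (set T))^nat) (SB : stochastic_basis P F).
Notation mart := (mart P F).
Notation essbdd := (essbdd P).

Definition approximable f := forall e : R, 0 < e ->
  exists n g, [/\ measurable_for (F n) g, essbdd g & Ex (fun x => `|f x - g x|) <= e].

Lemma approximable_close f : L1 f -> (forall e : R, 0 < e -> exists g,
  [/\ L1 g, approximable g & Ex (fun x => `|f x - g x|) <= e]) -> approximable f.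
Proof.
move=> lf H e e0; have e2 : 0 < e / 2 by rewrite divr_gt0.
have [g [lg /(_ _ e2) [n [h [mh bh hg]]] fg]] := H _ e2.
exists n, h; split => //; have lh := essbdd_L1 bh.
rewrite [leRHS](splitr e); apply: le_trans (lerD fg hg).
rewrite -ExD; try by apply/L1_norm/L1B.
apply: Ex_le; [by apply/L1_norm/L1B|by apply: L1D; apply/L1_norm/L1B|].
by ae_intro => x; rewrite -[f x - h x](subrKA (g x)) ler_normD.
Qed.

Lemma approximableD f g (s : R) : L1 f -> L1 g -> approximable f -> approximable g ->
  approximable (fun x => f x + s * g x).
Proof.
move=> lf lg af ag e e0.
have e2 : 0 < e / 2 by rewrite divr_gt0.
have s1 : 0 < `|s| + 1 by rewrite ltr_wpDl.
have e3 : 0 < e / 2 / (`|s| + 1) by rewrite divr_gt0.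
have [n [f' [mf' bf' ff']]] := af _ e2.
have [m [g' [mg' bg' gg']]] := ag _ e3.
exists (maxn n m), (fun x => f' x + s * g' x); split.
- apply: adaptedD; first exact (adapted_mono SB (leq_maxl _ _) mf').
  apply: adaptedM; [exact: adapted_cst|exact (adapted_mono SB (leq_maxr _ _) mg')].
- by apply: essbddD => //; exact: essbddZ.
- have lf' := essbdd_L1 bf'; have lg' := essbdd_L1 bg'.
  apply: (@le_trans _ _ (Ex (fun x => `|f x - f' x|) + `|s| * Ex (fun x => `|g x - g' x|))).
    rewrite -ExZ; last by apply/L1_norm/L1B.
    rewrite -ExD; [|by apply/L1_norm/L1B|by apply/L1Z/L1_norm/L1B].
    apply: Ex_le; [apply/L1_norm/L1B; apply: L1D => //; exact: L1Z
      |by apply: L1D; [|apply: L1Z]; apply/L1_norm/L1B|].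
    ae_intro => x; rewrite -normrM.
    have -> : f x + s * g x - (f' x + s * g' x) = (f x - f' x) + s * (g x - g' x) by ring.
    exact: ler_normD.
  rewrite [leRHS](splitr e) lerD //.
  apply: le_trans (_ : (`|s| + 1) * (e / 2 / (`|s| + 1)) <= _); last by rewrite mulrC divfK ?gt_eqF.
  by apply: ler_pM => //; [apply: Ex_ge0; [exact/L1_norm/L1B|ae_intro]|rewrite lerDl].
Qed.

Lemma approximable_cst (c : R) : approximable (fun=> c).
Proof.
move=> e e0; exists 0, (fun=> c); split; [exact: adapted_cst|exact: essbdd_cst|].
rewrite (_ : (fun x => _) = fun=> 0) ?Ex_cst ?ltW //.
by apply/funext => x; rewrite subrr normr0.
Qed.

(** A Dynkin system argument: the union of the F_n generates the sigma-algebra and is stable under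
    intersection because the filtration increases; the good sets are closed under complements and
    disjoint unions. *)
Lemma approximable_indic A : measurable A -> approximable (\1_A : T -> R).
Proof.
move=> mA.
have [gen sA] : d.-measurable = <<s \bigcup_n F n >> /\ <<s \bigcup_n F n >> A.
  by have gen := basis_generated SB; rewrite -gen.
have li B : measurable B -> L1 (\1_B : T -> R) by move=> mB; exact/essbdd_L1/essbdd_indic.
move: A sA {mA}; apply: (dynkin_induction gen).
- move=> A B [n _ FA] [m _ FB]; exists (maxn n m) => //.
  have s := basis_sigma_algebra SB (maxn n m).
  have FA' := filtration_mono SB (leq_maxl n m) FA.
  have FB' := filtration_mono SB (leq_maxr n m) FB.
  by apply: (g_measurable s); apply: measurableI; exact: sub_sigma_algebra.
- rewrite indicT; exact: approximable_cst.
- move=> A [n _ FA] e e0; exists n, \1_A; split.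
  + exact (adapted_indic SB FA).
  + exact: essbdd_indic (filtration_measurable SB FA).
  + rewrite (_ : (fun x => _) = fun=> 0) ?Ex_cst ?ltW //.
    by apply/funext => x; rewrite subrr normr0.
- move=> S mS aS.
  have -> : (\1_(~` S) : T -> R) = (fun x => 1 + (-1) * \1_S x).
    by apply/funext => x; rewrite !indicE in_setC; case: (x \in S) => /=; rewrite ?mulr1 ?mulr0 ?subrr ?addr0.
  apply: approximableD => //; [exact: L1_cst|exact: li|exact: approximable_cst].
- move=> B mB tB aB.
  have mU := bigcup_measurable (P := setT) (fun k _ => mB k).
  apply: approximable_close; first exact: li.
  move=> e e0.
  pose f N x : R := \sum_(k < N) \1_(B k) x.
  have lf N : L1 (f N) by apply: L1_sum => k _; exact: li.
  have af N : approximable (f N).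
    elim: N => [|N IH].
      rewrite (_ : f 0 = fun=> 0); first exact: approximable_cst.
      by apply/funext => x; rewrite /f big_ord0.
    rewrite (_ : f N.+1 = fun x => f N x + 1 * \1_(B N) x).
      by apply: approximableD => //; exact: li.
    by apply/funext => x; rewrite /f big_ord_recr /= mul1r.
  (* By disjointness the partial sums of indicators jump at most once from 0 to 1, so they are
     bounded by 1 and eventually constant at every point. *)
  have fE x : (exists2 k, (\bigcup_k B k) x & forall N, f N x = (k < N)%N%:R) \/
      (~ (\bigcup_k B k) x /\ forall N, f N x = 0).
    have [[k _ Bx]|no] := pselect ((\bigcup_k B k) x); [left|right].
      exists k; first by exists k.
      have Bi i : \1_(B i) x = (i == k)%:R :> R.
        rewrite indicE; congr (_%:R); congr nat_of_bool; apply/idP/eqP => [|->]; last exact/mem_set.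
        by move=> /set_mem Bi; apply: contrapT => ik; have /trivIsetP/(_ i k Logic.I Logic.I) := tB;
          move/eqP: ik => ik /(_ ik) => /seteqP [+ _] => /(_ x); apply.
      elim=> [|N IH]; first by rewrite /f big_ord0.
      rewrite /f big_ord_recr /= -/(f N x) IH Bi ltnS.
      by case: (ltngtP k N) => _; rewrite ?addr0 ?add0r.
    split => // N; rewrite /f big1 // => k _; rewrite indicE.
    by case: (boolP (x \in B k)) => // /set_mem Bx; exfalso; apply: no; exists k.
  have := @Ex_dominated_convergence f \1_(\bigcup_k B k) (fun=> 1).
  case/(_ _ _ _ _ _ e e0) => //.
  + by move=> k; exact: L1_measurable (lf k).
  + exact: L1_cst.
  + by move=> k; ae_intro => x; case: (fE x) => [[i _ ->]|[_ ->]]; rewrite ?normr0 ?normr_nat ?lern1 ?leq_b1.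
  + ae_intro => x; rewrite indicE; case: (fE x) => [[i Bx fi]|[nBx fi]].
      rewrite (mem_set Bx); apply: cvg_near_cst; exists i.+1 => // N /= iN.
      by rewrite fi iN.
    rewrite (memNset nBx); by apply: cvg_near_cst; exists 0.
  + move=> N /(_ N (leqnn N)) h; exists (f N); split => //.
    apply: le_trans h; rewrite le_eqVlt; apply/orP; left; apply/eqP; congr (Rintegral P _ _); apply/funext => x.
    by rewrite distrC.
Qed.

Import HBSimple.

Lemma approximable_L1 f : L1 f -> approximable f.
Proof.
move=> lf; apply: approximable_close => // e e0.
have [g [lg _ +]] := approximation_sfun_integrable measurableT lf.
move=> /fine_cvgP [_ /cvgrPdist_le /(_ _ e0) [N _ /(_ N (leqnn N))]].
rewrite /= sub0r normrN => h.
exists (g N : T -> R); split; first exact: lg.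
- have [s gs] : exists s : seq R, (g N : T -> R) = fun x => \sum_(y <- s) y * \1_(g N @^-1` [set y]) x.
    exists (finmap.enum_fset (fset_set (range (g N)))); apply/funext => x; rewrite {1}(fimfunE (g N)).
    by rewrite fsbig_finite.
  rewrite gs; elim: s {gs} => [|y s IH].
    rewrite (_ : (fun x => _) = fun=> 0); first exact: approximable_cst.
    by apply/funext => x; rewrite big_nil.
  have li z : L1 (\1_(g N @^-1` [set z]) : T -> R).
    by apply/essbdd_L1/essbdd_indic.
  rewrite (_ : (fun x => _) = fun x => (\sum_(z <- s) z * \1_(g N @^-1` [set z]) x) + y * \1_(g N @^-1` [set y]) x).
    apply: approximableD => //; last exact: approximable_indic.
    by apply: L1_sum => z _; exact: L1Z.
  by apply/funext => x; rewrite big_cons addrC.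
- by apply: le_trans h; exact: ler_norm.
Qed.

(** If g is known at time N then E_n g = g for n >= N, and conditional expectation contracts L^1;
    the error is at most twice the distance from f to g. *)
Lemma levy f : L1 f -> forall e : R, 0 < e ->
  exists N, forall n, (N <= n)%N -> Ex (fun x => `|f x - mart f n x|) <= e.
Proof.
move=> lf e e0; have e2 : 0 < e / 2 by rewrite divr_gt0.
have [N [g [mg bg fg]]] := approximable_L1 lf e2; have lg := essbdd_L1 bg.
have lfg := L1_norm (L1B lf lg).
exists N => n Nn; have lm := mart_L1 SB lf n; have lfg' := mart_L1 SB lfg n.
apply: le_trans (_ : Ex (fun x => `|f x - g x| + mart (fun y => `|f y - g y|) n x) <= _).
  apply: Ex_le; [by apply/L1_norm/L1B|exact: L1D|].
  ae_using (mart_id SB Nn mg lg); ae_using (martB SB n lf lg); ae_using (mart_norm SB n (L1B lf lg)).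
  ae_intro => x h1 h2 h3; rewrite h2 h3 in h1.
  rewrite -(subrKA (g x) (f x)); apply: le_trans (ler_normD _ _) _.
  by rewrite lerD // distrC.
by rewrite ExD // Ex_mart // [leRHS](splitr e) lerD.
Qed.

Lemma mart_inj f g : L1 f -> L1 g -> (forall n, {ae P, forall x, mart f n x = mart g n x}) ->
  {ae P, forall x, f x = g x}.
Proof.
move=> lf lg fg; have lfg := L1_norm (L1B lf lg).
have : {ae P, forall x, `|f x - g x| = 0}.
  apply: Ex_eq0 => //; first by ae_intro.
  apply/ler_addgt0Pl => e e0; rewrite addr0.
  have [N HN] := levy (L1B lf lg) e0.
  apply: le_trans (HN N (leqnn N)).
  have lm := mart_L1 SB (L1B lf lg) N.
  apply: Ex_le => //; first by apply/L1_norm/L1B => //; exact: L1B.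
  ae_using (martB SB N lf lg); ae_using (fg N); ae_intro => x h1 ->.
  by rewrite h1 subrr subr0.
apply: filterS => x /eqP; rewrite normr_eq0 subr_eq0 => /eqP. exact.
Qed.

Lemma L1_sqr f g : measurable_fun setT f -> measurable_fun setT g ->
  L1 (fun x => f x ^+ 2) -> L1 (fun x => g x ^+ 2) -> L1 (fun x => f x * g x).
Proof.
move=> mf mg lf lg; apply: (@L1_le _ _ _ _ _ (fun x => f x ^+ 2 + g x ^+ 2)).
- exact: measurable_funM.
- exact: L1D.
- by ae_intro => x; have := sqr_ge0 (f x - g x); have := sqr_ge0 (f x + g x);
    rewrite ler_norml => h1 h2; apply/andP; split; nra.
Qed.

Lemma L2_L1 f : measurable_fun setT f -> L1 (fun x => f x ^+ 2) -> L1 f.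
Proof.
move=> mf lf; have := @L1_sqr f (fun=> 1) mf _ lf.
rewrite (_ : (fun x => f x * 1) = f); last by apply/funext => x; rewrite mulr1.
by apply; [exact: measurable_cst|exact: L1_cst].
Qed.

Lemma L2B f g : measurable_fun setT f -> measurable_fun setT g ->
  L1 (fun x => f x ^+ 2) -> L1 (fun x => g x ^+ 2) -> L1 (fun x => (f x - g x) ^+ 2).
Proof.
move=> mf mg lf lg.
have := L1D (L1D lf lg) (L1Z (- 2) (L1_sqr mf mg lf lg)).
by congr (integrable _ _ _); apply/funext => x /=; congr EFin; ring.
Qed.

(** f is truncated at a height K, which costs little in L^2; an L^1 approximation g of f is
    truncated likewise, and the squared L^2 distance of the truncations is at most 2K times the L^1
    distance of f and g. *)
Lemma approximable_L2 f : measurable_fun setT f -> L1 (fun x => f x ^+ 2) -> forall e : R, 0 < e ->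
  exists n g, [/\ measurable_for (F n) g, essbdd g & Ex (fun x => (f x - g x) ^+ 2) <= e].
Proof.
move=> mf lf e e0; have e4 : 0 < e / 4 by rewrite divr_gt0.
pose t (K : nat) (y : R) := clip K%:R y.
have mt K : measurable_fun setT (t K) by exact: measurable_clip.
have tK K y : `|t K y| <= K%:R by exact: clip_norm.
have tl K y z : (t K y - t K z) ^+ 2 <= 2 * K%:R * `|y - z|.
  rewrite -real_normK ?num_real // expr2 ler_pM //; last exact: clip_lip.
  by apply: le_trans (ler_normB _ _) _; rewrite mulr_natl mulr2n lerD.
have mft K : measurable_fun setT (fun x => f x - t K (f x)).
  by apply: measurable_funB => //; apply: (measurableT_comp (mt K)).
have [K] : exists K, Ex (fun x => (f x - t K (f x)) ^+ 2) <= e / 4.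
  have [||||| N /(_ N (leqnn N)) h] :=
    @Ex_dominated_convergence (fun K x => (f x - t K (f x)) ^+ 2) (fun=> 0) (fun x => f x ^+ 2) _ _ _ _ _ _ e4.
  - by move=> K; exact/measurable_funX.
  - exact: measurable_cst.
  - exact: lf.
  - move=> K; ae_intro => x; rewrite ger0_norm ?sqr_ge0 //.
    rewrite -(real_normK (num_real (f x))) -real_normK ?num_real // ler_sqr ?nnegrE //.
    exact: clip_diff.
  - ae_intro => x; apply: cvg_near_cst.
    exists (Num.truncn `|f x|).+1 => // K /= NK.
    have fK : `|f x| <= K%:R.
      apply/ltW/(lt_le_trans (truncnS_gt _)); rewrite ler_nat; exact: NK.
    rewrite /t clip_id //.
    by rewrite subrr expr0n.
  exists N; apply: le_trans h; rewrite le_eqVlt; apply/orP; left; apply/eqP.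
  by congr (Rintegral P _ _); apply/funext => x; rewrite subr0 ger0_norm ?sqr_ge0.
set fK := fun x => t K (f x); move=> HK.
have bfK : essbdd fK.
  split; first exact: (measurableT_comp (mt K)).
  by exists K%:R; ae_intro => x; exact: tK.
have K1 : (0:R) < 2 * K%:R + 1 by rewrite ltr_wpDl.
have [n [g [mg bg fg]]] := approximable_L1 (L2_L1 mf lf) (divr_gt0 e4 K1).
have btg : essbdd (fun x => t K (g x)).
  split; first exact: (measurableT_comp (mt K) (essbdd_measurable bg)).
  by exists K%:R; ae_intro => x; exact: tK.
exists n, (fun x => t K (g x)); split => //.
  exact: (adapted_comp (mt K) mg).
have ltg := essbdd_L1 (essbddX btg); have ltf := essbdd_L1 (essbddX bfK).
have mtg := essbdd_measurable btg; have mtf := essbdd_measurable bfK.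
have lfg := L1_norm (L1B (L2_L1 mf lf) (essbdd_L1 bg)).
apply: le_trans (_ : Ex (fun x => 2 * (f x - fK x) ^+ 2 + 2 * (2 * K%:R * `|f x - g x|)) <= _).
  apply: Ex_le; [exact: L2B|apply: L1D; apply: L1Z; [exact: L2B|exact: L1Z]|].
  by ae_intro => x; have := tl K (f x) (g x); have := sqr_ge0 (f x - fK x - (fK x - t K (g x))); rewrite /fK; nra.
rewrite ExD; [|apply: L1Z; exact: L2B|apply: L1Z; exact: L1Z].
rewrite !ExZ //; [|exact: L1Z|exact: L2B].
have E0 : 0 <= Ex (fun x => `|f x - g x|) by apply: Ex_ge0 => //; ae_intro.
move: fg HK; rewrite ler_pdivlMr //; nra.
Qed.

End density.

(** * The H1 norm: continuity, and density of finite sums of bounded jumps *)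

Section hardy_norm.
Context d (T : measurableType d) (R : realType) (P : probability T R).
Context (F : (set (set T))^nat) (SB : stochastic_basis P F).
Implicit Types (f g h b : T -> R) (A B : set T) (n m k l N M : nat) (u v w : nat -> T -> R).
Notation L1 f := (P.-integrable setT (EFin \o f)).
Notation Ex f := (Rintegral P setT f).
Notation mart := (mart P F).
Notation essbdd := (essbdd P).
Notation prev := (@Defs.prev d T R).
Notation mdiff := (@Defs.mdiff d T R).
Notation jump := (jump P F).
Notation square_fun := (@square_fun d T R).
Notation H1_norm := (H1_norm P).

Lemma sqsum_le_square_fun u x N : ((sqsum (mdiff u ^~ x) N)%:E <= square_fun u x)%E.
Proof.
rewrite /Defs.square_fun.
have -> : ((sqsum (mdiff u ^~ x) N)%:E = (\sum_(0 <= k < N) (`|mdiff u k x| ^+ 2)%:E) `^ 2^-1)%E.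
  rewrite sumEFin poweR_EFin powR12_sqrt big_mkord; last by apply: sumr_ge0 => i _; rewrite exprn_ge0.
  by congr (Num.sqrt _)%:E; apply: eq_bigr => k _; rewrite real_normK ?num_real.
apply: gt0_ler_poweR => //; rewrite ?in_itv /= ?leey ?andbT.
- by apply: sume_ge0 => k _; rewrite lee_fin exprn_ge0.
- by apply: nneseries_ge0 => k _ _; rewrite lee_fin exprn_ge0.
- by apply: nneseries_lim_ge => k _ _; rewrite lee_fin exprn_ge0.
Qed.

Lemma square_fun_le u x (c : \bar R) : (forall N, ((sqsum (mdiff u ^~ x) N)%:E <= c)%E) ->
  (square_fun u x <= c)%E.
Proof.
case: c => [r||] H; [|by rewrite leey|by have := H 0; rewrite leeNy_eq].
have r0 : 0 <= r by have := H 0; rewrite sqsum0.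
rewrite /Defs.square_fun.
have -> : (r%:E = (r ^+ 2)%:E `^ 2^-1)%E.
  by rewrite poweR_EFin powR12_sqrt ?sqr_ge0 // sqrtr_sqr ger0_norm.
apply: gt0_ler_poweR => //; rewrite ?in_itv /= ?leey ?andbT ?lee_fin ?sqr_ge0 //.
  by apply: nneseries_ge0 => k _ _; rewrite lee_fin exprn_ge0.
apply: lime_le; first by apply: is_cvg_nneseries => k _ _; rewrite lee_fin exprn_ge0.
apply: nearW => N; rewrite sumEFin big_mkord lee_fin.
rewrite (eq_bigr (fun k : 'I_N => mdiff u k x ^+ 2)) => [|k _]; last by rewrite real_normK ?num_real.
by rewrite -(sqr_sqsum (mdiff u ^~ x)) ler_sqr ?nnegrE ?sqsum_ge0 // -lee_fin.
Qed.

Lemma L1_sqsum (a : nat -> T -> R) N : (forall k, L1 (a k)) -> L1 (fun x => sqsum (a ^~ x) N).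
Proof.
move=> la; apply: (@L1_le _ _ _ _ _ (fun x => \sum_(k < N) `|a k x|)).
- by apply: measurable_sqsum => k _; exact: L1_measurable (la k).
- by apply: L1_sum => k _; exact: L1_norm.
- by ae_intro => x; rewrite ger0_norm ?sqsum_ge0 // sqsum_sum.
Qed.

Lemma Ex_sqsum_H1 u N : (forall k, L1 (u k)) ->
  ((Ex (fun x => sqsum (mdiff u ^~ x) N))%:E <= H1_norm u)%E.
Proof.
move=> lu; have ld k := L1_mdiff k lu.
rewrite -Ex_EFin; last exact: L1_sqsum.
rewrite H1_normE; apply: ge0_le_integral => //.
- by move=> x _; rewrite lee_fin sqsum_ge0.
- by apply/measurable_EFinP/measurable_sqsum => k _; exact: L1_measurable (ld k).
- by apply: measurable_square_fun => k; exact: L1_measurable (lu k).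
- by move=> x _; exact: sqsum_le_square_fun.
Qed.

Lemma H1_norm_le u (c : R) : (forall k, L1 (u k)) ->
  (forall N, Ex (fun x => sqsum (mdiff u ^~ x) N) <= c) -> (H1_norm u <= c%:E)%E.
Proof.
move=> lu H; have ld k := L1_mdiff k lu.
pose g N x := (sqsum (mdiff u ^~ x) N)%:E.
have g0 N x : (0 <= g N x)%E by rewrite lee_fin sqsum_ge0.
have mg N : measurable_fun setT (g N).
  by apply/measurable_EFinP/measurable_sqsum => k _; exact: L1_measurable (ld k).
have ndg x : {homo g ^~ x : n m / (n <= m)%N >-> (n <= m)%E}.
  by move=> n m nm; rewrite lee_fin sqsum_le.
have cvg_g x : cvgn (g ^~ x) by exact: ereal_nondecreasing_is_cvgn.
rewrite H1_normE; apply: (@le_trans _ _ (\int[P]_x limn (g ^~ x))%E).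
  apply: ge0_le_integral => //.
  - by move=> x _; exact: square_fun_ge0.
  - by apply: measurable_square_fun => k; exact: L1_measurable (lu k).
  - exact: emeasurable_fun_cvg (fun x _ => cvg_g x).
  - by move=> x _; apply: square_fun_le => N; apply: lime_ge => //; exists N => // m /= Nm; exact: ndg.
rewrite monotone_convergence //.
apply: lime_le.
  apply: ereal_nondecreasing_is_cvgn => n m nm; apply: ge0_le_integral => // x _; exact: ndg.
apply: nearW => N; rewrite /g Ex_EFin ?lee_fin //; exact: L1_sqsum.
Qed.

(** The inequality (x + y)^2 <= 2 x^2 + 2 y^2 in each term takes the place of Minkowski's
    inequality; the loss of a factor 2 only affects constants. *)
Lemma sqsum_lin (a b c : nat -> R) (s t : R) N : 0 <= s -> 0 <= t ->
  (forall k, (k < N)%N -> `|c k| <= s * `|a k| + t * `|b k|) ->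
  sqsum c N <= 2 * s * sqsum a N + 2 * t * sqsum b N.
Proof.
move=> s0 t0 H; have sa := sqsum_ge0 a N; have sb := sqsum_ge0 b N.
rewrite -ler_sqr ?nnegrE ?sqsum_ge0 ?addr_ge0 ?mulr_ge0 //.
apply: (@le_trans _ _ (2 * s ^+ 2 * sqsum a N ^+ 2 + 2 * t ^+ 2 * sqsum b N ^+ 2)); last first.
  have := mulr_ge0 (mulr_ge0 s0 sa) (mulr_ge0 t0 sb).
  by have := sqr_ge0 (s * sqsum a N); have := sqr_ge0 (t * sqsum b N); nra.
rewrite !sqr_sqsum !mulr_sumr -big_split /=; apply: ler_sum => k _.
have := H k (ltn_ord k) => {}H.
rewrite -(real_normK (num_real (c k))) -(real_normK (num_real (a k))) -(real_normK (num_real (b k))).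
apply: (@le_trans _ _ ((s * `|a k| + t * `|b k|) ^+ 2)); first by rewrite ler_sqr ?nnegrE ?addr_ge0 ?mulr_ge0.
by have := sqr_ge0 (s * `|a k| - t * `|b k|); nra.
Qed.

Lemma H1_norm_lin u v w (s t cu cv : R) : (forall k, L1 (u k)) -> (forall k, L1 (v k)) ->
  (forall k, L1 (w k)) -> 0 <= s -> 0 <= t ->
  (forall k, {ae P, forall x, `|mdiff w k x| <= s * `|mdiff u k x| + t * `|mdiff v k x|}) ->
  (H1_norm u <= cu%:E)%E -> (H1_norm v <= cv%:E)%E ->
  (H1_norm w <= (2 * s * cu + 2 * t * cv)%:E)%E.
Proof.
move=> lu lv lw s0 t0 H Hu Hv.
have ldu k := L1_mdiff k lu; have ldv k := L1_mdiff k lv; have ldw k := L1_mdiff k lw.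
apply: H1_norm_le => // N.
have hu : Ex (fun x => sqsum (mdiff u ^~ x) N) <= cu.
  by rewrite -lee_fin; apply: le_trans Hu; exact: Ex_sqsum_H1.
have hv : Ex (fun x => sqsum (mdiff v ^~ x) N) <= cv.
  by rewrite -lee_fin; apply: le_trans Hv; exact: Ex_sqsum_H1.
apply: (@le_trans _ _ (Ex (fun x => 2 * s * sqsum (mdiff u ^~ x) N + 2 * t * sqsum (mdiff v ^~ x) N))).
  apply: Ex_le; [exact: L1_sqsum|by apply: L1D; apply: L1Z; exact: L1_sqsum|].
  ae_using (ae_countable (P := P) H); ae_intro => x Hx.
  by apply: sqsum_lin => // k _; exact: Hx.
rewrite ExD; try by apply: L1Z; exact: L1_sqsum.
by rewrite !ExZ; try exact: L1_sqsum; rewrite lerD // ler_wpM2l ?mulr_ge0.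
Qed.

Lemma ae_mdiff u v k : (forall k, {ae P, forall x, u k x = v k x}) ->
  {ae P, forall x, mdiff u k x = mdiff v k x}.
Proof.
move=> uv; rewrite /Defs.mdiff; case: k => [|k] /=.
  by ae_using (uv 0); ae_intro => x ->.
by ae_using (uv k.+1); ae_using (uv k); ae_intro => x -> ->.
Qed.

Lemma ae_L1 f g : L1 f -> measurable_fun setT g -> {ae P, forall x, f x = g x} -> L1 g.
Proof. by move=> lf mg fg; have [] := Ex_ae lf mg fg. Qed.

Lemma martingale_L1 u : is_martingale P F u -> forall k, L1 (u k).
Proof. by move=> mu k; have [_ /LfunL1] := mu k. Qed.

Lemma martingale_lin u v (s t : R) : is_martingale P F u -> is_martingale P F v ->
  is_martingale P F (fun n x => s * u n x + t * v n x).
Proof.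
move=> mu mv n; have [au /LfunL1 lu hu] := mu n; have [av /LfunL1 lv hv] := mv n.
split.
- by apply: adaptedD; apply: adaptedM => //; exact: adapted_cst.
- by apply/LfunL1; apply: L1D; exact: L1Z.
- ae_using (mart_lin SB s t n (martingale_L1 mu n.+1) (martingale_L1 mv n.+1)).
  by ae_using hu; ae_using hv; ae_intro => x -> -> ->.
Qed.

Lemma martingale_mdiff u k : is_martingale P F u ->
  {ae P, forall x, prev (mart (mdiff u k)) k x = 0}.
Proof.
move=> mu; case: k => [|k] /=; first by ae_intro.
have [ak _ h] := mu k; have lk := martingale_L1 mu k.
ae_using (martB SB k (martingale_L1 mu k.+1) lk).
ae_using (mart_id SB (leqnn k) ak lk).
ae_using h; ae_intro => x h1 h2 h3.
by rewrite /Defs.mdiff /= in h3 *; rewrite h3 h2 -h1 subrr.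
Qed.

Lemma Ex_mart_sqr f n : measurable_fun setT f -> L1 (fun x => f x ^+ 2) ->
  L1 (fun x => mart f n x ^+ 2) /\ Ex (fun x => mart f n x ^+ 2) <= Ex (fun x => f x ^+ 2).
Proof.
move=> mf lf2; have lf := L2_L1 mf lf2; have lm := mart_L1 SB lf n; have lm2 := mart_L1 SB lf2 n.
have lmm : L1 (fun x => mart f n x ^+ 2).
  apply: L1_le lm2 _; first by apply: measurable_funX; exact: L1_measurable lm.
  by ae_using (mart_sqr SB n lf lf2); ae_intro => x; rewrite ger0_norm ?sqr_ge0.
by split => //; rewrite -(Ex_mart SB n lf2); apply: Ex_le => //; exact: mart_sqr.
Qed.

Lemma Ex_mart_diff f n m : (n <= m)%N -> measurable_fun setT f -> L1 (fun x => f x ^+ 2) ->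
  Ex (fun x => (mart f m x - mart f n x) ^+ 2) =
  Ex (fun x => mart f m x ^+ 2) - Ex (fun x => mart f n x ^+ 2).
Proof.
move=> nm mf lf2; have lf := L2_L1 mf lf2.
have [lm2 _] := Ex_mart_sqr m mf lf2; have [ln2 _] := Ex_mart_sqr n mf lf2.
have mm := mart_measurable SB lf m; have mn := mart_measurable SB lf n.
have lnm := L1_sqr mn mm ln2 lm2.
have [lp ep] := pull_out SB (mart_adapted SB lf n) (mart_L1 SB lf m) lnm.
have e : Ex (fun x => mart f n x * mart f m x) = Ex (fun x => mart f n x ^+ 2).
  rewrite -ep; symmetry; apply: (proj2 (Ex_ae _ _ _)) => //.
    by apply: measurable_funX.
  by ae_using (mart_tower SB nm lf); ae_intro => x ->; rewrite expr2.
rewrite (_ : (fun x => _) = fun x => (mart f m x ^+ 2 + mart f n x ^+ 2) - 2 * (mart f n x * mart f m x)).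
  by rewrite ExB ?ExD ?ExZ //; [rewrite e; ring|exact: L1D|exact: L1Z].
by apply/funext => x; ring.
Qed.

Lemma Ex_sum_mdiff_sqr f N : measurable_fun setT f -> L1 (fun x => f x ^+ 2) ->
  (forall k, L1 (fun x => mdiff (mart f) k x ^+ 2)) /\
  Ex (fun x => \sum_(k < N) mdiff (mart f) k x ^+ 2) <= Ex (fun x => f x ^+ 2).
Proof.
move=> mf lf2; have lf := L2_L1 mf lf2; have mm k := mart_measurable SB lf k.
have lm k : L1 (fun x => mart f k x ^+ 2) by have [] := Ex_mart_sqr k mf lf2.
have lp k : L1 (fun x => prev (mart f) k x ^+ 2).
  by case: k => [|k] //=; rewrite (_ : (fun x => _) = fun=> 0 ^+ 2); [exact: L1_cst|].
have ld k : L1 (fun x => mdiff (mart f) k x ^+ 2).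
  by apply: L2B => //; case: k => [|k] //=; exact: measurable_cst.
split => //; rewrite Ex_sum //.
have E k : Ex (fun x => mdiff (mart f) k x ^+ 2) =
    Ex (fun x => mart f k x ^+ 2) - Ex (fun x => prev (mart f) k x ^+ 2).
  case: k => [|k] /=; last exact: Ex_mart_diff.
  rewrite [X in _ - X](_ : _ = 0); last first.
    by rewrite (_ : (fun x => _) = fun=> 0) ?Ex_cst //; apply/funext => x /=; rewrite expr0n.
  by rewrite subr0; congr (Rintegral P _ _); apply/funext => x; rewrite /Defs.mdiff /= subr0.
have -> : \sum_(k < N) Ex (fun x => mdiff (mart f) k x ^+ 2) = Ex (fun x => prev (mart f) N x ^+ 2).
  elim: N => [|N IH].
    rewrite big_ord0 (_ : (fun x => _) = fun=> 0) ?Ex_cst //; apply/funext => x /=; by rewrite expr0n.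
  by rewrite big_ord_recr /= IH E /= addrC subrK.
case: N => [|N] /=; last by have [] := Ex_mart_sqr N mf lf2.
rewrite (_ : (fun x => _) = fun=> 0); last by apply/funext => x /=; rewrite expr0n.
by rewrite Ex_cst; apply: Ex_ge0 => //; ae_intro => x; exact: sqr_ge0.
Qed.

(** S <= S^2 / (2 e) + e / 2 replaces Cauchy-Schwarz, and the second moments of the differences add
    up to at most that of f by orthogonality. *)
Lemma H1_norm_L2 f (e : R) : 0 < e -> measurable_fun setT f -> L1 (fun x => f x ^+ 2) ->
  Ex (fun x => f x ^+ 2) <= e ^+ 2 -> (H1_norm (mart f) <= e%:E)%E.
Proof.
move=> e0 mf lf2 fe; have lf := L2_L1 mf lf2.
have lm k := mart_L1 SB lf k.
apply: H1_norm_le => // N.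
have [ld dN] := Ex_sum_mdiff_sqr N mf lf2.
have ls : L1 (fun x => \sum_(k < N) mdiff (mart f) k x ^+ 2) by apply: L1_sum.
apply: (@le_trans _ _ (Ex (fun x => (2 * e)^-1 * \sum_(k < N) mdiff (mart f) k x ^+ 2 + e / 2))).
  apply: Ex_le; [by apply: L1_sqsum => k; exact: L1_mdiff|by apply: L1D; [exact: L1Z|exact: L1_cst]|].
  ae_intro => x; rewrite -(sqr_sqsum (mdiff (mart f) ^~ x)).
  set S := sqsum _ _; have := sqr_ge0 (S - e) => h.
  rewrite -subr_ge0 (_ : _ - _ = (S - e) ^+ 2 / (2 * e)); last by field; rewrite gt_eqF.
  by rewrite divr_ge0 // mulr_ge0 // ltW.
rewrite (ExD (L1Z _ ls) (L1_cst _ _)) (ExZ _ ls) Ex_cst.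
rewrite mulrC -lerBrDr ler_pdivrMr ?mulr_gt0 //; apply: le_trans dN (le_trans fe _).
by rewrite le_eqVlt; apply/orP; left; apply/eqP; field.
Qed.

(** Truncating g destroys its cancellation, which is restored by subtracting the conditional
    expectation of the truncation. As E_(k-1) g = 0, that correction is, up to sign, the conditional
    expectation of the truncation error, no larger in L^1. *)
Lemma jump_approximation k g : L1 g -> measurable_for (F k) g ->
  {ae P, forall x, prev (mart g) k x = 0} -> forall e : R, 0 < e ->
  exists2 w, jump k w & Ex (fun x => `|w x - g x|) <= e.
Proof.
move=> lg ag g0 e e0; have e2 : 0 < e / 2 by rewrite divr_gt0.
have mg := L1_measurable lg; have lng := L1_norm lg.
pose c (K : nat) x := clip K%:R (g x).
have mc K : measurable_fun setT (c K) by exact: (measurableT_comp (measurable_clip _) mg).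
have [||||| N /(_ N (leqnn N)) h] :=
    @Ex_dominated_convergence _ _ _ P (fun K x => g x - c K x) (fun=> 0) (fun x => `|g x|) _ _ _ _ _ _ e2.
- by move=> K; exact: measurable_funB.
- exact: measurable_cst.
- exact: lng.
- by move=> K; ae_intro => x; exact: clip_diff.
- ae_intro => x; apply: cvg_near_cst.
  exists (Num.truncn `|g x|).+1 => // K /= NK.
  rewrite /c clip_id ?subrr //.
  by apply/ltW/(lt_le_trans (truncnS_gt _)); rewrite ler_nat; exact: NK.
have bc : essbdd (c N).
  by split => //; exists N%:R; ae_intro => x; exact: clip_norm.
have ac : measurable_for (F k) (c N) by exact: (adapted_comp (measurable_clip _) ag).
exists (fun x => c N x - prev (mart (c N)) k x); first exact: jump_center.
have lc := essbdd_L1 bc; have lcg := L1B lg lc.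
have lp : L1 (prev (mart (fun y => g y - c N y)) k).
  by apply: L1_prev => j; exact: mart_L1.
have lpc : L1 (prev (mart (c N)) k) by apply: L1_prev => j; exact: mart_L1.
have hp : Ex (fun x => `|prev (mart (fun y => g y - c N y)) k x|) <= Ex (fun x => `|g x - c N x|).
  case: k {ag g0 ac lpc} lp => [|k] /= lp.
    by under eq_Rintegral do rewrite normr0; rewrite Ex_cst Ex_ge0 //; [exact: L1_norm|ae_intro].
  rewrite -(Ex_mart SB k (L1_norm lcg)); apply: Ex_le; [exact: L1_norm|exact: mart_L1 (L1_norm _) _|].
  exact: mart_norm.
have h' : Ex (fun x => `|g x - c N x|) <= e / 2.
  by apply: le_trans h; rewrite le_eqVlt; apply/orP; left; apply/eqP; congr (Rintegral P _ _); apply/funext => x; rewrite subr0.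
apply: (@le_trans _ _ (Ex (fun x => `|g x - c N x| + `|prev (mart (fun y => g y - c N y)) k x|))).
  apply: Ex_le; [by apply: L1_norm; apply: L1B => //; exact: L1B|by apply: L1D; exact: L1_norm|].
  have hm : {ae P, forall x, prev (mart (fun y => g y - c N y)) k x = prev (mart g) k x - prev (mart (c N)) k x}.
    by case: (k) => [|j] /=; [ae_intro => x; rewrite subrr|exact: martB].
  ae_using hm; ae_using g0; ae_intro => x -> ->; rewrite sub0r normrN.
  have -> : c N x - prev (mart (c N)) k x - g x = - (g x - c N x) - prev (mart (c N)) k x by ring.
  by apply: le_trans (ler_normB _ _) _; rewrite normrN.
by rewrite ExD; [|exact: L1_norm|exact: L1_norm]; rewrite [leRHS](splitr e) lerD // (le_trans hp).
Qed.

Lemma sum_sqr_cat (a : nat -> R) n N M : (n <= N)%N -> (M <= N)%N ->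
  \sum_(k < n) a k ^+ 2 + \sum_(n <= k < M) a k ^+ 2 <= \sum_(k < N) a k ^+ 2.
Proof.
move=> nN MN; have mono m : (m <= N)%N -> \sum_(k < m) a k ^+ 2 <= \sum_(k < N) a k ^+ 2.
  by move=> mN; rewrite -!sqr_sqsum ler_sqr ?nnegrE ?sqsum_ge0 // sqsum_le.
have [nM|Mn] := leqP n M.
  apply: le_trans (mono M MN); rewrite -!(big_mkord xpredT (fun k => a k ^+ 2)).
  by rewrite [leRHS](big_cat_nat (n := n)).
by rewrite [X in _ + X]big_geq ?(ltnW Mn) // addr0; exact: mono.
Qed.

(** The tail square sum is at most sqrt(S^2 - S_n^2), where S is the full square function; this is
    dominated by S and tends to 0 almost surely. *)
Lemma H1_tail u : is_martingale P F u -> (H1_norm u < +oo)%E -> forall e : R, 0 < e ->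
  exists n, forall M, Ex (fun x => Num.sqrt (\sum_(n <= k < M) mdiff u k x ^+ 2)) <= e.
Proof.
move=> mu hu e e0; have lu := martingale_L1 mu; have ld k := L1_mdiff k lu.
have ms : measurable_fun setT (square_fun u).
  by apply: measurable_square_fun => k; exact: L1_measurable (lu k).
have isq : P.-integrable setT (square_fun u).
  apply/integrableP; split => //; move: hu; rewrite H1_normE.
  by under [X in _ -> (X < _)%E]eq_integral do rewrite gee0_abs ?square_fun_ge0 //.
pose S x := fine (square_fun u x).
have lS : L1 S.
  have := integrable_fin_num measurableT isq => hfin; apply/integrableP; split.
    by apply/measurable_EFinP; apply: measurableT_comp => //.
  have /integrableP[_] := isq; apply: le_lt_trans; apply: ge0_le_integral => //.
  - by apply: measurableT_comp => //; apply/measurable_EFinP; exact: measurableT_comp.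
  - exact: measurableT_comp.
  - move=> x _; rewrite /S /=; case: (square_fun u x) => [r| |] //=; by rewrite leey.
have Sfin : {ae P, forall x, square_fun u x = (S x)%:E}.
  have := integrable_ae measurableT isq; apply: filterS => x /(_ Logic.I) h.
  by rewrite /S fineK.
have mq N : measurable_fun setT (fun x => sqsum (mdiff u ^~ x) N).
  by apply: measurable_sqsum => k _; exact: L1_measurable (ld k).
pose f n x := Num.sqrt (S x ^+ 2 - sqsum (mdiff u ^~ x) n ^+ 2).
have mf n : measurable_fun setT (f n).
  apply: (measurableT_comp (continuous_measurable_fun (@sqrt_continuous R))).
  by apply: measurable_funB; apply: measurable_funX => //; exact: L1_measurable lS.
have [||||| N /(_ N (leqnn N)) h] :=
    @Ex_dominated_convergence _ _ _ P f (fun=> 0) S _ _ _ _ _ _ e0 => //.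
- move=> n; ae_using Sfin; ae_intro => x hx.
  have S0 : 0 <= S x by rewrite -lee_fin -hx square_fun_ge0.
  rewrite ger0_norm ?sqrtr_ge0 // -[leRHS](ger0_norm S0) -sqrtr_sqr ler_wsqrtr //.
  by rewrite gerBl sqr_ge0.
- ae_using Sfin; ae_intro => x hx.
  have S0 : 0 <= S x by rewrite -lee_fin -hx square_fun_ge0.
  have le_S n : sqsum (mdiff u ^~ x) n <= S x by rewrite -lee_fin -hx sqsum_le_square_fun.
  have cS : sqsum (mdiff u ^~ x) n @[n --> \oo] --> S x.
    apply/cvgrPdist_le => /= eps eps0.
    have [N HN] : exists N, S x - eps <= sqsum (mdiff u ^~ x) N.
      apply: contrapT => /forallNP no.
      suff : (square_fun u x <= (S x - eps)%:E)%E by rewrite hx lee_fin; lra.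
      by apply: square_fun_le => M; rewrite lee_fin ltW // ltNge; apply/negP/no.
    exists N => // n /= Nn; rewrite ger0_norm ?subr_ge0 //.
    by have := sqsum_le (mdiff u ^~ x) Nn; lra.
  have -> : (0 : R) = Num.sqrt (S x ^+ 2 - S x ^+ 2) by rewrite subrr sqrtr0.
  apply: continuous_cvg; first exact: sqrt_continuous.
  by apply: cvgB; [exact: cvg_cst|by rewrite expr2; under eq_fun do rewrite expr2; exact: cvgM].
exists N => M; apply: le_trans h.
have lf : L1 (f N).
  apply: L1_le lS _ => //; ae_using Sfin; ae_intro => x hx.
  have S0 : 0 <= S x by rewrite -lee_fin -hx square_fun_ge0.
  rewrite ger0_norm ?sqrtr_ge0 // -[leRHS](ger0_norm S0) -sqrtr_sqr ler_wsqrtr //.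
  by rewrite gerBl sqr_ge0.
have ae_le : {ae P, forall x, Num.sqrt (\sum_(N <= k < M) mdiff u k x ^+ 2) <= f N x}.
  ae_using Sfin; ae_intro => x hx; have S0 : 0 <= S x by rewrite -lee_fin -hx square_fun_ge0.
  rewrite ler_wsqrtr // lerBrDr.
  have h : sqsum (mdiff u ^~ x) (maxn N M) <= S x by rewrite -lee_fin -hx sqsum_le_square_fun.
  apply: le_trans (_ : sqsum (mdiff u ^~ x) (maxn N M) ^+ 2 <= _); last by rewrite ler_sqr ?nnegrE ?sqsum_ge0.
  by rewrite !sqr_sqsum addrC sum_sqr_cat ?leq_maxl ?leq_maxr.
have mt : measurable_fun setT (fun x => Num.sqrt (\sum_(N <= k < M) mdiff u k x ^+ 2)).
  apply: (measurableT_comp (continuous_measurable_fun (@sqrt_continuous R))).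
  by apply: measurable_sum => k; apply: measurable_funX; exact: L1_measurable (ld k).
apply: Ex_le.
- apply: L1_le lf _ => //; ae_using ae_le; ae_intro => x.
  by rewrite ger0_norm ?sqrtr_ge0.
- by apply: L1_norm; apply: L1B => //; exact: L1_cst.
- by ae_using ae_le; ae_intro => x; rewrite subr0 ger0_norm ?sqrtr_ge0.
Qed.

(** The martingale is cut where its tail is below e / 2, and each of the N remaining differences is
    replaced by a bounded jump; N errors of size e / 2 / (N + 1) keep the total below e. *)
Lemma H1_density u : H1 P F u -> forall e : R, 0 < e -> exists N v,
  [/\ (forall k, jump k (v k)), (forall k x, (N <= k)%N -> v k x = 0) &
    (H1_norm (fun n x => mart (fun y => \sum_(k < N) v k y) n x - u n x)%R <= e%:E)%E].
Proof.
move=> [mu hu] e e0; have lu := martingale_L1 mu; have ld k := L1_mdiff k lu.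
have e2 : 0 < e / 2 by rewrite divr_gt0.
have [N HN] := H1_tail mu hu e2.
have eN : 0 < e / 2 / N.+1%:R by rewrite divr_gt0.
have H k : exists w : T -> R, jump k w /\ Ex (fun x => `|w x - mdiff u k x|) <= e / 2 / N.+1%:R.
  have amd : measurable_for (F k) (mdiff u k) by apply: (adapted_mdiff SB) => j; have [] := mu j.
  have [w jw hw] := jump_approximation (ld k) amd (martingale_mdiff k mu) eN.
  by exists w.
have [v0 Hv0] := choice H.
pose v k x := if (k < N)%N then v0 k x else 0.
have jv k : jump k (v k).
  rewrite /v; case: ltnP => _; last exact: jump0.
  by have [] := Hv0 k.
exists N, v; split => //; first by move=> k x Nk; rewrite /v ltnNge Nk.
pose phi y := \sum_(k < N) v k y; rewrite -/phi.
have bphi : essbdd phi by apply: essbdd_sum => k _; have [] := jv k.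
have lphi := essbdd_L1 bphi.
set w := fun n x => _; have lw k : L1 (w k) by apply: L1B => //; exact: mart_L1.
have lv k : L1 (v k) by have [_ /essbdd_L1] := jv k.
apply: H1_norm_le => // M.
pose tl x := Num.sqrt (\sum_(N <= k < M) mdiff u k x ^+ 2).
have ltl : L1 tl.
  apply: (@L1_le _ _ _ _ _ (fun x => sqsum (mdiff u ^~ x) M)).
  - apply: (measurableT_comp (continuous_measurable_fun (@sqrt_continuous R))).
    by apply: measurable_sum => k; apply: measurable_funX; exact: L1_measurable (ld k).
  - exact: L1_sqsum.
  - ae_intro => x; rewrite ger0_norm ?sqrtr_ge0 // ler_wsqrtr //.
    apply: le_trans (sum_sqr_cat (mdiff u ^~ x) (leq0n _) (leqnn M)).
    rewrite big_ord0 add0r; have [NM|MN] := leqP N M; last first.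
      by rewrite [leLHS]big_geq ?(ltnW MN) //; apply: sumr_ge0 => k _; exact: sqr_ge0.
    by rewrite [leRHS](big_cat_nat (n := N)) //= lerDr; apply: sumr_ge0 => k _; exact: sqr_ge0.
have lsum : L1 (fun x => \sum_(k < N) `|v k x - mdiff u k x|).
  by apply: L1_sum => k _; apply/L1_norm/L1B.
apply: (@le_trans _ _ (Ex (fun x => \sum_(k < N) `|v k x - mdiff u k x| + tl x))).
  apply: Ex_le; [by apply: L1_sqsum => k; exact: L1_mdiff|exact: L1D|].
  have jv' k : (k < N)%N -> jump k (v k) by [].
  ae_using (ae_countable (P := P) (finite_mdiff SB jv')); ae_intro => x Hx.
  have dw k : mdiff w k x = (if (k < N)%N then v k x else 0) - mdiff u k x.
    rewrite -Hx /w /Defs.mdiff; case: k => [|k] /=; ring.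
  have s0 : 0 <= \sum_(k < N) `|v k x - mdiff u k x| by exact: sumr_ge0.
  rewrite -ler_sqr ?nnegrE ?sqsum_ge0 ?addr_ge0 ?sqrtr_ge0 // sqrrD.
  rewrite sqr_sqsum [X in _ <= _ + X]sqr_sqrtr; last by apply: sumr_ge0 => k _; exact: sqr_ge0.
  have c0 : 0 <= (\sum_(k < N) `|v k x - mdiff u k x|) * tl x *+ 2 by rewrite mulrn_wge0 // mulr_ge0 // sqrtr_ge0.
  have hs : \sum_(k < N) (v k x - mdiff u k x) ^+ 2 <= (\sum_(k < N) `|v k x - mdiff u k x|) ^+ 2.
    have := sqsum_sum (fun k => v k x - mdiff u k x) N.
    by rewrite -ler_sqr ?nnegrE ?sqsum_ge0 // sqr_sqsum.
  have hM : \sum_(k < M) mdiff w k x ^+ 2 <=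
      \sum_(k < N) (v k x - mdiff u k x) ^+ 2 + \sum_(N <= k < M) mdiff u k x ^+ 2.
    rewrite -!(big_mkord xpredT (fun k => mdiff w k x ^+ 2)) -!(big_mkord xpredT (fun k => (v k x - mdiff u k x) ^+ 2)).
    have dN k : (k < N)%N -> mdiff w k x ^+ 2 = (v k x - mdiff u k x) ^+ 2 by move=> kN; rewrite dw kN.
    have [NM|MN] := leqP N M.
      rewrite (big_cat_nat (n := N)) //= lerD //; apply: ler_sum_nat => k /andP[k1 k2]; first by rewrite dN.
      by rewrite dw ltnNge k1 /= sub0r sqrrN.
    rewrite [X in _ <= X + _](big_cat_nat (n := M)) ?(ltnW MN) //= [X in _ <= _ + X]big_geq ?(ltnW MN) // addr0.
    rewrite -[leLHS]addr0 lerD //; last by apply: sumr_ge0 => k _; exact: sqr_ge0.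
    by apply: ler_sum_nat => k /andP[k1 k2]; rewrite dN // (ltn_trans k2).
  by move: hM hs c0; lra.
rewrite ExD // Ex_sum; last by move=> k _; apply/L1_norm/L1B.
rewrite [leRHS](splitr e) lerD ?HN //.
apply: (@le_trans _ _ (\sum_(k < N) e / 2 / N.+1%:R)).
  apply: ler_sum => k _; have [_] := Hv0 k; apply: le_trans; rewrite le_eqVlt; apply/orP; left; apply/eqP.
  by congr (Rintegral P _ _); apply/funext => x; rewrite /v ltn_ord.
rewrite sumr_const card_ord -[leLHS]mulr_natr mulrAC ler_pdivrMr // ler_wpM2l ?(ltW e2) //.
by rewrite ler_nat.
Qed.

End hardy_norm.

(** * Weak and strong L^q bounds *)

Section weak_type.
Context d (T : measurableType d) (R : realType) (P : probability T R).
Implicit Types (f g h b : T -> R) (A B : set T) (n m k l N M : nat) (q c t : R).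
Notation L1 f := (P.-integrable setT (EFin \o f)).
Notation Ex f := (Rintegral P setT f).

(** With q >= 1, z^q <= z (x + y)^(q-1) for z between 0 and x + y. It lets the distribution bounds
    of two functions be added without a further constant. *)
Lemma powR_superadditive q (x y : R) : 1 <= q -> 0 <= x -> 0 <= y ->
  x `^ q + y `^ q <= (x + y) `^ q.
Proof.
move=> q1 x0 y0; have q0 : 0 <= q - 1 by rewrite subr_ge0.
have [xy0|xy0] := eqVneq (x + y) 0.
  have -> : x = 0 by lra.
  have -> : y = 0 by lra.
  by rewrite !addr0 powR0 ?addr0 // gt_eqF // (lt_le_trans _ q1).
have H z : 0 <= z <= x + y -> z `^ q <= z * (x + y) `^ (q - 1).
  move=> /andP[z0 zs].
  rewrite -mulr_powRB1 ?(lt_le_trans _ q1) // ler_wpM2l //.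
  by apply: ge0_ler_powR => //; rewrite nnegrE //; exact: addr_ge0.
apply: le_trans (lerD (H x _) (H y _)) _; try by apply/andP; split; lra.
rewrite -mulrDl -{1}[x + y]powRr1 ?addr_ge0 // -powRD; last by rewrite xy0 implybT.
by have -> : 1 + (q - 1) = q by ring.
Qed.

Lemma cvg_powR q (s : nat -> R) (l : R) : 1 <= q -> (forall i, 0 <= s i) -> 0 <= l ->
  s i @[i --> \oo] --> l -> s i `^ q @[i --> \oo] --> l `^ q.
Proof.
move=> q1 s0 l0 sl; have q0 : 0 < q by exact: lt_le_trans q1.
move: l0; rewrite le_eqVlt => /orP[/eqP l0|l0].
  rewrite -l0 in sl *; rewrite powR0 ?gt_eqF //.
  apply/cvgrPdist_lt => e e0.
  have m0 : 0 < Num.min e 1 by rewrite lt_min e0 ltr01.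
  have /cvgrPdist_lt /(_ _ m0) [N _ HN] := sl; exists N => // i /= Ni.
  have := HN i Ni; rewrite /= !sub0r !normrN (ger0_norm (s0 i)) ger0_norm ?powR_ge0 // lt_min => /andP[h1 h2].
  apply: le_lt_trans h1; have [z|z] := eqVneq (s i) 0; first by rewrite z powR0 // gt_eqF.
  by apply: ge1r_powR => //; rewrite lt_neqAle eq_sym z s0 ltW.
have c : {for l, continuous (@powR R ^~ q)}.
  apply/differentiable_continuous/derivable1_diffP; apply: derivable_powR.
  by rewrite in_itv /= l0.
exact: (continuous_cvg _ c sl).
Qed.

Lemma ae_le_measure A B : measurable A -> measurable B ->
  {ae P, forall x, A x -> B x} -> (P A <= P B)%E.
Proof.
move=> mA mB AB; rewrite -!Ex_indic1 // lee_fin; have li C : measurable C -> L1 (\1_C : T -> R).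
  by move=> mC; exact/essbdd_L1/essbdd_indic.
apply: Ex_le; [exact: li|exact: li|]; ae_using AB; ae_intro => x h; rewrite !indicE.
by case: (boolP (x \in A)) => // /set_mem /h /mem_set ->.
Qed.

(** The quasi-norm of weak L^q is at most c, read as a bound on the distribution function: it passes
    to limits and sums level by level, free of the q-th root and of the supremum. *)
Definition weak_le q f c := forall t, 0 < t ->
  (P [set x | (t < `|f x|)%R] <= ((c / t) `^ q)%:E)%E.

Lemma measurable_level f t : measurable_fun setT f -> measurable [set x | t < `|f x|].
Proof.
move=> mf; have : measurable_fun setT (fun x => `|f x|) by exact: measurableT_comp.
move=> mnf; rewrite -[X in measurable X]setTI.
by have := mnf measurableT _ (measurable_itv `]t, +oo[); congr (measurable (_ `&` _)); apply/seteqP; split => x /=; rewrite in_itv /= andbT.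
Qed.

Lemma weak_normP q f c : 1 <= q -> measurable_fun setT f -> 0 <= c ->
  (weak_norm P q f <= c%:E)%E <-> weak_le q f c.
Proof.
move=> q1 mf c0; have q0 : 0 < q by exact: lt_le_trans q1.
have E t : 0 < t -> (t%:E * P [set x | (t < `|f x|)%R] `^ q^-1 <= c%:E)%E <->
    (P [set x | (t < `|f x|)%R] <= ((c / t) `^ q)%:E)%E.
  move=> t0; have ml := measurable_level t mf.
  have Pf : P [set x | t < `|f x|] = (fine (P [set x | t < `|f x|]))%:E.
    by rewrite fineK // fin_num_measure.
  have P0 : 0 <= fine (P [set x | t < `|f x|]) by exact: fine_ge0.
  rewrite Pf; set a := fine _ in P0 *; rewrite poweR_EFin -EFinM !lee_fin.
  rewrite mulrC -ler_pdivlMr //.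
  have ct0 : 0 <= c / t by rewrite divr_ge0 // ltW.
  split => h.
    have := ge0_ler_powR (ltW q0) _ _ h; rewrite !nnegrE => /(_ (powR_ge0 _ _) ct0).
    by rewrite -powRrM mulVf ?gt_eqF // powRr1.
  have := @ge0_ler_powR _ q^-1 _ _ _ _ _ h; rewrite !nnegrE invr_ge0 => /(_ (ltW q0) P0 (powR_ge0 _ _)).
  by rewrite -powRrM mulfV ?gt_eqF // powRr1.
split => [h t t0|h].
  apply/E => //; apply: le_trans h; apply: ereal_sup_ubound; by exists t.
by apply: ge_ereal_sup => _ [t /= t0 <-]; apply/E => //; exact: h.
Qed.

Lemma weak_le_mono q f c c' : 1 <= q -> 0 <= c <= c' -> weak_le q f c -> weak_le q f c'.
Proof.
move=> q1 /andP[c0 cc] h t t0; apply: le_trans (h t t0) _.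
have q0 : 0 <= q by exact: le_trans q1.
rewrite lee_fin; apply: ge0_ler_powR; rewrite ?nnegrE //.
- by rewrite divr_ge0 // ltW.
- by rewrite divr_ge0 ?(ltW t0) // (le_trans c0).
- by rewrite ler_pM2r ?invr_gt0.
Qed.

(** If |h| > t then |f| or |g| exceeds t / 2; this halving is the factor 2. *)
Lemma weak_le_add q f g h c e : 1 <= q -> 0 <= c -> 0 <= e ->
  measurable_fun setT f -> measurable_fun setT g -> measurable_fun setT h ->
  {ae P, forall x, `|h x| <= `|f x| + `|g x|} ->
  weak_le q f c -> weak_le q g e -> weak_le q h (2 * (c + e)).
Proof.
move=> q1 c0 e0 mf mg mh H hf hg t t0; have t2 : 0 < t / 2 by rewrite divr_gt0.
have mlf := measurable_level (t / 2) mf; have mlg := measurable_level (t / 2) mg.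
apply: (@le_trans _ _ (P ([set x | (t / 2 < `|f x|)%R] `|` [set x | (t / 2 < `|g x|)%R]))).
  apply: ae_le_measure; [exact: measurable_level|exact: measurableU|].
  ae_using H; ae_intro => x hx tx /=.
  have [|fx] := ltP (t / 2) `|f x|; first by left.
  right; rewrite ltNge; apply/negP => gx; move: (le_trans hx (lerD fx gx)).
  by rewrite -splitr leNgt tx.
apply: le_trans (measureU2 _ _ _) _ => //.
apply: le_trans (leeD (hf _ t2) (hg _ t2)) _.
rewrite -EFinD lee_fin; apply: le_trans (powR_superadditive _ _ _) _ => //; try by rewrite divr_ge0 // ltW.
by rewrite le_eqVlt; apply/orP; left; apply/eqP; congr (_ `^ q); field; rewrite gt_eqF.
Qed.

Lemma weak_le_ae q f g c : measurable_fun setT f -> measurable_fun setT g ->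
  {ae P, forall x, `|f x| <= `|g x|} -> weak_le q g c -> weak_le q f c.
Proof.
move=> mf mg H hg t t0; apply: le_trans (hg t t0).
apply: ae_le_measure; [exact: measurable_level|exact: measurable_level|].
by ae_using H; ae_intro => x hx tx; exact: lt_le_trans tx hx.
Qed.

Lemma weak_le_eq0 q f : 1 <= q -> measurable_fun setT f -> weak_le q f 0 ->
  {ae P, forall x, f x = 0}.
Proof.
move=> q1 mf h; have q0 : q != 0 by rewrite gt_eqF // (lt_le_trans _ q1).
have H k : {ae P, forall x, `|f x| <= k.+1%:R^-1}.
  exists [set x | k.+1%:R^-1 < `|f x|]; split => //.
  - exact: measurable_level.
  - by apply/eqP; rewrite eq_le measure_ge0 andbT (le_trans (h k.+1%:R^-1 _)) // mul0r powR0.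
  - by move=> x /= /negP; rewrite -ltNge.
ae_using (ae_countable (P := P) H); ae_intro => x Hx.
apply/eqP; rewrite -normr_le0; apply/ler_addgt0Pr => e e0; rewrite add0r.
have := Hx (Num.truncn e^-1); move/le_trans; apply.
by rewrite invf_ple ?posrE // ltW // truncnS_gt.
Qed.

Lemma weak_le_zero q f : 1 <= q -> measurable_fun setT f ->
  (forall e : R, 0 < e -> weak_le q f e) -> {ae P, forall x, f x = 0}.
Proof.
move=> q1 mf h; apply: (@weak_le_eq0 q) => // t t0; have q0 : q != 0 by rewrite gt_eqF // (lt_le_trans _ q1).
rewrite mul0r powR0 //; apply/lee_addgt0Pr => e e0; rewrite add0e.
(* The value t e^(1/q) is chosen so that the weak bound at the level t is exactly e. *)
have e1 : 0 < t * e `^ q^-1 by rewrite mulr_gt0 // powR_gt0.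
have := h _ e1 t t0; rewrite mulrAC mulfV ?gt_eqF // mul1r -powRrM mulVf // powRr1 //.
exact: ltW.
Qed.

(** Where |f| > t, eventually |X_i| > t. The events that |X_i| > t for all i >= n increase with n,
    and for large n each has probability at most the common bound. *)
Lemma weak_le_fatou q (X : nat -> T -> R) f c : (forall i, measurable_fun setT (X i)) ->
  measurable_fun setT f -> {ae P, forall x, X i x @[i --> \oo] --> f x} ->
  (exists N, forall i, (N <= i)%N -> weak_le q (X i) c) -> weak_le q f c.
Proof.
move=> mX mf Xf [N0 HN0] t t0.
have ml := measurable_level t mf; have mlX i := measurable_level t (mX i).
pose B n := \bigcap_(i in [set i | (n <= i)%N]) [set x | t < `|X i x|].
have mB n : measurable (B n) by apply: bigcap_measurableType.
have B_le n : (N0 <= n)%N -> (P (B n) <= ((c / t) `^ q)%:E)%E.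
  move=> nN; apply: le_trans (HN0 n nN t t0); apply: le_measure; rewrite ?inE //.
  by move=> x; apply => /=.
have ndB : nondecreasing_seq B.
  move=> n m nm; apply/subsetPset => x Bx i /= mi; apply: Bx; exact: leq_trans nm mi.
have mU := bigcup_measurable (P := setT) (fun k _ => mB k).
apply: (@le_trans _ _ (P (\bigcup_n B n))).
  apply: ae_le_measure => //; ae_using Xf; ae_intro => x hx tx.
  have : `|X i x| @[i --> \oo] --> `|f x| by apply: cvg_norm.
  move=> /cvgrPdist_lt /(_ (`|f x| - t)); rewrite subr_gt0 => /(_ tx) [N _ HN].
  exists N => // i /= Ni; have := HN i Ni; rewrite /= ltr_norml => /andP[_]; lra.
have := nondecreasing_cvg_mu mB mU ndB => /(_ _ P) h.
rewrite -(cvg_lim _ h) //; apply: lime_le; first by apply/cvg_ex; exists (P (\bigcup_n B n)).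
by exists N0.
Qed.

Lemma Lnorm_leP q f c : 1 <= q -> 0 <= c -> ('N[P]_(q%:E)[EFin \o f] <= c%:E)%E <->
  (\int[P]_x ((`|f x| `^ q)%:E) <= (c `^ q)%:E)%E.
Proof.
move=> q1 c0; have q0 : 0 < q by exact: lt_le_trans q1.
have i0 : (0 <= \int[P]_x (`|f x| `^ q)%:E)%E by apply: integral_ge0 => x _; rewrite lee_fin powR_ge0.
rewrite unlock /=; split => h.
  have := @gt0_ler_poweR _ q (ltW q0) _ _ _ _ h; rewrite !in_itv /= !leey !andbT poweR_ge0 lee_fin => /(_ isT c0).
  by rewrite -poweRrM mulVf ?gt_eqF // poweRe1 // poweR_EFin.
have := @gt0_ler_poweR _ q^-1 _ _ _ _ _ h; rewrite !in_itv /= !leey !andbT lee_fin invr_ge0 => /(_ (ltW q0) i0 (powR_ge0 _ _)).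
by rewrite -powRrM mulfV ?gt_eqF // powRr1.
Qed.

Lemma weak_le_Lnorm q f c : 1 <= q -> measurable_fun setT f -> 0 <= c ->
  ('N[P]_(q%:E)[EFin \o f] <= c%:E)%E -> weak_le q f c.
Proof.
move=> q1 mf c0 h t t0; have q0 : 0 < q by exact: lt_le_trans q1.
have ml := measurable_level t mf.
have tq0 : 0 < t `^ q by exact: powR_gt0.
have mp : measurable_fun setT (fun x => `|f x| `^ q).
  by apply: (measurableT_comp (measurable_powR _)); exact: measurableT_comp.
have H : ((t `^ q)%:E * P [set x | (t < `|f x|)%R] <= (c `^ q)%:E)%E.
  apply: le_trans (proj1 (Lnorm_leP _ q1 c0) h).
  rewrite -[X in (_ * P X)%E]setIT -integral_indic // -ge0_integralZl //; last 2 first.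
  - by apply/measurable_EFinP; exact: measurable_indic.
  - by rewrite lee_fin ltW.
  apply: ge0_le_integral => //.
  - by move=> x _; rewrite mule_ge0 // lee_fin // ltW.
  - by apply/measurable_EFinP; apply: measurable_funM => //; exact: measurable_indic.
  - exact/measurable_EFinP.
  - move=> x _; rewrite -EFinM lee_fin indicE; case: (boolP (x \in _)) => [/set_mem /= tx|_].
      by rewrite mulr1 ge0_ler_powR ?nnegrE // ltW.
    by rewrite mulr0 powR_ge0.
rewrite powRM ?invr_ge0 ?(ltW t0) //.
have -> : t^-1 `^ q = (t `^ q)^-1 by rewrite -powR_inv1 ?(ltW t0) // powRAC powR_inv1 ?(ltW tq0).
by rewrite EFinM lee_pdivlMr // muleC.
Qed.

(** At the height 2^-i the weak bound is (c 2^-i)^q, at most c 2^-i once this is below 1 because q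
    >= 1; so the exceptional probabilities are summable. The rate 4^-i in weak L^q thus yields
    almost sure convergence. *)
Lemma weak_le_borel_cantelli q (X : nat -> T -> R) c : 1 <= q -> 0 <= c ->
  (forall i, measurable_fun setT (X i)) ->
  (forall i, weak_le q (X i) (c * 4^-1 ^+ i)) ->
  {ae P, forall x, exists N, forall i, (N <= i)%N -> `|X i x| <= 2^-1 ^+ i}.
Proof.
move=> q1 c0 mX H; pose A i := [set x | 2^-1 ^+ i < `|X i x|].
have mA i : measurable (A i) by exact: measurable_level.
have PA i : (P (A i) <= (c * 2^-1 ^+ i)%:E)%E.
  have [c1|c1] := leP (c * 2^-1 ^+ i) 1; last by apply: le_trans (probability_le1 P (mA i)) _; rewrite lee_fin ltW.
  have p0 : (0 : R) < 2^-1 ^+ i by rewrite exprn_gt0 // invr_gt0.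
  apply: le_trans (H i _ p0) _; rewrite lee_fin.
  have -> : c * 4^-1 ^+ i / 2^-1 ^+ i = c * 2^-1 ^+ i.
    rewrite -[RHS](mulfK (lt0r_neq0 p0)); congr (_ / _); rewrite -mulrA -exprMn; congr (_ * _ ^+ i); by field.
  have a0 : 0 <= c * 2^-1 ^+ i by rewrite mulr_ge0 // ltW.
  have [a00|an0] := eqVneq (c * 2^-1 ^+ i) 0; first by rewrite a00 powR0 // gt_eqF // (lt_le_trans _ q1).
  by apply: ge1r_powR => //; rewrite lt_neqAle eq_sym an0 a0.
have S : (\sum_(0 <= i <oo) P (A i) < +oo)%E.
  apply: (@le_lt_trans _ _ (c / (1 - 2^-1))%:E); last exact: ltry.
  apply: lime_le; first exact: is_cvg_nneseries.
  apply: nearW => n; apply: le_trans (_ : (\sum_(0 <= i < n) (c * 2^-1 ^+ i)%:E <= _)%E).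
    by apply: lee_sum => i _.
  rewrite sumEFin lee_fin; apply: le_trans (geometric_le_lim n _ _ _) => //.
  by rewrite ger0_norm ?invr_ge0 // invf_lt1 // ltr1n.
have L0 := lim_sup_set_cvg0 mA S.
exists (lim_sup_set A); split => //.
  by apply: bigcap_measurableType => k _; apply: bigcup_measurable.
move=> x /= h; rewrite /lim_sup_set => n _.
have [i ni Ai] : exists2 i, (n <= i)%N & A i x.
  apply: contrapT => no; apply: h; exists n => i ni; rewrite leNgt; apply/negP => Ai.
  by apply: no; exists i.
by exists i.
Qed.

Lemma ae_of_null_set (Z : set T) : measurable Z -> P Z = 0%E -> {ae P, forall x, ~ Z x}.
Proof. by move=> mZ Z0; exists Z; split => // x /contrapT. Qed.

Lemma Lnorm_fatou q (X : nat -> T -> R) f c : 1 <= q -> 0 <= c ->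
  (forall i, measurable_fun setT (X i)) ->
  measurable_fun setT f -> {ae P, forall x, X i x @[i --> \oo] --> f x} ->
  (exists N, forall i, (N <= i)%N -> ('N[P]_(q%:E)[EFin \o X i] <= c%:E)%E) ->
  ('N[P]_(q%:E)[EFin \o f] <= c%:E)%E.
Proof.
move=> q1 c0 mX mf Xf [N HN]; apply/Lnorm_leP => //.
have mp (g : T -> R) : measurable_fun setT g -> measurable_fun setT (fun x => (`|g x| `^ q)%:E).
  by move=> mg; apply/measurable_EFinP; apply: (measurableT_comp (measurable_powR _)); exact: measurableT_comp.
have [Z [mZ Z0 HZ]] := Xf.
have mC := measurableC mZ.
(* Multiplication by the indicator of a set of full measure makes the convergence hold at every
   point, so that the lower limit is identified everywhere with a measurable function. *)
have indC x : \1_(~` Z) x = 0 :> R \/ (\1_(~` Z) x = 1 :> R /\ X i x @[i --> \oo] --> f x).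
  rewrite indicE; case: (boolP (x \in ~` Z)) => [/set_mem nZ|_]; [right|by left].
  by split => //; apply: contrapT => h; apply: nZ; exact: HZ.
have q0 : 0 < q by exact: lt_le_trans q1.
pose Y i x := \1_(~` Z) x * X i x; pose g x := \1_(~` Z) x * f x.
have mi : measurable_fun setT (\1_(~` Z) : T -> R) by exact: measurable_indic.
have mY i : measurable_fun setT (Y i) by exact: measurable_funM.
have mg : measurable_fun setT g by exact: measurable_funM.
have aeZ : {ae P, forall x, \1_(~` Z) x = 1 :> R}.
  by ae_using (ae_of_null_set mZ Z0); ae_intro => x nZ; rewrite indicE mem_set.
have Yg x : (`|Y i x| `^ q)%:E @[i --> \oo] --> (`|g x| `^ q)%:E.
  apply: cvg_EFin; first exact: nearW.
  have [h|[h hx]] := indC x.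
    rewrite /Y /g h; under eq_fun do rewrite mul0r; rewrite mul0r. exact: cvg_cst.
  rewrite /Y /g h; under eq_fun do rewrite mul1r; rewrite mul1r.
  by apply: cvg_powR => //; exact: cvg_norm.
have -> : (\int[P]_x (`|f x| `^ q)%:E = \int[P]_x limn_einf (fun i => (`|Y i x| `^ q)%:E))%E.
  apply: ae_eq_integral => //; [exact: mp| |].
    rewrite (_ : (fun x => _) = fun x => (`|g x| `^ q)%:E); first exact: mp.
    by apply/funext => x; have [-> _] := cvg_limn_einf_sup (Yg x).
  ae_using aeZ; ae_intro => x hx _; have [-> _] := cvg_limn_einf_sup (Yg x).
  by rewrite /g hx mul1r.
apply: le_trans (fatou P measurableT (fun i => mp _ (mY i)) _) _.
  by move=> i x _; rewrite lee_fin powR_ge0.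
rewrite limn_einf_lim; apply: lime_le; first exact: is_cvg_einfs.
exists N => // n /= Nn; apply: (@le_trans _ _ (\int[P]_x (`|Y n x| `^ q)%:E)%E).
  by apply: ereal_inf_lbound; exists n => /=.
apply: le_trans (proj1 (Lnorm_leP _ q1 c0) (HN n Nn)).
apply: ge0_le_integral => //.
- exact: mp.
- exact: mp.
- move=> x _; rewrite lee_fin ge0_ler_powR ?nnegrE ?(ltW q0) // /Y normrM.
  by have [->|[-> _]] := indC x; rewrite ?normr0 ?normr1 ?mul0r ?mul1r.
Qed.

Lemma measurable_norm_powR q g : measurable_fun setT g ->
  measurable_fun setT (fun x => `|g x| `^ q).
Proof.
by move=> mg; apply: (measurableT_comp (measurable_powR _)); exact: measurableT_comp.
Qed.

Lemma Lnorm_le_ae q f g : 1 <= q -> measurable_fun setT f -> measurable_fun setT g ->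
  {ae P, forall x, `|f x| <= `|g x|} ->
  ('N[P]_(q%:E)[EFin \o f] <= 'N[P]_(q%:E)[EFin \o g])%E.
Proof.
move=> q1 mf mg fg; have q0 : 0 < q by exact: lt_le_trans q1.
have [->|] := eqVneq ('N[P]_(q%:E)[EFin \o g])%E +oo%E; first exact: leey.
rewrite -ltey => gfin; have gf : 'N[P]_(q%:E)[EFin \o g]%E \is a fin_num by rewrite ge0_fin_numE // Lnorm_ge0.
rewrite -(fineK gf); apply/Lnorm_leP => //; first exact/fine_ge0/Lnorm_ge0.
apply: le_trans (_ : (\int[P]_x (`|g x| `^ q)%:E <= _)%E); last first.
  by apply/Lnorm_leP => //; [exact/fine_ge0/Lnorm_ge0|rewrite fineK].
apply: ae_le_integral => //; try exact: measurable_norm_powR.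
by ae_using fg; ae_intro => x h; rewrite ge0_ler_powR ?nnegrE ?(ltW q0).
Qed.

Lemma Lnorm_scale q f (s c : R) : 1 <= q -> measurable_fun setT f -> 0 <= c ->
  ('N[P]_(q%:E)[EFin \o f] <= c%:E)%E ->
  ('N[P]_(q%:E)[EFin \o (fun x => (s * f x)%R)] <= (`|s| * c)%:E)%E.
Proof.
move=> q1 mf c0 h; apply/Lnorm_leP => //; first exact: mulr_ge0.
under eq_integral do rewrite normrM powRM // EFinM.
rewrite ge0_integralZl //; last by apply/measurable_EFinP; exact: measurable_norm_powR.
by rewrite powRM // EFinM lee_wpmul2l ?lee_fin ?powR_ge0 //; apply/Lnorm_leP.
Qed.

Lemma Lnorm_sum q (J : eqType) (s : seq J) (f : J -> T -> R) (c : J -> R) : 1 <= q ->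
  (forall i, measurable_fun setT (f i)) ->
  (forall i, i \in s -> ('N[P]_(q%:E)[EFin \o f i] <= (c i)%:E)%E) ->
  ('N[P]_(q%:E)[EFin \o (fun x => (\sum_(i <- s) f i x)%R)] <= (\sum_(i <- s) c i)%:E)%E.
Proof.
move=> q1 mf; elim: s => [|i s IH] H.
  rewrite big_nil; apply/Lnorm_leP => //.
  under eq_integral do rewrite big_nil normr0.
  have q0 : q != 0 by rewrite gt_eqF // (lt_le_trans _ q1).
  by rewrite powR0 // integral0.
rewrite big_cons EFinD; apply: le_trans (_ : ('N[P]_(q%:E)[EFin \o (f i \+ (fun x => \sum_(j <- s) f j x))%R] <= _)%E).
  by rewrite le_eqVlt; apply/orP; left; apply/eqP; congr Lnorm; apply/funext => x /=; rewrite big_cons.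
apply: le_trans (minkowski_EFin P _ _ q1) _ => //; first exact: measurable_sum.
apply: leeD; first by apply: H; rewrite inE eqxx.
by apply: IH => j js; apply: H; rewrite inE js orbT.
Qed.

Lemma Lnorm1_Ex f : L1 f -> ('N[P]_1[EFin \o f] = (Ex (fun x => `|f x|))%:E)%E.
Proof. by move=> lf; rewrite Lnorm1 -Ex_EFin //; exact: L1_norm. Qed.

End weak_type.

Lemma exp_half_le (R : realType) (e : R) : 0 < e -> exists K : nat, 2^-1 ^+ K <= e.
Proof.
move=> e0; exists (Num.truncn e^-1).+1; rewrite exprVn invf_ple ?posrE ?exprn_gt0 //.
apply/ltW/(lt_le_trans (truncnS_gt _)).
by rewrite -natrX ler_nat ltnW // ltn_expl.
Qed.

(** * Essential suprema of conditional expectations *)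

Section conditional_sup.
Context d (T : measurableType d) (R : realType) (P : probability T R).
Context (G : set (set T)) (sG : sigma_algebra setT G) (GT : G `<=` d.-measurable).
Implicit Types (f g h : T -> R) (A B : set T).

Lemma cond_exp_ge0P h : measurable_fun setT h -> (forall x, 0 <= h x) ->
  is_cond_exp P G (EFin \o h) (cond_exp P G (EFin \o h)).
Proof.
move=> mh h0; have := cond_exp_exists_ge0 P sG GT mh h0.
exact: (@xgetPex _ (cst 0%E) [set g | is_cond_exp P G (EFin \o h) g]).
Qed.

(** The version chosen by [cond_exp] is nonnegative only almost everywhere, and the norm is that of
    |g|. Testing on the sets of [G] where g < 0 and where g > M shows that both are null. *)
Lemma ess_cond_exp_le h (M : R) : measurable_fun setT h -> (forall x, 0 <= h x) -> 0 <= M ->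
  (forall A, G A -> (\int[P]_(x in A) (h x)%:E <= M%:E * P A)%E) ->
  ('N[P]_+oo[cond_exp P G (EFin \o h)] <= M%:E)%E.
Proof.
move=> mh h0 M0 H; have [mg Eg] := cond_exp_ge0P mh h0.
set g := cond_exp _ _ _ in mg Eg *.
have mgT : measurable_fun setT g by exact: measurable_forW mg.
pose N := [set x | (g x < 0)%E]; pose B := [set x | (M%:E < g x)%E].
have GN : G N.
  have -> : N = g @^-1` [set` `]-oo, 0%E[] by apply/seteqP; split => x; rewrite /N /= in_itv.
  by apply: (measurable_for_preimage sG mg); exact: emeasurable_itv.
have GB : G B.
  have -> : B = g @^-1` [set` `]M%:E, +oo[] by apply/seteqP; split => x; rewrite /B /= in_itv /= andbT.
  by apply: (measurable_for_preimage sG mg); exact: emeasurable_itv.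
have mN := GT GN; have mB := GT GB.
have gN : {ae P, forall x, N x -> g x = 0%E}.
  apply/ae_eq_integral_abs => //; first exact: measurable_funTS.
  have gp : (\int[P]_(x in N) (g^\+ x) = 0)%E.
    by rewrite (eq_integral (fun=> 0%E)) ?integral0 // => x /set_mem /= xN; rewrite funeposE; apply/max_idPr/ltW.
  have gn : (\int[P]_(x in N) (g^\- x) = \int[P]_(x in N) `|g x|)%E.
    apply: eq_integral => x /set_mem /= xN; rewrite funenegE lee0_abs ?(ltW xN) //.
    by apply/max_idPl; rewrite oppe_ge0 ltW.
  have : (0 <= \int[P]_(x in N) g x)%E by rewrite Eg //; apply: integral_ge0 => x _; rewrite lee_fin.
  rewrite (integralE P N g) gp gn sub0e oppe_ge0 => h'; apply/eqP; rewrite eq_le h' /=.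
  by apply: integral_ge0.
have gB : {ae P, forall x, B x -> g x = M%:E}.
  have mgM : measurable_fun setT (fun x => g x - M%:E)%E by apply: emeasurable_funB.
  have : {ae P, forall x, B x -> (g x - M%:E = 0)%E}.
    apply/ae_eq_integral_abs => //; first exact: measurable_funTS.
    have PB : P B \is a fin_num by rewrite fin_num_measure.
    have gM0 x : B x -> (0 <= g x - M%:E)%E by move=> xB; rewrite sube_ge0 // ltW.
    rewrite (eq_integral (fun x => g x - M%:E)%E); last by move=> x /set_mem xB; rewrite gee0_abs // gM0.
    apply/eqP; rewrite eq_le integral_ge0 // andbT.
    have E : (\int[P]_(x in B) g x = \int[P]_(x in B) (g x - M%:E) + M%:E * P B)%E.
      rewrite -integral_cst // -ge0_integralD //; last exact: measurable_funTS.
      by apply: eq_integral => x _; rewrite subeK.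
    have := H B GB; rewrite -(Eg B GB) E -[leRHS]add0e leeD2rE //.
    by rewrite fin_numM.
  apply: filterS => x h' /h' gx; rewrite -[g x](@subeK _ _ M%:E) // gx add0e //.
rewrite unlock /= probability_setT lte01; apply/ess_supP.
ae_using gN; ae_using gB; ae_intro => x hB hN /=.
have [gx|gx] := leP 0%E (g x).
  rewrite gee0_abs // leNgt; apply/negP => Mg.
  by move: (Mg); rewrite hB ?ltxx.
by move: (gx); rewrite hN ?ltxx.
Qed.

Lemma ess_cond_exp_bound h (M : R) : measurable_fun setT h -> (forall x, 0 <= h x) ->
  0 <= M -> ('N[P]_+oo[cond_exp P G (EFin \o h)] <= M%:E)%E ->
  forall A, G A -> (\int[P]_(x in A) (h x)%:E <= M%:E * P A)%E.
Proof.
move=> mh h0 M0 H A GA; have [mg Eg] := cond_exp_ge0P mh h0.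
set g := cond_exp _ _ _ in mg Eg H.
have mgT : measurable_fun setT g by exact: measurable_forW mg.
have mA := GT GA.
move: H; rewrite unlock /= probability_setT lte01 => /ess_supP H.
rewrite -(Eg A GA) -integral_cst //.
apply: (@le_trans _ _ (\int[P]_(x in A) `|g x|)%E).
  apply: le_trans (lee_abs _) _.
  apply: le_abse_integral => //; exact: measurable_funTS.
apply: ae_ge0_le_integral => //.
- by apply: measurable_funTS; apply: measurableT_comp.
by ae_using H; ae_intro => x ? _.
Qed.

End conditional_sup.

(** * BMO with an arbitrary exponent *)

Section bmo.
Context d (T : measurableType d) (R : realType) (P : probability T R).
Context (F : (set (set T))^nat) (SB : stochastic_basis P F).
Implicit Types (f g h b c : T -> R) (A B : set T) (n m k l N M : nat) (u v w : nat -> T -> R) (p K : R).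
Notation L1 f := (P.-integrable setT (EFin \o f)).
Notation Ex f := (Rintegral P setT f).
Notation mart := (mart P F).
Notation essbdd := (essbdd P).
Notation prev := (@Defs.prev d T R).

Let FT n : F n `<=` d.-measurable := @basis_sub _ _ _ _ _ SB n.
Let sF n : sigma_algebra setT (F n) := @basis_sigma_algebra _ _ _ _ _ SB n.

Lemma measurable_oscillation p b n : L1 b ->
  measurable_fun setT (fun x => `|b x - prev (mart b) n x| `^ p).
Proof.
move=> lb; apply: measurable_norm_powR; apply: measurable_funB; first exact: L1_measurable lb.
by case: n => [|n] /=; [exact: measurable_cst|exact: mart_measurable].
Qed.

Lemma bmo_moment p b K : 1 <= p -> 0 <= K -> L1 b -> (BMO_norm P F p b <= K%:E)%E ->
  forall n A, F n A ->
  (\int[P]_(x in A) (`|b x - prev (mart b) n x| `^ p)%:E <= (K `^ p)%:E * P A)%E.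
Proof.
move=> p1 K0 lb bK n A FA; have p0 : 0 < p by exact: lt_le_trans p1.
have mo := measurable_oscillation p n lb.
apply: (ess_cond_exp_bound (sF n) (@FT n) mo) => //; first exact: powR_ge0.
have h : ('N[P]_+oo[cond_exp P (F n) (fun x => (`|b x - prev (mart b) n x| `^ p)%:E)] `^ p^-1 <= K%:E)%E.
  by apply: le_trans bK; apply: ereal_sup_ubound; exists n.
have := @gt0_ler_poweR _ p (ltW p0) _ _ _ _ h; rewrite !in_itv /= !leey !andbT poweR_ge0 lee_fin => /(_ isT K0).
by rewrite -poweRrM mulVf ?gt_eqF // poweRe1 ?Lnorm_ge0 // poweR_EFin.
Qed.

Lemma BMO_norm_le p b (M : R) : 1 <= p -> 0 <= M -> L1 b -> (forall n A, F n A ->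
  (\int[P]_(x in A) (`|b x - prev (mart b) n x| `^ p)%:E <= M%:E * P A)%E) ->
  (BMO_norm P F p b <= (M `^ p^-1)%:E)%E.
Proof.
move=> p1 M0 lb H; have p0 : 0 < p by exact: lt_le_trans p1.
apply: ge_ereal_sup => _ [n _ <-].
have mo := measurable_oscillation p n lb.
have := ess_cond_exp_le (sF n) (@FT n) mo (fun x => powR_ge0 _ _) M0 (H n) => h.
have := @gt0_ler_poweR _ p^-1 _ _ _ _ _ h.
by rewrite !in_itv /= !leey !andbT lee_fin invr_ge0 Lnorm_ge0 ?poweR_EFin; apply => //; exact: ltW.
Qed.

(** From y <= K + K (y / K)^p, valid for p >= 1 whether y <= K or not, p-th moments control first
    moments with the constant 2K; the John-Nirenberg estimates then apply for every exponent p. *)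
Lemma bmo1_BMO p b K : 1 <= p -> 0 < K -> L1 b -> (BMO_norm P F p b <= K%:E)%E ->
  bmo1 P F (2 * K) b.
Proof.
move=> p1 K0 lb bK; split => // n A FA; have p0 : 0 < p by exact: lt_le_trans p1.
have mA := FT FA.
have lp : L1 (prev (mart b) n) by apply: L1_prev => k; exact: mart_L1.
have lo := L1_norm (L1B lb lp).
have Kp0 : 0 < K `^ p by exact: powR_gt0.
rewrite -lee_fin -L1_set // EFinM Ex_indic1 //.
have mo := measurable_oscillation p n lb.
have pt (y : R) : 0 <= y -> y <= K + K * (K `^ p)^-1 * y `^ p.
  move=> y0; have [yK|Ky] := leP y K.
    by rewrite -[leLHS]addr0 lerD // !mulr_ge0 ?invr_ge0 ?powR_ge0 // ltW.
  rewrite -[leLHS]add0r lerD ?(ltW K0) //.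
  have yp : y = K * (y / K) by rewrite mulrC divfK // gt_eqF.
  rewrite -{2}(divfK (lt0r_neq0 K0) y) powRM ?divr_ge0 ?(ltW K0) //.
  rewrite [(y / K) `^ p * _]mulrC mulrA divfK ?gt_eqF // {1}yp ler_pM2l //.
  by apply: le1r_powR => //; rewrite ler_pdivlMr // mul1r ltW.
apply: (@le_trans _ _ (\int[P]_(x in A) (K%:E + (K * (K `^ p)^-1)%:E * (`|b x - prev (mart b) n x| `^ p)%:E))%E).
  apply: ge0_le_integral => //.
  - by apply/measurable_EFinP/measurable_funTS; exact: L1_measurable lo.
  - by apply/measurable_EFinP/measurable_funTS; apply: measurable_funD => //; apply: measurable_funM.
  - by move=> x _; rewrite -EFinM -EFinD lee_fin pt.
rewrite ge0_integralD //; last 3 first.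
- by move=> x _; rewrite lee_fin ltW.
- by move=> x _; rewrite mule_ge0 ?lee_fin ?mulr_ge0 ?invr_ge0 ?powR_ge0 ?(ltW K0).
- by apply/measurable_EFinP/measurable_funTS; apply: measurable_funM.
rewrite integral_cst // ge0_integralZl //; last 2 first.
- by apply/measurable_EFinP/measurable_funTS.
- by rewrite lee_fin !mulr_ge0 ?invr_ge0 ?powR_ge0 ?(ltW K0).
have := bmo_moment p1 (ltW K0) lb bK FA => h.
apply: le_trans (leeD2l _ (lee_wpmul2l _ h)) _.
  by rewrite lee_fin !mulr_ge0 ?invr_ge0 ?powR_ge0 ?(ltW K0).
rewrite muleA -EFinM divfK ?gt_eqF // -ge0_muleDl ?lee_fin ?(ltW K0) // -EFinD.
by rewrite (_ : K + K = 2 * K) // mulr_natl mulr2n.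
Qed.

Lemma prev_mart_lin (s t : R) b c n : L1 b -> L1 c ->
  {ae P, forall x, prev (mart (fun y => s * b y + t * c y)) n x =
    s * prev (mart b) n x + t * prev (mart c) n x}.
Proof.
by case: n => [|n] lb lc /=; [ae_intro => x; rewrite !mulr0 addr0|exact: mart_lin].
Qed.

Lemma BMO_norm_ge0 p b : (0 <= BMO_norm P F p b)%E.
Proof.
have h : ('N[P]_+oo[cond_exp P (F 0%N) (fun x => (`|b x - prev (mart b) 0%N x| `^ p)%R%:E)] `^ p^-1 <= BMO_norm P F p b)%E.
  by apply: ereal_sup_ubound; exists 0%N.
exact: le_trans (poweR_ge0 _ _) h.
Qed.

Lemma BMO_norm_fin p b : (BMO_norm P F p b < +oo)%E ->
  exists2 K, 0 <= K & BMO_norm P F p b = K%:E.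
Proof.
by have := BMO_norm_ge0 p b; case: (BMO_norm P F p b) => [r||] // r0 _; exists r.
Qed.

Lemma integral_lin_le A (a e X Y : R) f g h : measurable A -> 0 <= a -> 0 <= e -> 0 <= X -> 0 <= Y ->
  measurable_fun setT f -> measurable_fun setT g -> (forall x, 0 <= f x) -> (forall x, 0 <= g x) ->
  (\int[P]_(x in A) (f x)%:E <= X%:E * P A)%E -> (\int[P]_(x in A) (g x)%:E <= Y%:E * P A)%E ->
  measurable_fun setT h -> (forall x, 0 <= h x) ->
  {ae P, forall x, h x <= a * f x + e * g x} ->
  (\int[P]_(x in A) (h x)%:E <= (a * X + e * Y)%:E * P A)%E.
Proof.
move=> mA a0 e0 X0 Y0 mf mg f0 g0 hf hg mh h0 H.
apply: (@le_trans _ _ (\int[P]_(x in A) (a%:E * (f x)%:E + e%:E * (g x)%:E))%E).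
  apply: ae_ge0_le_integral => //.
  - by move=> x _; rewrite lee_fin.
  - by apply/measurable_EFinP; exact: measurable_funTS.
  - by move=> x _; rewrite -!EFinM -EFinD lee_fin addr_ge0 ?mulr_ge0.
  - by apply/measurable_EFinP/measurable_funTS; apply: measurable_funD; exact: measurable_funM.
  - by ae_using H; ae_intro => x hx _; rewrite -!EFinM -EFinD lee_fin.
have mf' : measurable_fun A (EFin \o f) by apply/measurable_EFinP; exact: measurable_funTS.
have mg' : measurable_fun A (EFin \o g) by apply/measurable_EFinP; exact: measurable_funTS.
rewrite ge0_integralD //; last 4 first.
- by move=> x _; rewrite mule_ge0 ?lee_fin.
- by apply: emeasurable_funM.
- by move=> x _; rewrite mule_ge0 ?lee_fin.
- by apply: emeasurable_funM.
rewrite !ge0_integralZl ?lee_fin //; try by move=> x _; rewrite lee_fin.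
rewrite EFinD ge0_muleDl ?lee_fin ?mulr_ge0 // !EFinM -!muleA.
by apply: leeD; apply: lee_wpmul2l; rewrite ?lee_fin.
Qed.

(** Only finiteness of the norm is at stake, so (u + v)^p <= (2 u)^p + (2 v)^p suffices in place of
    the triangle inequality. *)
Lemma BMO_lin p b c (s t : R) : 1 <= p -> BMO P F p b -> BMO P F p c ->
  BMO P F p (fun x => s * b x + t * c x).
Proof.
move=> p1 [/LfunL1 lb hb] [/LfunL1 lc hc]; have p0 : 0 < p by exact: lt_le_trans p1.
have l : L1 (fun x => s * b x + t * c x) by apply: L1D; exact: L1Z.
split; first exact/LfunL1.
have [Kb Kb0 /eqP] := BMO_norm_fin hb; rewrite eq_le => /andP[HKb _].
have [Kc Kc0 /eqP] := BMO_norm_fin hc; rewrite eq_le => /andP[HKc _].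
pose M := (2 * `|s|) `^ p * Kb `^ p + (2 * `|t|) `^ p * Kc `^ p.
have M0 : 0 <= M by rewrite addr_ge0 // mulr_ge0 // powR_ge0.
apply: le_lt_trans (BMO_norm_le p1 M0 l _) (ltry _) => n A FA.
have mA := FT FA; have mb := measurable_oscillation p n lb; have mc := measurable_oscillation p n lc.
have pt (y z : R) : `|s * y + t * z| `^ p <= (2 * `|s|) `^ p * `|y| `^ p + (2 * `|t|) `^ p * `|z| `^ p.
  rewrite -!powRM ?mulr_ge0 //.
  have H (u v : R) : 0 <= u -> 0 <= v -> (u + v) `^ p <= (2 * u) `^ p + (2 * v) `^ p.
    move=> u0 v0; have [uv|vu] := leP u v.
      rewrite -[leLHS]add0r lerD ?powR_ge0 // ge0_ler_powR ?nnegrE ?addr_ge0 ?mulr_ge0 ?(ltW p0) //; lra.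
    rewrite -[leLHS]addr0 lerD ?powR_ge0 // ge0_ler_powR ?nnegrE ?addr_ge0 ?mulr_ge0 ?(ltW p0) //; lra.
  apply: le_trans (_ : (`|s| * `|y| + `|t| * `|z|) `^ p <= _).
    rewrite ge0_ler_powR ?nnegrE ?addr_ge0 ?mulr_ge0 ?(ltW p0) // -!normrM; exact: ler_normD.
  by rewrite -!mulrA; apply: H; exact: mulr_ge0.
rewrite /M; apply: (integral_lin_le mA (powR_ge0 _ _) (powR_ge0 _ _) (powR_ge0 _ _) (powR_ge0 _ _) mb mc).
- by move=> x; exact: powR_ge0.
- by move=> x; exact: powR_ge0.
- exact: bmo_moment.
- exact: bmo_moment.
- exact: measurable_oscillation.
- by move=> x; exact: powR_ge0.
ae_using (prev_mart_lin s t n lb lc); ae_intro => x ->.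
by rewrite (_ : _ - _ = s * (b x - prev (mart b) n x) + t * (c x - prev (mart c) n x)); [exact: pt|ring].
Qed.

Lemma Ex_le_fatou (f : nat -> T -> R) g (C : R) : (forall n, L1 (fun x => f n x ^+ 2)) ->
  (forall n, measurable_fun setT (f n)) -> measurable_fun setT g ->
  (forall n, Ex (fun x => f n x ^+ 2) <= C ^+ 2) -> 0 <= C ->
  {ae P, forall x, f n x @[n --> \oo] --> g x} -> L1 (fun x => g x ^+ 2) /\ Ex (fun x => g x ^+ 2) <= C ^+ 2.
Proof.
move=> lf mf mg HC C0 fg; have q2 : (1 : R) <= 2 by rewrite ler1n.
have H : ('N[P]_(2%:E)[EFin \o g] <= C%:E)%E.
  apply: (Lnorm_fatou q2 C0 mf mg fg); exists 0%N => n _; apply/Lnorm_leP => //.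
  under eq_integral do rewrite powR_mulrn // real_normK ?num_real //.
  by rewrite powR_mulrn // Ex_EFin // lee_fin.
have := proj1 (Lnorm_leP P g q2 C0) H.
under eq_integral do rewrite powR_mulrn // real_normK ?num_real //.
rewrite powR_mulrn //; apply: integral_le_L1; first exact: measurable_funX.
by move=> x; exact: sqr_ge0.
Qed.

(** L^1 errors of size 4^-i at well-chosen times, and the Borel-Cantelli argument with exponent 1,
    replace the martingale convergence theorem. *)
Lemma levy_ae f : L1 f -> exists N : nat -> nat,
  {ae P, forall x, mart f (N i) x @[i --> \oo] --> f x}.
Proof.
move=> lf; have e4 i : 0 < 4^-1 ^+ i :> R by rewrite exprn_gt0 // invr_gt0.
have [N HN] := choice (fun i => levy SB lf (e4 i)).
exists N; have l i := mart_L1 SB lf (N i).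
have m i : measurable_fun setT (fun x => f x - mart f (N i) x) by exact: L1_measurable (L1B lf (l i)).
have W i : weak_le P 1 (fun x => f x - mart f (N i) x) (1 * 4^-1 ^+ i).
  apply: weak_le_Lnorm (lexx _) (m i) _ _; first by rewrite mul1r ltW.
  rewrite mul1r.
  by rewrite Lnorm1_Ex ?lee_fin; [exact: HN|exact: L1B].
ae_using (weak_le_borel_cantelli (lexx _) ler01 m W); ae_intro => x [n Hn].
apply/cvgrPdist_le => e e0.
have [M HM] := exp_half_le e0.
exists (maxn n M) => // i /=; rewrite geq_max => /andP[ni Ki].
apply: le_trans (Hn i ni) (le_trans _ HM).
by apply: ler_wiXn2l => //; rewrite ?invr_ge0 // invf_le1 // ler1n.
Qed.

(** The quadratic John-Nirenberg bound from time 0 on the whole space gives E b_m^2 <= 18 K^2,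
    rounded up to (5K)^2, uniformly in m; Fatou's lemma passes to b. *)
Lemma bmo1_L2 b K : 0 < K -> bmo1 P F K b -> L1 (fun x => b x ^+ 2).
Proof.
move=> K0 bK; have [lb _] := bK; have [N HN] := levy_ae lb.
have bm n : essbdd (mart b n) := essbdd_prev_mart SB bK n.+1.
have C0 : 0 <= 5 * K by rewrite mulr_ge0 // ltW.
have [] // := Ex_le_fatou (f := fun i => mart b (N i)) (g := b) _ _ _ _ C0 HN.
- by move=> n; apply/essbdd_L1/essbddX.
- by move=> n; exact: essbdd_measurable (bm _).
- exact: L1_measurable lb.
- move=> n; have := john_nirenberg_prev SB K0 bK (leq0n (N n).+1) (filtration_setT SB 0%N).
  rewrite (_ : Ex (\1_setT) = 1); last by rewrite indicT Ex_cst.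
  rewrite (_ : (fun x => _) = fun x => mart b (N n) x ^+ 2); last by apply/funext => x; rewrite indicT mul1r subr0.
  by move/le_trans; apply; rewrite mulr1 exprMn ler_wpM2r ?sqr_ge0 // -natrX ler_nat.
Qed.

End bmo.

(** * The series L(f, b) in L^1 *)

Section product_series.
Context d (T : measurableType d) (R : realType) (P : probability T R).
Context (F : (set (set T))^nat) (SB : stochastic_basis P F).
Implicit Types (f g h b c : T -> R) (A B : set T) (n m k l N M : nat) (u v w : nat -> T -> R) (K : R).
Notation L1 f := (P.-integrable setT (EFin \o f)).
Notation Ex f := (Rintegral P setT f).
Notation mart := (mart P F).
Notation essbdd := (essbdd P).
Notation mdiff := (@Defs.mdiff d T R).
Notation jump := (jump P F).
Notation H1_norm := (H1_norm P).

Definition L1_limit (f : nat -> T -> R) g := forall e : R, 0 < e ->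
  exists N, forall n, (N <= n)%N -> Ex (fun x => `|f n x - g x|) <= e.

Lemma L1_limit_lin (f1 f2 : nat -> T -> R) g1 g2 (s t : R) :
  (forall n, L1 (f1 n)) -> (forall n, L1 (f2 n)) -> L1 g1 -> L1 g2 ->
  L1_limit f1 g1 -> L1_limit f2 g2 ->
  L1_limit (fun n x => s * f1 n x + t * f2 n x) (fun x => s * g1 x + t * g2 x).
Proof.
move=> l1 l2 lg1 lg2 h1 h2 e e0.
pose M := `|s| + `|t| + 1; have M0 : 0 < M by rewrite /M ltr_wpDl // addr_ge0.
have eM : 0 < e / M by rewrite divr_gt0.
have [N1 H1] := h1 _ eM; have [N2 H2] := h2 _ eM.
exists (maxn N1 N2) => n; rewrite geq_max => /andP[n1 n2].
have d1 := L1_norm (L1B (l1 n) lg1); have d2 := L1_norm (L1B (l2 n) lg2).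
apply: (@le_trans _ _ (Ex (fun x => `|s| * `|f1 n x - g1 x| + `|t| * `|f2 n x - g2 x|))).
  apply: Ex_le.
  - by apply/L1_norm/L1B; apply: L1D; exact: L1Z.
  - by apply: L1D; exact: L1Z.
  - ae_intro => x; rewrite -!normrM.
    rewrite (_ : _ - _ = s * (f1 n x - g1 x) + t * (f2 n x - g2 x)); last by ring.
    exact: ler_normD.
rewrite ExD ?ExZ //; [|exact: L1Z|exact: L1Z].
apply: le_trans (_ : `|s| * (e / M) + `|t| * (e / M) <= _).
  by rewrite lerD // ler_wpM2l ?H1 ?H2.
rewrite -mulrDl mulrA ler_pdivrMr // mulrC ler_wpM2l ?(ltW e0) // /M; lra.
Qed.

Lemma L1_limit_unique (f : nat -> T -> R) g h : (forall n, L1 (f n)) -> L1 g -> L1 h ->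
  L1_limit f g -> L1_limit f h -> {ae P, forall x, g x = h x}.
Proof.
move=> lf lg lh fg fh; have lgh := L1_norm (L1B lg lh).
have : {ae P, forall x, `|g x - h x| = 0}.
  apply: Ex_eq0 => //; first by ae_intro.
  apply/ler_addgt0Pl => e e0; rewrite addr0; have e2 : 0 < e / 2 by rewrite divr_gt0.
  have [N1 H1] := fg _ e2; have [N2 H2] := fh _ e2; pose n := maxn N1 N2.
  have d1 := L1_norm (L1B (lf n) lg); have d2 := L1_norm (L1B (lf n) lh).
  rewrite [leRHS](splitr e).
  apply: le_trans (lerD (H1 n (leq_maxl _ _)) (H2 n (leq_maxr _ _))).
  rewrite -ExD //; apply: Ex_le => //; first exact: L1D.
  ae_intro => x; rewrite -[g x - h x](subrKA (f n x)) [`|f n x - g x|]distrC; exact: ler_normD.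
by apply: filterS => x /eqP; rewrite normr_eq0 subr_eq0 => /eqP.
Qed.

Lemma L1_limit_ae (f f' : nat -> T -> R) g : (forall n, L1 (f n)) -> (forall n, L1 (f' n)) -> L1 g ->
  (forall n, {ae P, forall x, f n x = f' n x}) -> L1_limit f g -> L1_limit f' g.
Proof.
move=> lf lf' lg ff' fg e e0; have [N HN] := fg e e0; exists N => n Nn; apply: le_trans (HN n Nn).
apply: Ex_le; [by apply/L1_norm/L1B|by apply/L1_norm/L1B|].
by ae_using (ff' n); ae_intro => x ->.
Qed.

Lemma L1_limit_norm (f : nat -> T -> R) g (C : R) : (forall n, L1 (f n)) -> L1 g -> L1_limit f g ->
  (forall n, Ex (fun x => `|f n x|) <= C) -> Ex (fun x => `|g x|) <= C.
Proof.
move=> lf lg fg HC; apply/ler_addgt0Pr => e e0; have [N HN] := fg e e0.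
have d1 := L1_norm (L1B (lf N) lg).
apply: le_trans (lerD (HC N) (HN N (leqnn N))).
rewrite -ExD //; last exact: L1_norm.
apply: Ex_le; [exact: L1_norm|by apply: L1D => //; exact: L1_norm|].
ae_intro => x; rewrite [`|f N x - _|]distrC addrC -{1}[g x](subrK (f N x)); exact: ler_normD.
Qed.

Lemma L1_series_ge0 (h : nat -> T -> R) (C : R) : (forall k, L1 (h k)) ->
  (forall k x, 0 <= h k x) -> (forall N, \sum_(k < N) Ex (h k) <= C) ->
  exists2 g, L1 g & L1_limit (fun n x => \sum_(k < n) h k x) g.
Proof.
move=> lh h0 HC; pose G x := (\sum_(0 <= k <oo) (h k x)%:E)%E.
have mh k := L1_measurable (lh k).
have G0 x : (0 <= G x)%E by apply: nneseries_ge0 => k _ _; rewrite lee_fin.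
have mG : measurable_fun setT G.
  by apply: ge0_emeasurable_sum => // [k x _ _|k _]; [rewrite lee_fin|exact/measurable_EFinP].
have IG : (\int[P]_x G x <= C%:E)%E.
  rewrite integral_nneseries //; last 2 first.
  - by move=> k; exact/measurable_EFinP.
  - by move=> k x _; rewrite lee_fin.
  apply: lime_le; first by apply: is_cvg_nneseries => k _ _; apply: integral_ge0 => x _; rewrite lee_fin.
  apply: nearW => n; under eq_bigr do rewrite Ex_EFin //.
  by rewrite sumEFin lee_fin big_mkord.
have iG : P.-integrable setT G.
  apply/integrableP; split => //; under eq_integral do rewrite gee0_abs //.
  exact: le_lt_trans IG (ltry _).
pose g x := fine (G x).
have Gfin : {ae P, forall x, G x = (g x)%:E}.
  have := integrable_ae measurableT iG; apply: filterS => x /(_ Logic.I) hx.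
  by rewrite /g fineK.
have mg : measurable_fun setT g by exact: measurableT_comp.
have lg : L1 g.
  apply/integrableP; split; first exact/measurable_EFinP.
  apply: le_lt_trans (_ : _ <= \int[P]_x G x)%E _; last exact: le_lt_trans IG (ltry _).
  apply: ae_ge0_le_integral => //.
  - by apply: measurableT_comp => //; exact/measurable_EFinP.
  - by ae_using Gfin; ae_intro => x hx _; rewrite hx lee_fin ger0_norm // -lee_fin -hx.
have part n x : ((\sum_(k < n) h k x)%:E <= G x)%E.
  by rewrite -sumEFin -(big_mkord xpredT (fun k => (h k x)%:E)); apply: nneseries_lim_ge => k _ _; rewrite lee_fin.
exists g => // e e0.
apply: (Ex_dominated_convergence (g := g)) => //.
- by move=> n; apply: measurable_sum => k; exact: mh.
- move=> n; ae_using Gfin; ae_intro => x hx; rewrite ger0_norm ?sumr_ge0 //.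
  by rewrite -lee_fin -hx.
- ae_using Gfin; ae_intro => x hx.
  have : (\sum_(0 <= k < n) (h k x)%:E)%E @[n --> \oo] --> G x.
    by apply: is_cvg_nneseries => k _ _; rewrite lee_fin.
  rewrite hx; under eq_fun do rewrite sumEFin big_mkord.
  by move/fine_cvgP => [].
Qed.

Lemma L1_series (h : nat -> T -> R) (C : R) : (forall k, L1 (h k)) ->
  (forall N, \sum_(k < N) Ex (fun x => `|h k x|) <= C) ->
  exists2 g, L1 g & L1_limit (fun n x => \sum_(k < n) h k x) g.
Proof.
move=> lh HC; pose p k x : R := `|h k x|; pose q k x : R := `|h k x| + h k x.
have lp k : L1 (p k) by exact: L1_norm.
have lq k : L1 (q k) by apply: L1D => //; exact: L1_norm.
have [gp lgp Hp] := L1_series_ge0 lp (fun k x => normr_ge0 _) HC.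
have [||gq lgq Hq] := @L1_series_ge0 q (2 * C) lq.
- by move=> k x; rewrite /q -lerBlDr sub0r -normrN ler_norm.
- move=> N; apply: le_trans (_ : 2 * \sum_(k < N) Ex (p k) <= _); last by rewrite ler_wpM2l.
  rewrite mulr_sumr; apply: ler_sum => k _; rewrite -ExZ //; apply: Ex_le => //; first exact: L1Z.
  by ae_intro => x; rewrite /q /p mulr_natl mulr2n lerD2l ler_norm.
exists (fun x => 1 * gq x + (-1) * gp x); first by apply: L1D; exact: L1Z.
have ls (r : nat -> T -> R) n : (forall k, L1 (r k)) -> L1 (fun x => \sum_(k < n) r k x) by move=> lr; apply: L1_sum.
have hqp := L1_limit_lin 1 (-1) (fun n => ls q n lq) (fun n => ls p n lp) lgq lgp Hq Hp.
rewrite (_ : (fun n x => _) = fun n x => 1 * \sum_(k < n) q k x + -1 * \sum_(k < n) p k x) //.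
apply/funext => n; apply/funext => x.
by rewrite mul1r mulN1r -sumrB; apply: eq_bigr => k _; rewrite /q /p addrAC subrr add0r.
Qed.

Definition product_series u b n x := \sum_(k < n) mdiff u k x * mdiff (mart b) k x.

(** The condition under which [Lsum] chooses its value, written with real expectations; uniqueness
    of L^1 limits makes the choice immaterial up to null sets. *)
Definition is_Lsum u b g := L1 g /\ L1_limit (product_series u b) g.

Section bounds.
Context (b : T -> R) (K : R) (K0 : 0 < K) (bK : bmo1 P F K b).

Let bdd k : essbdd (mdiff (mart b) k). Proof. exact: (essbdd_bmo_mdiff SB bK). Qed.

Lemma L1_product u k : (forall k, L1 (u k)) -> L1 (fun x => mdiff u k x * mdiff (mart b) k x).
Proof.
move=> lu; have ld := L1_mdiff k lu; have := essbdd_L1M (bdd k) ld.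
by congr (integrable _ _ _); apply/funext => x /=; rewrite mulrC.
Qed.

Lemma L1_product_series u n : (forall k, L1 (u k)) -> L1 (product_series u b n).
Proof. by move=> lu; apply: L1_sum => k _; exact: L1_product. Qed.

(** The duality between H1 and BMO. With s <= s' the consecutive square sums, |a e| <= 3K a^2 / (2
    s') + s' e^2 / (6K), and a^2 <= 2 (s' - s) s' makes the first term 3K (s' - s), which
    telescopes. The second is summed by [carleson] with the weight s': 18 K^2 / (6K) = 3K more. *)
Lemma Ex_product_bound u N : (forall k, L1 (u k)) -> (forall k, measurable_for (F k) (u k)) ->
  \sum_(k < N) Ex (fun x => `|mdiff u k x * mdiff (mart b) k x|) <=
  6 * K * Ex (fun x => sqsum (mdiff u ^~ x) N).
Proof.
move=> lu au; have ld k := L1_mdiff k lu.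
have ad k : measurable_for (F k) (mdiff u k) by apply: (adapted_mdiff SB).
pose S k x := sqsum (mdiff u ^~ x) k; pose dd k := mdiff (mart b) k.
(* The square sum including the index k, which is known at time k, as a weight at k must be; it is
   frozen after N so that the final weight is S_N. *)
pose W k x := S (minn k.+1 N) x.
have lS k : L1 (S k) by exact: L1_sqsum.
have aW k : measurable_for (F k) (W k).
  apply: (@adapted_comp _ _ _ F k (@Num.sqrt R)); first by apply: continuous_measurable_fun; exact: sqrt_continuous.
  apply: adapted_sum => i _; under eq_fun do rewrite expr2.
  have ik : (i <= k)%N by rewrite -ltnS (leq_trans (ltn_ord i)) ?geq_minl.
  by apply: adaptedM; exact (adapted_mono SB ik (@ad i)).
have W0 k x : 0 <= W k x <= W k.+1 x.
  rewrite sqsum_ge0 sqsum_le // leq_min geq_minr andbT (leq_trans (geq_minl _ _)) //.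
have lWd k : L1 (fun x => W k x * dd k x ^+ 2).
  have := essbdd_L1M (essbddX (bdd k)) (lS (minn k.+1 N)).
  by congr (integrable _ _ _); apply/funext => x /=; rewrite mulrC.
have L0 : 0 <= 18 * K ^+ 2 by rewrite mulr_ge0 // sqr_ge0.
have C := carleson SB (fun k _ => jump_bmo_mdiff SB bK k)
  (fun n A nN FA => john_nirenberg SB K0 bK nN FA) aW (fun k => lS _) W0 L0 (M := N).
have pt k x : (k < N)%N -> `|mdiff u k x * dd k x| <=
    3 * K * (S k.+1 x - S k x) + (6 * K)^-1 * (W k x * dd k x ^+ 2).
  move=> kN; have -> : W k x = S k.+1 x by rewrite /W (minn_idPl _).
  have := sqsum_incr (mdiff u ^~ x) k; have := sqsum_leS (mdiff u ^~ x) k.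
  have := normr_sqsum (mdiff u ^~ x) k; have := sqsum_ge0 (mdiff u ^~ x) k.
  rewrite -/(S k x) -/(S k.+1 x); set s := S k x; set s' := S k.+1 x; set a := mdiff u k x; set e := dd k x.
  move=> s0 as' ss' inc.
  have [s'0|s'0] := eqVneq s' 0.
    have -> : a = 0 by apply/eqP; rewrite -normr_le0 -s'0.
    by rewrite mul0r normr0 s'0 mul0r mulr0 addr0 mulr_ge0 ?mulr_ge0 ?(ltW K0) // subr_ge0 -s'0.
  have s'p : 0 < s' by rewrite lt_neqAle eq_sym s'0 (le_trans _ as').
  have K6 : 0 < 6 * K by rewrite mulr_gt0.
  have E1 : 6 * K * (3 * K * (s' - s) + (6 * K)^-1 * (s' * e ^+ 2)) = 18 * K ^+ 2 * (s' - s) + s' * e ^+ 2.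
    by field; rewrite gt_eqF.
  rewrite -(ler_pM2l K6) E1 -(ler_pM2l s'p) normrM -(real_normK (num_real e)).
  have := sqr_ge0 (3 * K * `|a| - s' * `|e|); rewrite -(real_normK (num_real a)) in inc.
  have := ler_wpM2l (sqr_ge0 (3 * K)) inc; nra.
rewrite -Ex_sum; last by move=> k _; apply: L1_norm; exact: L1_product.
have lN := lS N; have lW := fun k => lS (minn k.+1 N).
have ld2 : L1 (fun x => \sum_(k < N) W k x * dd k x ^+ 2) by apply: L1_sum.
apply: (@le_trans _ _ (Ex (fun x => 3 * K * S N x + (6 * K)^-1 * \sum_(k < N) W k x * dd k x ^+ 2))).
  apply: Ex_le; [by apply: L1_sum => k _; apply: L1_norm; exact: L1_product|by apply: L1D; exact: L1Z|].
  ae_intro => x.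
  apply: (@le_trans _ _ (\sum_(k < N) (3 * K * (S k.+1 x - S k x) + (6 * K)^-1 * (W k x * dd k x ^+ 2)))).
    by apply: ler_sum => k _; exact: pt.
  rewrite big_split /= -!mulr_sumr lerD2r ler_wpM2l ?mulr_ge0 ?(ltW K0) //.
  rewrite -(big_mkord xpredT (fun k => S k.+1 x - S k x)) telescope_sumr // /S sqsum0 subr0 //.
rewrite ExD ?ExZ //; [|exact: L1Z|exact: L1Z].
have -> : 6 * K * Ex (S N) = 3 * K * Ex (S N) + (6 * K)^-1 * (18 * K ^+ 2 * Ex (S N)).
  by field; rewrite gt_eqF.
rewrite lerD2l ler_wpM2l ?invr_ge0 ?mulr_ge0 ?(ltW K0) //.
by move: C; rewrite /W /minn ltnNge leqnSn.
Qed.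

Lemma Lsum_exists u : H1 P F u -> exists g, is_Lsum u b g.
Proof.
move=> [mu hu]; have lu := martingale_L1 mu.
have [C HC] : exists C, (H1_norm u <= C%:E)%E.
  exists (fine (H1_norm u)); rewrite fineK // ge0_fin_numE //; exact: Lnorm_ge0.
have [||g lg Hg] := @L1_series (fun k x => mdiff u k x * mdiff (mart b) k x) (6 * K * C).
- by move=> k; exact: L1_product.
- move=> N; apply: le_trans (Ex_product_bound N lu _) _; first by move=> k; have [] := mu k.
  rewrite ler_wpM2l ?mulr_ge0 ?(ltW K0) // -lee_fin; apply: le_trans HC; exact: Ex_sqsum_H1.
- by exists g.
Qed.

Lemma Lsum_bound u g (C : R) : is_martingale P F u -> (H1_norm u <= C%:E)%E -> is_Lsum u b g ->
  Ex (fun x => `|g x|) <= 6 * K * C.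
Proof.
move=> mu HC [lg Lg]; have lu := martingale_L1 mu.
apply: (L1_limit_norm (fun n => L1_product_series n lu) lg Lg) => N.
apply: (@le_trans _ _ (\sum_(k < N) Ex (fun x => `|mdiff u k x * mdiff (mart b) k x|))).
  rewrite -Ex_sum; last by move=> k _; apply: L1_norm; exact: L1_product.
  apply: Ex_le.
  - by apply: L1_norm; exact: L1_product_series.
  - by apply: L1_sum => k _; apply: L1_norm; exact: L1_product.
  - by ae_intro => x; exact: ler_norm_sum.
apply: le_trans (Ex_product_bound N lu _) _; first by move=> k; have [] := mu k.
rewrite ler_wpM2l ?mulr_ge0 ?(ltW K0) // -lee_fin; apply: le_trans HC; exact: Ex_sqsum_H1.
Qed.

Lemma Lsum_spec u : H1 P F u -> is_Lsum u b (Lsum P F u b).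
Proof.
move=> hu; have lu := martingale_L1 (proj1 hu).
rewrite /Lsum; set S := [set g | _ ].
have E g : S g <-> is_Lsum u b g.
  split => [[/LfunL1 lg Hg]|[lg Hg]]; (split; first by try exact/LfunL1).
- move=> e e0; move/fine_cvgP : Hg => [_ /cvgrPdist_le /(_ _ e0) [N _ HN]].
  exists N => n Nn; have := HN n Nn; rewrite /= sub0r normrN; apply: le_trans.
  rewrite Lnorm1_Ex; last first.
    by have := L1B (L1_product_series n lu) lg; congr (integrable _ _ _); apply/funext => x /=; rewrite big_mkord.
  apply: le_trans (ler_norm _); rewrite le_eqVlt; apply/orP; left; apply/eqP.
  by congr (Rintegral P _ _); apply/funext => x; rewrite big_mkord.
- have N1 n : ('N[P]_1[EFin \o (fun x =>
        (\sum_(0 <= k < n) mdiff u k x * mdiff (mart b) k x) - g x)%R] =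
      (Ex (fun x => `|product_series u b n x - g x|))%:E)%E.
    rewrite Lnorm1_Ex; last first.
      by have := L1B (L1_product_series n lu) lg; congr (integrable _ _ _); apply/funext => x /=; rewrite big_mkord.
    by congr EFin; congr (Rintegral P _ _); apply/funext => x; rewrite big_mkord.
  under eq_fun do rewrite N1; apply: cvg_EFin; first exact: nearW.
  apply/cvgrPdist_le => e e0; have [N HN] := Hg e e0; exists N => // n /= Nn.
  rewrite sub0r normrN ger0_norm; last by apply: Ex_ge0; [exact/L1_norm/L1B/lg/L1_product_series|ae_intro].
  exact: HN.
have [g Hg] := Lsum_exists hu.
by apply/E; apply: xgetPex; exists g; apply/E.
Qed.

Lemma Lsum_unique u g h : (forall k, L1 (u k)) -> is_Lsum u b g -> is_Lsum u b h ->
  {ae P, forall x, g x = h x}.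
Proof.
move=> lu [lg Hg] [lh Hh]; exact: L1_limit_unique (fun n => L1_product_series n lu) lg lh Hg Hh.
Qed.

Lemma Lsum_lin_left u v (s t : R) : H1 P F u -> H1 P F v ->
  H1 P F (fun n x => s * u n x + t * v n x) ->
  {ae P, forall x, Lsum P F (fun n x => s * u n x + t * v n x) b x =
    s * Lsum P F u b x + t * Lsum P F v b x}.
Proof.
move=> hu hv hw; have [lgu Hu] := Lsum_spec hu; have [lgv Hv] := Lsum_spec hv.
have [lgw Hw] := Lsum_spec hw.
have lu := martingale_L1 (proj1 hu); have lv := martingale_L1 (proj1 hv); have lw := martingale_L1 (proj1 hw).
apply: (Lsum_unique lw) => //; split; first by apply: L1D; exact: L1Z.
have := L1_limit_lin s t (fun n => L1_product_series n lu) (fun n => L1_product_series n lv) lgu lgv Hu Hv.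
congr L1_limit; apply/funext => n; apply/funext => x; rewrite /product_series !mulr_sumr -big_split /=.
by apply: eq_bigr => k _; rewrite /Defs.mdiff; case: (nat_of_ord k) => [|j] /=; ring.
Qed.

Lemma finite_Lsum v N : (forall k, (k < N)%N -> jump k (v k)) ->
  is_Lsum (mart (fun x => \sum_(k < N) v k x)) b (fun x => \sum_(k < N) v k x * mdiff (mart b) k x).
Proof.
move=> jv; have [mf _] := H1_finite_mart SB jv; set f := fun x => _ in mf *.
have lf := martingale_L1 mf.
have lv k : (k < N)%N -> L1 (fun x => v k x * mdiff (mart b) k x).
  by move=> kN; have [_ bv _] := jv k kN; apply/essbdd_L1/essbddM.
have lg : L1 (fun x => \sum_(k < N) v k x * mdiff (mart b) k x) by apply: L1_sum => k _; exact: lv.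
split => // e e0; exists N => n Nn.
have ae0 : {ae P, forall x, `|product_series (mart f) b n x - \sum_(k < N) v k x * mdiff (mart b) k x| = 0}.
  ae_using (ae_countable (P := P) (finite_mdiff SB jv)); ae_intro => x Hx.
  rewrite /product_series; under eq_bigr do rewrite Hx.
  apply/eqP; rewrite normr_eq0 subr_eq0; apply/eqP.
  rewrite -(big_mkord xpredT (fun k => (if (k < N)%N then v k x else 0) * mdiff (mart b) k x)).
  rewrite (big_cat_nat (n := N)) //= [X in _ + X]big1_seq ?addr0; last first.
    by move=> k /andP[_]; rewrite mem_index_iota => /andP[Nk _]; rewrite ltnNge Nk mul0r.
  by rewrite big_mkord; apply: eq_bigr => k _; rewrite ltn_ord.
have ln := L1_norm (L1B (L1_product_series n lf) lg).
apply: le_trans (ltW e0); apply: le_trans (Ex_le ln (L1_cst P 0) _) _; last by rewrite Ex_cst.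
by ae_using ae0; ae_intro => x ->.
Qed.

End bounds.

Lemma Lsum_lin_right u b c K (s t : R) : H1 P F u -> 0 < K -> bmo1 P F K b -> bmo1 P F K c ->
  (exists2 K', 0 < K' & bmo1 P F K' (fun x => s * b x + t * c x)) ->
  {ae P, forall x, Lsum P F u (fun y => s * b y + t * c y) x =
    s * Lsum P F u b x + t * Lsum P F u c x}.
Proof.
move=> hu K0 bK cK [K' K'0 bcK]; have lu := martingale_L1 (proj1 hu).
have [lg1 H1'] := Lsum_spec K0 bK hu; have [lg2 H2] := Lsum_spec K0 cK hu.
apply: (Lsum_unique bcK lu (Lsum_spec K'0 bcK hu)).
split; first by apply: L1D; exact: L1Z.
have := L1_limit_lin s t (fun n => L1_product_series bK n lu) (fun n => L1_product_series cK n lu) lg1 lg2 H1' H2.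
apply: L1_limit_ae.
- by move=> n; apply: L1D; apply: L1Z; [exact: (L1_product_series bK)|exact: (L1_product_series cK)].
- by move=> n; exact: (L1_product_series bcK).
- by apply: L1D; exact: L1Z.
move=> n; have [lb _] := bK; have [lc _] := cK.
ae_using (ae_countable (P := P) (fun k => mart_lin SB s t k lb lc)); ae_intro => x Hx.
rewrite /product_series !mulr_sumr -big_split /=; apply: eq_bigr => k _.
by rewrite /Defs.mdiff; case: (nat_of_ord k) => [|j] /=; rewrite ?Hx; ring.
Qed.

Lemma Lsum_ae u v b c K : H1 P F u -> H1 P F v -> 0 < K -> bmo1 P F K b -> bmo1 P F K c ->
  (forall n, {ae P, forall x, u n x = v n x}) -> {ae P, forall x, b x = c x} ->
  {ae P, forall x, Lsum P F u b x = Lsum P F v c x}.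
Proof.
move=> hu hv K0 bK cK uv bc; have lu := martingale_L1 (proj1 hu); have lv := martingale_L1 (proj1 hv).
have [lg H] := Lsum_spec K0 bK hu.
suff H' : is_Lsum v c (Lsum P F u b) by exact: (Lsum_unique cK lv H' (Lsum_spec K0 cK hv)).
split; first exact: lg.
apply: L1_limit_ae H; last 1 first.
- move=> n; have [lb _] := bK; have [lc _] := cK.
  ae_using (ae_countable (P := P) (fun k => ae_mdiff k uv)).
  ae_using (ae_countable (P := P) (fun k => ae_mdiff k (fun n => mart_ae SB n lb lc bc))).
  by ae_intro => x h1 h2; apply: eq_bigr => k _; rewrite h1 h2.
- by move=> n; exact: (L1_product_series bK).
- by move=> n; exact: (L1_product_series cK).
- exact: lg.
Qed.

End product_series.

Lemma rat_close (R : realType) (y e : R) : 0 < e -> exists r : rat, `|y - ratr r| < e.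
Proof.
move=> e0; have [r] := @rat_in_itvoo R (y - e) (y + e) ltac:(lra).
by rewrite in_itv /= => /andP[h1 h2]; exists r; rewrite ltr_norml; apply/andP; split; lra.
Qed.

(** * Lipschitz extension from the rationals *)

Section lipschitz_families.
Context (R : realType).
Implicit Types (X : rat -> R) (Y c e : R).

(** McShane's extension of a function on the rationals with Lipschitz constant [Y]. As a countable
    supremum it depends measurably on a parameter. *)
Definition lipschitz_ext X Y c : R :=
  fine (ereal_sup [set (X r - `|c - ratr r| * Y)%:E | r in setT]).

Definition lipschitz_on_rat X Y := forall r s, `|X r - X s| <= `|ratr r - ratr s| * Y.

Lemma lipschitz_extP X Y c r : 0 <= Y -> lipschitz_on_rat X Y ->
  `|lipschitz_ext X Y c - X r| <= `|c - ratr r| * Y.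
Proof.
move=> Y0 LX; rewrite /lipschitz_ext; set S := ereal_sup _.
have lo s : ((X s - `|c - ratr s| * Y)%:E <= S)%E by apply: ereal_sup_ubound; exists s.
have hi s : (S <= (X s + `|c - ratr s| * Y)%:E)%E.
  apply: ge_ereal_sup => _ [t _ <-]; rewrite lee_fin.
  have := LX t s; rewrite ler_norml => /andP[_ h].
  have : `|ratr t - ratr s| <= `|c - ratr t| + `|c - ratr s| :> R.
    by rewrite -[_ - _](subrKA c) (distrC c (ratr t)); exact: ler_normD.
  by move=> /ler_wpM2r - /(_ Y Y0); lra.
have : S \is a fin_num.
  by rewrite fin_numE; apply/andP; split; apply/eqP => Sy; [have := lo r|have := hi r]; rewrite Sy.
move=> /fineK Sf; move: (lo r) (hi r); rewrite -Sf !lee_fin ler_norml => h1 h2.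
by apply/andP; split; lra.
Qed.

(** Both rational parameters approach their targets at once, the coefficient [D] being fixed. Two
    targets are needed when two symbols are compared. *)
Lemma le0_dense (A D c e : R) :
  (forall r s : rat, A <= (`|c - ratr r| + `|e - ratr s|) * D) -> A <= 0.
Proof.
move=> H; rewrite leNgt; apply/negP => A0.
have D1 : 0 < `|D| + 1 by rewrite ltr_wpDl.
have d0 : 0 < A / (2 * (`|D| + 1)) by rewrite divr_gt0 ?mulr_gt0.
have [r hr] := rat_close c d0; have [s hs] := rat_close e d0.
have := H r s; apply/negP; rewrite -ltNge.
apply: (@le_lt_trans _ _ ((`|c - ratr r| + `|e - ratr s|) * `|D|)); first by rewrite ler_wpM2l ?addr_ge0 // ler_norm.
apply: (@le_lt_trans _ _ ((A / (2 * (`|D| + 1)) + A / (2 * (`|D| + 1))) * `|D|)).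
  by rewrite ler_wpM2r // lerD // ltW.
rewrite (_ : _ + _ = A / (`|D| + 1)); last by field; rewrite gt_eqF.
by rewrite mulrAC ltr_pdivrMr // ltr_pM2l // ltrDl.
Qed.

Lemma lipschitz_ext_lip X Y c e : 0 <= Y -> lipschitz_on_rat X Y ->
  `|lipschitz_ext X Y c - lipschitz_ext X Y e| <= `|c - e| * Y.
Proof.
move=> Y0 LX; rewrite -subr_le0; apply: (@le0_dense _ (2 * Y) c e) => r s.
have h1 := lipschitz_extP c r Y0 LX; have h2 := lipschitz_extP e r Y0 LX.
have h3 : `|lipschitz_ext X Y c - lipschitz_ext X Y e| <= `|c - ratr r| * Y + `|e - ratr r| * Y.
  by rewrite -[_ - _](subrKA (X r)); apply: le_trans (ler_normD _ _) _; rewrite lerD // distrC.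
have h4 : `|e - ratr r| <= `|c - e| + `|c - ratr r|.
  by rewrite -[_ - _](subrKA c) (distrC c e); exact: ler_normD.
have := ler_wpM2r Y0 h4; have := mulr_ge0 (normr_ge0 (e - ratr s)) Y0; lra.
Qed.

End lipschitz_families.

Section square_integrable.
Context d (T : measurableType d) (R : realType) (P : probability T R).
Implicit Types f : T -> R.
Notation L1 f := (P.-integrable setT (EFin \o f)).

Lemma LfunL2 f : f \in Lfun P 2%:E <-> measurable_fun setT f /\ L1 (fun x => f x ^+ 2).
Proof.
split => [f2|[mf lf]].
  split; last exact: Lfun2_integrable_sqr.
  by move: f2; rewrite inE => /andP[]; rewrite inE.
rewrite inE; apply/andP; split; rewrite inE //=.
apply: (@le_lt_trans _ _ (Num.sqrt (Rintegral P setT (fun x => f x ^+ 2)))%:E); last exact: ltry.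
have I0 : 0 <= Rintegral P setT (fun x => f x ^+ 2) by apply: Ex_ge0 => //; ae_intro => x; exact: sqr_ge0.
apply/Lnorm_leP; rewrite ?ler1n ?sqrtr_ge0 //.
under eq_integral do rewrite powR_mulrn // real_normK ?num_real //.
by rewrite powR_mulrn ?sqrtr_ge0 // sqr_sqrtr // Ex_EFin.
Qed.

End square_integrable.

(** * Evaluation along b(x) *)

Section evaluation.
Context d (T : measurableType d) (R : realType) (P : probability T R).
Implicit Types (f g h b c phi psi X : T -> R) (U W : (T -> R) -> (T -> R)).
Notation L1 f := (P.-integrable setT (EFin \o f)).

(** Evaluation at c = b(x) cannot be done inside an almost sure statement for a fixed parameter:
    countably many rational statements are made to hold at once, and only then is x fixed and the
    parameter moved to b(x). *)
Lemma ae_le0_dense b c A D : (forall r s : rat,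
    {ae P, forall x, A x <= (`|b x - ratr r| + `|c x - ratr s|) * D x}) ->
  {ae P, forall x, A x <= 0}.
Proof.
move=> H; ae_using (ae_countable (P := P) (fun r => ae_countable (P := P) (H r))).
by ae_intro => x hx; exact: (@le0_dense _ _ (D x) (b x) (c x)).
Qed.

Lemma ae_le0_dense1 b A D : (forall r : rat,
    {ae P, forall x, A x <= `|b x - ratr r| * D x}) ->
  {ae P, forall x, A x <= 0}.
Proof.
move=> H; apply: (@ae_le0_dense b (fun=> 0) A (fun x => `|D x|)) => r s.
ae_using (H r); ae_intro => x h; apply: le_trans h _.
apply: le_trans (_ : `|b x - ratr r| * `|D x| <= _); first by rewrite ler_wpM2l // ler_norm.
by rewrite ler_wpM2r // lerDl.
Qed.

Context (U : (T -> R) -> (T -> R)) (opU : L1_operator P U) (subU : sublinear_op P U).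

Lemma L1_op_measurable f : L1 f -> measurable_fun setT (U f).
Proof. by move=> lf; apply: (op_measurable opU); apply/LfunL1. Qed.

Lemma L1_op_ae f g : L1 f -> L1 g -> {ae P, forall x, f x = g x} -> {ae P, forall x, U f x = U g x}.
Proof. by move=> lf lg; apply: (op_ae opU); apply/LfunL1. Qed.

Lemma L1_sublinear (s t : R) f g : L1 f -> L1 g ->
  {ae P, forall x, `|U (fun y => s * f y + t * g y) x| <= `|s| * `|U f x| + `|t| * `|U g x|}.
Proof. by move=> lf lg; apply: subU; apply/LfunL1. Qed.

Lemma L1_op_scale (s : R) f : L1 f -> {ae P, forall x, `|U (fun y => s * f y) x| <= `|s| * `|U f x|}.
Proof.
move=> lf; ae_using (L1_sublinear s 0 lf lf); ae_intro => x.
rewrite normr0 mul0r addr0; apply: le_trans; rewrite le_eqVlt; apply/orP; left; apply/eqP.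
by congr (`|U _ x|); apply/funext => y; rewrite mul0r addr0.
Qed.

Lemma L1_op_subadd f g h : L1 f -> L1 g -> (forall x, h x = f x + g x) ->
  {ae P, forall x, `|U h x| <= `|U f x| + `|U g x|}.
Proof.
move=> lf lg hfg; ae_using (L1_sublinear 1 1 lf lg); ae_intro => x; rewrite normr1 !mul1r.
apply: le_trans; rewrite le_eqVlt; apply/orP; left; apply/eqP.
by congr (`|U _ x|); apply/funext => y; rewrite !mul1r.
Qed.

(* The operators whose commutators are controlled by those of U. *)
Definition dominated W := (forall f, L1 f -> measurable_fun setT (W f)) /\
  forall f g, L1 f -> L1 g ->
    {ae P, forall x, `|W f x - W g x| <= `|U (fun y => f y - g y) x|}.

(** Sublinearity gives |U f| <= |U g| + |U (f - g)|; the symmetric inequality uses |U (-h)| <= |U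
    h|. *)
Lemma dominated_abs : dominated (abs_op U).
Proof.
split => [f lf|f g lf lg]; first by apply: measurableT_comp => //; exact: L1_op_measurable.
have lfg := L1B lf lg.
have e1 x : f x = g x + (f x - g x) by ring.
have e2 x : g x = f x + (-1) * (f x - g x) by ring.
ae_using (L1_op_subadd lg lfg e1); ae_using (L1_op_subadd lf (L1Z (-1) lfg) e2).
ae_using (L1_op_scale (-1) lfg); ae_intro => x h1 h2 h3.
rewrite normrN1 mul1r in h1; rewrite /abs_op ler_norml; apply/andP; split; lra.
Qed.

Lemma dominated_linear : linear_op P U -> dominated U.
Proof.
move=> linU; split => [f lf|f g lf lg]; first exact: L1_op_measurable.
have := linU 1 (-1) f g; rewrite !LfunL1 => /(_ lf lg); apply: filterS => x h.
rewrite le_eqVlt; apply/orP; left; apply/eqP; congr (`|_|).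
by rewrite (_ : (fun y => _) = fun y => 1 * f y + -1 * g y); [rewrite h; ring|apply/funext => y; ring].
Qed.

(** Domination suffices: U (f - g) = U (0 f) almost everywhere, and this vanishes by
    sublinearity. *)
Lemma dominated_ae W f g : dominated W -> L1 f -> L1 g -> {ae P, forall x, f x = g x} ->
  {ae P, forall x, W f x = W g x}.
Proof.
move=> [_ dW] lf lg fg; have lfg := L1B lf lg.
have z : {ae P, forall x, f x - g x = 0 * f x} by ae_using fg; ae_intro => x ->; ring.
ae_using (dW f g lf lg); ae_using (L1_op_ae lfg (L1Z 0 lf) z); ae_using (L1_op_scale 0 lf).
ae_intro => x; rewrite normr0 mul0r => h1 -> h2; apply/eqP; rewrite -subr_eq0 -normr_le0.
exact: le_trans h2 h1.
Qed.

(* [h] is the value at [c = b x] of the family [c |-> W (psi - c phi) x]. *)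
Definition evaluation W b psi phi h := measurable_fun setT h /\
  forall c : R, {ae P, forall x, `|h x - W (fun y => psi y - c * phi y) x| <= `|b x - c| * `|U phi x|}.

Lemma dominated_shift W psi phi (c e : R) : dominated W -> L1 psi -> L1 phi ->
  {ae P, forall x, `|W (fun y => psi y - c * phi y) x - W (fun y => psi y - e * phi y) x|
    <= `|c - e| * `|U phi x|}.
Proof.
move=> [_ dW] lpsi lphi.
have l (a : R) : L1 (fun y => psi y - a * phi y) by apply: L1B => //; exact: L1Z.
ae_using (dW _ _ (l c) (l e)); ae_using (L1_op_scale (e - c) lphi); ae_intro => x h1 h2.
apply: le_trans h2 _; rewrite (_ : (fun y => _) = fun y => (e - c) * phi y); first by rewrite (distrC c).
by apply/funext => y; ring.
Qed.

Definition rat_family W psi phi x (r : rat) := W (fun y => psi y - ratr r * phi y) x.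

Lemma rat_family_lipschitz W psi phi : dominated W -> L1 psi -> L1 phi ->
  {ae P, forall x, lipschitz_on_rat (rat_family W psi phi x) `|U phi x|}.
Proof.
move=> dW lpsi lphi.
ae_using (ae_countable (P := P) (fun r => ae_countable (P := P) (fun s =>
  dominated_shift (ratr r) (ratr s) dW lpsi lphi))).
by ae_intro => x h r s; exact: h.
Qed.

(** For rational c the family is Lipschitz with constant |U phi| (x) outside one null set; its
    McShane extension is evaluated at b(x). *)
Lemma evaluation_exists W b psi phi : dominated W -> measurable_fun setT b -> L1 psi -> L1 phi ->
  exists h, evaluation W b psi phi h.
Proof.
move=> dW mb lpsi lphi; have l (c : R) : L1 (fun y => psi y - c * phi y) by apply: L1B => //; exact: L1Z.
have mX r : measurable_fun setT (fun x => rat_family W psi phi x r) by apply: (proj1 dW).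
have mU := L1_op_measurable lphi.
exists (fun x => lipschitz_ext (rat_family W psi phi x) `|U phi x| (b x)); split.
  apply: measurableT_comp => //.
  (* An enumeration of the rationals, with value 0 outside the range of the coding, presents the
     supremum as one over a sequence of measurable functions. *)
  pose dec (k : nat) : rat := odflt 0 (unpickle k).
  pose f k x := (rat_family W psi phi x (dec k) - `|b x - ratr (dec k)| * `|U phi x|)%:E.
  have mf k : measurable_fun setT (f k).
    apply/measurable_EFinP; apply: measurable_funB => //; apply: measurable_funM; apply: measurableT_comp => //.
    by apply: measurable_funB.
  have := @measurable_fun_esups _ T R setT f mf 0%N.
  congr measurable_fun; apply/funext => x; rewrite /esups /sdrop.
  congr ereal_sup; apply/seteqP; split => [_ [k _ <-]|_ [r _ <-]] /=; first by exists (dec k).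
  by exists (pickle r) => //; rewrite /f /dec pickleK.
move=> c; rewrite /=.
have H : {ae P, forall x, `|lipschitz_ext (rat_family W psi phi x) `|U phi x| (b x) -
    W (fun y => psi y - c * phi y) x| - `|b x - c| * `|U phi x| <= 0}.
  apply: (@ae_le0_dense1 (fun=> c) _ (fun x => 2 * `|U phi x|)) => r.
  ae_using (rat_family_lipschitz dW lpsi lphi); ae_using (dominated_shift (ratr r) c dW lpsi lphi).
  ae_intro => x h1 /(lipschitz_extP (b x) r (normr_ge0 _)) h2; rewrite -/(rat_family W psi phi x r) in h1.
  have h3 : `|b x - ratr r| <= `|b x - c| + `|c - ratr r|.
    by rewrite -[_ - _](subrKA c); exact: ler_normD.
  have := ler_wpM2r (normr_ge0 (U phi x)) h3.
  have : `|lipschitz_ext (rat_family W psi phi x) `|U phi x| (b x) - W (fun y => psi y - c * phi y) x| <=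
     `|b x - ratr r| * `|U phi x| + `|ratr r - c| * `|U phi x|.
    by rewrite -[_ - W _ x](subrKA (rat_family W psi phi x r)); apply: le_trans (ler_normD _ _) _; exact: lerD.
  by rewrite (distrC (ratr r)); lra.
by ae_using H; ae_intro => x; rewrite subr_le0.
Qed.

Lemma evaluation_unique W b psi phi h h' : evaluation W b psi phi h -> evaluation W b psi phi h' ->
  {ae P, forall x, h x = h' x}.
Proof.
move=> [mh H] [mh' H'].
have : {ae P, forall x, `|h x - h' x| <= 0}.
  apply: (@ae_le0_dense1 b _ (fun x => 2 * `|U phi x|)) => r.
  ae_using (H (ratr r)); ae_using (H' (ratr r)); ae_intro => x h1 h2.
  rewrite -[h x - h' x](subrKA (W (fun y => psi y - ratr r * phi y) x)).
  apply: le_trans (ler_normD _ _) _; rewrite (distrC _ (h' x)); lra.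
by apply: filterS => x; rewrite normr_le0 subr_eq0 => /eqP.
Qed.

Lemma evaluation_ae W b b' psi psi' phi phi' h h' : dominated W -> L1 psi -> L1 phi -> L1 psi' -> L1 phi' ->
  measurable_fun setT h' -> {ae P, forall x, b x = b' x} -> {ae P, forall x, psi x = psi' x} ->
  {ae P, forall x, phi x = phi' x} -> {ae P, forall x, h x = h' x} ->
  evaluation W b psi phi h -> evaluation W b' psi' phi' h'.
Proof.
move=> dW lpsi lphi lpsi' lphi' mh' bb' pp' ff' hh' [_ H]; split => // c.
have l f g : L1 f -> L1 g -> L1 (fun y => f y - c * g y) by move=> lf lg; apply: L1B => //; exact: L1Z.
have e : {ae P, forall x, psi x - c * phi x = psi' x - c * phi' x}.
  by ae_using pp'; ae_using ff'; ae_intro => x -> ->.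
ae_using (dominated_ae dW (l _ _ lpsi lphi) (l _ _ lpsi' lphi') e).
by ae_using (L1_op_ae lphi lphi' ff'); ae_using hh'; ae_using bb'; ae_using (H c); ae_intro => x h1 <- <- <- <-.
Qed.

Lemma evaluation_linear b psi phi : linear_op P U -> measurable_fun setT b -> L1 psi -> L1 phi ->
  evaluation U b psi phi (fun x => U psi x - b x * U phi x).
Proof.
move=> linU mb lpsi lphi; have mpsi := L1_op_measurable lpsi; have mphi := L1_op_measurable lphi.
split; first by apply: measurable_funB => //; exact: measurable_funM.
move=> c; have := linU 1 (- c) psi phi; rewrite !LfunL1 => /(_ lpsi lphi); apply: filterS => x h.
rewrite (_ : (fun y => _) = fun y => 1 * psi y + - c * phi y); last by apply/funext => y; ring.
rewrite h (_ : _ - _ = - (b x - c) * U phi x); last by ring.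
by rewrite normrM normrN.
Qed.

(** A version continuous in c is determined by its rational values, where the Lipschitz bound holds,
    and so inherits the bound at b(x); conversely the Lipschitz extension is such a version. This
    trades the existential definition for inequalities with fixed c. *)
Lemma commutator_onP W b phi h : dominated W -> L1 phi -> L1 (fun y => b y * phi y) ->
  commutator_on P W b phi h <-> evaluation W b (fun y => b y * phi y) phi h.
Proof.
move=> dW lphi lb; split => [[mh [V [VE Vc Vh]]]|[mh H]]; split => //.
- move=> c; ae_using (ae_countable (P := P) (fun r : rat => VE (ratr r))).
  ae_using (ae_countable (P := P) (fun r : rat => dominated_shift (ratr r) c dW lb lphi)).
  ae_using Vc; ae_using Vh; ae_intro => x -> cx h1 h2.
  apply/ler_addgt0Pr => e e0; pose Y : R := `|U phi x|.
  have Y1 : 0 < Y + 1 by rewrite /Y ltr_wpDl.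
  have e2 : 0 < e / 2 by rewrite divr_gt0.
  have e2Y : 0 < e / 2 / (Y + 1) by rewrite divr_gt0.
  have /cvgrPdist_lt /(_ _ e2) [/= del del0 Hdel] := cx (b x).
  have m0 : 0 < Num.min del (e / 2 / (Y + 1)) by rewrite lt_min del0.
  have [r] := rat_close (b x) m0; rewrite lt_min => /andP[r1 r2].
  have v1 := Hdel (ratr r) r1; rewrite (h2 r) in v1.
  have v2 := h1 r; have v3 : `|ratr r - c| <= `|b x - c| + `|b x - ratr r|.
    by rewrite (_ : ratr r - c = (b x - c) - (b x - ratr r)); [exact: ler_normB|ring].
  have v4 := ler_wpM2r (normr_ge0 (U phi x)) v3.
  have v5 : `|b x - ratr r| * `|U phi x| <= e / 2.
    have := ltW r2; rewrite ler_pdivlMr // -/Y; apply: le_trans.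
    by rewrite ler_wpM2l // lerDl.
  rewrite -[V _ x - _](subrKA (W (fun y => b y * phi y - ratr r * phi y) x)).
  apply: le_trans (ler_normD _ _) _; lra.
- exists (fun (c : R) x => lipschitz_ext (rat_family W (fun y => b y * phi y) phi x) `|U phi x| c); split.
  + move=> c.
    have Hc : {ae P, forall x, `|lipschitz_ext (rat_family W (fun y => b y * phi y) phi x) `|U phi x| c -
        W (fun y => b y * phi y - c * phi y) x| <= 0}.
      apply: (@ae_le0_dense1 (fun=> c) _ (fun x => 2 * `|U phi x|)) => r.
      ae_using (rat_family_lipschitz dW lb lphi); ae_using (dominated_shift (ratr r) c dW lb lphi).
      ae_intro => x h1 /(lipschitz_extP c r (normr_ge0 _)) h2.
      rewrite -[_ - W _ x](subrKA (rat_family W (fun y => b y * phi y) phi x r)).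
      apply: le_trans (ler_normD _ _) _; rewrite (distrC (ratr r)) in h1.
      by rewrite -/(rat_family W (fun y => b y * phi y) phi x r) in h1; lra.
    by apply: filterS Hc => x; rewrite normr_le0 subr_eq0 => /eqP.
  + ae_using (rat_family_lipschitz dW lb lphi); ae_intro => x LX c.
    apply/cvgrPdist_lt => e e0.
    have Y1 : 0 < `|U phi x| + 1 by rewrite ltr_wpDl.
    exists (e / (`|U phi x| + 1)) => /=; first by rewrite divr_gt0.
    move=> c' cc'; apply: le_lt_trans (lipschitz_ext_lip c c' (normr_ge0 _) LX) _.
    apply: le_lt_trans (_ : `|c - c'| * (`|U phi x| + 1) < _); first by rewrite ler_wpM2l // lerDl.
    by rewrite -ltr_pdivlMr.
  + have Hb : {ae P, forall x, `|h x - lipschitz_ext (rat_family W (fun y => b y * phi y) phi x) `|U phi x| (b x)| <= 0}.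
      apply: (@ae_le0_dense1 b _ (fun x => 2 * `|U phi x|)) => r.
      ae_using (rat_family_lipschitz dW lb lphi); ae_using (H (ratr r)).
      ae_intro => x h1 /(lipschitz_extP (b x) r (normr_ge0 _)) h2.
      rewrite -[h x - _](subrKA (rat_family W (fun y => b y * phi y) phi x r)).
      apply: le_trans (ler_normD _ _) _; rewrite distrC in h2.
      by rewrite -/(rat_family W (fun y => b y * phi y) phi x r) in h1; lra.
    by apply: filterS Hb => x; rewrite normr_le0 subr_eq0 => /eqP.
Qed.

Section commutators.
Context (F : (set (set T))^nat) (SB : stochastic_basis P F) (q : R) (q1 : 1 <= q).
Notation mart := (mart P F).
Implicit Types (u : nat -> T -> R).

Lemma weak_norm_ltP f : measurable_fun setT f -> {ae P, forall x, f x = 0} <->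
  forall e : R, 0 < e -> (weak_norm P q f < e%:E)%E.
Proof.
move=> mf; split => [f0 e e0|H]; last first.
  apply: (weak_le_zero q1 mf) => e e0; apply/weak_normP => //; [exact: ltW|exact/ltW/H].
apply: (@le_lt_trans _ _ (0%:E)); last by rewrite lte_fin.
apply/weak_normP => // t t0; apply: le_trans (_ : P set0 <= _)%E; last by rewrite measure0 lee_fin powR_ge0.
apply: ae_le_measure => //; first exact: measurable_level.
by ae_using f0; ae_intro => x fx /=; rewrite fx normr0 ltNge (ltW t0).
Qed.

Lemma weak_norm_le f g : measurable_fun setT f -> measurable_fun setT g ->
  {ae P, forall x, `|f x| <= `|g x|} -> (weak_norm P q f <= weak_norm P q g)%E.
Proof.
move=> mf mg fg; apply: ge_ereal_sup => _ [t /= t0 <-].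
apply: (@le_trans _ _ (t%:E * P [set x | (t < `|g x|)%R] `^ q^-1)%E); last first.
  by apply: ereal_sup_ubound; exists t.
apply: lee_wpmul2l; first by rewrite lee_fin ltW.
apply: gt0_ler_poweR; rewrite ?in_itv /= ?leey ?andbT ?measure_ge0 ?invr_ge0 ?(le_trans _ q1) //.
apply: ae_le_measure; [exact: measurable_level|exact: measurable_level|].
by ae_using fg; ae_intro => x h /= tx; exact: lt_le_trans tx h.
Qed.

Lemma H1_norm_ae0 u : (forall k, measurable_fun setT (u k)) ->
  (forall k, {ae P, forall x, u k x = 0}) -> H1_norm P u = 0%E.
Proof.
move=> mu u0; rewrite (@ae_eq_H1_norm _ _ _ P _ (fun _ _ => 0)) //.
  rewrite H1_normE (eq_integral (fun=> 0%E)) ?integral0 // => x _.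
  rewrite (@square_fun_finite _ _ _ _ 0%N) ?sqsum0 // => -[|k] _; exact: subrr.
by move=> k; exact: ae_mdiff.
Qed.

(** Both clauses of [is_commutator] agree on L^2 data. In the first, a function is determined by its
    martingale, so the representative is unique; in the second, phi itself is admissible, at
    distance 0 from u. *)
Lemma commutator_onE W b u phi h : dominated W -> L1 phi -> L1 (fun y => phi y ^+ 2) ->
  measurable_fun setT b -> L1 (fun y => b y * phi y) ->
  (forall k, measurable_fun setT (u k)) ->
  (forall n, {ae P, forall x, u n x = mart phi n x}) -> is_commutator P F q W b u h ->
  evaluation W b (fun y => b y * phi y) phi h.
Proof.
move=> dW lphi lphi2 mb lb mu uphi [[phi' [/LfunL2 [mp' l2'] u' C]]|[mh L]].
  have lphi' := L2_L1 mp' l2'.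
  have pp' : {ae P, forall x, phi x = phi' x}.
    apply: (mart_inj SB lphi lphi') => n.
    by ae_using (uphi n); ae_using (u' n); ae_intro => x <- <-.
  have bpp : {ae P, forall x, b x * phi x = b x * phi' x} by ae_using pp'; ae_intro => x ->.
  have lb' := ae_L1 lb (measurable_funM mb mp') bpp.
  have [mh H] := proj1 (commutator_onP h dW lphi' lb') C.
  apply: (evaluation_ae dW lb' lphi' lb lphi mh _ _ _ _ (conj mh H)); try exact: aeW.
  - by ae_using bpp; ae_intro.
  - by ae_using pp'; ae_intro.
have [k0 Hk0] := evaluation_exists dW mb lb lphi.
have mk0 := proj1 Hk0; have mphi := L1_measurable lphi.
have e0 : {ae P, forall x, k0 x - h x = 0}.
  apply/weak_norm_ltP; first exact: measurable_funB.
  move=> e e0; have [r r0 Hr] := L e e0.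
  have [||k /(commutator_onP _ dW lphi lb) Ck wk] := Hr phi.
  - exact/LfunL2.
  - rewrite (_ : H1_norm _ _ = 0%E) ?lte_fin //.
    have mm k := mart_measurable SB lphi k.
    apply: H1_norm_ae0 => k; first exact: measurable_funB.
    by ae_using (uphi k); ae_intro => x ->; exact: subrr.
  apply: le_lt_trans wk; have mk := proj1 Ck; apply: weak_norm_le; [exact: measurable_funB|exact: measurable_funB|].
  by ae_using (evaluation_unique Hk0 Ck); ae_intro => x ->.
apply: (evaluation_ae dW lb lphi lb lphi mh _ _ _ _ Hk0) => //; try exact: aeW.
by ae_using e0; ae_intro => x /eqP; rewrite subr_eq0 => /eqP.
Qed.

Lemma commutator_L2 W b u phi : dominated W -> measurable_fun setT phi -> L1 (fun y => phi y ^+ 2) ->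
  measurable_fun setT b -> L1 (fun y => b y * phi y) ->
  (forall k, measurable_fun setT (u k)) ->
  (forall n, {ae P, forall x, u n x = mart phi n x}) ->
  evaluation W b (fun y => b y * phi y) phi (commutator P F q W b u).
Proof.
move=> dW mphi lphi2 mb lb mu uphi; have lphi := L2_L1 mphi lphi2.
apply: (commutator_onE dW lphi lphi2 mb lb mu uphi).
apply: (@xgetPex _ (cst 0) [set h | is_commutator P F q W b u h]).
have [h Hh] := evaluation_exists dW mb lb lphi; exists h; left; exists phi; split => //.
- exact/LfunL2.
- exact/commutator_onP.
Qed.

End commutators.

End evaluation.

(** * The main estimate *)

Section class_K.
Context d (T : measurableType d) (R : realType) (P : probability T R).
Context (F : (set (set T))^nat) (SB : stochastic_basis P F).
Context (p q : R) (p1 : 1 <= p) (q1 : 1 <= q) (U : (T -> R) -> (T -> R)) (KU : K_class P F p q U).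
Implicit Types (f g h b c e phi psi Z : T -> R) (A B : set T) (n m k l N M : nat) (u v w a : nat -> T -> R).
Notation L1 f := (P.-integrable setT (EFin \o f)).
Notation Ex f := (Rintegral P setT f).
Notation mart := (mart P F).
Notation essbdd := (essbdd P).
Notation prev := (@Defs.prev d T R).
Notation mdiff := (@Defs.mdiff d T R).
Notation jump := (jump P F).
Notation evaluation := (evaluation P U).

Let opU : L1_operator P U := K_operator KU.
Let subU : sublinear_op P U := K_sublinear KU.
Let mUf f : L1 f -> measurable_fun setT (U f). Proof. exact: L1_op_measurable. Qed.

Lemma Lnorm_normr f : ('N[P]_(q%:E)[EFin \o (fun x => `|f x|%R)] = 'N[P]_(q%:E)[EFin \o f])%E.
Proof. exact: (Lnorm_abse P (EFin \o f) q%:E). Qed.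

Lemma H1_bound : exists2 C, 0 < C & forall w N, (forall k, (k < N)%N -> jump k (w k)) ->
  ('N[P]_(q%:E)[EFin \o U (fun x => (\sum_(k < N) w k x)%R)] <=
   (C * Ex (fun x => sqsum (w ^~ x) N))%R%:E)%E.
Proof.
have [C C0 HC] := K_H1 KU; exists C => // w N jw.
rewrite EFinM -(H1_finite SB jw); apply: HC; last exact: H1_finite_mart.
by apply/LfunL1/essbdd_L1; exact: finite_mart_essbdd jw.
Qed.

Lemma L1_bound : exists2 C, 0 < C & forall f, L1 f -> weak_le P q (U f) (C * Ex (fun x => `|f x|)).
Proof.
have [C C0 HC] := K_L1 KU; exists C => // f lf.
apply/weak_normP => //; first exact: mUf.
  by rewrite mulr_ge0 ?(ltW C0) //; apply: Ex_ge0; [exact: L1_norm|ae_intro].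
by rewrite EFinM -Lnorm1_Ex //; apply: HC; exact/LfunL1.
Qed.

Lemma L1_op_sum (J : eqType) (s : seq J) (f : J -> T -> R) : (forall i, L1 (f i)) ->
  {ae P, forall x, `|U (fun y => \sum_(i <- s) f i y) x| <= \sum_(i <- s) `|U (f i) x|}.
Proof.
move=> lf; elim: s => [|i s IH].
  ae_using (L1_op_scale subU 0 (L1_cst P 0)); ae_intro => x; rewrite normr0 !mul0r big_nil.
  apply: le_trans; rewrite le_eqVlt; apply/orP; left; apply/eqP; congr (`|U _ x|).
  by apply/funext => y; rewrite big_nil.
have ls : L1 (fun y => \sum_(j <- s) f j y) by apply: L1_sum.
have hs x : \sum_(j <- i :: s) f j x = f i x + \sum_(j <- s) f j x by rewrite big_cons.
ae_using IH; ae_using (L1_op_subadd subU (lf i) ls hs); ae_intro => x h1 h2.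
by rewrite big_cons (le_trans h1) // lerD2l.
Qed.

(** A majorant of U (c f - b(x) f) (x) expressed without freezing b(x): for r close to b(x) the last
    term disappears. Below, c is b_(n-1) and f a jump or an atom. *)
Definition controlled b c f Z := measurable_fun setT Z /\
  forall r : R, {ae P, forall x, `|U (fun y => c y * f y - r * f y) x| <= Z x + `|b x - r| * `|U f x|}.

(** The commutator with c controls U (c f - c(x) f) (x); passing from c(x) to b(x) costs |b - c| |U
    f|. These are the two quantities bounded in the conditions on atoms and jumps. *)
Lemma evaluation_controlled b c f e : measurable_fun setT b -> measurable_fun setT c -> L1 f ->
  evaluation (abs_op U) c (fun y => c y * f y) f e ->
  controlled b c f (fun x => `|e x| + `|(b x - c x) * U f x|).
Proof.
move=> mb mc lf [me He]; have mU := mUf lf; split.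
  by apply: measurable_funD; apply: measurableT_comp => //; apply: measurable_funM => //; exact: measurable_funB.
move=> r; ae_using (He r); ae_intro => x h; rewrite /abs_op in h.
have h1 : `|U (fun y => c y * f y - r * f y) x| <= `|e x| + `|c x - r| * `|U f x|.
  have := ler_normB (e x) (e x - `|U (fun y => c y * f y - r * f y) x|).
  by rewrite (_ : e x - (e x - _) = `|U (fun y => c y * f y - r * f y) x|); [rewrite normr_id; lra|ring].
have h2 : `|c x - r| <= `|b x - c x| + `|b x - r|.
  rewrite (_ : c x - r = (b x - r) - (b x - c x)); last by ring.
    by have := ler_normB (b x - r) (b x - c x); lra.
by have := ler_wpM2r (normr_ge0 (U f x)) h2; rewrite normrM; lra.
Qed.

(** Sublinearity directly gives |U (s f)| <= s |U f|; the reverse inequality, needed for the last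
    term, follows on multiplying by s^-1. *)
Lemma controlled_scale b c f Z (s : R) : 0 < s -> L1 f -> L1 (fun y => c y * f y) ->
  controlled b c f Z -> controlled b c (fun x => s * f x) (fun x => s * Z x).
Proof.
move=> s0 lf lcf [mZ H]; split; first exact: measurable_funM.
move=> r; have lr : L1 (fun y => c y * f y - r * f y) by apply: L1B => //; exact: L1Z.
ae_using (H r); ae_using (L1_op_scale subU s lr); ae_using (L1_op_scale subU s^-1 (L1Z s lf)).
ae_intro => x h1 h2 h3.
rewrite (_ : (fun y => s^-1 * (s * f y)) = f) in h1; last by apply/funext => y; rewrite mulKf // gt_eqF.
rewrite (_ : (fun y => s * (c y * f y - r * f y)) = fun y => c y * (s * f y) - r * (s * f y)) in h2; last first.
  by apply/funext => y; ring.
apply: le_trans h2 _; rewrite gtr0_norm //.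
rewrite normfV (gtr0_norm s0) ler_pdivlMl // in h1.
have := ler_wpM2l (ltW s0) h3; have := ler_wpM2l (normr_ge0 (b x - r)) h1; lra.
Qed.

Lemma bmo_prev b n : BMO P F p b -> measurable_fun setT b /\ essbdd (prev (mart b) n).
Proof.
move=> [/LfunL1 lb hb]; split; first exact: L1_measurable lb.
have [K K0 bK] := BMO_norm_fin hb.
have K1 : 0 < K + 1 by rewrite ltr_wpDl.
have bK' : (BMO_norm P F p b <= (K + 1)%:E)%E by rewrite bK lee_fin lerDl.
exact: (essbdd_prev_mart SB (bmo1_BMO SB p1 K1 lb bK')).
Qed.

Lemma commutator_controlled b n f (X : R) : BMO P F p b -> essbdd f -> 0 <= X ->
  ('N[P]_(q%:E)[EFin \o (fun x => (b x - prev (mart b) n x) * U f x)%R] <= X%:E)%E ->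
  ('N[P]_(q%:E)[EFin \o commutator P F q (abs_op U) (prev (mart b) n) (mart f)] <= X%:E)%E ->
  exists2 Z, controlled b (prev (mart b) n) f Z & ('N[P]_(q%:E)[EFin \o Z] <= (2 * X)%:E)%E.
Proof.
move=> bB bf X0 h1 h2; have [mb bc] := bmo_prev n bB; set c := prev _ n in bc *.
have mc := essbdd_measurable bc; have mf := essbdd_measurable bf; have lf := essbdd_L1 bf.
have He := commutator_L2 opU subU SB q1 (dominated_abs opU subU) mf (essbdd_L1 (essbddX bf)) mc
  (essbdd_L1 (essbddM bc bf)) (fun k => mart_measurable SB lf k) (fun n => aeW P (fun x => erefl)).
set e := commutator _ _ _ _ _ _ in He h2 *.
exists (fun x => `|e x| + `|(b x - c x) * U f x|); first exact: evaluation_controlled.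
have me := proj1 He; have mU : measurable_fun setT (fun x => (b x - c x) * U f x).
  by apply: measurable_funM; [exact: measurable_funB|exact: mUf].
apply: le_trans (minkowski_EFin P _ _ q1) _; try exact: measurableT_comp.
by rewrite !Lnorm_normr mulr_natl mulr2n EFinD leeD.
Qed.

Lemma jump_controlled : exists2 C, 0 < C & forall b K k h, BMO P F p b -> 0 < K ->
  (BMO_norm P F p b <= K%:E)%E -> jump k h ->
  exists2 Z, controlled b (prev (mart b) k) h Z &
    ('N[P]_(q%:E)[EFin \o Z] <= (C * K * Ex (fun x => `|h x|))%:E)%E.
Proof.
have [C C0 HC] := K_jump KU; exists (2 * C); first by rewrite mulr_gt0.
move=> b K k h bB K0 bK [ah bh h0]; have lh := essbdd_L1 bh.
have E0 : 0 <= Ex (fun x => `|h x|) by apply: Ex_ge0; [exact: L1_norm|ae_intro].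
have [] := HC k h b (And3 ah (proj2 (LfunL1 P h) lh) h0) bB.
rewrite Lnorm1_Ex // -EFinM => h1 h2.
have X0 : 0 <= C * Ex (fun x => `|h x|) * K by rewrite !mulr_ge0 // ltW.
have le_K : ((C * Ex (fun x => `|h x|))%:E * BMO_norm P F p b <= (C * Ex (fun x => `|h x|) * K)%:E)%E.
  by rewrite [leRHS]EFinM; apply: lee_wpmul2l => //; rewrite lee_fin mulr_ge0 // ltW.
have [Z cZ HZ] := commutator_controlled bB bh X0 (le_trans h1 le_K) (le_trans h2 le_K).
exists Z => //; apply: le_trans HZ _; rewrite lee_fin le_eqVlt; apply/orP; left; apply/eqP; ring.
Qed.

Lemma mart_scale f n (s : R) : L1 f ->
  {ae P, forall x, mart (fun y => s * f y) n x = s * mart f n x}.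
Proof.
move=> lf; have as_ : measurable_for (F n) (fun=> s) by exact: adapted_cst.
exact: (mart_pull SB as_ lf (L1Z s lf)).
Qed.

Lemma jumpZ k h (s : R) : jump k h -> jump k (fun x => s * h x).
Proof.
move=> [ah bh h0]; split; [|exact: essbddZ|].
- by apply: adaptedM => //; exact: adapted_cst.
- case: k h0 {ah} => [|k] h0 /=; first by ae_intro.
  have lh := essbdd_L1 bh.
  ae_using (mart_scale k s lh); ae_using h0.
  by ae_intro => x /= -> ->; rewrite mulr0.
Qed.

(** Division by s P(A) brings the conditional square function below 1 / P(A). The vanishing of the
    differences up to time n gives the zero conditional expectation and removes the term of index 0
    from the square function. *)
Lemma atomic_simple_atom N n A (s : R) a : atomic P F N n A s a -> 0 < Ex (\1_A) ->
  simple_atom P F n A (fun x => (s * Ex (\1_A))^-1 * \sum_(k < N) a k x).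
Proof.
move=> [FA s0 ja a0 asum] PA0.
have mA := filtration_measurable SB FA.
set sg := s * Ex (\1_A); have sg0 : 0 < sg by rewrite mulr_gt0.
pose w k x := sg^-1 * a k x.
have jw k : jump k (w k) by exact: jumpZ.
rewrite (_ : (fun x => _) = fun x => \sum_(k < N) w k x); last by apply/funext => x; rewrite mulr_sumr.
have bw k : essbdd (w k) by have [] := jw k.
have bf : essbdd (fun x => \sum_(k < N) w k x) by apply: essbdd_sum => k _.
split => //.
- exact/LfunL1/essbdd_L1.
- ae_using (finite_mart SB (fun k (_ : (k < N)%N) => jw k) n); ae_intro => x ->.
  by rewrite big1 // => k kn; rewrite /w a0 ?mulr0 //; left.
- move=> x /eqP fx; apply: contrapT => nA; apply: fx; rewrite big1 // => k _; rewrite /w a0 ?mulr0 //; by right.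
- have PAE : (P A)^-1%E = (Ex (\1_A))^-1%:E.
    by rewrite -Ex_indic1 // inver gt_eqF.
  rewrite PAE unlock /= probability_setT lte01; apply/ess_sup_inf.ess_supP.
  set f := fun x => _ in bf *; have lf := essbdd_L1 bf.
  have jwN k (_ : (k < N)%N) := jw k.
  pose wN k x := if (k < N)%N then w k x else 0.
  have bwN k : essbdd (wN k) by rewrite /wN; case: (k < N)%N => //; exact: essbdd_cst.
  have bd k : essbdd (mdiff (mart f) k).
    by apply: essbddB; [exact: essbdd_mart|apply: essbdd_prev => j; exact: essbdd_mart].
  have ld2 k : L1 (fun y => `|mdiff (mart f) k y| ^+ 2) by apply/essbdd_L1/essbddX/essbdd_norm.
  have lw2 k : L1 (fun y => wN k y ^+ 2) by apply/essbdd_L1/essbddX.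
  have dw k : {ae P, forall x, `|mdiff (mart f) k x| ^+ 2 = wN k x ^+ 2}.
    by ae_using (finite_mdiff SB jwN k); ae_intro => x ->; rewrite real_normK ?num_real.
  have ba k : essbdd (a k) by have [] := ja k.
  have la2 k : L1 (fun y => a k y ^+ 2) by exact/essbdd_L1/essbddX.
  (* The square function is built from the differences of the sum; these agree almost everywhere
     with the normalized jumps before N and with 0 afterwards. *)
  have cE m : {ae P, forall x, cond_exp P (F m) (fun y => (`|mdiff (mart f) m.+1 y| ^+ 2)%:E) x =
      (if (m.+1 < N)%N then sg^-1 ^+ 2 * mart (fun y => a m.+1 y ^+ 2) m x else 0)%:E}.
    ae_using (cond_exp_mart SB (ld2 m.+1) m); ae_using (mart_ae SB m (ld2 m.+1) (lw2 m.+1) (dw m.+1)).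
    have [mN|Nm] := ltnP m.+1 N.
      ae_using (mart_scale m (sg^-1 ^+ 2) (la2 m.+1)).
      ae_intro => x h1 h2 h3; rewrite h3 h2 -h1; congr (mart _ m x)%:E.
      by apply/funext => y; rewrite /wN mN /w exprMn.
    ae_using (mart_cst SB 0 m); ae_intro => x h1 h2 h3; rewrite h3 h2 -[in RHS]h1; congr (mart _ m x)%:E.
    by apply/funext => y; rewrite /wN ltnNge Nm /= expr0n.
  have nn m : {ae P, forall x, 0 <= mart (fun y => a m.+1 y ^+ 2) m x}.
    by apply: mart_ge0 => //; ae_intro => x; exact: sqr_ge0.
  ae_using (ae_countable (P := P) nn); ae_using (ae_countable (P := P) cE); ae_using asum; ae_using (dw 0%N); ae_intro => x d0 hs hE hnn.
  rewrite /= gee0_abs ?poweR_ge0 // /cond_square_fun.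
  have w00 : wN 0%N x = 0 by rewrite /wN /w a0 ?mulr0 ?if_same //; left.
  rewrite d0 w00 expr0n add0e (eq_eseriesr (fun m _ => hE m)).
  rewrite (@eseries_finite _ _ N.-1); last first.
    move=> m Nm; rewrite (_ : (m.+1 < N)%N = false) //.
    by apply/negbTE; rewrite -leqNgt; case: (N) Nm.
  have PA1 : 0 < (Ex (\1_A))^-1 by rewrite invr_gt0.
  have -> : (((Ex (\1_A))^-1)%:E = (((Ex (\1_A))^-1) ^+ 2)%:E `^ 2^-1)%E.
    by rewrite poweR_EFin powR12_sqrt ?sqr_ge0 // sqrtr_sqr gtr0_norm.
  set S := \sum_(k < N.-1) _.
  have S0 : 0 <= S by apply: sumr_ge0 => k _; case: ifP => // _; rewrite mulr_ge0 ?sqr_ge0.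
  apply: gt0_ler_poweR; rewrite ?in_itv /= ?leey ?andbT ?lee_fin ?sqr_ge0 //.
  have SE : S = sg^-1 ^+ 2 * \sum_(k < N) prev (mart (fun y => a k y ^+ 2)) k x.
    rewrite /S; case: (N) => [|M] /=; first by rewrite !big_ord0 mulr0.
    rewrite big_ord_recl /= add0r mulr_sumr; apply: eq_bigr => k _.
    by rewrite ltnS ltn_ord.
  rewrite SE; apply: le_trans (ler_wpM2l (sqr_ge0 _) hs) _.
  rewrite -exprMn /sg invfM mulrAC mulVf ?mul1r // gt_eqF //.
Qed.

Lemma controlled_ae0 b c f Z : L1 f -> L1 (fun y => c y * f y) -> {ae P, forall x, f x = 0} ->
  measurable_fun setT Z -> (forall x, 0 <= Z x) -> controlled b c f Z.
Proof.
move=> lf lcf f0 mZ Z0; split => // r.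
have lr : L1 (fun y => c y * f y - r * f y) by apply: L1B => //; exact: L1Z.
have e : {ae P, forall x, c x * f x - r * f x = 0 * f x} by ae_using f0; ae_intro => x ->; ring.
ae_using (L1_op_ae opU lr (L1Z 0 lf) e); ae_using (L1_op_scale subU 0 lf); ae_intro => x h ->.
rewrite normr0 mul0r in h; apply: le_trans h _.
by rewrite addr_ge0 // mulr_ge0.
Qed.

Lemma atom_controlled : exists2 C, 0 < C & forall b K N n A (s : R) a, BMO P F p b -> 0 < K ->
  (BMO_norm P F p b <= K%:E)%E -> atomic P F N n A s a ->
  exists2 Z, controlled b (prev (mart b) n) (fun x => \sum_(k < N) a k x) Z &
    ('N[P]_(q%:E)[EFin \o Z] <= (C * K * (s * Ex (\1_A)))%:E)%E.
Proof.
have [C C0 HC] := K_atom KU; exists (2 * C); first by rewrite mulr_gt0.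
move=> b K N n A s a bB K0 bK at_; have [FA s0 ja a0 asum] := at_.
have [mb bc] := bmo_prev n bB.
have mA := filtration_measurable SB FA.
have ba k : essbdd (a k) by have [] := ja k.
have bf : essbdd (fun x => \sum_(k < N) a k x) by apply: essbdd_sum.
have lf := essbdd_L1 bf; have lcf := essbdd_L1 (essbddM bc bf).
have EA0 : 0 <= Ex (\1_A : T -> R) by exact: Rintegral_ge0.
(* If P(A) = 0 no normalization exists, but the sum vanishes almost everywhere and Z = 0 serves. *)
move: (EA0); rewrite le_eqVlt => /orP[/eqP EA|EA].
  exists (fun=> 0).
    apply: controlled_ae0 => //.
    have li : L1 (\1_A : T -> R) by exact/essbdd_L1/essbdd_indic.
    have : {ae P, forall x, \1_A x = 0 :> R} by apply: Ex_eq0 => //; [ae_intro|rewrite -EA].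
    apply: filterS => x; rewrite indicE; case: (boolP (x \in A)) => [_ /eqP|/negP nA _]; first by rewrite oner_eq0.
    by rewrite big1 // => k _; apply: a0; right => xA; apply: nA; exact/mem_set.
  apply/Lnorm_leP => //; first by rewrite -EA !mulr0.
  rewrite normr0 powR0 ?integral0 ?lee_fin ?powR_ge0 // gt_eqF // (lt_le_trans _ q1) //.
have sa := atomic_simple_atom at_ EA; set f' := fun x => _ in sa.
have bf' : essbdd f' by exact: essbddZ.
have [h1 h2] := HC n A f' b sa bB.
have le_K : (C%:E * BMO_norm P F p b <= (C * K)%:E)%E.
  by rewrite EFinM; apply: lee_wpmul2l => //; rewrite lee_fin ltW.
have CK0 : 0 <= C * K by rewrite mulr_ge0 // ltW.
have [Z cZ HZ] := commutator_controlled bB bf' CK0 (le_trans h1 le_K) (le_trans h2 le_K).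
have sg0 : 0 < s * Ex (\1_A) by rewrite mulr_gt0.
exists (fun x => s * Ex (\1_A) * Z x).
  have := controlled_scale sg0 (essbdd_L1 bf') (essbdd_L1 (essbddM bc bf')) cZ.
  by congr controlled; apply/funext => x; rewrite /f' mulVKf // gt_eqF.
have := Lnorm_scale (s * Ex (\1_A)) q1 (proj1 cZ) _ HZ; rewrite gtr0_norm // => H.
apply: le_trans (H _) _; first by rewrite mulr_ge0.
by rewrite lee_fin le_eqVlt; apply/orP; left; apply/eqP; ring.
Qed.

Lemma evaluation_le b psi phi h Z D : measurable_fun setT b -> L1 psi -> L1 phi ->
  evaluation (abs_op U) b psi phi h ->
  (forall r : rat, {ae P, forall x, `|U (fun y => psi y - ratr r * phi y) x| <= Z x + `|b x - ratr r| * D x}) ->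
  {ae P, forall x, `|h x| <= Z x}.
Proof.
move=> mb lpsi lphi [mh Hh] H.
have : {ae P, forall x, `|h x| - Z x <= 0}.
  apply: (@ae_le0_dense1 _ _ _ P b _ (fun x => D x + `|U phi x|)) => r.
  ae_using (H r); ae_using (Hh (ratr r)); ae_intro => x h1 h2; rewrite /abs_op in h1.
  have := ler_normD (h x - `|U (fun y => psi y - ratr r * phi y) x|) `|U (fun y => psi y - ratr r * phi y) x|.
  rewrite subrK normr_id; lra.
by apply: filterS => x; rewrite subr_le0.
Qed.

(** Subadditivity splits U (psi - r phi) into the U (g_j), bounded outright, and the U (c_j f_j - r
    f_j), bounded by Z_j up to a multiple of |b - r|. The split is made for each rational r, before
    r tends to b(x). *)
Lemma pieces_estimate (J : finType) b psi phi h (f g c Z : J -> T -> R) (X Y : J -> R) :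
  measurable_fun setT b -> L1 psi -> L1 phi -> evaluation (abs_op U) b psi phi h ->
  (forall j, L1 (f j)) -> (forall j, L1 (g j)) -> (forall j, L1 (fun x => c j x * f j x)) ->
  {ae P, forall x, psi x = \sum_j (g j x + c j x * f j x)} ->
  {ae P, forall x, phi x = \sum_j f j x} ->
  (forall j, controlled b (c j) (f j) (Z j)) ->
  (forall j, ('N[P]_(q%:E)[EFin \o U (g j)] <= (X j)%:E)%E) ->
  (forall j, ('N[P]_(q%:E)[EFin \o Z j] <= (Y j)%:E)%E) ->
  ('N[P]_(q%:E)[EFin \o h] <= (\sum_j (X j + Y j)%R)%:E)%E.
Proof.
move=> mb lpsi lphi Hh lf lg lcf psiE phiE cZ hX hY.
pose Zt x := \sum_j (`|U (g j) x| + `|Z j x|).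
have mZ j := proj1 (cZ j); have mg j := mUf (lg j).
have mZj j : measurable_fun setT (fun x => `|U (g j) x| + `|Z j x|).
  by apply: measurable_funD; exact: measurableT_comp.
have mZt : measurable_fun setT Zt by apply: measurable_sum.
have hZ : {ae P, forall x, `|h x| <= Zt x}.
  apply: (evaluation_le (D := fun x => \sum_j `|U (f j) x|) mb lpsi lphi Hh) => r.
  have lcr j : L1 (fun y => c j y * f j y - ratr r * f j y) by apply: L1B => //; exact: L1Z.
  have lgc j : L1 (fun y => g j y + (c j y * f j y - ratr r * f j y)) by exact: L1D.
  have lr : L1 (fun y => psi y - ratr r * phi y) by apply: L1B => //; exact: L1Z.
  have e : {ae P, forall x, psi x - ratr r * phi x = \sum_j (g j x + (c j x * f j x - ratr r * f j x))}.
    ae_using psiE; ae_using phiE; ae_intro => x -> ->; rewrite mulr_sumr -sumrB.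
    by apply: eq_bigr => j _; rewrite addrA.
  have lsum : L1 (fun x => \sum_j (g j x + (c j x * f j x - ratr r * f j x))) by apply: L1_sum.
  ae_using (L1_op_ae opU lr lsum e).
  ae_using (L1_op_sum (index_enum J) lgc).
  ae_using (ae_countable (P := P) (fun j => L1_op_subadd subU (lg j) (lcr j) (fun x => erefl))).
  ae_using (ae_countable (P := P) (fun j => proj2 (cZ j) (ratr r))).
  ae_intro => x h1 h2 h3 ->; apply: le_trans h3 _; rewrite mulr_sumr -big_split /=; apply: ler_sum => j _.
  apply: le_trans (h2 j) _; rewrite -addrA lerD2l; apply: le_trans (h1 j) _.
  by rewrite lerD2r ler_norm.
apply: le_trans (_ : ('N[P]_(q%:E)[EFin \o Zt] <= _)%E).
  apply: Lnorm_le_ae => //; first exact: proj1 Hh.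
  by ae_using hZ; ae_intro => x hx; apply: le_trans hx _; exact: ler_norm.
apply: Lnorm_sum => // j _; rewrite EFinD.
apply: le_trans (minkowski_EFin P _ _ q1) _; try exact: measurableT_comp.
by rewrite !Lnorm_normr leeD.
Qed.

Section main_estimate.
Context (CH CJ CA : R) (CH0 : 0 < CH) (CJ0 : 0 < CJ) (CA0 : 0 < CA).
Hypothesis HH : forall w N, (forall k, (k < N)%N -> jump k (w k)) ->
  ('N[P]_(q%:E)[EFin \o U (fun x => (\sum_(k < N) w k x)%R)] <=
   (CH * Ex (fun x => sqsum (w ^~ x) N))%R%:E)%E.
Hypothesis HJ : forall b K k h, BMO P F p b -> 0 < K ->
  (BMO_norm P F p b <= K%:E)%E -> jump k h ->
  exists2 Z, controlled b (prev (mart b) k) h Z &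
    ('N[P]_(q%:E)[EFin \o Z] <= (CJ * K * Ex (fun x => `|h x|))%:E)%E.
Hypothesis HA : forall b K N n A (s : R) a, BMO P F p b -> 0 < K ->
  (BMO_norm P F p b <= K%:E)%E -> atomic P F N n A s a ->
  exists2 Z, controlled b (prev (mart b) n) (fun x => \sum_(k < N) a k x) Z &
    ('N[P]_(q%:E)[EFin \o Z] <= (CA * K * (s * Ex (\1_A)))%:E)%E.

Context (b : T -> R) (K : R) (bB : BMO P F p b) (K0 : 0 < K) (bK : (BMO_norm P F p b <= K%:E)%E).
Context (N' : nat) (v : nat -> T -> R) (jv : forall k, jump k (v k)).
Let N := N'.+1.
Let c k := prev (mart b) k.
Let dd k := mdiff (mart b) k.
Let lb : L1 b. Proof. by case: bB => /LfunL1. Qed.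
Let mb : measurable_fun setT b. Proof. exact: L1_measurable lb. Qed.
Let K20 : 0 < 2 * K. Proof. exact: mulr_gt0. Qed.
Let b1 : bmo1 P F (2 * K) b. Proof. exact: bmo1_BMO bK. Qed.
Let bc k : essbdd (c k). Proof. exact: (essbdd_prev_mart SB b1). Qed.
Let bdd k : essbdd (dd k). Proof. exact: (essbdd_bmo_mdiff SB b1). Qed.
Let psi x := \sum_(k < N) v k x * (c N x - dd k x).
Let phi x := \sum_(k < N) v k x.
Let S x := sqsum (v ^~ x) N.

(** Each jump h_k contributes c_k h_k plus its products with later differences of b, and each atom
    c_n times itself plus the two paraproducts. As [bmo1] holds with 2K, the constants are 10, twice
    5, and 28, twice 9 + 5. *)
Lemma finite_estimate_eta h (eta : R) : 0 < eta -> evaluation (abs_op U) b psi phi h ->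
  ('N[P]_(q%:E)[EFin \o h] <= ((10 * CH + CJ) * K * (6 * Ex S) + (28 * CH + CA) * K * (8 * Ex S + 3 * eta))%:E)%E.
Proof.
move=> eta0 Hh.
have [I [n [A [s [a [hh [at_ jh vE hhS sS]]]]]]] := davis_decomposition SB N' jv eta0.
have bv k : essbdd (v k) by have [] := jv k.
have bhh k : essbdd (hh k) by have [] := jh k.
have ba i k : essbdd (a i k) by have [_ _ /(_ k) [_ ba _] _ _] := at_ i.
have HZJ k : exists Z, controlled b (c k) (hh k) Z /\
    ('N[P]_(q%:E)[EFin \o Z] <= (CJ * K * Ex (fun x => `|hh k x|))%:E)%E.
  by have [Z ? ?] := HJ bB K0 bK (jh k); exists Z.
have [ZJ HZJ'] := choice HZJ.
have HZA i : exists Z, controlled b (c (n i)) (fun x => \sum_(k < N) a i k x) Z /\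
    ('N[P]_(q%:E)[EFin \o Z] <= (CA * K * (s i * Ex (\1_(A i))))%:E)%E.
  by have [Z ? ?] := HA bB K0 bK (at_ i); exists Z.
have [ZA HZA'] := choice HZA.
have [lh mhh] : (forall k, L1 (hh k)) /\ (forall k, 0 <= Ex (fun x => `|hh k x|)).
  by split => k; [exact: essbdd_L1|apply: Ex_ge0; [exact/L1_norm/essbdd_L1|ae_intro]].
pose J := ('I_N + I)%type.
pose f (j : J) x := match j with inl k => hh k x | inr i => \sum_(k < N) a i k x end.
pose g (j : J) x := match j with
  | inl k => \sum_(l < N) jump_para P F b k (hh k) l x
  | inr i => \sum_(l < N) para1 P F b (a i) l x + \sum_(k < N) para2 P F b (n i) (a i) k x end.
pose cc (j : J) := match j with inl k => c k | inr i => c (n i) end.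
pose Z (j : J) := match j with inl k => ZJ k | inr i => ZA i end.
pose X (j : J) := match j with inl k => 10 * CH * K * Ex (fun x => `|hh k x|)
  | inr i => 28 * CH * K * (s i * Ex (\1_(A i))) end.
pose Y (j : J) := match j with inl k => CJ * K * Ex (fun x => `|hh k x|)
  | inr i => CA * K * (s i * Ex (\1_(A i))) end.
have jp k l : jump l (jump_para P F b k (hh k) l) by exact: (jump_para_jump SB b1).
have jp1 i l : jump l (para1 P F b (a i) l) by exact: (para1_jump SB b1 (at_ i)).
have jp2 i l : jump l (para2 P F b (n i) (a i) l) by exact: (para2_jump SB b1 (at_ i)).
have bsum (w : nat -> T -> R) : (forall l, jump l (w l)) -> essbdd (fun x => \sum_(l < N) w l x).
  by move=> jw; apply: essbdd_sum => l _; have [] := jw l.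
have bf j : essbdd (f j) by case: j => [k|i]; rewrite /f; [exact: bhh|apply: essbdd_sum => k _; exact: ba].
have bg j : essbdd (g j) by case: j => [k|i]; rewrite /g; [exact (bsum _ (jp k))|exact: (essbddD (bsum _ (jp1 i)) (bsum _ (jp2 i)))].
have bcc j : essbdd (cc j) by case: j => [k|i]; rewrite /cc; exact: bc.
have lpsi : L1 psi by apply/essbdd_L1/essbdd_sum => k _; apply: essbddM => //; exact: essbddB.
have lphi : L1 phi by apply/essbdd_L1/essbdd_sum.
apply: le_trans (pieces_estimate mb lpsi lphi Hh (f := f) (g := g) (c := cc) (Z := Z) (X := X) (Y := Y) _ _ _ _ _ _ _ _) _.
- by move=> j; exact: essbdd_L1.
- by move=> j; exact: essbdd_L1.
- by move=> j; apply: essbdd_L1; exact: essbddM.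
(* For a jump at k, c_N - d_k b = (c_N - c_(k+1)) + c_k: the first part is [jump_para], the second
   the controlled term. *)
- ae_using vE; ae_intro => x hv; rewrite big_sumType /=.
  rewrite (eq_bigr (fun k : 'I_N => hh k x * (c N x - dd k x))) => [|k _]; last first.
    by rewrite sum_jump_para // -/(c N) -/(c k.+1) /c prev_mdiff -/(dd k) -/(c k); ring.
  rewrite [X in _ = _ + X](eq_bigr (fun i => \sum_(k < N) a i k x * (c N x - dd k x))) => [|i _]; last first.
    by rewrite (paraproduct_identity P F b N (n i)).
  rewrite /psi exchange_big /= -big_split /=; apply: eq_bigr => k _.
  by rewrite (hv k (ltn_ord k)) mulrDl mulr_suml.
- ae_using vE; ae_intro => x hv; rewrite big_sumType /= exchange_big /= -big_split /=.
  by apply: eq_bigr => k _; exact: hv.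
- by case=> [k|i]; [have [] := HZJ' k|have [] := HZA' i].
- case=> [k|i] /=.
    apply: le_trans (HH (fun l _ => jp k l)) _; rewrite lee_fin.
    have := jump_para_bound SB K20 b1 (ltn_ord k) (jh k) => /(ler_wpM2l (ltW CH0)).
    by move/le_trans; apply; rewrite le_eqVlt; apply/orP; left; apply/eqP; ring.
  have l1 := essbdd_L1 (bsum _ (jp1 i)); have l2 := essbdd_L1 (bsum _ (jp2 i)).
  have m1 := mUf l1; have m2 := mUf l2.
  pose G x := `|U (fun x => \sum_(l < N) para1 P F b (a i) l x) x| + `|U (fun x => \sum_(k < N) para2 P F b (n i) (a i) k x) x|.
  have mG : measurable_fun setT G by apply: measurable_funD; exact: measurableT_comp.
  apply: le_trans (_ : ('N[P]_(q%:E)[EFin \o G] <= _)%E).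
    apply: Lnorm_le_ae => //; first exact/mUf/(essbdd_L1 (bg (inr i))).
    ae_using (L1_op_subadd subU l1 l2 (fun x => erefl)); ae_intro => x hx.
    by rewrite [leRHS]ger0_norm // addr_ge0.
  apply: le_trans (minkowski_EFin P _ _ q1) _; try exact: measurableT_comp.
  have B1 := para1_bound SB K20 b1 (at_ i); have B2 := para2_bound SB K20 b1 (at_ i).
  apply: le_trans (_ : ((CH * (9 * s i * (2 * K) * Ex (\1_(A i))))%:E + (CH * (5 * s i * (2 * K) * Ex (\1_(A i))))%:E <= _)%E).
    apply: leeD.
      rewrite Lnorm_normr; apply: le_trans (HH (fun l _ => jp1 i l)) _.
      by rewrite lee_fin ler_wpM2l ?(ltW CH0).
    rewrite Lnorm_normr; apply: le_trans (HH (fun l _ => jp2 i l)) _.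
    by rewrite lee_fin ler_wpM2l ?(ltW CH0).
  by rewrite -EFinD lee_fin le_eqVlt; apply/orP; left; apply/eqP; ring.
- by case=> [k|i]; [have [] := HZJ' k|have [] := HZA' i].
rewrite lee_fin big_sumType /=.
rewrite (eq_bigr (fun k : 'I_N => (10 * CH + CJ) * K * Ex (fun x => `|hh k x|))) => [|k _]; last by ring.
rewrite [X in _ + X <= _](eq_bigr (fun i => (28 * CH + CA) * K * (s i * Ex (\1_(A i))))) => [|i _]; last by ring.
rewrite -!mulr_sumr; apply: lerD; apply: ler_wpM2l => //.
  by rewrite mulr_ge0 ?(ltW K0) // addr_ge0 ?mulr_ge0 ?(ltW CH0) ?(ltW CJ0).
by rewrite mulr_ge0 ?(ltW K0) // addr_ge0 ?mulr_ge0 ?(ltW CH0) ?(ltW CA0).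
Qed.

(** The lowest level eta is arbitrary and may tend to 0; 284 is 6 times 10 plus 8 times 28. *)
Lemma finite_estimate h : evaluation (abs_op U) b psi phi h ->
  ('N[P]_(q%:E)[EFin \o h] <= ((284 * CH + 6 * CJ + 8 * CA) * K * Ex S)%:E)%E.
Proof.
move=> Hh; apply/lee_addgt0Pr => e e0.
have C0 : 0 < 3 * (28 * CH + CA) * K by rewrite !mulr_gt0 // addr_gt0 // mulr_gt0.
apply: le_trans (finite_estimate_eta (divr_gt0 e0 C0) Hh) _; rewrite -EFinD lee_fin.
rewrite le_eqVlt; apply/orP; left; apply/eqP; field.
by rewrite ?gt_eqF // ?addr_gt0 ?mulr_gt0.
Qed.

End main_estimate.

End class_K.

Lemma cvg_fast_cauchy (R : realType) (a : nat -> R) :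
  (exists N, forall i, (N <= i)%N -> `|a i.+1 - a i| <= 2^-1 ^+ i) -> cvgn a.
Proof.
move=> [N HN]; apply/cauchy_cvgP/cauchy_exP => e e0 /=.
have [M HM] := @exp_half_le R (e / 4) (divr_gt0 e0 (ltr0n _ 4)).
pose K := maxn N M.
have HK : 2^-1 ^+ K <= e / 4 :> R.
  by apply: le_trans HM; apply: ler_wiXn2l; rewrite ?invr_ge0 ?leq_maxr // invf_le1 // ler1n.
have D j : `|a K - a (K + j)%N| <= 2 * 2^-1 ^+ K - 2 * 2^-1 ^+ (K + j).
  elim: j => [|j IH]; first by rewrite addn0 !subrr normr0.
  rewrite addnS -[a K - _](subrKA (a (K + j)%N)); apply: le_trans (ler_normD _ _) _.
  have := HN (K + j)%N (leq_trans (leq_maxl N M) (leq_addr _ _)); rewrite distrC exprS; lra.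
exists (a K); exists K => // i /= Ki; rewrite /ball /= -(subnKC Ki).
apply: le_lt_trans (D _) _; have : (0 : R) <= 2^-1 ^+ (K + (i - K)) by rewrite exprn_ge0 // invr_ge0.
lra.
Qed.

(** * Extension to H1 *)

Section approximation.
Context d (T : measurableType d) (R : realType) (P : probability T R).
Context (F : (set (set T))^nat) (SB : stochastic_basis P F).
Implicit Types (f g h b c e phi psi Z : T -> R) (n m k l N M : nat) (u v w a : nat -> T -> R).
Notation L1 f := (P.-integrable setT (EFin \o f)).
Notation Ex f := (Rintegral P setT f).
Notation mart := (mart P F).
Notation essbdd := (essbdd P).
Notation prev := (@Defs.prev d T R).
Notation mdiff := (@Defs.mdiff d T R).
Notation jump := (jump P F).
Notation H1_norm := (H1_norm P).

Definition L2 phi := measurable_fun setT phi /\ L1 (fun x => phi x ^+ 2).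

Lemma L2_lin phi psi (s t : R) : L2 phi -> L2 psi -> L2 (fun x => s * phi x + t * psi x).
Proof.
move=> [mf lf] [mg lg]; split; first by apply: measurable_funD; exact: measurable_funM.
have := L1D (L1D (L1Z (s ^+ 2) lf) (L1Z (t ^+ 2) lg)) (L1Z (2 * s * t) (L1_sqr mf mg lf lg)).
by congr (integrable _ _ _); apply/funext => x /=; congr EFin; ring.
Qed.

Lemma essbdd_L2 phi : essbdd phi -> L2 phi.
Proof. by move=> bphi; split; [exact: essbdd_measurable bphi|exact/essbdd_L1/essbddX]. Qed.

Definition H1_dist_le u v (e : R) := (H1_norm (fun n x => u n x - v n x)%R <= e%:E)%E.

Lemma mdiff_sub u v k x : mdiff (fun n x => u n x - v n x) k x = mdiff u k x - mdiff v k x.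
Proof. by rewrite /Defs.mdiff; case: k => [|k] /=; ring. Qed.

Lemma H1_dist_triangle u v w (e e' : R) : (forall k, L1 (u k)) -> (forall k, L1 (v k)) -> (forall k, L1 (w k)) ->
  H1_dist_le u v e -> H1_dist_le w v e' -> H1_dist_le u w (2 * (e + e')).
Proof.
move=> lu lv lw h h'; rewrite /H1_dist_le (_ : 2 * (e + e') = 2 * 1 * e + 2 * 1 * e'); last by ring.
apply: (H1_norm_lin _ _ _ _ _ _ h h') => //; try by move=> k; exact: L1B.
by move=> k; ae_intro => x; rewrite !mdiff_sub !mul1r -(subrKA (mdiff v k x)) (distrC (mdiff w k x)) ler_normD.
Qed.

Lemma H1_dist_lin u u' v v' (s t e e' : R) : (forall k, L1 (u k)) -> (forall k, L1 (v k)) ->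
  (forall k, L1 (u' k)) -> (forall k, L1 (v' k)) ->
  H1_dist_le u u' e -> H1_dist_le v v' e' ->
  H1_dist_le (fun n x => s * u n x + t * v n x) (fun n x => s * u' n x + t * v' n x)
    (2 * `|s| * e + 2 * `|t| * e').
Proof.
move=> lu lv lu' lv' h h'; apply: (H1_norm_lin _ _ _ _ _ _ h h') => //; try by move=> k; exact: L1B.
  by move=> k; apply: L1B; apply: L1D; exact: L1Z.
move=> k; ae_intro => x; rewrite !mdiff_sub -!normrM.
apply: le_trans (ler_normD _ _); rewrite le_eqVlt; apply/orP; left; apply/eqP; congr (`|_|).
by rewrite /Defs.mdiff; case: k => [|k] /=; ring.
Qed.

Lemma H1_dist_ae u u' v v' (e : R) : (forall k, measurable_fun setT (u k)) -> (forall k, measurable_fun setT (v k)) ->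
  (forall k, measurable_fun setT (u' k)) -> (forall k, measurable_fun setT (v' k)) ->
  (forall n, {ae P, forall x, u n x = u' n x}) -> (forall n, {ae P, forall x, v n x = v' n x}) ->
  H1_dist_le u v e -> H1_dist_le u' v' e.
Proof.
move=> mu mv mu' mv' uu' vv'; rewrite /H1_dist_le (@ae_eq_H1_norm _ _ _ P _ (fun n x => u' n x - v' n x)) //.
- by move=> k; exact: measurable_funB.
- by move=> k; exact: measurable_funB.
- by move=> k; apply: ae_mdiff => n; ae_using (uu' n); ae_using (vv' n); ae_intro => x -> ->.
Qed.

Lemma H1_dist_norm u v (e e' : R) : (forall k, L1 (u k)) -> (forall k, L1 (v k)) ->
  H1_dist_le u v e -> (H1_norm v <= e'%:E)%E -> (H1_norm u <= (2 * (e + e'))%:E)%E.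
Proof.
move=> lu lv h h'; rewrite (_ : 2 * (e + e') = 2 * 1 * e + 2 * 1 * e'); last by ring.
apply: (H1_norm_lin _ _ _ _ _ _ h h') => //; try by move=> k; exact: L1B.
by move=> k; ae_intro => x; rewrite !mdiff_sub !mul1r -{1}(subrK (mdiff v k x) (mdiff u k x)) ler_normD.
Qed.

Lemma H1_mart_L2 phi : L2 phi -> H1 P F (mart phi).
Proof.
move=> [mphi lphi2]; have lphi := L2_L1 mphi lphi2; split; first exact: mart_is_martingale.
have E0 : 0 <= Ex (fun x => phi x ^+ 2) by apply: Ex_ge0 => //; ae_intro => x; exact: sqr_ge0.
have e0 : 0 < Ex (fun x => phi x ^+ 2) + 1 by rewrite ltr_wpDl.
apply: le_lt_trans (H1_norm_L2 SB e0 mphi lphi2 _) (ltry _); nra.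
Qed.

Lemma is_Lsum_lin b (K : R) u v g h (s t : R) : bmo1 P F K b -> (forall k, L1 (u k)) -> (forall k, L1 (v k)) ->
  is_Lsum P F u b g -> is_Lsum P F v b h ->
  is_Lsum P F (fun n x => s * u n x + t * v n x) b (fun x => s * g x + t * h x).
Proof.
move=> bK lu lv [lg Hg] [lh Hh]; split; first by apply: L1D; exact: L1Z.
move=> e e0; have [N HN] := L1_limit_lin s t (fun n => L1_product_series SB bK n lu) (fun n => L1_product_series SB bK n lv) lg lh Hg Hh e0.
exists N => n Nn; apply: le_trans (HN n Nn); rewrite le_eqVlt; apply/orP; left; apply/eqP.
congr (Rintegral P _ _); apply/funext => x; congr (`|_ - _|).
rewrite /product_series !mulr_sumr -big_split /=.
by apply: eq_bigr => k _; rewrite /Defs.mdiff; case: (nat_of_ord k) => [|j] /=; ring.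
Qed.

Section L2_approximation.
Context (b : T -> R) (K : R) (K0 : 0 < K) (bK : bmo1 P F K b).
Let lb : L1 b. Proof. exact: bmo1_L1 bK. Qed.
Let lb2 : L1 (fun x => b x ^+ 2). Proof. exact: (bmo1_L2 SB K0 bK). Qed.
Let mb : measurable_fun setT b. Proof. exact: L1_measurable lb. Qed.

Lemma L1_bmoM phi : L2 phi -> L1 (fun x => b x * phi x).
Proof. by move=> [mphi lphi2]; exact: L1_sqr. Qed.

(** phi is replaced by a bounded g known at some time, and N' is taken so large that g (b - b_(N'))
    is small too. The error splits into b (phi - f), f (b - b_(N')) and the difference of the two
    series L, each small in L^1. *)
Lemma L2_approximation phi : L2 phi -> forall eta : R, 0 < eta -> exists N' v,
  let f := fun x => \sum_(k < N'.+1) v k x in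
  [/\ forall k, jump k (v k),
      Ex (fun x => `|phi x - f x|) <= eta,
      H1_dist_le (mart phi) (mart f) eta &
      Ex (fun x => `|(b x * phi x - Lsum P F (mart phi) b x) -
         \sum_(k < N'.+1) v k x * (prev (mart b) N'.+1 x - mdiff (mart b) k x)|) <=
      (Ex (fun x => b x ^+ 2) + 6 * K + 2) * eta].
Proof.
move=> phi2 eta eta0; have [mphi lphi2] := phi2; have lphi := L2_L1 mphi lphi2.
have eta2 : 0 < eta ^+ 2 by rewrite exprn_gt0.
have [n [g [ag bg Eg]]] := approximable_L2 SB mphi lphi2 eta2.
have [mg [Cg HCg]] := bg; have lg := essbdd_L1 bg.
have C1 : 0 < `|Cg| + 1 by rewrite ltr_wpDl.
have [M HM] := levy SB lb (divr_gt0 eta0 C1).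
pose N' := maxn n M; exists N', (mdiff (mart g)) => f.
have fE : {ae P, forall x, f x = g x}.
  ae_using (mart_id SB (leq_maxl n M) ag lg); ae_intro => x hx.
  by rewrite /f sum_mdiff /= hx.
have jv k : jump k (mdiff (mart g) k).
  apply: jump_mdiff => //; apply: essbddB; first exact: essbdd_mart.
  by apply: essbdd_prev => j; exact: essbdd_mart.
have bv k : essbdd (mdiff (mart g) k) by have [] := jv k.
have bf : essbdd f by apply: essbdd_sum.
have lf := essbdd_L1 bf; have mf := essbdd_measurable bf.
have f2 := essbdd_L2 bf; have d2 := L2_lin 1 (-1) phi2 f2.
have dE x : 1 * phi x + -1 * f x = phi x - f x by ring.
have [md ld2] : L2 (fun x => phi x - f x) by move: d2; congr L2; apply/funext => x.
have Ed : Ex (fun x => (phi x - f x) ^+ 2) <= eta ^+ 2.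
  apply: le_trans Eg; apply: Ex_le => //; first exact: L2B mphi mg lphi2 (essbdd_L1 (essbddX bg)).
  by ae_using fE; ae_intro => x ->.
have ld := L2_L1 md ld2.
have H1d : H1_dist_le (mart phi) (mart f) eta.
  have := H1_norm_L2 SB eta0 md ld2 Ed; rewrite /H1_dist_le (@ae_eq_H1_norm _ _ _ P _ (fun n x => mart phi n x - mart f n x)) //.
  - by move=> k; exact: mart_measurable.
  - by move=> k; apply: measurable_funB; exact: mart_measurable.
  - by move=> k; apply: ae_mdiff => j; exact: martB.
have small h : measurable_fun setT h -> L1 (fun x => h x ^+ 2) ->
    Ex (fun x => `|h x * (phi x - f x)|) <= 2^-1 * (Ex (fun x => h x ^+ 2) + 1) * eta.
  move=> mh lh2; have lhd := L1_sqr mh md lh2 ld2.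
  apply: (@le_trans _ _ (Ex (fun x => (eta / 2) * h x ^+ 2 + (2 * eta)^-1 * (phi x - f x) ^+ 2))).
    apply: Ex_le; [exact: L1_norm|by apply: L1D; exact: L1Z|ae_intro => x].
    rewrite normrM; set s := `|h x|; set t := `|phi x - f x|.
    rewrite -(real_normK (num_real (h x))) -(real_normK (num_real (phi x - f x))) -/s -/t.
    rewrite -subr_ge0 (_ : _ - _ = (eta * s - t) ^+ 2 / (2 * eta)); last by field; rewrite gt_eqF.
    by rewrite divr_ge0 ?sqr_ge0 // mulr_ge0 // ltW.
  rewrite ExD; [|exact: L1Z|exact: L1Z].
  rewrite !ExZ //; apply: le_trans (lerD (lexx _) (ler_wpM2l _ Ed)) _.
    by rewrite invr_ge0 mulr_ge0 // ltW.
  by rewrite le_eqVlt; apply/orP; left; apply/eqP; field; rewrite gt_eqF.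
split => //.
  have m1 : measurable_fun setT (fun _ : T => 1 : R) by exact: measurable_cst.
  have := small (fun=> 1) m1 (L1_cst P _); rewrite Ex_cst expr1n.
  rewrite (_ : 2^-1 * (1 + 1) * eta = eta); last by field.
  by apply: le_trans; rewrite le_eqVlt; apply/orP; left; apply/eqP; congr (Rintegral P _ _); apply/funext => x; rewrite mul1r.
pose c := prev (mart b) N'.+1; have bc : essbdd c := essbdd_prev_mart SB bK N'.+1.
pose La x := \sum_(k < N'.+1) mdiff (mart g) k x * mdiff (mart b) k x.
have HL := finite_Lsum SB bK (fun k (_ : (k < N'.+1)%N) => jv k).
have HP := Lsum_spec SB K0 bK (H1_mart_L2 phi2).
have lLa : L1 La := proj1 HL; have lLp := proj1 HP.
have lmp k := mart_L1 SB lphi k; have lmf k := mart_L1 SB lf k.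
have HD : Ex (fun x => `|Lsum P F (mart phi) b x - La x|) <= 6 * K * eta.
  have mm := martingale_lin SB 1 (-1) (mart_is_martingale SB lphi) (mart_is_martingale SB lf).
  have LL := is_Lsum_lin 1 (-1) bK lmp lmf HP HL.
  have nn : (H1_norm (fun n x => 1 * mart phi n x + -1 * mart f n x)%R <= eta%:E)%E.
    move: H1d; rewrite /H1_dist_le; congr (Defs.H1_norm P _ <= _)%E.
    by apply/funext => k; apply/funext => x; ring.
  have := Lsum_bound SB K0 bK mm nn LL; apply: le_trans; rewrite le_eqVlt; apply/orP; left; apply/eqP.
  by congr (Rintegral P _ _); apply/funext => x; rewrite mul1r mulN1r.
have lbp := L1_bmoM phi2.
have lbd : L1 (fun x => b x * (phi x - f x)) by apply: L1_bmoM; split.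
have lfc := essbdd_L1M bf (L1B lb (essbdd_L1 bc)).
apply: (@le_trans _ _ (Ex (fun x => (`|b x * (phi x - f x)| + `|f x * (b x - c x)|) + `|Lsum P F (mart phi) b x - La x|))).
  apply: Ex_le.
  - apply: L1_norm; apply: L1B; first exact: L1B.
    by apply/essbdd_L1/essbdd_sum => k _; apply: essbddM => //; apply: essbddB => //; exact: (essbdd_bmo_mdiff SB bK).
  - by apply: L1D; [apply: L1D; exact: L1_norm|apply: L1_norm; exact: L1B].
  - ae_intro => x; under eq_bigr do rewrite mulrBr.
    rewrite sumrB -/(La x) -mulr_suml -/(f x) -/(c x).
    rewrite (_ : _ - _ = (b x * (phi x - f x) + f x * (b x - c x)) - (Lsum P F (mart phi) b x - La x)); last by ring.
    apply: le_trans (ler_normB _ _) _; rewrite lerD2r; exact: ler_normD.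
rewrite ExD; [|by apply: L1D; exact: L1_norm|by apply: L1_norm; exact: L1B].
rewrite ExD; [|exact: L1_norm|exact: L1_norm].
have Ef : Ex (fun x => `|f x * (b x - c x)|) <= eta.
  apply: (@le_trans _ _ (Ex (fun x => (`|Cg| + 1) * `|b x - mart b N' x|))).
    apply: Ex_le; [exact: L1_norm|apply: L1Z; apply: L1_norm; exact: L1B (mart_L1 SB lb N')|].
    ae_using fE; ae_using HCg; ae_intro => x h1 h2.
    rewrite normrM h2 ler_wpM2r //; apply: le_trans h1 _; have := ler_norm Cg; lra.
  rewrite ExZ; last by apply: L1_norm; exact: L1B (mart_L1 SB lb N').
  by rewrite mulrC -ler_pdivlMr //; apply: HM; exact: leq_maxr.
(* The three parts cost (E b^2 + 1) eta / 2, eta and 6 K eta. *)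
have Eb := small b mb lb2.
have E0 : 0 <= Ex (fun x => b x ^+ 2) by apply: Ex_ge0 => //; ae_intro => x; exact: sqr_ge0.
have := mulr_ge0 E0 (ltW eta0); lra.
Qed.

End L2_approximation.

Section extension.
Context (q : R) (q1 : 1 <= q).
Implicit Types (X : (T -> R) -> T -> R).

(* Families over L2 that are Lipschitz from the H1 distance to weak L^q have
   a unique continuous extension to H1. *)
Definition H1_lipschitz X (C : R) := (forall phi, L2 phi -> measurable_fun setT (X phi)) /\
  forall phi psi (e : R), L2 phi -> L2 psi -> 0 < e -> H1_dist_le (mart phi) (mart psi) e ->
    weak_le P q (fun x => X phi x - X psi x) (C * e).

Definition extends X u h (C : R) := measurable_fun setT h /\
  forall phi (e : R), L2 phi -> 0 < e -> H1_dist_le (mart phi) u e ->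
    weak_le P q (fun x => X phi x - h x) (C * e).

Lemma L2_mart_L1 phi k : L2 phi -> L1 (mart phi k).
Proof. by move=> [mphi lphi]; apply: mart_L1 => //; exact: L2_L1. Qed.

Lemma H1_approximation u : H1 P F u -> exists phi : nat -> T -> R,
  (forall i, L2 (phi i)) /\ forall i, H1_dist_le (mart (phi i)) u (4^-1 ^+ i).
Proof.
move=> hu; have H i : exists phi, L2 phi /\ H1_dist_le (mart phi) u (4^-1 ^+ i).
  have e0 : 0 < 4^-1 ^+ i :> R by rewrite exprn_gt0 // invr_gt0.
  have [N [v [jv _ Hv]]] := H1_density SB hu e0.
  exists (fun y => \sum_(k < N) v k y); split => //.
  by apply/essbdd_L2/essbdd_sum => k _; have [] := jv k.
have [phi Hphi] := choice H.
by exists phi; split => i; have [] := Hphi i.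
Qed.

Lemma extends_seq X u h (C D : R) (phi : nat -> T -> R) : H1_lipschitz X C -> 0 <= C -> 0 < D ->
  forall C', 0 <= C' -> extends X u h C' ->
  (forall i, L2 (phi i)) -> (forall i, H1_dist_le (mart (phi i)) u (D * 4^-1 ^+ i)) ->
  {ae P, forall x, X (phi i) x @[i --> \oo] --> h x}.
Proof.
move=> [mX _] C0 D0 C' C'0 [mh Hh] phi2 Hphi.
have m i : measurable_fun setT (fun x => X (phi i) x - h x) by apply: measurable_funB => //; exact: mX.
have W i : weak_le P q (fun x => X (phi i) x - h x) (C' * D * 4^-1 ^+ i).
  rewrite -mulrA; apply: Hh => //; by rewrite mulr_gt0 // exprn_gt0 // invr_gt0.
have CD0 : 0 <= C' * D by rewrite mulr_ge0 // ltW.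
ae_using (weak_le_borel_cantelli q1 CD0 m W); ae_intro => x [n Hn].
apply/cvgrPdist_le => e e0; have [M HM] := exp_half_le e0.
exists (maxn n M) => // i /=; rewrite geq_max => /andP[ni Mi].
rewrite distrC; apply: le_trans (Hn i ni) (le_trans _ HM).
by apply: ler_wiXn2l => //; rewrite ?invr_ge0 // invf_le1 // ler1n.
Qed.

Lemma ae_cauchy (f : nat -> T -> R) : (forall i, measurable_fun setT (f i)) ->
  {ae P, forall x, exists N, forall i, (N <= i)%N -> `|f i.+1 x - f i x| <= 2^-1 ^+ i} ->
  exists2 h : T -> R, measurable_fun setT h & {ae P, forall x, f i x @[i --> \oo] --> h x}.
Proof.
move=> mf H; pose E i x := (f i x)%:E.
have mE i : measurable_fun setT (E i) by exact/measurable_EFinP.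
have mL : measurable_fun setT (fun x => limn_esup (E ^~ x)) by exact: measurable_fun_limn_esup.
exists (fun x => fine (limn_esup (E ^~ x))); first exact: measurableT_comp.
ae_using H; ae_intro => x /cvg_fast_cauchy /cvg_ex[l fl].
have El : E i x @[i --> \oo] --> l%:E by apply: cvg_EFin => //; exact: nearW.
by have [_ ->] := cvg_limn_einf_sup El.
Qed.

(** The values along an approximating sequence at the rate 4^-i converge almost surely, and Fatou's
    lemma for weak bounds compares the limit with any other phi. The triangle inequality for the H1
    distance loses a factor 2, so two distances e make 4 e. *)
Lemma extends_exists X u (C : R) : H1 P F u -> H1_lipschitz X C -> 0 <= C ->
  exists h, extends X u h (4 * C).
Proof.
move=> hu LX C0; have [phi [phi2 Hphi]] := H1_approximation hu.
have lu := martingale_L1 (proj1 hu).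
have lm psi k : L2 psi -> L1 (mart psi k) by exact: L2_mart_L1.
have mX i : measurable_fun setT (X (phi i)) by apply: (proj1 LX).
have p0 i : 0 < 4^-1 ^+ i :> R by rewrite exprn_gt0 // invr_gt0.
have W i : weak_le P q (fun x => X (phi i.+1) x - X (phi i) x) (4 * C * 4^-1 ^+ i).
  rewrite (_ : 4 * C * _ = C * (4 * 4^-1 ^+ i)); last by ring.
  have e4 : 0 < 4 * 4^-1 ^+ i :> R by rewrite mulr_gt0.
  apply: (proj2 LX (phi i.+1) (phi i) _ (phi2 _) (phi2 _) e4).
  have h : H1_dist_le (mart (phi i.+1)) u (4^-1 ^+ i).
    by apply: le_trans (Hphi i.+1) _; rewrite lee_fin exprS ler_piMl ?(ltW (p0 i)) // invf_le1 // ler1n.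
  have := H1_dist_triangle _ lu _ h (Hphi i) => /(_ (fun k => lm _ k (phi2 i.+1)) (fun k => lm _ k (phi2 i))).
  by rewrite (_ : 2 * _ = 4 * 4^-1 ^+ i) //; ring.
have [h mh Hh] := ae_cauchy mX (weak_le_borel_cantelli q1 (mulr_ge0 (ler0n _ 4) C0) (fun i => measurable_funB (mX i.+1) (mX i)) W).
exists h; split => // psi e psi2 e0 He.
have [M HM] := exp_half_le e0.
apply: (@weak_le_fatou _ _ _ P q (fun i x => X psi x - X (phi i) x)).
- by move=> i; apply: measurable_funB => //; apply: (proj1 LX).
- by apply: measurable_funB => //; apply: (proj1 LX).
- by ae_using Hh; ae_intro => x hx; apply: cvgB => //; exact: cvg_cst.
exists M => i Mi; rewrite (_ : 4 * C * e = C * (4 * e)); last by ring.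
have e4 : 0 < 4 * e by rewrite mulr_gt0.
apply: (proj2 LX psi (phi i) _ psi2 (phi2 _) e4).
have h2 : 4^-1 ^+ i <= e.
  apply: le_trans HM; apply: le_trans (_ : 2^-1 ^+ i <= _).
    by apply: lerXn2r; rewrite ?nnegrE ?invr_ge0 // lef_pV2 ?posrE // ler_nat.
  by apply: ler_wiXn2l => //; rewrite ?invr_ge0 // invf_le1 // ler1n.
have h3 : H1_dist_le (mart (phi i)) u e by apply: le_trans (Hphi i) _; rewrite lee_fin.
have := H1_dist_triangle _ lu _ He h3 => /(_ (fun k => lm _ k psi2) (fun k => lm _ k (phi2 i))).
by rewrite (_ : 2 * _ = 4 * e) //; ring.
Qed.

End extension.

End approximation.

Lemma cvg_half_pow (R : realType) (a : nat -> R) (l c : R) : 0 <= c ->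
  (exists N, forall i, (N <= i)%N -> `|a i - l| <= c * 2^-1 ^+ i) -> a i @[i --> \oo] --> l.
Proof.
move=> c0 [N HN]; apply/cvgrPdist_le => e e0.
have c1 : 0 < c + 1 by rewrite ltr_wpDl.
have [M HM] := exp_half_le (divr_gt0 e0 c1).
exists (maxn N M) => // i /=; rewrite geq_max => /andP[Ni Mi].
have hi : 2^-1 ^+ i <= e / (c + 1).
  by apply: le_trans HM; apply: ler_wiXn2l => //; rewrite ?invr_ge0 // invf_le1 // ler1n.
rewrite distrC; apply: le_trans (HN i Ni) _; move: hi; rewrite ler_pdivlMr //; apply: le_trans.
by rewrite mulrC ler_wpM2l ?exprn_ge0 ?invr_ge0 // lerDl.
Qed.

Section extended_commutator.
Context d (T : measurableType d) (R : realType) (P : probability T R).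
Context (F : (set (set T))^nat) (SB : stochastic_basis P F).
Context (p q : R) (p1 : 1 <= p) (q1 : 1 <= q) (U : (T -> R) -> (T -> R)) (KU : K_class P F p q U).
Implicit Types (f g h b c e phi psi Z : T -> R) (n m k l N M : nat) (u v w a : nat -> T -> R).
Implicit Types (W : (T -> R) -> T -> R).
Notation L1 f := (P.-integrable setT (EFin \o f)).
Notation Ex f := (Rintegral P setT f).
Notation mart := (mart P F).
Notation essbdd := (essbdd P).
Notation prev := (@Defs.prev d T R).
Notation mdiff := (@Defs.mdiff d T R).
Notation H1_norm := (H1_norm P).
Notation evaluation := (evaluation P U).
Notation dominated := (dominated P U).
Notation L2 := (L2 P).
Notation H1_dist_le := (H1_dist_le P).

Let opU : L1_operator P U := K_operator KU.
Let subU : sublinear_op P U := K_sublinear KU.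
Let mUf f : L1 f -> measurable_fun setT (U f). Proof. exact: L1_op_measurable. Qed.

Lemma evaluation_diff W b psi psi' phi phi' h h' Z D : dominated W -> measurable_fun setT b ->
  L1 psi -> L1 psi' -> L1 phi -> L1 phi' ->
  evaluation W b psi phi h -> evaluation W b psi' phi' h' ->
  (forall r : rat, {ae P, forall x, `|U (fun y => (psi y - ratr r * phi y) - (psi' y - ratr r * phi' y)) x|
     <= Z x + `|b x - ratr r| * D x}) ->
  {ae P, forall x, `|h x - h' x| <= Z x}.
Proof.
move=> dW mb lpsi lpsi' lphi lphi' [_ Hh] [_ Hh'] H.
have l f g (r : R) : L1 f -> L1 g -> L1 (fun y => f y - r * g y) by move=> lf lg; apply: L1B => //; exact: L1Z.
have : {ae P, forall x, `|h x - h' x| - Z x <= 0}.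
  apply: (@ae_le0_dense1 _ _ _ P b _ (fun x => D x + `|U phi x| + `|U phi' x|)) => r.
  ae_using (H r); ae_using (Hh (ratr r)); ae_using (Hh' (ratr r)).
  ae_using (proj2 dW _ _ (l _ _ (ratr r) lpsi lphi) (l _ _ (ratr r) lpsi' lphi')); ae_intro => x h1 h2 h3 h4.
  set A := W _ x in h1 h3; set A' := W _ x in h1 h2.
  rewrite (_ : h x - h' x = (h x - A) - (h' x - A') + (A - A')); last by ring.
  have := ler_normD ((h x - A) - (h' x - A')) (A - A'); have := ler_normB (h x - A) (h' x - A'); lra.
by apply: filterS => x; rewrite subr_le0.
Qed.

Lemma H1_norm_ge0 u : (0 <= H1_norm u)%E.
Proof. exact: Lnorm_ge0. Qed.

Lemma H1_norm_fin u : (H1_norm u < +oo)%E -> exists2 C : R, 0 <= C & H1_norm u = C%:E.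
Proof.
move=> uf; exists (fine (H1_norm u)); first by rewrite fine_ge0 // H1_norm_ge0.
by rewrite fineK // ge0_fin_numE // H1_norm_ge0.
Qed.

Lemma H1_lin u v (s t : R) : H1 P F u -> H1 P F v -> H1 P F (fun n x => s * u n x + t * v n x).
Proof.
move=> [mu /H1_norm_fin[cu _ ucu]] [mv /H1_norm_fin[cv _ vcv]].
have mw := martingale_lin SB s t mu mv; split => //.
have lu := martingale_L1 mu; have lv := martingale_L1 mv; have lw := martingale_L1 mw.
apply: le_lt_trans (ltry (2 * `|s| * cu + 2 * `|t| * cv)).
apply: (H1_norm_lin (u := u) (v := v)) => //; rewrite ?ucu ?vcv // => k; ae_intro => x.
by rewrite -!normrM; apply: le_trans (ler_normD _ _); rewrite le_eqVlt; apply/orP; left; apply/eqP; congr (`|_|); rewrite /Defs.mdiff; case: k => [|k] /=; ring.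
Qed.

Lemma H1_dist_sym u v (e : R) : H1_dist_le u v e -> H1_dist_le v u e.
Proof.
rewrite /H1_dist_le (_ : H1_norm (fun n x => v n x - u n x)%R = H1_norm (fun n x => u n x - v n x)%R) //.
congr (Lnorm P _ _); apply/funext => x; congr (_ `^ _)%E; apply: eq_eseriesr => k _.
by rewrite !mdiff_sub distrC.
Qed.

Definition eval W b psi phi := xget (cst 0) [set h | evaluation W b psi phi h].

Lemma evalP W b psi phi : dominated W -> measurable_fun setT b -> L1 psi -> L1 phi ->
  evaluation W b psi phi (eval W b psi phi).
Proof.
move=> dW mb lpsi lphi.
apply: (@xgetPex _ (cst 0) [set h | evaluation W b psi phi h]).
exact: evaluation_exists.
Qed.

(* The value at x is the modulus of U (b phi - L(phi, b) - b(x) phi) at x. *)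
Definition remainder b phi := eval (abs_op U) b (fun x => b x * phi x - Lsum P F (mart phi) b x) phi.

Definition L2_commutator W b phi := eval W b (fun x => b x * phi x) phi.

Let dabs : dominated (abs_op U). Proof. exact: dominated_abs. Qed.

Section fixed_symbol.
Context (b : T -> R) (K : R) (bB : BMO P F p b) (K0 : 0 < K) (bK : (BMO_norm P F p b <= K%:E)%E).
Let lb : L1 b. Proof. by case: bB => /LfunL1. Qed.
Let mb : measurable_fun setT b. Proof. exact: L1_measurable lb. Qed.
Let K20 : 0 < 2 * K. Proof. exact: mulr_gt0. Qed.
Let b1 : bmo1 P F (2 * K) b. Proof. exact: bmo1_BMO bK. Qed.

Let Lp phi := Lsum P F (mart phi) b.

Let L2L1 phi : L2 phi -> L1 phi. Proof. by move=> [? ?]; exact: L2_L1. Qed.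

Let L1b phi : L2 phi -> L1 (fun x => b x * phi x). Proof. exact: (L1_bmoM SB K20 b1). Qed.

Let HLp phi : L2 phi -> is_Lsum P F (mart phi) b (Lp phi).
Proof. by move=> phi2; apply: (Lsum_spec SB K20 b1); exact: H1_mart_L2. Qed.

Let L1Lp phi : L2 phi -> L1 (Lp phi). Proof. by move=> /HLp[]. Qed.

Let L1psi phi : L2 phi -> L1 (fun x => b x * phi x - Lp phi x).
Proof. by move=> phi2; apply: L1B; [exact: L1b|exact: L1Lp]. Qed.

Lemma remainderP phi : L2 phi ->
  evaluation (abs_op U) b (fun x => b x * phi x - Lp phi x) phi (remainder b phi).
Proof. by move=> phi2; apply: evalP => //; [exact: L1psi|exact: L2L1]. Qed.

Lemma L2_commutatorP W phi : dominated W -> L2 phi ->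
  evaluation W b (fun x => b x * phi x) phi (L2_commutator W b phi).
Proof. by move=> dW phi2; apply: evalP => //; [exact: L1b|exact: L2L1]. Qed.

Lemma remainder_le phi (r : R) : L2 phi -> {ae P, forall x,
  `|U (fun y => (b y * phi y - Lp phi y) - r * phi y) x| <= `|remainder b phi x| + `|b x - r| * `|U phi x|}.
Proof.
move=> phi2; ae_using (proj2 (remainderP phi2) r); ae_intro => x; rewrite /abs_op => h.
have := ler_normB (remainder b phi x) (remainder b phi x - `|U (fun y => (b y * phi y - Lp phi y) - r * phi y) x|).
by rewrite subKr normr_id; lra.
Qed.

Lemma Lsum_mart_lin phi psi (s t : R) : L2 phi -> L2 psi ->
  {ae P, forall x, Lp (fun y => s * phi y + t * psi y) x = s * Lp phi x + t * Lp psi x}.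
Proof.
move=> phi2 psi2; have chi2 := L2_lin s t phi2 psi2.
have L := is_Lsum_lin SB s t b1 (fun k => L2_mart_L1 SB k phi2) (fun k => L2_mart_L1 SB k psi2) (HLp phi2) (HLp psi2).
have hw := H1_lin s t (H1_mart_L2 SB phi2) (H1_mart_L2 SB psi2).
have lw := martingale_L1 (proj1 hw).
have E n : {ae P, forall x, mart (fun y => s * phi y + t * psi y) n x = s * mart phi n x + t * mart psi n x}.
  by apply: mart_lin => //; exact: L2L1.
ae_using (Lsum_unique SB b1 lw (Lsum_spec SB K20 b1 hw) L).
ae_using (Lsum_ae SB (H1_mart_L2 SB chi2) hw K20 b1 b1 E (aeW _ (fun x => erefl (b x)))).
by ae_intro => x h1 h2; rewrite /Lp h1.
Qed.

End fixed_symbol.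

(** The estimate for finite sums is applied to approximations at distance 4^-i; the remainders
    converge almost surely by the weak type (1, q), and Fatou's lemma carries over the strong bound.
    The H1 norms of the approximations are at most 2 (4^-i + delta), eventually 4 delta, whence the
    factor 4. *)
Lemma remainder_bound : exists2 C : R, 0 < C & forall b (K : R) phi (delta : R), BMO P F p b -> 0 < K ->
  (BMO_norm P F p b <= K%:E)%E -> L2 phi -> 0 < delta -> (H1_norm (mart phi) <= delta%:E)%E ->
  ('N[P]_(q%:E)[EFin \o remainder b phi] <= (C * K * delta)%:E)%E.
Proof.
have [CH CH0 HH] := H1_bound SB KU; have [CJ CJ0 HJ] := jump_controlled SB p1 q1 KU.
have [CA CA0 HA] := atom_controlled SB p1 q1 KU; have [CL CL0 HL] := L1_bound q1 KU.
have [CM eCM] : {CM : R | CM = 284 * CH + 6 * CJ + 8 * CA} by eexists.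
have CM0 : 0 < CM by rewrite eCM; lra.
exists (CM * 4); first exact: mulr_gt0.
move=> b K phi delta bB K0 bK phi2 d0 Hd.
have lb : L1 b by case: bB => /LfunL1.
have mb := L1_measurable lb; have K20 : 0 < 2 * K by exact: mulr_gt0.
have b1 := bmo1_BMO SB p1 K0 lb bK.
have lphi : L1 phi by case: phi2 => ? ?; exact: L2_L1.
pose psi x := b x * phi x - Lsum P F (mart phi) b x.
have lpsi : L1 psi.
  by apply: L1B; [exact: (L1_bmoM SB K20 b1)|exact: (proj1 (Lsum_spec SB K20 b1 (H1_mart_L2 SB phi2)))].
have p0 i : 0 < 4^-1 ^+ i :> R by rewrite exprn_gt0 // invr_gt0.
have [N' HN'] := choice (fun i => L2_approximation SB K20 b1 phi2 (p0 i)).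
have [v Hv] := choice HN'.
pose f i x := \sum_(k < (N' i).+1) v i k x.
pose psi' i x := \sum_(k < (N' i).+1) v i k x * (prev (mart b) (N' i).+1 x - mdiff (mart b) k x).
have bv i k : essbdd (v i k) by have [/(_ k)[]] := Hv i.
have lf i : L1 (f i) by apply/essbdd_L1/essbdd_sum => k _.
have lpsi' i : L1 (psi' i).
  apply/essbdd_L1/essbdd_sum => k _; apply: essbddM => //; apply: essbddB.
    exact: (essbdd_prev_mart SB b1).
  exact: (essbdd_bmo_mdiff SB b1).
pose h i := eval (abs_op U) b (psi' i) (f i).
have Hh i : evaluation (abs_op U) b (psi' i) (f i) (h i) by exact: evalP.
have H0 : evaluation (abs_op U) b psi phi (remainder b phi) by exact: (remainderP bB K0 bK).
pose c := Ex (fun x => b x ^+ 2) + 6 * (2 * K) + 2.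
have c0 : 0 <= c.
  have : 0 <= Ex (fun x => b x ^+ 2).
    by apply: Ex_ge0; [exact: (bmo1_L2 SB K20 b1)|ae_intro => x; exact: sqr_ge0].
  rewrite /c; lra.
have cvg : {ae P, forall x, h i x @[i --> \oo] --> remainder b phi x}.
  have W1 i : weak_le P q (U (fun x => psi x - psi' i x)) (CL * c * 4^-1 ^+ i).
    apply: weak_le_mono (HL _ (L1B lpsi (lpsi' i))) => //.
    have [_ _ _ H] := Hv i; apply/andP; split.
      by apply: mulr_ge0; [exact: ltW|apply: Ex_ge0; [apply: L1_norm; exact: L1B|ae_intro => x; exact: normr_ge0]].
    by rewrite -mulrA ler_wpM2l ?(ltW CL0).
  have W2 i : weak_le P q (U (fun x => phi x - f i x)) (CL * 4^-1 ^+ i).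
    apply: weak_le_mono (HL _ (L1B lphi (lf i))) => //.
    have [_ H _ _] := Hv i; apply/andP; split.
      by apply: mulr_ge0; [exact: ltW|apply: Ex_ge0; [apply: L1_norm; exact: L1B|ae_intro => x; exact: normr_ge0]].
    by rewrite ler_wpM2l ?(ltW CL0).
  (* Since |r| <= |b(x)| + |b(x) - r|, the error in phi enters with the factor |b(x)|, finite at
     each point, which suffices for almost sure convergence. *)
  have D i : {ae P, forall x, `|remainder b phi x - h i x| <= `|U (fun y => psi y - psi' i y) x| + `|b x| * `|U (fun y => phi y - f i y) x|}.
    apply: (evaluation_diff (D := fun x => `|U (fun y => phi y - f i y) x|) dabs mb lpsi (lpsi' i) lphi (lf i) H0 (Hh i)) => r.
    ae_using (L1_sublinear subU 1 (- ratr r) (L1B lpsi (lpsi' i)) (L1B lphi (lf i))); ae_intro => x.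
    rewrite normr1 mul1r normrN => H.
    rewrite (_ : (fun y => _) = fun y => 1 * (psi y - psi' i y) + - ratr r * (phi y - f i y)); last by apply/funext => y; ring.
    apply: le_trans H _; rewrite -addrA lerD2l -mulrDl ler_wpM2r //.
    by have := ler_normB (b x) (b x - ratr r); rewrite subKr.
  have m1 i := mUf (L1B lpsi (lpsi' i)); have m2 i := mUf (L1B lphi (lf i)).
  ae_using (weak_le_borel_cantelli q1 (mulr_ge0 (ltW CL0) c0) m1 W1).
  ae_using (weak_le_borel_cantelli q1 (ltW CL0) m2 W2).
  ae_using (ae_countable (P := P) D); ae_intro => x Dx [n2 H2] [n1 H1].
  apply: (@cvg_half_pow _ _ _ (1 + `|b x|)); first by rewrite addr_ge0.
  exists (maxn n1 n2) => i; rewrite geq_max => /andP[/H1 h1 /H2 h2].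
  rewrite distrC; apply: le_trans (Dx i) _; rewrite mulrDl mul1r; apply: lerD => //.
  by rewrite ler_wpM2l.
have [M HM] := exp_half_le d0.
apply: (@Lnorm_fatou _ _ _ P q h) => //.
- by rewrite mulr_ge0 ?(ltW d0) // mulr_ge0 ?(ltW K0) // mulr_ge0 // ltW.
- by move=> i; have [] := Hh i.
- by have [] := H0.
exists M => i Mi; have [jv _ Hd' _] := Hv i.
apply: le_trans (finite_estimate SB p1 q1 KU CH0 CJ0 CA0 HH HJ HA bB K0 bK jv (Hh i)) _.
rewrite lee_fin -eCM (_ : CM * 4 * K * delta = CM * K * (4 * delta)); last by ring.
rewrite ler_wpM2l // ?mulr_ge0 ?(ltW K0) ?(ltW CM0) // -lee_fin -(H1_finite SB) //.
have Hd'' := H1_dist_sym Hd'.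
have lm k : L1 (mart (f i) k) by exact: mart_L1.
have lm' k : L1 (mart phi k) by exact: mart_L1.
apply: le_trans (H1_dist_norm lm lm' Hd'' Hd) _; rewrite lee_fin.
have : 4^-1 ^+ i <= delta; last lra.
apply: le_trans HM; apply: le_trans (_ : 2^-1 ^+ i <= _).
  by apply: lerXn2r; rewrite ?nnegrE ?invr_ge0 // lef_pV2 ?posrE // ler_nat.
by apply: ler_wiXn2l => //; rewrite ?invr_ge0 // invf_le1 // ler1n.
Qed.

End extended_commutator.

(** The numerical core of sublinearity in the symbol: dy and dz stand for the distances of two
    rationals to b(x) and c(x), X for |U phi| (x), y and z for the two remainders. All error terms
    carry a factor dy or dz. *)
Lemma combination_arith (R : realDomainType) (h A G X y z dy dz Uy Uz s t : R) :
  0 <= s -> 0 <= t -> 0 <= dy -> 0 <= dz -> 0 <= X ->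
  `|h - `|A| | <= G * X -> G <= s * dy + t * dz -> `|A| <= s * Uy + t * Uz ->
  Uy <= y + dy * X -> Uz <= z + dz * X ->
  `|h| - (s * y + t * z) <= (dy + dz) * (2 * (s + t) * X).
Proof.
move=> s0 t0 dy0 dz0 X0 h1 h2 h3 h4 h5.
have h6 := ler_wpM2l s0 h4; have h7 := ler_wpM2l t0 h5; have h8 := ler_wpM2r X0 h2.
have h9 : `|h| <= `|h - `|A| | + `|A|.
  by have := ler_normD (h - `|A|) `|A|; rewrite subrK normr_id.
have h10 := mulr_ge0 (mulr_ge0 s0 dz0) X0; have h11 := mulr_ge0 (mulr_ge0 t0 dy0) X0.
lra.
Qed.

(** * Lipschitz families over L^2: the remainder, the commutator and W (L(phi, b)) *)

Section families.
Context d (T : measurableType d) (R : realType) (P : probability T R).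
Context (F : (set (set T))^nat) (SB : stochastic_basis P F).
Context (p q : R) (p1 : 1 <= p) (q1 : 1 <= q) (U : (T -> R) -> (T -> R)) (KU : K_class P F p q U).
Implicit Types (f g h b c e phi psi Z : T -> R) (n m k l N M : nat) (u v w a : nat -> T -> R).
Implicit Types (W : (T -> R) -> T -> R).
Notation L1 f := (P.-integrable setT (EFin \o f)).
Notation Ex f := (Rintegral P setT f).
Notation mart := (mart P F).
Notation H1_norm := (H1_norm P).
Notation evaluation := (evaluation P U).
Notation dominated := (dominated P U).
Notation L2 := (L2 P).
Notation H1_dist_le := (H1_dist_le P).
Notation remainder := (remainder P F U).
Notation L2_commutator := (L2_commutator P U).

Let opU : L1_operator P U := K_operator KU.
Let subU : sublinear_op P U := K_sublinear KU.
Let mUf f : L1 f -> measurable_fun setT (U f). Proof. exact: L1_op_measurable. Qed.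
Let dabs : dominated (abs_op U). Proof. exact: dominated_abs. Qed.
Let L2L1 phi : L2 phi -> L1 phi. Proof. by move=> [? ?]; exact: L2_L1. Qed.

Lemma H1_dist_mart phi psi (e : R) : L2 phi -> L2 psi -> H1_dist_le (mart phi) (mart psi) e ->
  (H1_norm (mart (fun y => (1 * phi y + -1 * psi y)%R)) <= e%:E)%E.
Proof.
move=> phi2 psi2; have lphi := L2L1 phi2; have lpsi := L2L1 psi2.
have lchi := L2L1 (L2_lin 1 (-1) phi2 psi2).
rewrite /H1_dist_le (@ae_eq_H1_norm _ _ _ P _ (mart (fun y => 1 * phi y + -1 * psi y))) //.
- by move=> k; apply: measurable_funB; exact: mart_measurable.
- by move=> k; exact: mart_measurable.
- by move=> k; apply: ae_mdiff => n; ae_using (mart_lin SB 1 (-1) n lphi lpsi); ae_intro => x ->; ring.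
Qed.

Section fixed_symbol.
Context (b : T -> R) (K : R) (bB : BMO P F p b) (K0 : 0 < K) (bK : (BMO_norm P F p b <= K%:E)%E).
Let lb : L1 b. Proof. by case: bB => /LfunL1. Qed.
Let mb : measurable_fun setT b. Proof. exact: L1_measurable lb. Qed.
Let K20 : 0 < 2 * K. Proof. exact: mulr_gt0. Qed.
Let b1 : bmo1 P F (2 * K) b. Proof. exact: bmo1_BMO bK. Qed.
Let Lp phi := Lsum P F (mart phi) b.
Let L1b phi : L2 phi -> L1 (fun x => b x * phi x). Proof. exact: (L1_bmoM SB K20 b1). Qed.
Let L1L u : H1 P F u -> L1 (Lsum P F u b).
Proof. by move=> hu; have [] := Lsum_spec SB K20 b1 hu. Qed.
Let L1Lp phi : L2 phi -> L1 (Lp phi). Proof. by move=> /(H1_mart_L2 SB)/L1L. Qed.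
Let L1psi phi : L2 phi -> L1 (fun x => b x * phi x - Lp phi x).
Proof. by move=> phi2; apply: L1B; [exact: L1b|exact: L1Lp]. Qed.
Let L1r f g (r : R) : L1 f -> L1 g -> L1 (fun y => f y - r * g y).
Proof. by move=> lf lg; apply: L1B => //; exact: L1Z. Qed.
Let RP phi (phi2 : L2 phi) := remainderP SB p1 KU bB K0 bK phi2.
Let CP W phi (dW : dominated W) (phi2 : L2 phi) := L2_commutatorP SB p1 KU bB K0 bK dW phi2.

Lemma remainder_measurable phi : L2 phi -> measurable_fun setT (remainder b phi).
Proof. by move=> /RP[]. Qed.

Lemma L2_commutator_measurable W phi : dominated W -> L2 phi -> measurable_fun setT (L2_commutator W b phi).
Proof. by move=> dW /(CP dW)[]. Qed.

Lemma remainder_lin phi psi (s t : R) : L2 phi -> L2 psi ->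
  {ae P, forall x, `|remainder b (fun y => s * phi y + t * psi y) x|
    <= `|s| * `|remainder b phi x| + `|t| * `|remainder b psi x|}.
Proof.
move=> phi2 psi2; have chi2 := L2_lin s t phi2 psi2.
apply: (evaluation_le (Z := fun x => `|s| * `|remainder b phi x| + `|t| * `|remainder b psi x|)
  (D := fun x => `|s| * `|U phi x| + `|t| * `|U psi x|) mb (L1psi chi2) (L2L1 chi2) (RP chi2)) => r.
pose g phi y := b y * phi y - Lp phi y - ratr r * phi y.
have lg phi' : L2 phi' -> L1 (g phi') by move=> h2; exact: (L1r (ratr r) (L1psi h2) (L2L1 h2)).
have E : {ae P, forall x, g (fun y => s * phi y + t * psi y) x = s * g phi x + t * g psi x}.
  have L : {ae P, forall x, Lp (fun y => s * phi y + t * psi y) x = s * Lp phi x + t * Lp psi x}.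
    exact: (Lsum_mart_lin SB p1 bB K0 bK s t phi2 psi2).
  by ae_using L; ae_intro => x; rewrite /g => ->; generalize (Lp phi x) (Lp psi x) => X Y; ring.
ae_using (L1_op_ae opU (lg _ chi2) (L1D (L1Z s (lg _ phi2)) (L1Z t (lg _ psi2))) E).
ae_using (L1_sublinear subU s t (lg _ phi2) (lg _ psi2)).
ae_using (remainder_le SB p1 KU bB K0 bK (ratr r) phi2); ae_using (remainder_le SB p1 KU bB K0 bK (ratr r) psi2).
ae_intro => x h1 h2 h3; rewrite /g /Lp /= => h4; rewrite h4; apply: le_trans h3 _.
have := ler_wpM2l (normr_ge0 s) h2; have := ler_wpM2l (normr_ge0 t) h1; rewrite /g /Lp; lra.
Qed.

Lemma remainder_diff phi psi : L2 phi -> L2 psi ->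
  {ae P, forall x, `|remainder b phi x - remainder b psi x| <= `|remainder b (fun y => 1 * phi y + -1 * psi y) x|}.
Proof.
move=> phi2 psi2; have chi2 := L2_lin 1 (-1) phi2 psi2; set chi := fun y => _ in chi2 *.
apply: (evaluation_diff (D := fun x => `|U chi x|) dabs mb (L1psi phi2) (L1psi psi2) (L2L1 phi2) (L2L1 psi2) (RP phi2) (RP psi2)) => r.
have E : {ae P, forall x, (b x * phi x - Lp phi x - ratr r * phi x) - (b x * psi x - Lp psi x - ratr r * psi x) =
    b x * chi x - Lp chi x - ratr r * chi x}.
  have L : {ae P, forall x, Lp chi x = 1 * Lp phi x + -1 * Lp psi x}.
    exact: (Lsum_mart_lin SB p1 bB K0 bK 1 (-1) phi2 psi2).
  by ae_using L; ae_intro => x ->; rewrite /chi; generalize (Lp phi x) (Lp psi x) => X Y; ring.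
ae_using (L1_op_ae opU (L1B (L1r (ratr r) (L1psi phi2) (L2L1 phi2)) (L1r (ratr r) (L1psi psi2) (L2L1 psi2)))
  (L1r (ratr r) (L1psi chi2) (L2L1 chi2)) E).
by ae_using (remainder_le SB p1 KU bB K0 bK (ratr r) chi2); ae_intro => x h1 h2; rewrite h2.
Qed.

(** The increment of the commutator is bounded by the remainder of chi plus U (L(chi, b)); the first
    is controlled in L^q and the second only in weak L^q, which is why the extension to H1 takes its
    values there. *)
Lemma L2_commutator_diff W phi psi : dominated W -> L2 phi -> L2 psi ->
  let chi := fun y => 1 * phi y + -1 * psi y in
  {ae P, forall x, `|L2_commutator W b phi x - L2_commutator W b psi x| <=
    `|remainder b chi x| + `|U (Lsum P F (mart chi) b) x|}.
Proof.
move=> dW phi2 psi2 chi; have chi2 : L2 chi := L2_lin 1 (-1) phi2 psi2.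
apply: (evaluation_diff (D := fun x => `|U chi x|) dW mb (L1b phi2) (L1b psi2) (L2L1 phi2) (L2L1 psi2) (CP dW phi2) (CP dW psi2)) => r.
rewrite (_ : (fun y => _) = fun y => (b y * chi y - Lp chi y - ratr r * chi y) + Lp chi y); last first.
  by apply/funext => y; rewrite /chi; ring.
ae_using (L1_op_subadd subU (L1r (ratr r) (L1psi chi2) (L2L1 chi2)) (L1Lp chi2) (fun x => erefl)).
by ae_using (remainder_le SB p1 KU bB K0 bK (ratr r) chi2); ae_intro => x; rewrite /Lp => h1 h2; lra.
Qed.

(** W (L(phi, b)) is itself an evaluation, of the pair formed by L(phi, b) and 0; its family differs
    from that of the commutator by exactly the one defining the remainder. *)
Lemma L2_commutator_remainder W phi : dominated W -> L2 phi ->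
  {ae P, forall x, `|L2_commutator W b phi x - W (Lsum P F (mart phi) b) x| <= `|remainder b phi x|}.
Proof.
move=> dW phi2.
have H : evaluation W b (Lp phi) (fun=> 0) (W (Lp phi)).
  split; first by apply: (proj1 dW); exact: L1Lp.
  move=> c; ae_intro => x; rewrite (_ : (fun y => _) = Lp phi); last by apply/funext => y; ring.
  by rewrite subrr normr0 mulr_ge0.
apply: (evaluation_diff (D := fun x => `|U phi x|) dW mb (L1b phi2) (L1Lp phi2) (L2L1 phi2) (L1_cst P 0) (CP dW phi2) H) => r.
rewrite (_ : (fun y => _) = fun y => b y * phi y - Lp phi y - ratr r * phi y); last by apply/funext => y; ring.
exact: (remainder_le SB p1 KU bB K0 bK (ratr r) phi2).
Qed.

Lemma Lsum_dist u phi (e : R) : H1 P F u -> L2 phi -> H1_dist_le (mart phi) u e ->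
  Ex (fun x => `|Lsum P F (mart phi) b x - Lsum P F u b x|) <= 12 * K * e.
Proof.
move=> hu phi2 H; have hphi := H1_mart_L2 SB phi2.
have L := is_Lsum_lin SB 1 (-1) b1 (martingale_L1 (proj1 hphi)) (martingale_L1 (proj1 hu)) (Lsum_spec SB K20 b1 hphi) (Lsum_spec SB K20 b1 hu).
have nn : (H1_norm (fun n x => 1 * mart phi n x + -1 * u n x)%R <= e%:E)%E.
  move: H; rewrite /H1_dist_le; congr (Defs.H1_norm P _ <= _)%E.
  by apply/funext => k; apply/funext => x; ring.
have := Lsum_bound SB K20 b1 (martingale_lin SB 1 (-1) (proj1 hphi) (proj1 hu)) nn L.
rewrite (_ : 6 * (2 * K) * e = 12 * K * e); last by ring.
apply: le_trans; rewrite le_eqVlt; apply/orP; left; apply/eqP.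
by congr (Rintegral P _ _); apply/funext => x; rewrite mul1r mulN1r.
Qed.

Lemma remainder_lipschitz : exists2 C : R, 0 <= C & H1_lipschitz P F q (remainder b) C.
Proof.
have [C C0 HC] := remainder_bound SB p1 q1 KU; exists (C * K); first by rewrite mulr_ge0 ?ltW.
split; first exact: remainder_measurable.
move=> phi psi e phi2 psi2 e0 H; have chi2 := L2_lin 1 (-1) phi2 psi2.
have mphi := remainder_measurable phi2; have mpsi := remainder_measurable psi2.
apply: weak_le_ae (remainder_diff phi2 psi2) _; [exact: measurable_funB|exact: remainder_measurable|].
apply: weak_le_Lnorm => //; first exact: remainder_measurable.
  by rewrite mulr_ge0 ?(ltW e0) // mulr_ge0 ?ltW.
exact: HC (H1_dist_mart phi2 psi2 H).
Qed.

Lemma Lsum_extends W : dominated W -> exists2 C : R, 0 <= C & forall u, H1 P F u ->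
  extends P F q (fun phi => W (Lsum P F (mart phi) b)) u (W (Lsum P F u b)) C.
Proof.
move=> dW; have [C C0 HC] := L1_bound q1 KU; exists (C * (12 * K)).
  by rewrite mulr_ge0 ?(ltW C0) // mulr_ge0 // ltW.
move=> u hu; have lu := L1L hu; split; first exact: (proj1 dW).
move=> phi e phi2 e0 H; have lphi := L1Lp phi2; have ld := L1B lphi lu.
apply: weak_le_ae (proj2 dW _ _ lphi lu) _; [by apply: measurable_funB; exact: (proj1 dW)|exact: mUf|].
apply: weak_le_mono (HC _ ld) => //; apply/andP; split.
  by rewrite mulr_ge0 ?(ltW C0) //; apply: Ex_ge0; [exact: L1_norm|ae_intro => x; exact: normr_ge0].
by rewrite -mulrA ler_wpM2l ?(ltW C0) //; exact: Lsum_dist.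
Qed.

Lemma Lsum_lipschitz W : dominated W ->
  exists2 C : R, 0 <= C & H1_lipschitz P F q (fun phi => W (Lsum P F (mart phi) b)) C.
Proof.
move=> /Lsum_extends[C C0 HC]; exists C => //; split.
  by move=> phi /(H1_mart_L2 SB)/HC[].
by move=> phi psi e phi2 /(H1_mart_L2 SB)/HC[_ H]; exact: H.
Qed.

Lemma L2_commutator_lipschitz W : dominated W ->
  exists2 C : R, 0 <= C & H1_lipschitz P F q (L2_commutator W b) C.
Proof.
move=> dW; have [C1 C10 HC1] := remainder_bound SB p1 q1 KU; have [C2 C20 HC2] := L1_bound q1 KU.
have C0 : 0 <= 2 * (C1 * K + C2 * (12 * K)).
  by rewrite mulr_ge0 // addr_ge0 // mulr_ge0 ?(ltW C10) ?(ltW C20) ?(ltW K0) // mulr_ge0 // ltW.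
exists (2 * (C1 * K + C2 * (12 * K))) => //.
split; first by move=> phi phi2; exact: L2_commutator_measurable.
move=> phi psi e phi2 psi2 e0 H; have chi2 := L2_lin 1 (-1) phi2 psi2.
have Hn := H1_dist_mart phi2 psi2 H; set chi := fun y => _ in chi2 Hn.
have mphi := L2_commutator_measurable dW phi2; have mpsi := L2_commutator_measurable dW psi2.
have mr := remainder_measurable chi2; have lL := L1Lp chi2.
have a0 : 0 <= C1 * K * e by rewrite mulr_ge0 ?(ltW e0) // mulr_ge0 ?ltW.
have c0 : 0 <= C2 * (12 * K * e) by rewrite mulr_ge0 ?(ltW C20) // mulr_ge0 ?(ltW e0) // mulr_ge0 // ltW.
rewrite (_ : _ * e = 2 * (C1 * K * e + C2 * (12 * K * e))); last by ring.
apply: (weak_le_add q1 a0 c0 mr (mUf lL) (measurable_funB mphi mpsi) (L2_commutator_diff dW phi2 psi2)).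
  by apply: weak_le_Lnorm => //; exact: HC1.
apply: weak_le_mono (HC2 _ lL) => //; apply/andP; split.
  by rewrite mulr_ge0 ?(ltW C20) //; apply: Ex_ge0; [exact: L1_norm|ae_intro => x; exact: normr_ge0].
rewrite ler_wpM2l ?(ltW C20) // (_ : 12 * K * e = 6 * (2 * K) * e); last by ring.
by apply: (Lsum_bound SB K20 b1 (proj1 (H1_mart_L2 SB chi2)) Hn); exact: (Lsum_spec SB K20 b1 (H1_mart_L2 SB chi2)).
Qed.

End fixed_symbol.

(** Two rationals r and r' approximate b(x) and c(x) independently, and s r + t r' approximates the
    combined symbol; a single parameter would not follow both values. *)
Lemma remainder_lin_symbol b c (K : R) phi (s t : R) : BMO P F p b -> BMO P F p c -> 0 < K ->
  (BMO_norm P F p b <= K%:E)%E -> (BMO_norm P F p c <= K%:E)%E -> L2 phi ->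
  {ae P, forall x, `|remainder (fun y => s * b y + t * c y) phi x|
    <= `|s| * `|remainder b phi x| + `|t| * `|remainder c phi x|}.
Proof.
move=> bB cB K0 bK cK phi2; have K20 : 0 < 2 * K by exact: mulr_gt0.
have gB := BMO_lin SB s t p1 bB cB; set g := fun y => _ in gB *.
have [Kg Kg0 EKg] := BMO_norm_fin (proj2 gB).
have Kg1 : 0 < Kg + 1 by rewrite ltr_wpDl.
have gK : (BMO_norm P F p g <= (Kg + 1)%:E)%E by rewrite EKg lee_fin lerDl.
have lB h : BMO P F p h -> L1 h by case=> /LfunL1.
have b1 := bmo1_BMO SB p1 K0 (lB _ bB) bK; have c1 := bmo1_BMO SB p1 K0 (lB _ cB) cK.
have g1 := bmo1_BMO SB p1 Kg1 (lB _ gB) gK.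
have Kg2 : 0 < 2 * (Kg + 1) by exact: mulr_gt0.
have Eg : exists2 K' : R, 0 < K' & bmo1 P F K' g by exists (2 * (Kg + 1)).
have lphi := L2L1 phi2; have hphi := H1_mart_L2 SB phi2.
pose psi h y := h y * phi y - Lsum P F (mart phi) h y.
have lpsi h Kh : 0 < Kh -> bmo1 P F Kh h -> L1 (psi h).
  by move=> Kh0 h1; apply: L1B; [exact: (L1_bmoM SB Kh0 h1)|exact: (proj1 (Lsum_spec SB Kh0 h1 hphi))].
have lb := lpsi _ _ K20 b1; have lc := lpsi _ _ K20 c1; have lg := lpsi _ _ Kg2 g1.
have [mg Hg] := remainderP SB p1 KU gB Kg1 gK phi2.
have L1r f (r : R) : L1 f -> L1 (fun y => f y - r * phi y) by move=> lf; apply: L1B => //; exact: L1Z.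
have : {ae P, forall x, `|remainder g phi x| - (`|s| * `|remainder b phi x| + `|t| * `|remainder c phi x|) <= 0}.
  apply: (@ae_le0_dense _ _ _ P b c _ (fun x => 2 * (`|s| + `|t|) * `|U phi x|)) => r r'.
  have E : {ae P, forall x, psi g x - (s * ratr r + t * ratr r') * phi x =
      s * (psi b x - ratr r * phi x) + t * (psi c x - ratr r' * phi x)}.
    ae_using (Lsum_lin_right SB (s := s) (t := t) hphi K20 b1 c1 Eg).
    ae_intro => x h; rewrite /psi h /g.
    by generalize (Lsum P F (mart phi) b x) (Lsum P F (mart phi) c x) => X Y; ring.
  ae_using (Hg (s * ratr r + t * ratr r')).
  ae_using (L1_op_ae opU (L1r _ (s * ratr r + t * ratr r') lg) (L1D (L1Z s (L1r _ (ratr r) lb)) (L1Z t (L1r _ (ratr r') lc))) E).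
  ae_using (L1_sublinear subU s t (L1r _ (ratr r) lb) (L1r _ (ratr r') lc)).
  ae_using (remainder_le SB p1 KU bB K0 bK (ratr r) phi2); ae_using (remainder_le SB p1 KU cB K0 cK (ratr r') phi2).
  ae_intro => x h1 h2 h3 h4; rewrite /abs_op -/(psi g) h4 => h5.
  apply: (combination_arith _ _ _ _ _ h5 _ h3 h2 h1) => //.
  rewrite -!normrM; apply: le_trans (ler_normD _ _); rewrite le_eqVlt; apply/orP; left; apply/eqP; congr (`|_|); rewrite /g.
  by generalize (b x) (c x) (ratr r : R) (ratr r' : R) => b' c' r1 r2; ring.
by apply: filterS => x; rewrite subr_le0.
Qed.

End families.

(** * Passing pointwise relations to the limit *)

Section limits.
Context (R : realType).
Implicit Types (a b c : nat -> R).

Lemma quarter_pow_le (e : R) : 0 < e -> exists N, forall i, (N <= i)%N -> 4^-1 ^+ i <= e.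
Proof.
move=> e0; have [N HN] := exp_half_le e0; exists N => i Ni.
apply: le_trans HN; apply: le_trans (_ : 2^-1 ^+ i <= _).
  by apply: lerXn2r; rewrite ?nnegrE ?invr_ge0 // lef_pV2 ?posrE // ler_nat.
by apply: ler_wiXn2l => //; rewrite ?invr_ge0 // invf_le1 // ler1n.
Qed.

Lemma lim_combination a b c (A B C s t : R) :
  a i @[i --> \oo] --> A -> b i @[i --> \oo] --> B -> c i @[i --> \oo] --> C ->
  (forall i, a i = s * b i + t * c i) -> A = s * B + t * C.
Proof.
move=> aA bB cC H; have L : (fun i => s * b i + t * c i) @ \oo --> s * B + t * C.
  by apply: cvgD; apply: cvgM => //; exact: cvg_cst.
have E : a = fun i => s * b i + t * c i by apply/funext.
by rewrite E in aA; apply: cvg_unique aA L.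
Qed.

Lemma lim_eq a b (A B : R) : a i @[i --> \oo] --> A -> b i @[i --> \oo] --> B ->
  (forall i, a i = b i) -> A = B.
Proof. by move=> aA bB H; move: aA; rewrite (funext H : a = b) => aA; exact: cvg_unique aA bB. Qed.

Lemma lim_norm_le a b c (A B C s t : R) :
  a i @[i --> \oo] --> A -> b i @[i --> \oo] --> B -> c i @[i --> \oo] --> C ->
  (forall i, `|a i| <= s * `|b i| + t * `|c i|) -> `|A| <= s * `|B| + t * `|C|.
Proof.
move=> aA bB cC H; have L : (fun i => s * `|b i| + t * `|c i|) @ \oo --> s * `|B| + t * `|C|.
  by apply: cvgD; apply: cvgM; [exact: cvg_cst|exact: cvg_norm|exact: cvg_cst|exact: cvg_norm].
by apply: (ler_cvg_to (cvg_norm aA) L); exact: nearW.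
Qed.

Lemma lim_dist_le a b c (A B C : R) :
  a i @[i --> \oo] --> A -> b i @[i --> \oo] --> B -> c i @[i --> \oo] --> C ->
  (forall i, `|a i - b i| <= `|c i|) -> `|A - B| <= `|C|.
Proof.
by move=> aA bB cC H; apply: (ler_cvg_to (cvg_norm (cvgB aA bB)) (cvg_norm cC)); exact: nearW.
Qed.

End limits.

(** * Extensions to H1 along fast approximating sequences *)

Section extension.
Context d (T : measurableType d) (R : realType) (P : probability T R).
Context (F : (set (set T))^nat) (SB : stochastic_basis P F) (q : R) (q1 : 1 <= q).
Implicit Types (f g h b c e phi psi Z : T -> R) (n m k l N M : nat) (u v w a : nat -> T -> R).
Implicit Types (X : (T -> R) -> T -> R).
Notation L1 f := (P.-integrable setT (EFin \o f)).
Notation mart := (mart P F).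
Notation L2 := (L2 P).
Notation H1_dist_le := (H1_dist_le P).
Notation H1_lipschitz := (H1_lipschitz P F q).
Notation extends := (extends P F q).

Definition is_extension X u h := exists2 C : R, 0 <= C & extends X u h C.

Definition lipschitz_family X := exists2 C : R, 0 <= C & H1_lipschitz X C.

Definition extension X u := xget (cst 0) [set h | is_extension X u h].

Lemma extensionP X u : H1 P F u -> lipschitz_family X -> is_extension X u (extension X u).
Proof.
move=> hu [C C0 LX]; apply: (@xgetPex _ (cst 0) [set h | is_extension X u h]).
have [h Hh] := extends_exists SB q1 hu LX C0; exists h; exists (4 * C) => //; exact: mulr_ge0.
Qed.

Lemma is_extension_measurable X u h : is_extension X u h -> measurable_fun setT h.
Proof. by case=> C _ []. Qed.

(** A geometric rate up to a constant, stable under linear combinations: one sequence serves several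
    families at once, so relations between them on L^2 pass to the limit point by point. *)
Definition approximates (phi : nat -> T -> R) u := (forall i, L2 (phi i)) /\
  exists2 D : R, 0 < D & forall i, H1_dist_le (mart (phi i)) u (D * 4^-1 ^+ i).

Lemma approximates_exists u : H1 P F u -> exists phi : nat -> T -> R, approximates phi u.
Proof.
move=> /(H1_approximation SB)[phi [phi2 H]]; exists phi; split => //.
by exists 1 => // i; rewrite mul1r.
Qed.

Lemma is_extension_seq X u h (phi : nat -> T -> R) : lipschitz_family X -> is_extension X u h -> approximates phi u ->
  {ae P, forall x, X (phi i) x @[i --> \oo] --> h x}.
Proof.
move=> [C C0 LX] [C' C'0 e] [phi2 [D D0 HD]]; exact: extends_seq LX C0 D0 _ C'0 e phi2 HD.
Qed.

Lemma approximates_lin (phi psi : nat -> T -> R) u v (s t : R) : H1 P F u -> H1 P F v ->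
  approximates phi u -> approximates psi v ->
  approximates (fun i y => s * phi i y + t * psi i y) (fun n x => s * u n x + t * v n x).
Proof.
move=> hu hv [phi2 [D D0 HD]] [psi2 [E E0 HE]].
have lu := martingale_L1 (proj1 hu); have lv := martingale_L1 (proj1 hv).
split; first by move=> i; exact: L2_lin.
have s0 := mulr_ge0 (normr_ge0 s) (ltW D0); have t0 := mulr_ge0 (normr_ge0 t) (ltW E0).
exists (2 * (`|s| * D) + 2 * (`|t| * E) + 1); first by rewrite ltr_wpDl // addr_ge0 // mulr_ge0.
move=> i; have lp k := L2_mart_L1 SB k (phi2 i); have lq k := L2_mart_L1 SB k (psi2 i).
have lc := L2_lin s t (phi2 i) (psi2 i).
have := H1_dist_lin s t lp lq lu lv (HD i) (HE i).
have mm f k : L1 f -> measurable_fun setT f by exact: L1_measurable.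
have ae n : {ae P, forall x, s * mart (phi i) n x + t * mart (psi i) n x = mart (fun y => s * phi i y + t * psi i y) n x}.
  have l1 : L1 (phi i) by have [? ?] := phi2 i; exact: L2_L1.
  have l2 : L1 (psi i) by have [? ?] := psi2 i; exact: L2_L1.
  by ae_using (mart_lin SB s t n l1 l2); ae_intro => x ->.
move=> /(@H1_dist_ae _ _ _ P _ (mart (fun y => s * phi i y + t * psi i y)) _ (fun n x => s * u n x + t * v n x)) H.
apply: le_trans (H _ _ _ _ ae (fun n => aeW _ (fun x => erefl))) _.
- by move=> k; apply/(L1_measurable (P := P))/L1D; exact: L1Z.
- by move=> k; apply/(L1_measurable (P := P))/L1D; exact: L1Z.
- by move=> k; exact: L1_measurable (L2_mart_L1 SB k lc).
- by move=> k; apply/(L1_measurable (P := P))/L1D; exact: L1Z.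
rewrite lee_fin !mulrDl !mulrA lerDl mul1r exprn_ge0 // invr_ge0.
Qed.

Lemma approximates_ae (phi : nat -> T -> R) u v : H1 P F u -> H1 P F v -> (forall n, {ae P, forall x, u n x = v n x}) ->
  approximates phi u -> approximates phi v.
Proof.
move=> hu hv uv [phi2 [D D0 HD]]; split => //; exists D => // i.
have lu := martingale_L1 (proj1 hu); have lv := martingale_L1 (proj1 hv).
have mm k := L1_measurable (L2_mart_L1 SB k (phi2 i)).
by apply: H1_dist_ae (HD i) => // [k|k|n]; [exact: L1_measurable (lu k)|exact: L1_measurable (lv k)|exact: aeW].
Qed.

Lemma approximates_norm (phi : nat -> T -> R) u (delta : R) : H1 P F u -> approximates phi u -> 0 < delta ->
  (H1_norm P u <= delta%:E)%E -> exists N, forall i, (N <= i)%N -> (H1_norm P (mart (phi i)) <= (4 * delta)%:E)%E.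
Proof.
move=> hu [phi2 [D D0 HD]] d0 Hd; have [N HN] := quarter_pow_le (divr_gt0 d0 D0).
exists N => i /HN; rewrite ler_pdivlMr // mulrC => h.
have := H1_dist_norm (fun k => L2_mart_L1 SB k (phi2 i)) (martingale_L1 (proj1 hu)) (HD i) Hd.
by move=> /le_trans; apply; rewrite lee_fin; lra.
Qed.

End extension.

(** * The extension agrees with the commutator *)

Section commutator_extension.
Context d (T : measurableType d) (R : realType) (P : probability T R).
Context (F : (set (set T))^nat) (SB : stochastic_basis P F).
Context (p q : R) (p1 : 1 <= p) (q1 : 1 <= q) (U : (T -> R) -> (T -> R)) (KU : K_class P F p q U).
Implicit Types (f g h b c e phi psi Z : T -> R) (n m k l N M : nat) (u v w a : nat -> T -> R).
Implicit Types (W : (T -> R) -> T -> R).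
Notation L1 f := (P.-integrable setT (EFin \o f)).
Notation mart := (mart P F).
Notation evaluation := (evaluation P U).
Notation dominated := (dominated P U).
Notation L2 := (L2 P).
Notation H1_dist_le := (H1_dist_le P).
Notation L2_commutator := (L2_commutator P U).
Notation is_extension := (is_extension P F q).
Notation approximates := (approximates P F).

Let L2L1 phi : L2 phi -> L1 phi. Proof. by move=> [? ?]; exact: L2_L1. Qed.

Lemma BMO_bound b : BMO P F p b -> exists2 K : R, 0 < K & (BMO_norm P F p b <= K%:E)%E.
Proof.
move=> bB; have [K K0 EK] := BMO_norm_fin (proj2 bB); exists (K + 1); first by rewrite ltr_wpDl.
by rewrite EK lee_fin lerDl.
Qed.

Section fixed_symbol.
Context (b : T -> R) (K : R) (bB : BMO P F p b) (K0 : 0 < K) (bK : (BMO_norm P F p b <= K%:E)%E).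
Context (W : (T -> R) -> T -> R) (dW : dominated W).
Let lb : L1 b. Proof. by case: bB => /LfunL1. Qed.
Let K20 : 0 < 2 * K. Proof. exact: mulr_gt0. Qed.
Let b1 : bmo1 P F (2 * K) b. Proof. exact: bmo1_BMO bK. Qed.
Let L1b phi : L2 phi -> L1 (fun x => b x * phi x). Proof. exact: (L1_bmoM SB K20 b1). Qed.
Let LX : lipschitz_family P F q (L2_commutator W b).
Proof. exact: (L2_commutator_lipschitz SB p1 q1 KU bB K0 bK dW). Qed.
Let mX phi : L2 phi -> measurable_fun setT (L2_commutator W b phi).
Proof. by case: LX => C _ [+ _]; apply. Qed.
Let XP phi : L2 phi -> evaluation W b (fun x => b x * phi x) phi (L2_commutator W b phi).
Proof. exact: (L2_commutatorP SB p1 KU bB K0 bK dW). Qed.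

Let onP phi h : L2 phi -> commutator_on P W b phi h <-> evaluation W b (fun x => b x * phi x) phi h.
Proof. by move=> phi2; apply: (commutator_onP (K_sublinear KU)) => //; [exact: L2L1|exact: L1b]. Qed.

Lemma is_extension_commutator_limit u h : is_extension (L2_commutator W b) u h ->
  commutator_limit P F q W b u h.
Proof.
move=> [C C0 [mh Hh]]; split => // e e0; have C1 : 0 < 2 * (C + 1) by rewrite mulr_gt0 // ltr_wpDl.
have r0 := divr_gt0 e0 C1; exists (e / (2 * (C + 1))) => // phi /LfunL2 phi2 /ltW H.
exists (L2_commutator W b phi).
  by apply/onP => //; exact: XP.
have c0 : 0 <= C * (e / (2 * (C + 1))) by rewrite mulr_ge0 // ltW.
apply: (@le_lt_trans _ _ (C * (e / (2 * (C + 1))))%:E).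
  by apply/weak_normP => //; [apply: measurable_funB => //; exact: mX|exact: Hh].
rewrite lte_fin mulrA ltr_pdivrMr //; nra.
Qed.

(** Both limits are compared at a single phi close to u, whose commutator is unique up to null sets;
    2 (C s + e / 8) <= e because s <= e / (8 (C + 1)). *)
Lemma commutator_limit_unique u h h' : H1 P F u -> is_extension (L2_commutator W b) u h ->
  commutator_limit P F q W b u h' -> {ae P, forall x, h x = h' x}.
Proof.
move=> hu [C C0 [mh Hh]] [mh' H']; have md := measurable_funB mh mh'.
have : {ae P, forall x, h x - h' x = 0}.
  apply: (weak_le_zero q1 md) => e e0.
  have e8 : 0 < e / 8 by rewrite divr_gt0.
  have [r r0 Hr] := H' _ e8; have C1 : 0 < 8 * (C + 1) by rewrite mulr_gt0 // ltr_wpDl.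
  pose s := Num.min (r / 2) (e / (8 * (C + 1))).
  have s0 : 0 < s by rewrite lt_min !divr_gt0.
  have [phi [phi2 Hphi]] := H1_approximation SB hu; have [N HN] := quarter_pow_le s0.
  have Hs : H1_dist_le (mart (phi N)) u s by apply: le_trans (Hphi N) _; rewrite lee_fin; exact: HN.
  have [k /(onP _ (phi2 N)) Ck /ltW] := Hr (phi N) (proj2 (LfunL2 P _) (phi2 N)) ltac:(apply: le_lt_trans Hs _; rewrite lte_fin; apply: le_lt_trans (_ : r / 2 < r); [by rewrite ge_min lexx|by rewrite ltr_pdivrMr // ltr_pMr // ltr1n]).
  have mk := proj1 Ck; have mkh := measurable_funB mk mh'.
  move=> /(weak_normP P q1 mkh (ltW e8)) Wk.
  have mx := mX (phi2 N); have mxh := measurable_funB mx mh.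
  have Wx := Hh _ _ (phi2 N) s0 Hs.
  have cs : 0 <= C * s by rewrite mulr_ge0 // ltW.
  apply: weak_le_mono (weak_le_add q1 cs (ltW e8) mxh mkh md _ Wx Wk) => //.
    apply/andP; split; first by rewrite mulr_ge0 // addr_ge0 // ltW.
    have : s <= e / (8 * (C + 1)) by rewrite ge_min lexx orbT.
    by rewrite ler_pdivlMr //; nra.
  ae_using (evaluation_unique Ck (XP (phi2 N))); ae_intro => x /= <-.
  by rewrite -(subrKA (k x)) (distrC (k x) (h x)) ler_normD.
by apply: filterS => x /eqP; rewrite subr_eq0 => /eqP.
Qed.

Lemma is_extension_ae u h h' : is_extension (L2_commutator W b) u h -> measurable_fun setT h' ->
  {ae P, forall x, h x = h' x} -> is_extension (L2_commutator W b) u h'.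
Proof.
move=> [C C0 [mh H]] mh' hh'; exists C => //; split => // phi e phi2 e0 He.
apply: weak_le_ae (H phi e phi2 e0 He); [exact: measurable_funB (mX phi2) mh'|exact: measurable_funB (mX phi2) mh|].
by ae_using hh'; ae_intro => x ->.
Qed.

(** [commutator] picks any function satisfying one of two clauses. If it comes from some phi in L^2,
    the Lipschitz bound at phi gives the extension property; if it is a limit, uniqueness of the
    limit does. *)
Lemma commutator_extends u : H1 P F u -> is_extension (L2_commutator W b) u (commutator P F q W b u).
Proof.
move=> hu; have lu := martingale_L1 (proj1 hu).
have E := extensionP SB q1 hu LX.
have : is_commutator P F q W b u (commutator P F q W b u).
  apply: (@xgetPex _ (cst 0) [set h | is_commutator P F q W b u h]).
  by exists (extension P F q (L2_commutator W b) u); right; exact: is_extension_commutator_limit.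
move=> [[phi [/LfunL2 phi2 uphi]]|L]; last first.
  by apply: is_extension_ae E _ (commutator_limit_unique hu E L); exact: (proj1 L).
move=> /(onP _ phi2) Ck.
have [C C0 [_ L]] := LX; exists C => //; split; first exact: (proj1 Ck).
move=> psi e psi2 e0 He.
have H : H1_dist_le (mart psi) (mart phi) e.
  apply: H1_dist_ae He => // k; try exact: L1_measurable (L2_mart_L1 SB k psi2).
  - exact: L1_measurable (lu k).
  - exact: L1_measurable (L2_mart_L1 SB k phi2).
  - exact: aeW.
apply: weak_le_ae (L psi phi e psi2 phi2 e0 H).
- exact: measurable_funB (mX psi2) (proj1 Ck).
- exact: measurable_funB (mX psi2) (mX phi2).
by ae_using (evaluation_unique Ck (XP phi2)); ae_intro => x ->.
Qed.

Lemma commutator_measurable u : H1 P F u -> measurable_fun setT (commutator P F q W b u).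
Proof. by move=> /commutator_extends /is_extension_measurable. Qed.

Lemma commutatorP u : H1 P F u -> commutator_limit P F q W b u (commutator P F q W b u).
Proof. by move=> /commutator_extends; exact: is_extension_commutator_limit. Qed.

Lemma commutator_seq u (phi : nat -> T -> R) : H1 P F u -> approximates phi u ->
  {ae P, forall x, L2_commutator W b (phi i) x @[i --> \oo] --> commutator P F q W b u x}.
Proof. by move=> hu; exact: (is_extension_seq q1 LX (commutator_extends hu)). Qed.

End fixed_symbol.

End commutator_extension.

(** * The extended remainder and the theorem *)

Section theorem.
Context d (T : measurableType d) (R : realType) (P : probability T R).
Context (F : (set (set T))^nat) (SB : stochastic_basis P F).
Context (p q : R) (p1 : 1 <= p) (q1 : 1 <= q) (U : (T -> R) -> (T -> R)) (KU : K_class P F p q U).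
Implicit Types (f g h b c e phi psi Z : T -> R) (n m k l N M : nat) (u v w a : nat -> T -> R).
Implicit Types (W : (T -> R) -> T -> R).
Notation L1 f := (P.-integrable setT (EFin \o f)).
Notation mart := (mart P F).
Notation H1_norm := (H1_norm P).
Notation dominated := (dominated P U).
Notation L2 := (L2 P).
Notation remainder := (remainder P F U).
Notation L2_commutator := (L2_commutator P U).
Notation approximates := (approximates P F).
Notation H1 := (H1 P F).
Notation BMO := (BMO P F p).
Notation BMO_norm := (BMO_norm P F p).
Notation Lsum := (Lsum P F).

Let opU : L1_operator P U := K_operator KU.
Let subU : sublinear_op P U := K_sublinear KU.
Let L2L1 phi : L2 phi -> L1 phi. Proof. by move=> [? ?]; exact: L2_L1. Qed.
Let dabs : dominated (abs_op U). Proof. exact: dominated_abs. Qed.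
Let lB b : BMO b -> L1 b. Proof. by case=> /LfunL1. Qed.
Let mB b : BMO b -> measurable_fun setT b. Proof. by move=> /lB; exact: L1_measurable. Qed.

(** The modulus is taken because the theorem uses R itself, not |R|, as the bound in both
    inequalities. *)
Definition remainder_ext u b x : R := `|extension P F q (remainder b) u x|.

Let norm_le_id (x y z s t : R) : `|x| <= s * `|y| + t * `|z| -> `|(`|x|)| <= s * `|(`|y|)| + t * `|(`|z|)|.
Proof. by rewrite !normr_id. Qed.

Lemma BMO_bound2 b c : BMO b -> BMO c ->
  exists2 K : R, 0 < K & (BMO_norm b <= K%:E)%E /\ (BMO_norm c <= K%:E)%E.
Proof.
move=> /BMO_bound[K K0 bK] /BMO_bound[K' K'0 cK]; exists (K + K'); first exact: addr_gt0.
by split; [apply: le_trans bK _|apply: le_trans cK _]; rewrite lee_fin ?lerDl ?lerDr ltW.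
Qed.

Lemma BMO_bmo1 b : BMO b -> exists2 K : R, 0 < K & bmo1 P F K b.
Proof.
move=> bB; have [K K0 bK] := BMO_bound bB; exists (2 * K); first exact: mulr_gt0.
exact: (bmo1_BMO SB p1 K0 (lB bB) bK).
Qed.

Lemma remainder_lipschitz_BMO b : BMO b -> lipschitz_family P F q (remainder b).
Proof. by move=> bB; have [K K0 bK] := BMO_bound bB; exact: (remainder_lipschitz SB p1 q1 KU bB K0 bK). Qed.

Lemma remainder_seq b u (phi : nat -> T -> R) : BMO b -> H1 u -> approximates phi u ->
  {ae P, forall x, remainder b (phi i) x @[i --> \oo] --> extension P F q (remainder b) u x}.
Proof.
by move=> /remainder_lipschitz_BMO LX hu; exact: (is_extension_seq q1 LX (extensionP SB q1 hu LX)).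
Qed.

Lemma Lsum_seq W b u (phi : nat -> T -> R) : dominated W -> BMO b -> H1 u -> approximates phi u ->
  {ae P, forall x, W (Lsum (mart (phi i)) b) x @[i --> \oo] --> W (Lsum u b) x}.
Proof.
move=> dW bB hu; have [K K0 bK] := BMO_bound bB.
have LX := Lsum_lipschitz SB p1 q1 KU bB K0 bK dW.
have [C C0 HC] := Lsum_extends SB p1 q1 KU bB K0 bK dW.
by apply: (is_extension_seq q1 LX); exists C => //; exact: HC.
Qed.

Lemma remainder_ext_measurable u b : H1 u -> BMO b -> measurable_fun setT (remainder_ext u b).
Proof.
move=> hu /remainder_lipschitz_BMO LX; apply: measurableT_comp => //.
exact: is_extension_measurable (extensionP SB q1 hu LX).
Qed.

(** [remainder_bound] needs positive bounds while either norm may vanish, so both are enlarged by a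
    small r, whose effect [arith] makes arbitrarily small. *)
Lemma remainder_ext_norm : exists2 C : R, 0 < C & forall u b, H1 u -> BMO b ->
  ('N[P]_(q%:E)[EFin \o remainder_ext u b] <= C%:E * H1_norm u * BMO_norm b)%E.
Proof.
have arith (C K D r e : R) : r * (4 * C * (K + D + 1)) <= e -> 0 <= C * r * (1 - r) ->
    C * (K + r) * (4 * (D + r)) <= C * 4 * D * K + e by lra.
have [C C0 HC] := remainder_bound SB p1 q1 KU; exists (C * 4); first exact: mulr_gt0.
move=> u b hu bB; have [K K0 EK] := BMO_norm_fin (proj2 bB).
have [D D0 ED] := H1_norm_fin (proj2 hu); rewrite EK ED -!EFinM.
have [phi Hphi] := approximates_exists SB hu.
have H (e : R) : 0 < e -> ('N[P]_(q%:E)[EFin \o remainder_ext u b] <= (C * (K + e) * (4 * (D + e)))%:E)%E.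
  move=> e0; have Ke : 0 < K + e by rewrite ltr_wpDl. have De : 0 < D + e by rewrite ltr_wpDl.
  have bK : (BMO_norm b <= (K + e)%:E)%E by rewrite EK lee_fin lerDl ltW.
  have uD : (H1_norm u <= (D + e)%:E)%E by rewrite ED lee_fin lerDl ltW.
  have [N HN] := approximates_norm SB hu Hphi De uD.
  have D4 : 0 < 4 * (D + e) by exact: mulr_gt0.
  rewrite /remainder_ext Lnorm_normr.
  have mh := is_extension_measurable (extensionP SB q1 hu (remainder_lipschitz_BMO bB)).
  have mX i : measurable_fun setT (remainder b (phi i)).
    exact: (remainder_measurable SB p1 KU bB Ke bK (proj1 Hphi i)).
  have c0 : 0 <= C * (K + e) * (4 * (D + e)) by rewrite mulr_ge0 ?(ltW D4) // mulr_ge0 // ltW.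
  apply: (Lnorm_fatou q1 c0 mX mh (remainder_seq bB hu Hphi)).
  by exists N => i Ni; apply: HC => //; [exact: (proj1 Hphi)|exact: HN].
apply/lee_addgt0Pr => e e0; rewrite -EFinD.
have M0 : 0 < 4 * C * (K + D + 1) by rewrite mulr_gt0 ?mulr_gt0 // ltr_wpDl // addr_ge0.
pose r := Num.min 1 (e / (4 * C * (K + D + 1))).
have r0 : 0 < r by rewrite lt_min ltr01 divr_gt0.
have r1 : r <= 1 by rewrite ge_min lexx.
have : r <= e / (4 * C * (K + D + 1)) by rewrite ge_min lexx orbT.
rewrite ler_pdivlMr // => re; apply: le_trans (H r r0) _; rewrite lee_fin.
by apply: arith re _; rewrite mulr_ge0 ?subr_ge0 // mulr_ge0 // ltW.
Qed.

Lemma remainder_ae b c phi : BMO b -> BMO c -> L2 phi -> {ae P, forall x, b x = c x} ->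
  {ae P, forall x, remainder b phi x = remainder c phi x}.
Proof.
move=> bB cB phi2 bc; have [K K0 [bK cK]] := BMO_bound2 bB cB; have K20 : 0 < 2 * K by exact: mulr_gt0.
have b1 := bmo1_BMO SB p1 K0 (lB bB) bK; have c1 := bmo1_BMO SB p1 K0 (lB cB) cK.
have Rb := remainderP SB p1 KU bB K0 bK phi2; have Rc := remainderP SB p1 KU cB K0 cK phi2.
have hphi := H1_mart_L2 SB phi2; have lphi := L2L1 phi2.
have l h : bmo1 P F (2 * K) h -> L1 (fun x => h x * phi x - Lsum (mart phi) h x).
  by move=> h1; apply: L1B; [exact: (L1_bmoM SB K20 h1)|exact: (proj1 (Lsum_spec SB K20 h1 hphi))].
apply: evaluation_unique Rc; apply: (evaluation_ae opU subU dabs (l _ b1) lphi (l _ c1) lphi _ bc _ _ _ Rb).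
- exact: (proj1 Rb).
- ae_using bc; ae_using (Lsum_ae SB hphi hphi K20 b1 c1 (fun n => aeW _ (fun x => erefl)) bc).
  by ae_intro => x -> ->.
- exact: aeW.
- exact: aeW.
Qed.

Lemma remainder_ext_ae u v b c : H1 u -> H1 v -> BMO b -> BMO c ->
  (forall n, {ae P, forall x, u n x = v n x}) -> {ae P, forall x, b x = c x} ->
  {ae P, forall x, remainder_ext u b x = remainder_ext v c x}.
Proof.
move=> hu hv bB cB uv bc; have [phi Hu] := approximates_exists SB hu.
have Hv := approximates_ae SB hu hv uv Hu.
ae_using (remainder_seq bB hu Hu); ae_using (remainder_seq cB hv Hv).
ae_using (ae_countable (P := P) (fun i => remainder_ae bB cB (proj1 Hu i) bc)).
by ae_intro => x E Hc Hb; exact: (congr1 Num.norm (lim_eq Hb Hc E)).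
Qed.

Lemma remainder_ext_lin u v b (s t : R) : H1 u -> H1 v -> BMO b ->
  {ae P, forall x, `|remainder_ext (fun n y => s * u n y + t * v n y) b x|
    <= `|s| * `|remainder_ext u b x| + `|t| * `|remainder_ext v b x|}.
Proof.
move=> hu hv bB; have [K K0 bK] := BMO_bound bB; have hw := H1_lin SB s t hu hv.
have [phi Hphi] := approximates_exists SB hu; have [psi Hpsi] := approximates_exists SB hv.
have Hchi := approximates_lin SB s t hu hv Hphi Hpsi.
ae_using (remainder_seq bB hu Hphi); ae_using (remainder_seq bB hv Hpsi); ae_using (remainder_seq bB hw Hchi).
ae_using (ae_countable (P := P) (fun i => remainder_lin SB p1 KU bB K0 bK s t (proj1 Hphi i) (proj1 Hpsi i))).
by ae_intro => x H h1 h2 h3; exact: norm_le_id (lim_norm_le h1 h3 h2 H).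
Qed.

Lemma remainder_ext_lin_symbol u b c (s t : R) : H1 u -> BMO b -> BMO c ->
  {ae P, forall x, `|remainder_ext u (fun y => s * b y + t * c y) x|
    <= `|s| * `|remainder_ext u b x| + `|t| * `|remainder_ext u c x|}.
Proof.
move=> hu bB cB; have [K K0 [bK cK]] := BMO_bound2 bB cB; have gB := BMO_lin SB s t p1 bB cB.
have [phi Hphi] := approximates_exists SB hu.
ae_using (remainder_seq bB hu Hphi); ae_using (remainder_seq cB hu Hphi); ae_using (remainder_seq gB hu Hphi).
ae_using (ae_countable (P := P) (fun i => remainder_lin_symbol SB p1 KU s t bB cB K0 bK cK (proj1 Hphi i))).
by ae_intro => x H h1 h2 h3; exact: norm_le_id (lim_norm_le h1 h3 h2 H).
Qed.

(** The inequality on L^2 passes to the limit along one sequence approximating u, for the remainder,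
    W (L(u, b)) and the commutator simultaneously. With W = |U| it contains both inequalities of the
    theorem; with W = U it bounds the bilinear operator. *)
Lemma commutator_remainder_ext W u b : dominated W -> H1 u -> BMO b ->
  {ae P, forall x, `|commutator P F q W b u x - W (Lsum u b) x| <= remainder_ext u b x}.
Proof.
move=> dW hu bB; have [K K0 bK] := BMO_bound bB; have [phi Hphi] := approximates_exists SB hu.
ae_using (remainder_seq bB hu Hphi); ae_using (Lsum_seq dW bB hu Hphi).
ae_using (commutator_seq SB p1 q1 KU bB K0 bK dW hu Hphi).
ae_using (ae_countable (P := P) (fun i => L2_commutator_remainder SB p1 KU bB K0 bK dW (proj1 Hphi i))).
by ae_intro => x H h1 h2 h3; exact: (lim_dist_le h1 h2 h3 H).
Qed.

Lemma remainder_ext_bounded : bounded_H1_BMO P F p q (fun u b => remainder_ext u b).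
Proof.
split; [exact: remainder_ext_measurable|exact: remainder_ext_ae|exact: remainder_ext_norm].
Qed.

Section linear.
Context (linU : linear_op P U).
Let dU : dominated U. Proof. exact: dominated_linear. Qed.
Let linUE (s t : R) f g : L1 f -> L1 g ->
  {ae P, forall x, U (fun y => s * f y + t * g y) x = s * U f x + t * U g x}.
Proof. by move=> lf lg; apply: linU; apply/LfunL1. Qed.

Lemma L1_BMO_L2 b phi : BMO b -> L2 phi -> L1 (fun x => b x * phi x).
Proof. by move=> /BMO_bmo1[K K0 b1] phi2; exact: (L1_bmoM SB K0 b1). Qed.

Lemma L2_commutator_linear b phi : BMO b -> L2 phi ->
  {ae P, forall x, L2_commutator U b phi x = U (fun y => b y * phi y) x - b x * U phi x}.
Proof.
move=> bB phi2; have [K K0 bK] := BMO_bound bB.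
apply: evaluation_unique (L2_commutatorP SB p1 KU bB K0 bK dU phi2) _.
by apply: evaluation_linear => //; [exact: mB|exact: L1_BMO_L2|exact: L2L1].
Qed.

Lemma commutator_lin u v b (s t : R) : H1 u -> H1 v -> BMO b ->
  {ae P, forall x, commutator P F q U b (fun n y => s * u n y + t * v n y) x
    = s * commutator P F q U b u x + t * commutator P F q U b v x}.
Proof.
move=> hu hv bB; have [K K0 bK] := BMO_bound bB; have hw := H1_lin SB s t hu hv.
have [phi Hphi] := approximates_exists SB hu; have [psi Hpsi] := approximates_exists SB hv.
have Hchi := approximates_lin SB s t hu hv Hphi Hpsi.
have E i : {ae P, forall x, L2_commutator U b (fun y => s * phi i y + t * psi i y) x =
    s * L2_commutator U b (phi i) x + t * L2_commutator U b (psi i) x}.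
  have p2 := proj1 Hphi i; have q2 := proj1 Hpsi i; have c2 := proj1 Hchi i.
  ae_using (L2_commutator_linear bB c2); ae_using (L2_commutator_linear bB p2); ae_using (L2_commutator_linear bB q2).
  ae_using (linUE s t (L2L1 p2) (L2L1 q2)); ae_using (linUE s t (L1_BMO_L2 bB p2) (L1_BMO_L2 bB q2)).
  ae_intro => x h1 h2 -> -> ->; rewrite h2.
  rewrite (_ : (fun y => b y * (s * phi i y + t * psi i y)) = fun y => s * (b y * phi i y) + t * (b y * psi i y)).
    by rewrite h1; ring.
  by apply/funext => y; ring.
ae_using (commutator_seq SB p1 q1 KU bB K0 bK dU hu Hphi); ae_using (commutator_seq SB p1 q1 KU bB K0 bK dU hv Hpsi).
ae_using (commutator_seq SB p1 q1 KU bB K0 bK dU hw Hchi); ae_using (ae_countable (P := P) E).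
by ae_intro => x H h1 h2 h3; exact: (lim_combination h1 h3 h2 H).
Qed.

Lemma commutator_lin_symbol u b c (s t : R) : H1 u -> BMO b -> BMO c ->
  {ae P, forall x, commutator P F q U (fun y => s * b y + t * c y) u x
    = s * commutator P F q U b u x + t * commutator P F q U c u x}.
Proof.
move=> hu bB cB; have gB := BMO_lin SB s t p1 bB cB; have [phi Hphi] := approximates_exists SB hu.
have [K K0 bK] := BMO_bound bB; have [K' K'0 cK] := BMO_bound cB; have [K'' K''0 gK] := BMO_bound gB.
have E i : {ae P, forall x, L2_commutator U (fun y => s * b y + t * c y) (phi i) x =
    s * L2_commutator U b (phi i) x + t * L2_commutator U c (phi i) x}.
  have p2 := proj1 Hphi i.
  ae_using (L2_commutator_linear gB p2); ae_using (L2_commutator_linear bB p2); ae_using (L2_commutator_linear cB p2).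
  ae_using (linUE s t (L1_BMO_L2 bB p2) (L1_BMO_L2 cB p2)).
  ae_intro => x h1 -> -> ->.
  rewrite (_ : (fun y => (s * b y + t * c y) * phi i y) = fun y => s * (b y * phi i y) + t * (c y * phi i y)).
    by rewrite h1; ring.
  by apply/funext => y; ring.
ae_using (commutator_seq SB p1 q1 KU bB K0 bK dU hu Hphi); ae_using (commutator_seq SB p1 q1 KU cB K'0 cK dU hu Hphi).
ae_using (commutator_seq SB p1 q1 KU gB K''0 gK dU hu Hphi); ae_using (ae_countable (P := P) E).
by ae_intro => x H h1 h2 h3; exact: (lim_combination h1 h3 h2 H).
Qed.

Lemma commutator_ae u v b c : H1 u -> H1 v -> BMO b -> BMO c ->
  (forall n, {ae P, forall x, u n x = v n x}) -> {ae P, forall x, b x = c x} ->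
  {ae P, forall x, commutator P F q U b u x = commutator P F q U c v x}.
Proof.
move=> hu hv bB cB uv bc; have [phi Hu] := approximates_exists SB hu.
have Hv := approximates_ae SB hu hv uv Hu.
have [K K0 bK] := BMO_bound bB; have [K' K'0 cK] := BMO_bound cB.
have E i : {ae P, forall x, L2_commutator U b (phi i) x = L2_commutator U c (phi i) x}.
  have p2 := proj1 Hu i; have lb := L1_BMO_L2 bB p2; have lc := L1_BMO_L2 cB p2.
  have e : {ae P, forall x, b x * phi i x = c x * phi i x} by ae_using bc; ae_intro => x ->.
  ae_using (L2_commutator_linear bB p2); ae_using (L2_commutator_linear cB p2); ae_using bc.
  by ae_using (L1_op_ae opU lb lc e); ae_intro => x h -> -> ->; rewrite h.
ae_using (commutator_seq SB p1 q1 KU bB K0 bK dU hu Hu); ae_using (commutator_seq SB p1 q1 KU cB K'0 cK dU hv Hv).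
ae_using (ae_countable (P := P) E); by ae_intro => x H Hc Hb; exact: lim_eq Hb Hc H.
Qed.

Let B u b x := commutator P F q U b u x - U (Lsum u b) x.

Let combB (s t a x y b c z w : R) : a = s * x + t * y -> b = c -> c = s * z + t * w ->
  a - b = s * (x - z) + t * (y - w).
Proof. by move=> -> -> ->; ring. Qed.

Let L1L u b : H1 u -> BMO b -> L1 (Lsum u b).
Proof. by move=> hu /BMO_bmo1[K K0 b1]; have [] := Lsum_spec SB K0 b1 hu. Qed.

Lemma linear_remainder_bilinear : bilinear_H1_BMO P F p (fun u b => B u b).
Proof.
split=> s t.
- move=> u v b hu hv bB; have [K K0 b1] := BMO_bmo1 bB; have hw := H1_lin SB s t hu hv.
  have lu := L1L hu bB; have lv := L1L hv bB; have lw := L1L hw bB.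
  ae_using (commutator_lin s t hu hv bB).
  ae_using (L1_op_ae opU lw (L1D (L1Z s lu) (L1Z t lv)) (Lsum_lin_left SB K0 b1 hu hv hw)).
  by ae_using (linUE s t lu lv); ae_intro => x h1 h2 h3; exact: (combB h3 h2 h1).
- move=> u b c hu bB cB; have gB := BMO_lin SB s t p1 bB cB; have [K K0 [bK cK]] := BMO_bound2 bB cB.
  have K20 : 0 < 2 * K by exact: mulr_gt0.
  have b1 := bmo1_BMO SB p1 K0 (lB bB) bK; have c1 := bmo1_BMO SB p1 K0 (lB cB) cK.
  have lb := L1L hu bB; have lc := L1L hu cB; have lg := L1L hu gB.
  ae_using (commutator_lin_symbol s t hu bB cB).
  ae_using (L1_op_ae opU lg (L1D (L1Z s lb) (L1Z t lc)) (Lsum_lin_right SB (s := s) (t := t) hu K20 b1 c1 (BMO_bmo1 gB))).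
  by ae_using (linUE s t lb lc); ae_intro => x h1 h2 h3; exact: (combB h3 h2 h1).
Qed.

Lemma linear_remainder_bounded : bounded_H1_BMO P F p q (fun u b => B u b).
Proof.
have mB' u b : H1 u -> BMO b -> measurable_fun setT (B u b).
  move=> hu bB; have [K K0 bK] := BMO_bound bB; apply: measurable_funB.
    exact: (commutator_measurable SB p1 q1 KU bB K0 bK dU hu).
  exact: (L1_op_measurable opU (L1L hu bB)).
split => //.
- move=> u v b c hu hv bB cB uv bc; have [K K0 [bK cK]] := BMO_bound2 bB cB.
  have K20 : 0 < 2 * K by exact: mulr_gt0.
  have b1 := bmo1_BMO SB p1 K0 (lB bB) bK; have c1 := bmo1_BMO SB p1 K0 (lB cB) cK.
  ae_using (commutator_ae hu hv bB cB uv bc).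
  ae_using (L1_op_ae opU (L1L hu bB) (L1L hv cB) (Lsum_ae SB hu hv K20 b1 c1 uv bc)).
  by ae_intro => x h1 h2; exact: (congr2 (fun y z => y - z) h2 h1).
(* The bilinear operator is dominated pointwise by the sublinear one and inherits its bound. *)
- have [C C0 HC] := remainder_ext_norm; exists C => // u b hu bB; apply: le_trans (HC u b hu bB).
  apply: Lnorm_le_ae => //; [exact: mB'|exact: remainder_ext_measurable|].
  by ae_using (commutator_remainder_ext dU hu bB); ae_intro => x h; apply: le_trans h _; exact: ler_norm.
Qed.

End linear.

End theorem.

Theorem theorem1p3 (d : measure_display) (T : measurableType d) (R : realType)
    (P : probability T R) (F : (set (set T))^nat) (p q : R)
    (U : (T -> R) -> (T -> R)) :
  stochastic_basis P F -> 1 <= p -> 1 <= q -> K_class P F p q U ->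
  (exists B : (T -> R)^nat -> (T -> R) -> (T -> R),
    [/\ bounded_H1_BMO P F p q B,
        subbilinear P F p B &
        forall f b, H1 P F f -> BMO P F p b ->
          commutator_limit P F q (abs_op U) b f
            (commutator P F q (abs_op U) b f) /\
          {ae P, forall x,
            `|U (Lsum P F f b) x| - B f b x
              <= commutator P F q (abs_op U) b f x
              <= B f b x + `|U (Lsum P F f b) x| }]) /\
  (linear_op P U ->
    let B := fun f b x => commutator P F q U b f x - U (Lsum P F f b) x in
    [/\ (forall f b, H1 P F f -> BMO P F p b ->
          commutator_limit P F q U b f (commutator P F q U b f)),
        bilinear_H1_BMO P F p B &
        bounded_H1_BMO P F p q B]).
Proof.
move=> SB p1 q1 KU; split.
  have dW := dominated_abs (K_operator KU) (K_sublinear KU).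
  exists (remainder_ext P F q U); split.
  - exact: (remainder_ext_bounded SB p1 q1 KU).
  - by split=> *; [exact: (remainder_ext_lin SB p1 q1 KU)|exact: (remainder_ext_lin_symbol SB p1 q1 KU)].
  - move=> f b hf bB; have [K K0 bK] := BMO_bound bB; split.
      exact: (commutatorP SB p1 q1 KU bB K0 bK dW hf).
    ae_using (commutator_remainder_ext SB p1 q1 KU dW hf bB); ae_intro => x.
    by rewrite /abs_op ler_norml => /andP[h1 h2]; apply/andP; split; lra.
move=> linU B; split.
- move=> f b hf bB; have [K K0 bK] := BMO_bound bB.
  exact: (commutatorP SB p1 q1 KU bB K0 bK (dominated_linear (K_operator KU) linU) hf).
- exact: (linear_remainder_bilinear SB p1 q1 KU linU).
- exact: (linear_remainder_bounded SB p1 q1 KU linU).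
Qed.
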